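(* Let $(X,\omega)$ be an $n$-dimensional compact Hermitian manifold such that the Hermitian form $\omega$ satisfies $$\partial\overline{\partial}\omega=0,\qquad \partial\omega\wedge\overline{\partial}\omega=0 .$$ Let $T_j$ be a closed positive $(1,1)$-current on $X$ for $j=1,\dots,m$. Let $T$ be a closed positive $(p,p)$-current on $X$ such that $m+p\leq n$. Then the relative non-pluripolar product $\langle T_1\wedge\dots\wedge T_m\,\dot{\wedge}\,T\rangle$ is well-defined.
   Context: Positivity: a $(q,q)$-current $S$ is positive if $\langle S,\Phi\rangle\ge 0$ for every strongly positive smooth test form $\Phi$ with compact support. For a positive $(q,q)$-current $S$ on an $n$-dimensional Hermitian manifold $(X,\omega)$ and a Borel set $K\subset X$, put $\|S\|_K:=\int_K S\wedge\omega^{n-q}$. The operator $dd^c$ is a fixed positive multiple of $i\partial\overline{\partial}$. A quasi-psh function is locally the sum of a psh function and a smooth function. For a real closed smooth $(1,1)$-form $\theta$, $\mathrm{PSH}(X,\theta)$ is the set of quasi-psh functions $u$ (not identically $-\infty$ on any connected component) with $dd^cu+\theta\geq 0$ in the sense of currents. Bedford--Taylor products: if $S$ is a closed positive current and $u$ is a locally bounded psh function, then $dd^cu\wedge S:=dd^c(uS)$, which is a closed positive current; iterating defines $dd^cu_1\wedge\dots\wedge dd^cu_m\wedge T$ for locally bounded psh functions $u_j$. By writing locally bounded quasi-psh functions locally as differences of a locally bounded psh function and a smooth function and expanding multilinearly, one defines $(dd^cv_1+\theta_1)\wedge\dots\wedge(dd^cv_m+\theta_m)\wedge T$ for locally bounded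 quasi-psh $v_j$ and smooth $(1,1)$-forms $\theta_j$; it is a current of order $0$. Relative non-pluripolar product: let $X$ be an $n$-dimensional complex manifold, $T$ a closed positive $(p,p)$-current on $X$, and $T_1,\dots,T_m$ closed positive $(1,1)$-currents on $X$ with $m+p\le n$. Write $T_j=dd^c\tilde u_j+\theta_j$ with $\theta_j$ a real closed smooth $(1,1)$-form and $\tilde u_j\in\mathrm{PSH}(X,\theta_j)$. For $k\in\mathbb{N}$ set $$\tilde u_{j,k}:=\max\{\tilde u_j,-k\},\qquad \tilde R_k:=(dd^c\tilde u_{1,k}+\theta_1)\wedge\dots\wedge(dd^c\tilde u_{m,k}+\theta_m)\wedge T .$$ The currents $\mathbf{1}_{\cap_{j=1}^m\{\tilde u_j>-k\}}\tilde R_k$ are positive. The non-pluripolar product of $T_1,\dots,T_m$ relative to $T$ is said to be well-defined if $$\sup_{k\in\mathbb{N}}\big\|\mathbf{1}_{\cap_{j=1}^m\{\tilde u_j>-k\}}\tilde R_k\big\|_K<\infty\quad\text{for every compact subset }K\subset X .$$ In that case the sequence $\mathbf{1}_{\cap_{j=1}^m\{\tilde u_j>-k\}}\tilde R_k$ converges weakly to a positive $(m+p,m+p)$-current, denoted $\langle T_1\wedge\dots\wedge T_m\,\dot{\wedge}\,T\rangle$. Both the condition and the limit are independent of the choices of $\theta_j$ and $\tilde u_j$. *)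

(* Defs.v *)
From HB Require Import structures.
From mathcomp Require Import all_boot all_order all_algebra.
From mathcomp Require Import all_classical all_reals all_analysis.
From mathcomp Require Import complex.

Set Implicit Arguments.
Unset Strict Implicit.
Unset Printing Implicit Defensive.

Import Order.TTheory GRing.Theory Num.Theory.
Import numFieldNormedType.Exports.

Local Open Scope classical_set_scope.
Local Open Scope complex_scope.
Local Open Scope ring_scope.

(* C^n, as the real normed space of pairs (x, y) standing for z = x + iy. *)
Notation Cn R n := ('rV[R]_n * 'rV[R]_n)%type.

Definition cscale (R : realType) (n : nat) (a : R[i]) (v : Cn R n) : Cn R n :=
  (complex.Re a *: v.1 - complex.Im a *: v.2,
   complex.Im a *: v.1 + complex.Re a *: v.2).

Definition J (R : realType) (n : nat) (v : Cn R n) : Cn R n := cscale 'i v.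

Definition iter_deriv (R : realType) (V W : normedModType R)
    (l : seq V) (f : V -> W) : V -> W :=
  foldr (fun v g => 'D_v g) f l.

(* C^oo: every iterated directional derivative exists and is differentiable. *)
Definition smooth_on (R : realType) (V W : normedModType R)
    (U : set V) (f : V -> W) : Prop :=
  forall (l : seq V) (z : V), U z -> differentiable (iter_deriv l f) z.

Definition holomorphic_on (R : realType) (n : nat)
    (U : set (Cn R n)) (f : Cn R n -> Cn R n) : Prop :=
  smooth_on U f /\ forall z v, U z -> 'D_(J v) f z = J ('D_v f z).

(* A chart c is the homeomorphism [chart_coord c] from [chart_dom c] onto its
   open image, with inverse [chart_param c]; both are junk elsewhere.  [chartAt]
   selects one chart around each point.  The carrier is pointed because the
   measurable spaces of the library are. *)
Record complexManifold (R : realType) (n : nat) := ComplexManifold {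
  carrier :> ptopologicalType ;
  chartIdx : Type ;
  chart_dom : chartIdx -> set carrier ;
  chart_coord : chartIdx -> carrier -> Cn R n ;
  chart_param : chartIdx -> Cn R n -> carrier ;
  chartAt : carrier -> chartIdx ;
  manifold_hausdorff : hausdorff_space carrier ;
  manifold_second_countable : @second_countable carrier ;
  dom_open : forall c, open (chart_dom c) ;
  coord_image_open : forall c, open (chart_coord c @` chart_dom c) ;
  coordK : forall c x, chart_dom c x -> chart_param c (chart_coord c x) = x ;
  coord_continuous : forall c x, chart_dom c x ->
    {for x, continuous (chart_coord c)} ;
  param_continuous : forall c z, (chart_coord c @` chart_dom c) z ->
    {for z, continuous (chart_param c)} ;
  dom_chartAt : forall x, chart_dom (chartAt x) x ;
  transition_holomorphic : forall c c',
    holomorphic_on (chart_coord c @` (chart_dom c `&` chart_dom c'))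
      (chart_coord c' \o chart_param c)
}.

(* The complex-valued R-multilinear alternating forms on C^n, a form of
   degree k being a function of sequences of vectors vanishing on the sequences
   of length other than k. *)
Section Exterior.
Variables (R : realType) (n : nat).
Local Notation V := (Cn R n).
Implicit Types a b : seq V -> R[i].

Definition alternating (k : nat) a : Prop :=
  [/\ forall s, size s != k -> a s = 0,
      forall (s1 s2 : seq V) (t : R) (v w : V),
        a (s1 ++ (t *: v + w) :: s2) =
        t%:C * a (s1 ++ v :: s2) + a (s1 ++ w :: s2)
    & forall s, ~~ uniq s -> a s = 0].

(* Bidegree (p, q) is the weight zeta^p * conj(zeta)^q under v |-> zeta v. *)
Definition bidegree (p q : nat) a : Prop :=
  alternating (p + q) a /\
  forall (zeta : R[i]) s,
    a (map (cscale zeta) s) = zeta ^+ p * conjc zeta ^+ q * a s.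

(* The number of inversions of the shuffle moving the entries selected by m
   in front of the others. *)
Fixpoint shuffle_inv (m : bitseq) : nat :=
  if m is b :: m' then ((if b then 0 else count id m') + shuffle_inv m')%N
  else 0%N.

Definition wedge_alt a b : seq V -> R[i] := fun s =>
  \sum_(m : (size s).-tuple bool)
    (-1) ^+ shuffle_inv m * a (mask m s) * b (mask (map negb m) s).

Definition unit_form : seq V -> R[i] := fun s => if s is [::] then 1 else 0.

Definition clinear (al : V -> R[i]) : Prop :=
  forall (zeta : R[i]) (v w : V),
    al (cscale zeta v + w) = zeta * al v + al w.

Definition covector (al : V -> R[i]) : seq V -> R[i] := fun s =>
  if s is [:: v] then al v else 0.

Definition i_alpha_bar (al : V -> R[i]) : seq V -> R[i] := fun s =>
  'i * wedge_alt (covector al) (covector (conjc \o al)) s.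

Definition strongly_positive (r : nat) a : Prop :=
  exists (N : nat) (lam : 'I_N -> R) (al : 'I_N -> 'I_r -> V -> R[i]),
    [/\ forall k, 0 <= lam k,
        forall k j, clinear (al k j)
      & forall s, a s = \sum_(k < N) (lam k)%:C *
          foldr (fun j b => wedge_alt (i_alpha_bar (al k j)) b) unit_form
            (enum 'I_r) s].

(* e_1, J e_1, ..., e_n, J e_n, positively oriented. *)
Definition std_frame : seq V :=
  flatten [seq [:: (delta_mx ord0 j, 0); J (delta_mx ord0 j, 0)]
          | j <- enum 'I_n].

End Exterior.

(* Lebesgue integral on C^n = R^2n: iterated integrals for nonnegative
   functions (Tonelli), then positive minus negative part. *)
Section LebesgueCn.
Variables (R : realType) (n : nat).
Local Open Scope ereal_scope.

Fixpoint iter_integral (k : nat) (f : seq R -> \bar R) : \bar R :=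
  if k is k'.+1 then
    \int[lebesgue_measure]_(x in [set: R])
      iter_integral k' (fun s => f (x :: s))
  else f [::].

Definition Cn_of_seq (s : seq R) : Cn R n :=
  (\row_(j < n) nth 0%R s j, \row_(j < n) nth 0%R s (n + j)%N).

Definition integral_Cn (f : Cn R n -> \bar R) : \bar R :=
  iter_integral (n + n) (fun s => f^\+ (Cn_of_seq s)) -
  iter_integral (n + n) (fun s => f^\- (Cn_of_seq s)).

(* A plurisubharmonic function here may be identically -oo; this is excluded
   in [PSH] below. *)
Definition psh_on (U : set (Cn R n)) (f : Cn R n -> \bar R) : Prop :=
  [/\ forall z, U z -> f z < +oo,
      forall z (a : R), U z -> f z < a%:E -> \forall w \near z, f w < a%:E
    & forall z v,
        (forall zeta : R[i], (`|zeta| <= 1)%R -> U (z + cscale zeta v)%R) ->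
        f z <= ((2 * pi)^-1)%:E *
          \int[lebesgue_measure]_(t in `[0%R, (2 * pi)%R])
            f (z + cscale (cos t +i* sin t) v)%R].

End LebesgueCn.

(* The value of a form at x is read in the frame of the chart [chartAt x]. *)
Definition diffForm (R : realType) (n : nat) (X : complexManifold R n) :=
  X -> seq (Cn R n) -> R[i].

Definition current (R : realType) (n : nat) (X : complexManifold R n) :=
  diffForm X -> R[i].

Section Forms.
Variables (R : realType) (n : nat) (X : complexManifold R n).
Local Notation V := (Cn R n).
Implicit Types (phi psi : diffForm X) (S : current X).

Definition chart_image (c : chartIdx X) : set V := chart_coord c @` chart_dom c.

(* Pullback of phi by chart_param c. *)
Definition local_expr (c : chartIdx X) phi (z : V) (s : seq V) : R[i] :=
  phi (chart_param c z)
    [seq 'D_v (chart_coord (chartAt (chart_param c z)) \o chart_param c) z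
    | v <- s].

Definition smooth_fun (f : X -> R) : Prop :=
  forall c, smooth_on (chart_image c) (f \o chart_param c).

Definition smooth_form phi : Prop :=
  forall c s,
    smooth_on (chart_image c) (fun z => complex.Re (local_expr c phi z s)) /\
    smooth_on (chart_image c) (fun z => complex.Im (local_expr c phi z s)).

Definition form_bidegree (p q : nat) phi : Prop :=
  smooth_form phi /\ forall x, bidegree p q (phi x).

Definition real_form phi : Prop := forall x s, complex.Im (phi x s) = 0.

Definition fzero : diffForm X := fun _ _ => 0.
Definition fone : diffForm X := fun _ => @unit_form R n.
Definition fadd phi psi : diffForm X := fun x s => phi x s + psi x s.
Definition fscale (a : R[i]) phi : diffForm X := fun x s => a * phi x s.
Definition fmul (f : X -> R) phi : diffForm X := fun x s => (f x)%:C * phi x s.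
Definition fwedge phi psi : diffForm X := fun x => wedge_alt (phi x) (psi x).
Definition fpow phi (r : nat) : diffForm X := iter r (fwedge phi) fone.

Definition cderiv (h : V -> R[i]) (z v : V) : R[i] :=
  'D_v (fun w => complex.Re (h w)) z +i* 'D_v (fun w => complex.Im (h w)) z.

(* The C-linear and C-antilinear parts of the differential. *)
Definition cderiv10 (h : V -> R[i]) (z v : V) : R[i] :=
  (cderiv h z v - 'i * cderiv h z (J v)) / 2.
Definition cderiv01 (h : V -> R[i]) (z v : V) : R[i] :=
  (cderiv h z v + 'i * cderiv h z (J v)) / 2.

(* (D phi)(v_0, ..., v_k) = sum_i (-1)^i D_(v_i) phi (v_0, ..^v_i.., v_k). *)
Definition alt_deriv (D : (V -> R[i]) -> V -> V -> R[i]) phi : diffForm X :=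
  fun x s => \sum_(i < size s) (-1) ^+ i *
    D (fun z => local_expr (chartAt x) phi z (take i s ++ drop i.+1 s))
      (chart_coord (chartAt x) x) (nth 0 s i).

Definition del : diffForm X -> diffForm X := alt_deriv cderiv10.
Definition delbar : diffForm X -> diffForm X := alt_deriv cderiv01.
Definition dform phi : diffForm X := fadd (del phi) (delbar phi).

(* dd^c = kappa * i del delbar, where kappa > 0 fixes the normalization. *)
Definition ddc (kappa : R) phi : diffForm X :=
  fscale (0 +i* kappa) (del (delbar phi)).

Definition hermitian_form (omega : diffForm X) : Prop :=
  [/\ form_bidegree 1 1 omega, real_form omega
    & forall x v, v != 0 -> 0 < omega x [:: v; J v]].

(* phi_k -> 0 in the C^oo topology *)
Definition cvg_form0 (phi : nat -> diffForm X) : Prop :=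
  forall (c : chartIdx X) (K : set V) (l s : seq V) (e : R),
    compact K -> K `<=` chart_image c -> 0 < e ->
    \forall k \near \oo, forall z, K z ->
      `|iter_deriv l (fun w => complex.Re (local_expr c (phi k) w s)) z| < e /\
      `|iter_deriv l (fun w => complex.Im (local_expr c (phi k) w s)) z| < e.

(* Test forms are not required to have compact support: these definitions are
   meant for compact X.  Smooth forms are then a Frechet space, so that
   sequential continuity is continuity. *)
Definition is_current (q : nat) S : Prop :=
  [/\ (q <= n)%N,
      forall (a : R[i]) phi psi,
        form_bidegree (n - q) (n - q) phi ->
        form_bidegree (n - q) (n - q) psi ->
        S (fadd (fscale a phi) psi) = a * S phi + S psi
    & forall phi : nat -> diffForm X,
        (forall k, form_bidegree (n - q) (n - q) (phi k)) -> cvg_form0 phi ->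
        (fun k => complex.Re (S (phi k))) @ \oo --> (0 : R) /\
        (fun k => complex.Im (S (phi k))) @ \oo --> (0 : R)].

Definition sp_test_form (r : nat) phi : Prop :=
  form_bidegree r r phi /\ forall x, strongly_positive r (phi x).

Definition positive_current (q : nat) S : Prop :=
  forall phi, sp_test_form (n - q) phi -> 0 <= S phi.

(* d S = 0, split into its two components del S = 0 and delbar S = 0. *)
Definition closed_current (q : nat) S : Prop :=
  forall (r : nat) psi, (r.+1 + q = n)%N ->
    (form_bidegree r r.+1 psi -> S (del psi) = 0) /\
    (form_bidegree r.+1 r psi -> S (delbar psi) = 0).

Definition closed_positive_current (q : nat) S : Prop :=
  [/\ is_current q S, positive_current q S & closed_current q S].

(* Integral over chart_dom c of h psi, for psi of bidegree (n, n). *)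
Definition chart_integral (c : chartIdx X) (h : X -> \bar R) psi : R[i] :=
  let I (part : R[i] -> R) := fine (integral_Cn
    ((fun z => h (chart_param c z) *
        (part (local_expr c psi z (std_frame R n)))%:E)%E \_ (chart_image c)))
  in I (@complex.Re R) +i* I (@complex.Im R).

Definition supported_in (c : chartIdx X) phi : Prop :=
  exists K : set X, [/\ compact K, K `<=` chart_dom c
    & forall x, ~ K x -> forall s, phi x s = 0].

(* <dd^c u + theta, phi> for phi with compact support in chart_dom c. *)
Definition ddc_add_pairing (kappa : R) (c : chartIdx X) (u : X -> \bar R)
    (theta phi : diffForm X) : R[i] :=
  chart_integral c u (ddc kappa phi) +
  chart_integral c (fun=> 1%E) (fwedge theta phi).

Definition quasi_psh (u : X -> \bar R) : Prop :=
  forall x, exists (U : set V) (f : V -> \bar R) (g : V -> R),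
    [/\ open U, U (chart_coord (chartAt x) x), U `<=` chart_image (chartAt x),
        psh_on U f /\ smooth_on U g
      & forall z, U z -> u (chart_param (chartAt x) z) = (f z + (g z)%:E)%E].

Definition PSH (kappa : R) (theta : diffForm X) (u : X -> \bar R) : Prop :=
  [/\ quasi_psh u,
      forall x, exists2 y, connected_component [set: X] x y & u y != -oo%E
    & forall c phi, supported_in c phi -> sp_test_form (n - 1) phi ->
        0 <= ddc_add_pairing kappa c u theta phi].

(* S = dd^c u + theta as (1,1)-currents; currents are determined locally. *)
Definition is_ddc_add (kappa : R) (u : X -> \bar R) (theta : diffForm X) S :
    Prop :=
  forall c phi, supported_in c phi -> form_bidegree (n - 1) (n - 1) phi ->
    S phi = ddc_add_pairing kappa c u theta phi.

Definition closed_real11 (theta : diffForm X) : Prop :=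
  [/\ form_bidegree 1 1 theta, real_form theta & dform theta = fzero].

Local Notation Borel := (g_sigma_algebraType (@open X)).

Definition signed_integral
    (mu : {finite_measure set Borel -> \bar R} *
          {finite_measure set Borel -> \bar R}) (g : X -> R) : R :=
  \int[mu.1]_(x in [set: Borel]) g x - \int[mu.2]_(x in [set: Borel]) g x.

(* The canonical extension of a linear form of order 0 on the smooth functions
   of the compact manifold X to bounded Borel functions: integration against the
   (unique) finite signed Borel measure representing it, written as a difference
   of two finite measures.  It is 0 if there is no such measure, i.e. if the
   linear form is not of order 0. *)
Definition order0_ext (L : (X -> R) -> R) (g : X -> R) : R :=
  let represents mu := forall f, smooth_fun f -> L f = signed_integral mu f in
  if pselect (exists mu, represents mu) is left h
  then signed_integral (projT1 (cid h)) g else 0.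

(* v S for S of order 0 and v bounded Borel:
   <v S, phi> is the integral of v against the measure f |-> <S, f phi>. *)
Definition mul_current (v : X -> R) S : current X := fun phi =>
  order0_ext (fun f => complex.Re (S (fmul f phi))) v +i*
  order0_ext (fun f => complex.Im (S (fmul f phi))) v.

(* 1_A S *)
Definition restrict_current (A : set X) S : current X := mul_current \1_A S.

Definition ddc_current (kappa : R) S : current X :=
  fun phi => S (ddc kappa phi).

Definition wedge_current (theta : diffForm X) S : current X :=
  fun phi => S (fwedge theta phi).

(* (dd^c v + theta) /\ S := dd^c (v S) + theta /\ S.  If locally v = u - g with
   u bounded psh and g smooth, this is dd^c (u S) + (theta - dd^c g) /\ S, since
   dd^c (g S) = dd^c g /\ S for S closed: iterating it is the multilinear
   expansion of Bedford-Taylor products. *)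
Definition bedford_taylor (kappa : R) (v : X -> R) (theta : diffForm X) S
    : current X :=
  fun phi => ddc_current kappa (mul_current v S) phi
             + wedge_current theta S phi.

Definition truncation (u : X -> \bar R) (k : nat) (x : X) : R :=
  fine (maxe (u x) (- k%:R)%:E).

Definition truncated_product (kappa : R) (m : nat) (theta : 'I_m -> diffForm X)
    (u : 'I_m -> X -> \bar R) (T : current X) (k : nat) : current X :=
  foldr (fun j S => bedford_taylor kappa (truncation (u j) k) (theta j) S) T
    (enum 'I_m).

(* ||S||_K for S of bidegree (q, q). *)
Definition mass (omega : diffForm X) (q : nat) (K : set X) S : R :=
  complex.Re (restrict_current K S (fpow omega (n - q))).

(* The condition does not depend on the decompositions T_j = dd^c u_j + theta_j,
   which exist globally on X; it is required for all of them. *)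
Definition non_pluripolar_product_well_defined (kappa : R) (omega : diffForm X)
    (m p : nat) (Tj : 'I_m -> current X) (T : current X) : Prop :=
  forall (theta : 'I_m -> diffForm X) (u : 'I_m -> X -> \bar R),
    (forall j, [/\ closed_real11 (theta j), PSH kappa (theta j) (u j)
                 & is_ddc_add kappa (u j) (theta j) (Tj j)]) ->
    forall K : set X, compact K ->
    exists M : R, forall k : nat,
      mass omega (m + p) K
        (restrict_current [set x | forall j, ((- k%:R)%:E < u j x)%E]
           (truncated_product kappa theta u T k)) <= M.

End Forms.

(* Main.v *)
(* Near every point, and for every k, max(u_j, -k) is a bounded
   pointwise limit of smooth functions v_N with dd^c v_N + theta_j + C omega >= 0,
   where C depends neither on k nor, X being compact, on the point.  Since
   integration by parts is available for smooth v_N, an induction on the number of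
   factors shows that prod_j (dd^c max(u_j, -k) + theta_j + C omega) /\ T is a
   positive current.  Expanding the product, every Bedford-Taylor product R_k of a
   subfamily has order 0, and is bounded above and below by such positive currents.
   The conditions on omega give dd^c (omega^r) = 0 for all r, so by Stokes the
   total masses of the positive currents do not depend on k; hence the measures
   R_k /\ omega^r have uniformly bounded total variation, which bounds the masses
   of their restrictions to Borel sets.

   The v_N are obtained from a sup-convolution (which makes a bounded usc function
   Lipschitz and decreases to it) followed by one-dimensional mollifications along
   the coordinate directions.  The submean value property is used in a form
   involving finitely many points of the circle, with an error, so that it passes
   through both operations; Taylor's formula then gives the sign of the Levi form. *)

Require Import Defs.
From HB Require Import structures.
From mathcomp Require Import all_boot all_order all_algebra.
From mathcomp Require Import all_classical all_reals all_analysis.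
From mathcomp Require Import measurable_realfun.
From mathcomp Require Import complex.
From mathcomp Require Import ring lra.
Import Defs.

Set Implicit Arguments.
Unset Strict Implicit.
Unset Printing Implicit Defensive.

Import Order.TTheory GRing.Theory Num.Theory.
Import numFieldNormedType.Exports.

Local Open Scope classical_set_scope.
Local Open Scope complex_scope.
Local Open Scope ring_scope.

(** * Exterior algebra *)

Section Exterior.
Variables (R : realType) (n : nat).
Local Notation V := (Cn R n).
Implicit Types (a b c : seq V -> R[i]) (s : seq V) (v w : V).

(** The definition of [mul_current] gives 0 when the current has no representing measures, so order
    0 must be known before each truncation is multiplied in. Plain products of the dd^c v_j +
    theta_j need not be positive, so order 0 is not automatic for them. Adding C omega restores
    positivity, but omega is not closed, and integration by parts needs closed currents. Hence only
    plain products are iterated as Bedford-Taylor currents; the perturbed product is defined by its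
    expansion, with the powers of omega moved to the test form. One induction carries linearity,
    order 0 and closedness of the plain product together with positivity of the perturbed one.

    Order 0 is encoded as a difference of two positive functionals on smooth functions. Daniell's
    construction turns these into Borel measures, and uniqueness makes the choice inside
    [order0_ext] harmless. The same encoding yields the final estimate: the value at 1 of the
    positive part dominates the mass on every Borel set. *)

Definition contr v a : seq V -> R[i] := fun s => a (v :: s).
Definition sgnf a : seq V -> R[i] := fun s => (-1) ^+ size s * a s.

Lemma wedge_nil a b : wedge_alt a b [::] = a [::] * b [::].
Proof.
rewrite /wedge_alt (big_pred1 [tuple]) /= ?expr0 ?mul1r //.
by move=> t; apply/esym/eqP; rewrite tuple0; apply/val_inj.
Qed.

(** The first vector goes either to [a] or to [b]; in the second case it jumps over all vectors
    given to [a], and [sgnf a] records the sign. So contraction is an antiderivation. The algebra of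
    [wedge_alt] follows from this recursion by induction on the vectors, without any further
    handling of shuffles. *)
Lemma wedge_cons a b v s : wedge_alt a b (v :: s) =
  wedge_alt (contr v a) b s + wedge_alt (sgnf a) (contr v b) s.
Proof.
rewrite /wedge_alt /=.
rewrite (reindex (fun p : bool * (size s).-tuple bool => [tuple of p.1 :: p.2]))
  /=; last first.
  exists (fun t : (size s).+1.-tuple bool => (thead t, [tuple of behead t])).
    by case=> x t _ /=; congr pair; apply: val_inj.
  by move=> t _; rewrite [RHS]tuple_eta; apply: val_inj.
rewrite -(pair_bigA _ (fun x (t : (size s).-tuple bool) =>
  (-1) ^+ shuffle_inv (x :: t) * a (mask (x :: t) (v :: s)) *
  b (mask (map negb (x :: t)) (v :: s)))) /=.
rewrite big_bool /=; congr (_ + _).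
apply: eq_bigr => t _; rewrite /sgnf /contr exprD size_mask ?size_tuple //.
by congr (_ * _); rewrite mulrA (mulrC ((-1) ^+ count id t)).
Qed.

Lemma sgnfK a : sgnf (sgnf a) = a.
Proof.
by apply/funext => s; rewrite /sgnf mulrA -expr2 sqrr_sign mul1r.
Qed.

Lemma contr_sgnf v a : contr v (sgnf a) = (fun s => - sgnf (contr v a) s).
Proof. by apply/funext => s; rewrite /contr /sgnf /= exprS !mulN1r mulNr. Qed.

Lemma wedgeDl a a' b s :
  wedge_alt (fun s => a s + a' s) b s = wedge_alt a b s + wedge_alt a' b s.
Proof.
by rewrite -big_split; apply: eq_bigr => t _; rewrite mulrDr mulrDl.
Qed.

Lemma wedgeDr a b b' s :
  wedge_alt a (fun s => b s + b' s) s = wedge_alt a b s + wedge_alt a b' s.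
Proof. by rewrite -big_split; apply: eq_bigr => t _; rewrite mulrDr. Qed.

Lemma wedgeZl k a b s :
  wedge_alt (fun s => k * a s) b s = k * wedge_alt a b s.
Proof.
rewrite /wedge_alt mulr_sumr; apply: eq_bigr => t _.
by rewrite (mulrCA _ k) -!mulrA.
Qed.

Lemma wedgeZr k a b s :
  wedge_alt a (fun s => k * b s) s = k * wedge_alt a b s.
Proof.
by rewrite /wedge_alt mulr_sumr; apply: eq_bigr => t _; rewrite mulrCA.
Qed.

Lemma wedgeNl a b s : wedge_alt (fun s => - a s) b s = - wedge_alt a b s.
Proof.
rewrite -[RHS]mulN1r -wedgeZl; congr wedge_alt.
by apply/funext => t; rewrite mulN1r.
Qed.

Lemma wedgeNr a b s : wedge_alt a (fun s => - b s) s = - wedge_alt a b s.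
Proof.
rewrite -[RHS]mulN1r -wedgeZr; congr wedge_alt.
by apply/funext => t; rewrite mulN1r.
Qed.

Lemma wedge0l b s : wedge_alt (fun=> 0) b s = 0.
Proof. by apply: big1 => t _; rewrite mulr0 mul0r. Qed.

Lemma wedge0r a s : wedge_alt a (fun=> 0) s = 0.
Proof. by apply: big1 => t _; rewrite mulr0. Qed.

Lemma wedge_suml (I : Type) (r : seq I) (F : I -> seq V -> R[i]) b s :
  wedge_alt (fun s => \sum_(i <- r) F i s) b s =
  \sum_(i <- r) wedge_alt (F i) b s.
Proof.
elim: r => [|i r IH].
  rewrite big_nil -[RHS](wedge0l b s); congr wedge_alt.
  by apply/funext => t; rewrite big_nil.
rewrite big_cons -IH -wedgeDl; congr wedge_alt.
by apply/funext => t; rewrite big_cons.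
Qed.

Lemma wedge_sumr (I : Type) (r : seq I) (F : I -> seq V -> R[i]) a s :
  wedge_alt a (fun s => \sum_(i <- r) F i s) s =
  \sum_(i <- r) wedge_alt a (F i) s.
Proof.
elim: r => [|i r IH].
  rewrite big_nil -[RHS](wedge0r a s); congr wedge_alt.
  by apply/funext => t; rewrite big_nil.
rewrite big_cons -IH -wedgeDr; congr wedge_alt.
by apply/funext => t; rewrite big_cons.
Qed.

Lemma contr_wedge v a b : contr v (wedge_alt a b) =
  (fun s => wedge_alt (contr v a) b s + wedge_alt (sgnf a) (contr v b) s).
Proof. by apply/funext => s; rewrite /contr wedge_cons. Qed.

Lemma sgnf_wedge a b : sgnf (wedge_alt a b) = wedge_alt (sgnf a) (sgnf b).
Proof.
apply/funext => s; elim: s a b => [|v s IH] a b.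
  by rewrite /sgnf !wedge_nil /= expr0 !mul1r.
rewrite [LHS]/sgnf wedge_cons /= exprS -mulrA mulrDr.
have -> : (-1) ^+ size s * wedge_alt (contr v a) b s =
  sgnf (wedge_alt (contr v a) b) s by [].
have -> : (-1) ^+ size s * wedge_alt (sgnf a) (contr v b) s =
  sgnf (wedge_alt (sgnf a) (contr v b)) s by [].
rewrite !IH wedge_cons !contr_sgnf wedgeNl wedgeNr -!/(sgnf _).
by rewrite mulN1r opprD.
Qed.

Lemma wedgeA a b c :
  wedge_alt a (wedge_alt b c) = wedge_alt (wedge_alt a b) c.
Proof.
apply/funext => s; elim: s a b c => [|v s IH] a b c.
  by rewrite !wedge_nil mulrA.
rewrite !wedge_cons sgnf_wedge !contr_wedge wedgeDl wedgeDr !IH.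
by rewrite addrA.
Qed.

Lemma wedge1l a : wedge_alt (@unit_form R n) a = a.
Proof.
apply/funext => s; elim: s a => [|v s IH] a; first by rewrite wedge_nil mul1r.
rewrite wedge_cons [X in X + _](_ : _ = 0); last first.
  by rewrite -[RHS](wedge0l a s).
rewrite add0r [sgnf _](_ : _ = @unit_form R n) ?IH //.
by apply/funext => -[|x t]; rewrite /sgnf /= ?expr0 ?mul1r ?mulr0.
Qed.

Lemma wedge1r a : wedge_alt a (@unit_form R n) = a.
Proof.
apply/funext => s; elim: s a => [|v s IH] a; first by rewrite wedge_nil mulr1.
by rewrite wedge_cons IH [X in _ + X](wedge0r _ s) addr0.
Qed.

Definition homogeneous (k : nat) a := forall s, size s != k -> a s = 0.

Lemma contr_homogeneous k v a :
  homogeneous k.+1 a -> homogeneous k (contr v a).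
Proof. by move=> h s hs; apply: h. Qed.

Lemma sgnf_hom k a : homogeneous k a -> sgnf a = (fun s => (-1) ^+ k * a s).
Proof.
move=> h; apply/funext => s; rewrite /sgnf.
by have [->//|/h->] := eqVneq (size s) k; rewrite !mulr0.
Qed.

Lemma wedge_hom k l a b : homogeneous k a -> homogeneous l b ->
  homogeneous (k + l) (wedge_alt a b).
Proof.
move=> ha hb s hs; apply: big1 => t _.
have [e|/ha->] := eqVneq (size (mask t s)) k; last by rewrite mulr0 mul0r.
rewrite hb ?mulr0 // size_mask ?size_map ?size_tuple //.
apply: contra hs => /eqP <-; rewrite -e size_mask ?size_tuple //.
by rewrite count_map (count_predC id t) size_tuple.
Qed.

Lemma wedgeC k l a b s : homogeneous k a -> homogeneous l b ->
  wedge_alt a b s = (-1) ^+ (k * l) * wedge_alt b a s.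
Proof.
elim: s k l a b => [|v s IH] k l a b ha hb.
  rewrite !wedge_nil mulrCA; case: k ha => [|k] ha.
    by rewrite mul0n expr0 mul1r mulrC.
  by rewrite ha // !(mul0r, mulr0).
rewrite !wedge_cons (sgnf_hom ha) (sgnf_hom hb) !wedgeZl mulrDr addrC.
have E k' l' a' b' : homogeneous k' a' -> homogeneous l' b' ->
    (-1) ^+ k' * wedge_alt a' (contr v b') s =
    (-1) ^+ (k' * l') * wedge_alt (contr v b') a' s.
  case: l' => [|l'] ha' hb'.
    rewrite [contr v b'](_ : _ = fun=> 0) ?wedge0l ?wedge0r ?mulr0 //.
    by apply/funext => t; apply: hb'.
  rewrite (IH k' l') //; last exact: contr_homogeneous.
  by rewrite mulrA -exprD mulnS.
rewrite (E k l) //; congr (_ + _); rewrite (E l k) // mulnC mulrA -exprD.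
by rewrite addnn -mul2n exprM sqrrN expr1n expr1n mul1r.
Qed.

Lemma wedgeC_even k l a b : ~~ odd (k * l) -> homogeneous k a ->
  homogeneous l b -> wedge_alt a b = wedge_alt b a.
Proof.
move=> e ha hb; apply/funext => s; rewrite (wedgeC s ha hb).
by rewrite -signr_odd (negbTE e) expr0 mul1r.
Qed.

Lemma wedge_map (f : V -> V) a b s : wedge_alt a b (map f s) =
  wedge_alt (a \o map f) (b \o map f) s.
Proof.
elim: s a b => [|v s IH] a b; first by rewrite !wedge_nil.
rewrite /= !wedge_cons !IH; congr (_ + wedge_alt _ _ s).
by apply/funext => t; rewrite /sgnf /= size_map.
Qed.

(* For multilinear functions, vanishing on lists with two equal neighbours is
   equivalent to alternation, and is stable under the recursion for wedge. *)
Definition mlin a := forall (s1 s2 : seq V) (t : R) (v w : V),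
  a (s1 ++ (t *: v + w) :: s2) =
  t%:C * a (s1 ++ v :: s2) + a (s1 ++ w :: s2).
Definition adjalt a := forall s1 s2 v, a (s1 ++ [:: v, v & s2]) = 0.

Lemma mlin_contr v a : mlin a -> mlin (contr v a).
Proof. by move=> h s1 s2 t x y; rewrite /contr -!cat_cons h. Qed.

Lemma mlin_sgnf a : mlin a -> mlin (sgnf a).
Proof.
move=> h s1 s2 t x y; rewrite /sgnf !size_cat /= h mulrDr; congr (_ + _).
by rewrite mulrCA.
Qed.

Lemma adjalt_contr v a : adjalt a -> adjalt (contr v a).
Proof. by move=> h s1 s2 x; rewrite /contr -cat_cons h. Qed.

Lemma adjalt_sgnf a : adjalt a -> adjalt (sgnf a).
Proof. by move=> h s1 s2 x; rewrite /sgnf h mulr0. Qed.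

Lemma mlin_wedge a b : mlin a -> mlin b -> mlin (wedge_alt a b).
Proof.
move=> ha hb s1; elim: s1 a b ha hb => [|x s1 IH] a b ha hb s2 t v w.
  rewrite /= !wedge_cons.
  have -> : contr (t *: v + w) a = (fun s => t%:C * contr v a s + contr w a s).
    by apply/funext => s; exact: (ha [::]).
  have -> : contr (t *: v + w) b = (fun s => t%:C * contr v b s + contr w b s).
    by apply/funext => s; exact: (hb [::]).
  rewrite wedgeDl wedgeDr wedgeZl wedgeZr; ring.
rewrite /= !wedge_cons !IH ?mulrDr; first exact: addrACA.
all: by [|exact: mlin_contr|exact: mlin_sgnf].
Qed.

Lemma adjalt_wedge a b : adjalt a -> adjalt b -> adjalt (wedge_alt a b).
Proof.
move=> ha hb s1; elim: s1 a b ha hb => [|x s1 IH] a b ha hb s2 v.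
  rewrite /= !wedge_cons contr_sgnf sgnfK wedgeNl.
  have -> : contr v (contr v a) = fun=> 0 by apply/funext => s; exact: (ha [::]).
  have -> : contr v (contr v b) = fun=> 0 by apply/funext => s; exact: (hb [::]).
  by rewrite wedge0l wedge0r addr0 add0r addrN.
by rewrite /= !wedge_cons !IH ?addr0 //;
  do ?[exact: adjalt_contr | exact: adjalt_sgnf].
Qed.

(** Polarization of the vanishing on the repeated vector v + w, written [1 *: v + w] to match the
    form of [mlin]. *)
Lemma adjalt_swap a s1 s2 v w : mlin a -> adjalt a ->
  a (s1 ++ [:: v, w & s2]) = - a (s1 ++ [:: w, v & s2]).
Proof.
move=> ha hb; have := hb s1 s2 (1 *: v + w).
rewrite ha -(cat_rcons v s1) -(cat_rcons w s1) !ha !cat_rcons !hb !rmorph1.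
rewrite !mul1r addr0 add0r => e; apply/eqP; rewrite -addr_eq0.
by apply/eqP; rewrite -[RHS]e.
Qed.

(** Adjacent swaps bring two equal entries next to each other. *)
Lemma adjaltP a : mlin a -> adjalt a -> forall s, ~~ uniq s -> a s = 0.
Proof.
move=> ha hb.
have H : forall s1 t s2 v, a (s1 ++ v :: t ++ v :: s2) = 0.
  move=> s1 t; elim: t s1 => [|w t IH] s1 s2 v; first exact: hb.
  rewrite /= adjalt_swap // -cat_rcons IH oppr0 //.
move=> s us; suff [s1 [t [s2 [v ->]]]] : exists s1 t s2 v,
  s = s1 ++ v :: t ++ v :: s2 by [].
elim: s us => // x s IH; rewrite /= negb_and negbK => /orP[|].
  by case/splitPr => p1 p2; exists [::], p1, p2, x.
by case/IH => s1 [t [s2 [v ->]]]; exists (x :: s1), t, s2, v.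
Qed.

Lemma alternatingP k a :
  alternating k a <-> [/\ homogeneous k a, mlin a & adjalt a].
Proof.
split=> -[h1 h2 h3]; split => //; last exact: adjaltP.
move=> s1 s2 v; apply: h3; rewrite cat_uniq /= inE eqxx /=.
by rewrite !(andbF, andbT).
Qed.

Lemma alternating_wedge k l a b : alternating k a -> alternating l b ->
  alternating (k + l) (wedge_alt a b).
Proof.
move=> /alternatingP[a1 a2 a3] /alternatingP[b1 b2 b3].
apply/alternatingP; split; [exact: wedge_hom|exact: mlin_wedge|].
exact: adjalt_wedge.
Qed.

Lemma bidegree_wedge p q p' q' a b : bidegree p q a -> bidegree p' q' b ->
  bidegree (p + p') (q + q') (wedge_alt a b).
Proof.
move=> [ha ea] [hb eb]; split.
  by rewrite addnACA; exact: alternating_wedge.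
move=> z s; rewrite wedge_map.
have -> : a \o map (cscale z) = fun s => z ^+ p * conjc z ^+ q * a s.
  by apply/funext => t; exact: ea.
have -> : b \o map (cscale z) = fun s => z ^+ p' * conjc z ^+ q' * b s.
  by apply/funext => t; exact: eb.
rewrite wedgeZl wedgeZr !exprD; ring.
Qed.

Lemma alternating_lin k a b (t : R[i]) : alternating k a -> alternating k b ->
  alternating k (fun s => t * a s + b s).
Proof.
move=> [a1 a2 a3] [b1 b2 b3]; split.
- by move=> s hs; rewrite a1 // b1 // mulr0 addr0.
- by move=> s1 s2 u v w; rewrite a2 b2; ring.
- by move=> s hs; rewrite a3 // b3 // mulr0 addr0.
Qed.

Lemma bidegree_lin p q a b (t : R[i]) : bidegree p q a -> bidegree p q b ->
  bidegree p q (fun s => t * a s + b s).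
Proof.
move=> [a1 a2] [b1 b2]; split; first exact: alternating_lin.
by move=> z s; rewrite a2 b2; ring.
Qed.

Lemma bidegree0 p q : bidegree p q (fun _ : seq V => 0).
Proof.
split; last by move=> *; rewrite mulr0.
by split=> // *; rewrite mulr0 addr0.
Qed.

Lemma bidegreeZ p q a (t : R[i]) : bidegree p q a ->
  bidegree p q (fun s => t * a s).
Proof.
move=> h; have := bidegree_lin t h (@bidegree0 p q).
by congr bidegree; apply/funext => s; rewrite addr0.
Qed.

Lemma bidegree_unit : bidegree 0 0 (@unit_form R n).
Proof.
split; last by move=> z [|x s] /=; rewrite !expr0 ?mulr0 ?mulr1.
split=> [[]//|s1 s2 t v w|[]//].
by case: s1 => [|? ?] /=; rewrite mulr0 addr0.
Qed.

End Exterior.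

(** * Smooth functions *)

Section Calculus.
Variables (R : realType).

Lemma diff_eps (V W : normedModType R) (f : V -> W) (df : {linear V -> W}) x :
  continuous df ->
  (forall e : R, 0 < e -> \forall h \near (0 : V),
     `|f (h + x) - f x - df h| <= e * `|h|) ->
  differentiable f x /\ 'd f x = df :> (V -> W).
Proof.
move=> cdf H.
have E : f \o shift x = cst (f x) + df +o_ (0 : V) id.
  apply/eqaddoP => e e0; near=> h; rewrite /= fctE /= opprD addrA.
  by near: h; exact: H.
have dE := diff_unique cdf E; split => //.
by apply/diff_locallyP; rewrite dE; split.
Unshelve. all: by end_near. Qed.

Lemma near_eq_differentiable (V W : normedModType R) (f g : V -> W) x :
  (\forall y \near x, f y = g y) -> differentiable f x -> differentiable g x.
Proof.
move=> fg df; have cdf := diff_continuous df.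
apply: (proj1 (diff_eps cdf _)) => e e0.
have /eqaddoP/(_ e e0) := diff_locally df.
have fg' : \forall h \near (0 : V), f (h + x) = g (h + x).
  rewrite (near_shift x) /=; apply: filterS fg => y fg.
  by rewrite /= sub0r addrNK.
have gx := nbhs_singleton fg.
by apply: filterS2 fg' => h <- H; rewrite -gx (le_trans _ H)// opprD addrA.
Qed.

Lemma dderivD (V W : normedModType R) (f g : V -> W) z v :
  differentiable f z -> differentiable g z ->
  'D_v (fun y => f y + g y) z = 'D_v f z + 'D_v g z.
Proof. by move=> df dg; apply: deriveD; exact: diff_derivable. Qed.

Lemma dderivB (V W : normedModType R) (f g : V -> W) z v :
  differentiable f z -> differentiable g z ->
  'D_v (fun y => f y - g y) z = 'D_v f z - 'D_v g z.
Proof. by move=> df dg; apply: deriveB; exact: diff_derivable. Qed.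

Lemma dderivM (V : normedModType R) (f g : V -> R) z v :
  differentiable f z -> differentiable g z ->
  'D_v (fun y => f y * g y) z = 'D_v f z * g z + f z * 'D_v g z.
Proof.
move=> df dg; rewrite [LHS]deriveM; try exact: diff_derivable.
by rewrite addrC /GRing.scale /= mulrC.
Qed.

Lemma dderiv_cst (V W : normedModType R) (c : W) (z v : V) :
  'D_v (fun=> c) z = 0.
Proof. exact: derive_cst. Qed.

Lemma dderivZv (V W : normedModType R) (f : V -> W) z v (t : R) :
  differentiable f z -> 'D_(t *: v) f z = t *: 'D_v f z.
Proof. by move=> df; rewrite !deriveE // linearZ. Qed.

Lemma dderivDv (V W : normedModType R) (f : V -> W) z v w :
  differentiable f z -> 'D_(v + w) f z = 'D_v f z + 'D_w f z.
Proof. by move=> df; rewrite !deriveE // linearD. Qed.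

Lemma dderiv_comp (U V W : normedModType R) (f : U -> V) (g : V -> W) z v :
  differentiable f z -> differentiable g (f z) ->
  'D_v (fun y => g (f y)) z = 'D_('D_v f z) g (f z).
Proof.
move=> df dg; rewrite !deriveE //; last exact: differentiable_comp.
by rewrite (diff_comp df dg).
Qed.

Lemma near_open (V : topologicalType) (U : set V) z (P : V -> Prop) :
  open U -> U z -> (forall y, U y -> P y) -> \forall y \near z, P y.
Proof. by move=> oU Uz H; apply: filterS H _; exact: open_nbhs_nbhs. Qed.

Section Smooth.
Variable (V : normedModType R).

Lemma iter_deriv_eq (W : normedModType R) (U : set V) (f g : V -> W) l :
  open U -> (forall z, U z -> f z = g z) ->
  forall z, U z -> iter_deriv l f z = iter_deriv l g z.
Proof.
move=> oU fg; elim: l => //= v l IH z Uz.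
by apply: near_eq_derive; apply: near_open oU Uz IH.
Qed.

Lemma smooth_eq (W : normedModType R) (U : set V) (f g : V -> W) :
  open U -> (forall z, U z -> f z = g z) -> smooth_on U f -> smooth_on U g.
Proof.
move=> oU fg sf l z Uz; apply: near_eq_differentiable (sf l z Uz).
apply: (near_open oU Uz) => y Uy; exact: (@iter_deriv_eq _ U f g l oU fg y Uy).
Qed.

Lemma smooth_subset (W : normedModType R) (U U' : set V) (f : V -> W) :
  U' `<=` U -> smooth_on U f -> smooth_on U' f.
Proof. by move=> s h l z /s; exact: h. Qed.

Lemma smooth_diff (W : normedModType R) (U : set V) (f : V -> W) z :
  smooth_on U f -> U z -> differentiable f z.
Proof. by move=> /(_ [::] z). Qed.

Lemma smooth_deriv (W : normedModType R) (U : set V) (f : V -> W) v :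
  smooth_on U f -> smooth_on U ('D_v f).
Proof.
move=> sf l z Uz; have := sf (l ++ [:: v]) z Uz.
by rewrite /iter_deriv foldr_cat.
Qed.

(** Coinduction for smoothness: a class of differentiable functions that is closed under directional
    derivatives consists of smooth functions. The induction takes directions from the end of the
    list, since [iter_deriv] applies the last one first. *)
Lemma smooth_coind (W : normedModType R) (U : set V) (P : (V -> W) -> Prop) :
  open U ->
  (forall f, P f -> forall z, U z -> differentiable f z) ->
  (forall f v, P f -> exists2 g, P g & forall z, U z -> 'D_v f z = g z) ->
  forall f, P f -> smooth_on U f.
Proof.
move=> oP Pd PD f Pf l; elim/last_ind: l f Pf => [|l v IH] f Pf z Uz.
  exact: Pd.
have [g Pg fg] := PD f v Pf; have := IH g Pg z Uz.
rewrite /iter_deriv -cats1 foldr_cat /=.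
apply: near_eq_differentiable; apply: (near_open oP Uz) => y Uy.
exact/esym/(@iter_deriv_eq _ U ('D_v f) g l oP fg y Uy).
Qed.

(** The Leibniz and chain rules turn one generator into a sum of several, so the class used for
    coinduction has to consist of finite sums of generators. *)
Inductive fspan (G : (V -> R) -> Prop) : (V -> R) -> Prop :=
| fspan0 : fspan G (fun=> 0)
| fspanD f g : G f -> fspan G g -> fspan G (fun z => f z + g z).

Lemma fspan_add G f g : fspan G f -> fspan G g -> fspan G (fun z => f z + g z).
Proof.
move=> Gf Gg; elim: Gf => [|h k Gh _ IH].
  by rewrite (_ : (fun z => _) = g) //; apply/funext => z; rewrite add0r.
rewrite (_ : (fun z => _) = fun z => h z + (k z + g z)); first exact: fspanD.
by apply/funext => z; rewrite addrA.
Qed.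

Lemma fspan1 G f : G f -> fspan G f.
Proof.
move=> Gf; rewrite (_ : f = fun z => f z + 0); last first.
  by apply/funext => z; rewrite addr0.
exact: fspanD Gf (fspan0 _).
Qed.

Lemma fspan_sum G (I : Type) (r : seq I) (F : I -> V -> R) :
  (forall i, fspan G (F i)) -> fspan G (fun z => \sum_(i <- r) F i z).
Proof.
move=> GF; elim: r => [|i r IH].
  rewrite (_ : (fun z => _) = fun=> 0); first exact: fspan0.
  by apply/funext => z; rewrite big_nil.
rewrite (_ : (fun z => _) = fun z => F i z + \sum_(j <- r) F j z).
  exact: fspan_add.
by apply/funext => z; rewrite big_cons.
Qed.

Lemma smooth_coind_span (U : set V) (G : (V -> R) -> Prop) : open U ->
  (forall f, G f -> forall z, U z -> differentiable f z) ->
  (forall f v, G f -> exists2 g, fspan G g & forall z, U z -> 'D_v f z = g z) ->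
  forall f, fspan G f -> smooth_on U f.
Proof.
move=> oU Gd GD.
have Sd f : fspan G f -> forall z, U z -> differentiable f z.
  elim=> [z _|g h Gg _ IH z Uz]; first exact: differentiable_cst.
  by apply: differentiableD; [exact: Gd|exact: IH].
apply: (smooth_coind oU) => // f v; elim=> [|g h Gg Sh [k Sk hk]].
  by exists (fun=> 0); [exact: fspan0|move=> z _; exact: dderiv_cst].
have [k' Sk' hk'] := GD g v Gg.
exists (fun z => k' z + k z); first exact: fspan_add.
by move=> z Uz; rewrite dderivD ?hk' ?hk //; [exact: Gd|exact: Sd].
Qed.

Lemma smooth_cst (W : normedModType R) (U : set V) (c : W) :
  open U -> smooth_on U (fun=> c).
Proof.
move=> oU; apply: (@smooth_coind _ _ (fun f => exists c, f = fun=> c)) => //.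
- by move=> f [d ->] z _; exact: differentiable_cst.
- move=> f v [d ->]; exists (fun=> 0); first by exists 0.
  by move=> z _; exact: dderiv_cst.
- by exists c.
Qed.

Lemma smoothD (W : normedModType R) (U : set V) (f g : V -> W) : open U ->
  smooth_on U f -> smooth_on U g -> smooth_on U (fun z => f z + g z).
Proof.
move=> oU sf sg; apply: (@smooth_coind _ _ (fun h => exists f g,
  [/\ smooth_on U f, smooth_on U g & h = fun z => f z + g z])) => //.
- move=> _ [{sf sg}f [{}g [sf sg ->]]] z Uz.
  by apply: differentiableD; [exact: smooth_diff sf Uz|exact: smooth_diff sg Uz].
- move=> _ v [{sf sg}f [{}g [sf sg ->]]].
  exists (fun z => 'D_v f z + 'D_v g z).
    by exists ('D_v f), ('D_v g); split=> //; exact: smooth_deriv.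
  by move=> z Uz; rewrite dderivD //;
    [exact: smooth_diff sf Uz|exact: smooth_diff sg Uz].
- by exists f, g.
Qed.

Lemma smoothM (U : set V) (f g : V -> R) : open U ->
  smooth_on U f -> smooth_on U g -> smooth_on U (fun z => f z * g z).
Proof.
move=> oU sf sg; pose G h := exists f g : V -> R,
  [/\ smooth_on U f, smooth_on U g & h = fun z => f z * g z].
apply: (@smooth_coind_span _ G) => //.
- move=> _ [{sf sg}f [{}g [sf sg ->]]] z Uz.
  by apply: differentiableM; [exact: smooth_diff sf Uz|exact: smooth_diff sg Uz].
- move=> _ v [{sf sg}f [{}g [sf sg ->]]].
  exists (fun z => 'D_v f z * g z + f z * 'D_v g z).
    apply: fspan_add; apply: fspan1; [exists ('D_v f), g|exists f, ('D_v g)];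
      by split=> //; exact: smooth_deriv.
  by move=> z Uz; rewrite dderivM //;
    [exact: smooth_diff sf Uz|exact: smooth_diff sg Uz].
- by apply: fspan1; exists f, g.
Qed.

Lemma smoothZ (U : set V) (f : V -> R) (c : R) : open U ->
  smooth_on U f -> smooth_on U (fun z => c * f z).
Proof. by move=> oU sf; apply: smoothM => //; exact: smooth_cst. Qed.

Lemma smoothN (U : set V) (f : V -> R) : open U ->
  smooth_on U f -> smooth_on U (fun z => - f z).
Proof.
move=> oU sf; apply: smooth_eq (smoothZ (-1) oU sf) => // z _.
by rewrite mulN1r.
Qed.

Lemma smoothB (U : set V) (f g : V -> R) : open U ->
  smooth_on U f -> smooth_on U g -> smooth_on U (fun z => f z - g z).
Proof. by move=> oU sf sg; apply: smoothD => //; exact: smoothN. Qed.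

Lemma smooth_sum (I : Type) (r : seq I) (F : I -> V -> R) U : open U ->
  (forall i, smooth_on U (F i)) -> smooth_on U (fun z => \sum_(i <- r) F i z).
Proof.
move=> oU sF; elim: r => [|i r IH].
  apply: smooth_eq (smooth_cst 0 oU) => // z _; first by rewrite big_nil.
apply: smooth_eq (smoothD oU (sF i) IH) => // z _.
by rewrite big_cons.
Qed.

Lemma smooth_prod (I : Type) (r : seq I) (F : I -> V -> R) U : open U ->
  (forall i, smooth_on U (F i)) -> smooth_on U (fun z => \prod_(i <- r) F i z).
Proof.
move=> oU sF; elim: r => [|i r IH].
  apply: smooth_eq (smooth_cst (1 : R) oU) => // z _; first by rewrite big_nil.
apply: smooth_eq (smoothM oU (sF i) IH) => // z _.
by rewrite big_cons.
Qed.

Lemma smooth_exp (f : V -> R) k U : open U ->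
  smooth_on U f -> smooth_on U (fun z => f z ^+ k).
Proof.
move=> oU sf; elim: k => [|k IH].
  by apply: smooth_eq (smooth_cst (1 : R) oU) => // z _; rewrite expr0.
apply: smooth_eq (smoothM oU sf IH) => // z _.
by rewrite exprS.
Qed.

Lemma smooth_linear (f : {linear V -> R}) U : open U ->
  continuous f -> smooth_on U f.
Proof.
move=> oU cf; apply: (@smooth_coind _ _ (fun g => g = f \/ exists c, g = fun=> c)).
- by [].
- move=> g [->|[c ->]] z _; last exact: differentiable_cst.
  exact: linear_differentiable.
- move=> g v [->|[c ->]].
    exists (fun=> f v); first by right; exists (f v).
    move=> z _; rewrite deriveE; last exact: linear_differentiable.
    by rewrite diff_lin.
  exists (fun=> 0); first by right; exists 0.
  by move=> z _; exact: dderiv_cst.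
- by left.
Qed.

End Smooth.

Section Smooth2.
Variable (V : normedModType R).

(* The target of t is given by finitely many coordinates x_i and vectors b_i. *)
Lemma smooth_comp (W : normedModType R) (I : finType) (b : I -> W)
    (x : I -> W -> R) (t : V -> W) (f : W -> R) (U : set V) (U' : set W) :
  open U -> (forall z, U z -> U' (t z)) ->
  (forall z, U z -> differentiable t z) ->
  (forall i, smooth_on U (x i \o t)) ->
  (forall z v, U z -> 'D_v t z = \sum_i 'D_v (x i \o t) z *: b i) ->
  smooth_on U' f -> smooth_on U (f \o t).
Proof.
move=> oU tU dt st Dt sf; pose G h := exists (f : W -> R) (g : V -> R),
  [/\ smooth_on U' f, smooth_on U g & h = fun z => f (t z) * g z].
have dft (h : W -> R) z : smooth_on U' h -> U z -> differentiable (fun y => h (t y)) z.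
  move=> sh Uz; apply: differentiable_comp (dt z Uz) _.
  exact: smooth_diff sh (tU _ Uz).
apply: (@smooth_coind_span _ U G) => //.
- move=> _ [{sf}f [g [sf sg ->]]] z Uz.
  by apply: differentiableM; [exact: dft|exact: smooth_diff sg Uz].
- move=> _ v [{sf}f [g [sf sg ->]]].
  exists (fun z => \sum_(i <- index_enum I)
      ('D_(b i) f (t z) * ('D_v (x i \o t) z * g z)) + f (t z) * 'D_v g z).
    apply: fspan_add; last first.
      by apply: fspan1; exists f, ('D_v g); split=> //; exact: smooth_deriv.
    apply: fspan_sum => i; apply: fspan1.
    exists ('D_(b i) f), (fun z => 'D_v (x i \o t) z * g z); split => //.
      exact: smooth_deriv.
    by apply: smoothM => //; exact: smooth_deriv.
  move=> z Uz; rewrite dderivM; [|exact: dft|exact: smooth_diff sg Uz].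
  congr (_ + _); have df := smooth_diff sf (tU _ Uz).
  rewrite dderiv_comp //; last exact: dt.
  rewrite Dt // deriveE // linear_sum mulr_suml; apply: eq_bigr => i _.
  rewrite linearZ /= -deriveE // /GRing.scale /= -!mulrA mulrCA; congr (_ * _).
- apply: fspan1; exists f, (fun=> 1); split=> //; first exact: smooth_cst.
  by apply/funext => z /=; rewrite mulr1.
Qed.

Lemma smooth_comp1 (t : V -> R) (f : R -> R) (U : set V) (U' : set R) :
  open U -> (forall z, U z -> U' (t z)) ->
  smooth_on U t -> smooth_on U' f -> smooth_on U (f \o t).
Proof.
move=> oU tU st; apply: (@smooth_comp R unit (fun=> 1) (fun=> id)) => //.
  by move=> z Uz; exact: smooth_diff st Uz.
by move=> z v _; rewrite (big_pred1 tt) //= /GRing.scale /= mulr1.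
Qed.

Lemma line_diff (W : normedModType R) (f : V -> W) (a u : V) (s : R) :
  differentiable f (a + s *: u) ->
  is_derive s 1 (fun s => f (a + s *: u)) ('D_u f (a + s *: u)).
Proof.
move=> df; have dl : differentiable (fun s : R => a + s *: u) s.
  by apply: differentiableD; [exact: differentiable_cst|
    exact: differentiableZl].
have d2 : differentiable (fun s : R => f (a + s *: u)) s.
  exact: differentiable_comp dl df.
apply: DeriveDef; first exact: diff_derivable.
rewrite dderiv_comp //; congr ('D__ _ _).
rewrite dderivD; [|exact: differentiable_cst|exact: differentiableZl].
rewrite dderiv_cst add0r deriveE; last exact: differentiableZl.
by rewrite diff_val /= scale1r.
Qed.

Lemma line_MVT (f : V -> R) (a u : V) :
  (forall s : R, 0 <= s <= 1 -> differentiable f (a + s *: u)) ->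
  exists2 c : R, 0 < c < 1 & f (a + u) - f a = 'D_u f (a + c *: u).
Proof.
move=> df.
have [||c] := @MVT R (fun s => f (a + s *: u))
  (fun s => 'D_u f (a + s *: u)) 0 1 ltr01.
- by move=> s; rewrite in_itv /= => /andP[s0 s1]; apply: line_diff; apply: df;
    rewrite !ltW.
- apply: derivable_within_continuous => s; rewrite in_itv /= => s01.
  by have [] := line_diff (df s s01).
rewrite in_itv /= => c01 E; exists c => //.
by move: E; rewrite scale1r scale0r addr0 subr0 mulr1.
Qed.

(** Two applications of the mean value theorem. The factor [d] in (0, 1) replaces the 1/2 of
    Taylor's formula, which is enough for bounds by the second derivative. *)
Lemma line_MVT2 (f : V -> R) (a u : V) (U : set V) :
  smooth_on U f -> (forall s : R, 0 <= s <= 1 -> U (a + s *: u)) ->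
  exists c d : R, [/\ 0 < c < 1, 0 < d < 1 &
   f (a + u) - f a - 'D_u f a = d * 'D_u ('D_u f) (a + c *: u)].
Proof.
move=> sf hU.
have [|d d01 E] := @line_MVT f a u.
  by move=> s /hU; exact: smooth_diff.
have hU' (s : R) : 0 <= s <= 1 -> U (a + s *: (d *: u)).
  move=> /andP[s0 s1]; rewrite scalerA; apply: hU; case/andP: d01 => d0 d1.
  by rewrite mulr_ge0 ?(ltW d0) //= mulr_ile1 // ltW.
have sDf := smooth_deriv u sf.
have [|c c01 E'] := @line_MVT ('D_u f) a (d *: u).
  by move=> s /hU'; exact: smooth_diff.
case/andP: c01 => c0 c1; case/andP: d01 => d0 d1.
exists (c * d), d; rewrite mulr_gt0 // d0 d1; split => //=.
  by rewrite mulr_ilt1 // ltW.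
rewrite E E' scalerA dderivZv //; apply: smooth_diff sDf _.
by rewrite -scalerA; apply: hU'; rewrite !ltW.
Qed.

End Smooth2.

Lemma dist_le2 (a b c e : R) :
  `|b - a| < e / 2 -> `|b - c| < e / 2 -> `|a - c| <= e.
Proof. by rewrite !ltr_norml ler_norml => /andP[? ?] /andP[? ?]; lra. Qed.

(** Both mixed derivatives are limits of the same second difference quotient, which is symmetric in
    the two directions. The mean value theorem, applied in one direction and then in the other,
    evaluates that quotient at a nearby point, where continuity of the mixed derivative applies. *)
Lemma schwarz (V : normedModType R) (f : V -> R) (U : set V) z u v :
  open U -> smooth_on U f -> U z -> 'D_u ('D_v f) z = 'D_v ('D_u f) z.
Proof.
move=> oU sf Uz.
suff H (w x : V) (e : R) : 0 < e ->
    \forall h \near 0^'+, `|h^-1 ^+ 2 * (f (z + h *: w + h *: x)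
      - f (z + h *: w) - (f (z + h *: x) - f z)) - 'D_x ('D_w f) z| < e.
  apply/eqP; rewrite -subr_eq0 -normr_le0; apply/ler_addgt0Pr => e e0.
  rewrite add0r; move: (e : R) e0 => {}e e0.
  have e2 : 0 < e / 2 by rewrite divr_gt0.
  have := @filter_ex _ _ _ _ (filterI (H u v _ e2) (H v u _ e2)) => -[h [h1 h2]].
  apply: (dist_le2 h2); move: h1; congr (`|_ * _ - _| < _).
  by rewrite (addrAC z); ring.
move: w x => {}u {}v e0.
have c2 : {for z, continuous ('D_v ('D_u f))}.
  apply: differentiable_continuous; apply: smooth_diff Uz.
  by do 2 apply: smooth_deriv.
have /nbhs_ballP[r /= r0 hr] : nbhs z
    (U `&` [set y | `|'D_v ('D_u f) z - 'D_v ('D_u f) y| < e]).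
  apply: filterI; first exact: open_nbhs_nbhs.
  by have /cvgrPdist_lt/(_ e e0) := c2.
have k0 : 0 < `|u| + `|v| + 1.
  by apply: ltr_wpDl => //; exact: addr_ge0.
near=> h.
have h0 : 0 < h by near: h; exact: nbhs_right_gt.
have hs : h * (`|u| + `|v| + 1) < r.
  rewrite -ltr_pdivlMr //.
  by near: h; apply: nbhs_right_lt; rewrite divr_gt0.
have B (s t : R) : 0 <= s <= 1 -> 0 <= t <= 1 ->
    ball z r (z + s *: (h *: u) + t *: (h *: v)).
  move=> /andP[s0 s1] /andP[t0 t1]; rewrite -ball_normE /= -addrA opprD addrA.
  rewrite subrr sub0r normrN; apply: le_lt_trans hs.
  apply: le_trans (ler_normD _ _) _; rewrite !normrZ !(ger0_norm s0, ger0_norm t0).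
  rewrite (gtr0_norm h0).
  have := ler_piMl (mulr_ge0 (ltW h0) (normr_ge0 u)) s1.
  have := ler_piMl (mulr_ge0 (ltW h0) (normr_ge0 v)) t1.
  by move: h0; lra.
have sDu := smooth_deriv u sf.
have [|s s01 E] := @line_MVT _ (fun y => f (y + h *: v) - f y) z (h *: u).
  move=> s s01; have B1 := B s 1 s01; have B0 := B s 0 s01.
  have dy (y w : V) : U (y + w) -> differentiable (fun y => f (y + w)) y.
    move=> Uy; apply: (@differentiable_comp _ _ _ _ (fun y => y + w)) => //.
    exact: smooth_diff sf Uy.
  apply: differentiableB.
    by apply: dy; rewrite -[h *: v]scale1r; apply: (hr _ (B1 _)).1; rewrite ler01 /=.
  apply: smooth_diff sf _; have := (hr _ (B0 _)).1.
  by rewrite scale0r addr0; apply; rewrite lexx ler01.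
have /andP[s0 s1] := s01; have s01' : 0 <= s <= 1 by rewrite !ltW.
have dfs : differentiable f (z + s *: (h *: u)).
  apply: smooth_diff sf _; have := (hr _ (B s 0 s01' _)).1.
  by rewrite scale0r addr0; apply; rewrite lexx ler01.
have Uv : U (z + s *: (h *: u) + h *: v).
  by have := (hr _ (B s 1 s01' _)).1; rewrite scale1r; apply; rewrite ler01 /=.
have [|t t01 E'] := @line_MVT _ ('D_u f) (z + s *: (h *: u)) (h *: v).
  by move=> t t01; apply: smooth_diff sDu _; apply: (hr _ _).1; exact: B.
have /andP[t0 t1] := t01; have t01' : 0 <= t <= 1 by rewrite !ltW.
have /= [Ust lt] := hr _ (B s t s01' t01').
have -> : f (z + h *: u + h *: v) - f (z + h *: u) - (f (z + h *: v) - f z) =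
  h ^+ 2 * 'D_v ('D_u f) (z + s *: (h *: u) + t *: (h *: v)).
  rewrite E dderivB //; last first.
    apply: (@differentiable_comp _ _ _ _ (fun y => y + h *: v)) => //.
    exact: smooth_diff sf Uv.
  rewrite (@dderiv_comp _ _ _ (fun y => y + h *: v)) //; last first.
    exact: smooth_diff sf Uv.
  rewrite dderivD // dderiv_cst addr0 derive_id !dderivZv //; last first.
    exact: smooth_diff sf Uv.
  rewrite -mulrBr -[_ - _]/('D_u f _ - 'D_u f _) E' dderivZv.
    by rewrite /GRing.scale /= mulrA expr2.
  exact: smooth_diff sDu Ust.
have hh : h^-1 ^+ 2 * h ^+ 2 = 1.
  by rewrite -exprMn mulVf ?expr1n //; apply/eqP => h0'; rewrite h0' ltxx in h0.
move: lt; set a := 'D_v _ z; set c := 'D_v _ _ => lt.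
by rewrite mulrA hh mul1r distrC.
Unshelve. all: by end_near. Qed.

End Calculus.

(** * Flat functions and smooth cutoffs on the line *)

Section FlatFunction.
Variable (R : realType).

(* e^(-1/x) / x^k, extended by 0: this family is stable under derivation. *)
Definition flat (k : nat) (x : R) : R :=
  if 0 < x then x^-1 ^+ k * expR (- x^-1) else 0.

Lemma flat_ge0 k x : 0 <= flat k x.
Proof.
rewrite /flat; case: ifP => // x0; apply: mulr_ge0; last exact: expR_ge0.
by rewrite exprn_ge0 // invr_ge0 ltW.
Qed.

(** The inequality 1 + x <= e^x at x = t/(m+1), raised to the power m+1. *)
Lemma expr_expRN_le (m : nat) (t : R) : 0 <= t ->
  t ^+ m.+1 * expR (- t) <= m.+1%:R ^+ m.+1.
Proof.
move=> t0; have m0 : (0 : R) < m.+1%:R by rewrite ltr0n.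
have : (t / m.+1%:R) ^+ m.+1 <= expR t.
  have -> : t = m.+1%:R * (t / m.+1%:R) by rewrite mulrC mulfVK ?gt_eqF.
  rewrite expRM_natl mulrC mulKf ?gt_eqF // lerXn2r ?nnegrE ?divr_ge0 ?expR_ge0
    ?(ltW m0) //.
  by apply: le_trans (expR_ge1Dx _); rewrite ler_wpDl.
rewrite expr_div_n ler_pdivrMr ?exprn_gt0 // => H.
by rewrite expRN ler_pdivrMr ?expR_gt0 // mulrC.
Qed.

(** A quadratic bound for every [k]: it makes each member of the family differentiable at 0 with
    derivative 0, which is the only point where the formula for the derivative is not evident. *)
Lemma flat_le_sqr k x : flat k x <= k.+2%:R ^+ k.+2 * x ^+ 2.
Proof.
rewrite /flat; case: ifPn => [x0|_]; last first.
  by rewrite mulr_ge0 ?sqr_ge0 // exprn_ge0.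
have := @expr_expRN_le k.+1 x^-1; rewrite invr_ge0 ltW // => /(_ isT) H.
rewrite -ler_pdivrMr ?exprn_gt0 //; apply: le_trans H.
by rewrite mulrAC -exprVn -exprD addn2.
Qed.

Lemma flat_derive_gt0 (k : nat) (x : R) : 0 < x ->
  is_derive x 1 (flat k) (- k%:R * flat k.+1 x + flat k.+2 x).
Proof.
move=> x0.
have xn0 : x != 0 by rewrite gt_eqF.
have near_x : \forall y \near x, y^-1 ^+ k * expR (- y^-1) = flat k y.
  have : \forall y \near x, 0 < y by exact: lt_nbhsr.
  by apply: filterS => y y0; rewrite /flat y0.
have i1 : is_derive x 1 (fun y : R => y^-1) (- x ^- 2).
  by have := @is_deriveV R id x 1 1 xn0 (is_derive_id _ _);
     rewrite /GRing.scale /= mulr1.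
have i3 : is_derive x 1 (fun y : R => expR (- y^-1)) (x ^- 2 * expR (- x^-1)).
  have := @is_derive1_comp R expR (fun y : R => - y^-1) x _ _
    (is_derive_expR _) (is_deriveN i1).
  by rewrite opprK mulrC.
have i2 : is_derive x 1 (fun y : R => y^-1 ^+ k) (- k%:R * x^-1 ^+ k.+1).
  have := @is_deriveX R R (fun y => y^-1) k x 1 _ i1.
  case: k {near_x} => [|k].
    by move=> _; rewrite oppr0 mul0r; exact: is_derive_cst.
  rewrite /= /GRing.scale /= exprfctE => H; apply: (is_derive_eq H).
  by rewrite -exprVn !exprS; ring.
apply: (near_eq_is_derive near_x).
have H := is_deriveM i2 i3; apply: is_derive_eq H _.
rewrite /flat x0 /GRing.scale /= -exprVn !exprS; ring.
Qed.

Lemma flat_diff (k : nat) (x : R) : differentiable (flat k) x /\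
  'D_1 (flat k) x = - k%:R * flat k.+1 x + flat k.+2 x.
Proof.
have [x0|x0|->] := ltgtP x 0; last first.
- have [|d e] := @diff_eps R R R (flat k) ( *:%R (0 : R)) 0 (@scaler_continuous _ _ _).
    move=> e e0; have C0 : (0 : R) < k.+2%:R ^+ k.+2 by rewrite exprn_gt0.
    have : \forall h \near (0 : R), `|h| < e / k.+2%:R ^+ k.+2.
      apply/nbhs_ballP; exists (e / k.+2%:R ^+ k.+2); first exact: divr_gt0.
      by move=> y /=; rewrite -ball_normE /= sub0r normrN.
    apply: filterS => h; rewrite ltr_pdivlMr // => he.
    have -> : flat k (0 : R) = 0 by rewrite /flat ltxx.
    rewrite /= addr0 (_ : 0 *: h = 0) ?subr0 ?(ger0_norm (flat_ge0 _ _)); last exact: scale0r.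
    apply: le_trans (flat_le_sqr _ _) _; rewrite -real_normK ?num_real //.
    by rewrite expr2 mulrA ler_wpM2r // mulrC ltW.
  split=> //; rewrite deriveE // (_ : 'd _ _ _ = 0).
    by rewrite /flat ltxx; ring.
  by rewrite e; exact: mul0r.
- have H := flat_derive_gt0 k x0; split; last by rewrite derive_val.
  by apply/derivable1_diffP; have [] := H.
have near_x : \forall y \near x, 0 = flat k y.
  have : \forall y \near x, y < 0 by exact: lt_nbhsl.
  by apply: filterS => y y0; rewrite /flat ltNge ltW.
split; first by apply: near_eq_differentiable near_x _; exact: differentiable_cst.
by rewrite -(near_eq_derive (1 : R) near_x) dderiv_cst /flat ltNge (ltW x0) /= !mulr0 addr0.
Qed.

Lemma flat_smooth k : smooth_on [set: R] (flat k).
Proof.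
pose G (f : R -> R) := exists c k, f = fun x => c * flat k x.
apply: (@smooth_coind_span _ _ _ G) => //.
- exact: openT.
- move=> _ [c [l ->]] z _; apply: differentiableM; first exact: differentiable_cst.
  exact: (flat_diff l z).1.
- move=> _ v [c [l ->]].
  exists (fun x => (v * c * - l%:R) * flat l.+1 x + v * c * flat l.+2 x).
    by apply: fspan_add; apply: fspan1; [exists (v * c * - l%:R), l.+1|
      exists (v * c), l.+2].
  move=> z _; have [d e] := flat_diff l z.
  have dc : differentiable (fun _ : R => c) z by exact: differentiable_cst.
  rewrite dderivM //.
  rewrite dderiv_cst mul0r add0r -[v in LHS]mulr1 -[v * 1]/(v *: 1) dderivZv // e.
  by rewrite /GRing.scale /=; ring.
- apply: fspan1; exists 1, k; apply/funext => x; by rewrite mul1r.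
Qed.

(** The inner term e * e^(-1/(t-1)) vanishes for t <= 1 and is at least 1 for t >= 2; the outer flat
    function then sees 1 in the first case and a nonpositive argument in the second. The factor e
    normalizes the value of the flat function at 1. *)
Definition plateau (t : R) : R :=
  expR 1 * flat 0 (1 - expR 1 * flat 0 (t - 1)).

Lemma flat0_le t : t <= 1 -> flat 0 t <= expR (-1).
Proof.
rewrite /flat expr0 mul1r; case: ifPn => [t0 t1|_ _]; last exact: expR_ge0.
by rewrite ler_expR lerN2 invf_ge1.
Qed.

Lemma plateau_ge0 t : 0 <= plateau t.
Proof. by rewrite mulr_ge0 ?expR_ge0 ?flat_ge0. Qed.

Lemma plateau_le1 t : plateau t <= 1.
Proof.
rewrite /plateau -ler_pdivlMl ?expR_gt0 // mulr1 -expRN flat0_le //.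
by rewrite gerBl mulr_ge0 ?expR_ge0 ?flat_ge0.
Qed.

Lemma plateau1 t : t <= 1 -> plateau t = 1.
Proof.
move=> t1; rewrite /plateau {2}/flat subr_gt0 ltNge t1 /= mulr0 subr0.
by rewrite /flat ltr01 expr0 mul1r invr1 expRN mulfV // gt_eqF ?expR_gt0.
Qed.

Lemma plateau0 t : 2 <= t -> plateau t = 0.
Proof.
move=> t2; rewrite /plateau {1}/flat ifF ?mulr0 //; apply/negbTE.
have t1 : 1 <= t - 1 by lra.
have t0 : 0 < t - 1 by lra.
rewrite -leNgt subr_le0 /flat t0 expr0 mul1r -expRD -[leLHS]expR0 ler_expR.
by rewrite subr_ge0 invf_le1.
Qed.

Lemma plateau_smooth : smooth_on [set: R] plateau.
Proof.
apply: smoothZ; first exact: openT.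
have oT := @openT R.
apply: (@smooth_comp1 R R (fun t => 1 - expR 1 * flat 0 (t - 1)) (flat 0)
  setT setT) => //; last exact: flat_smooth.
apply: smoothB => //; first exact: smooth_cst.
apply: smoothZ => //.
apply: (@smooth_comp1 R R (fun t => t - 1) (flat 0) setT setT) => //;
  last exact: flat_smooth.
apply: smoothB => //; last exact: smooth_cst.
by apply: (@smooth_linear R R idfun) => //= x; exact: cvg_id.
Qed.

End FlatFunction.

Lemma nonexpansive_continuous (R : realType) (V W : normedModType R)
    (f : {linear V -> W}) : (forall v, `|f v| <= `|v|) -> continuous f.
Proof.
move=> H v; apply/cvgrPdist_lt => e e0.
have : \forall w \near v, `|v - w| < e 
  by have := nbhsx_ballx v e e0; rewrite -ball_normE.
by apply: filterS => w; rewrite -linearB; apply: le_lt_trans; exact: H.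
Qed.

(** * Real coordinates of C^n *)

Section Coordinates.
Variables (R : realType) (n : nat).
Local Notation V := (Cn R n).
Local Notation C := R[i].

Definition bas (i : 'I_n + 'I_n) : V :=
  match i with inl j => (delta_mx 0 j, 0) | inr j => (0, delta_mx 0 j) end.

Definition crd (i : 'I_n + 'I_n) (v : V) : R :=
  match i with inl j => v.1 0 j | inr j => v.2 0 j end.

Fact crd_is_linear i : linear (crd i).
Proof. by move=> t v w; case: i => j /=; rewrite !mxE. Qed.
HB.instance Definition _ i := GRing.isLinear.Build R V R _ (crd i)
  (crd_is_linear i).

Lemma crd_le i v : `|crd i v| <= `|v|.
Proof.
have H (m : 'rV[R]_n) j : `|m 0 j| <= `|m|.
  by rewrite {2}/Num.norm /= mx_normrE (le_bigmax _ _ (0, j)).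
rewrite prod_normE le_max; case: i => j /=; first by rewrite H.
by rewrite (H v.2 j) orbT.
Qed.

Lemma crd_continuous i : continuous (crd i).
Proof. by apply: nonexpansive_continuous; exact: crd_le. Qed.

Lemma crdE v : v = \sum_i crd i v *: bas i.
Proof.
rewrite big_sumType /=; case: v => x y /=.
have -> : \sum_(i < n) x 0 i *: bas (inl i) = (x, 0).
  rewrite {2}(row_sum_delta x).
  by rewrite (big_morph (fun u : 'rV[R]_n => (u, 0 : 'rV[R]_n))
    (id1 := 0) (op1 := +%R)) //; [apply: eq_bigr => i _;
    rewrite /bas; congr pair; rewrite /= ?scaler0|
    move=> a b; congr pair; rewrite addr0].
have -> : \sum_(i < n) y 0 i *: bas (inr i) = (0, y).
  rewrite {2}(row_sum_delta y).
  by rewrite (big_morph (fun u : 'rV[R]_n => (0 : 'rV[R]_n, u))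
    (id1 := 0) (op1 := +%R)) //; [apply: eq_bigr => i _;
    rewrite /bas; congr pair; rewrite /= ?scaler0|
    move=> a b; congr pair; rewrite addr0].
by congr pair; rewrite /= ?addr0 ?add0r.
Qed.

End Coordinates.

Ltac cgen := repeat match goal with
  | |- context [cderiv ?h ?z ?v] => generalize (cderiv h z v); intro
  end.
Ltac cring := cgen; ring.

(** * C-linear and C-antilinear parts of the derivative *)

Section ComplexCalculus.
Variables (R : realType) (n : nat).
Local Notation V := (Cn R n).
Local Notation C := R[i].
Local Notation Re := complex.Re.
Local Notation Im := complex.Im.
Implicit Types (U : set V) (h g : V -> C) (z v w : V) (e : C).

Lemma complex_ext (a b : C) : Re a = Re b -> Im a = Im b -> a = b.
Proof. by case: a b => x y [x' y'] /= -> ->. Qed.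

Lemma ReD (a b : C) : Re (a + b) = Re a + Re b. Proof. by case: a b => ? ? []. Qed.
Lemma ImD (a b : C) : Im (a + b) = Im a + Im b. Proof. by case: a b => ? ? []. Qed.
Lemma ReN (a : C) : Re (- a) = - Re a. Proof. by case: a. Qed.
Lemma ReM (a b : C) : Re (a * b) = Re a * Re b - Im a * Im b.
Proof. by case: a b => ? ? []. Qed.
Lemma ImM (a b : C) : Im (a * b) = Re a * Im b + Im a * Re b.
Proof. by case: a b => ? ? [] ? ? /=; rewrite addrC. Qed.

Definition csm U h := smooth_on U (fun z => Re (h z)) /\
  smooth_on U (fun z => Im (h z)).

Lemma csm_eq U h g : open U -> (forall z, U z -> h z = g z) ->
  csm U h -> csm U g.
Proof.
move=> oU hg [h1 h2].
by split; [apply: smooth_eq h1|apply: smooth_eq h2] => // z Uz; rewrite hg.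
Qed.

Lemma csm_cst U (c : C) : open U -> csm U (fun=> c).
Proof. by move=> oU; split; exact: smooth_cst. Qed.

Lemma csmD U h g : open U -> csm U h -> csm U g -> csm U (fun z => h z + g z).
Proof.
move=> oU [h1 h2] [g1 g2]; split.
  by apply: smooth_eq (smoothD oU h1 g1) => // z _; rewrite ReD.
by apply: smooth_eq (smoothD oU h2 g2) => // z _; rewrite ImD.
Qed.

Lemma csmM U h g : open U -> csm U h -> csm U g -> csm U (fun z => h z * g z).
Proof.
move=> oU [h1 h2] [g1 g2]; split.
  apply: smooth_eq (smoothB oU (smoothM oU h1 g1) (smoothM oU h2 g2)) => // z _.
  by rewrite ReM.
apply: smooth_eq (smoothD oU (smoothM oU h1 g2) (smoothM oU h2 g1)) => // z _.
by rewrite ImM.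
Qed.

Lemma csmZ U (c : C) h : open U -> csm U h -> csm U (fun z => c * h z).
Proof. by move=> oU; apply: csmM => //; exact: csm_cst. Qed.

Lemma csm_real U (f : V -> R) : open U -> smooth_on U f ->
  csm U (fun z => (f z)%:C).
Proof. by move=> oU sf; split => //=; exact: smooth_cst. Qed.

Lemma csm_sum U (I : Type) (r : seq I) (F : I -> V -> C) : open U ->
  (forall i, csm U (F i)) -> csm U (fun z => \sum_(i <- r) F i z).
Proof.
move=> oU sF; elim: r => [|i r IH].
  by apply: csm_eq (csm_cst (0 : C) oU) => // z _; rewrite big_nil.
by apply: csm_eq (csmD oU (sF i) IH) => // z _; rewrite big_cons.
Qed.

Lemma csm_cderiv U h v : csm U h -> csm U (fun z => cderiv h z v).
Proof. by case=> h1 h2; split; exact: smooth_deriv. Qed.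

Lemma csm_diff U h z : csm U h -> U z ->
  differentiable (fun y => Re (h y)) z /\ differentiable (fun y => Im (h y)) z.
Proof. by move=> [h1 h2] Uz; split; exact: smooth_diff Uz. Qed.

Lemma cderiv_near h g z v : (\forall y \near z, h y = g y) ->
  cderiv h z v = cderiv g z v.
Proof.
move=> hg; apply: complex_ext => /=; apply: near_eq_derive;
  by apply: filterS hg => y ->.
Qed.

Lemma cderivD U h g z v : csm U h -> csm U g -> U z ->
  cderiv (fun y => h y + g y) z v = cderiv h z v + cderiv g z v.
Proof.
move=> sh sg Uz; have [h1 h2] := csm_diff sh Uz; have [g1 g2] := csm_diff sg Uz.
apply: complex_ext; rewrite /cderiv /=.
  have -> : (fun w => Re (h w + g w)) = (fun w => Re (h w) + Re (g w)).
    by apply/funext => y; rewrite ReD.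
  exact: dderivD.
have -> : (fun w => Im (h w + g w)) = (fun w => Im (h w) + Im (g w)).
  by apply/funext => y; rewrite ImD.
exact: dderivD.
Qed.

Lemma cderivM U h g z v : csm U h -> csm U g -> U z ->
  cderiv (fun y => h y * g y) z v = cderiv h z v * g z + h z * cderiv g z v.
Proof.
move=> sh sg Uz; have [h1 h2] := csm_diff sh Uz; have [g1 g2] := csm_diff sg Uz.
have M := fun f k df dk => @differentiableM R _ f k z df dk.
apply: complex_ext; rewrite ?ReD ?ImD ?ReM ?ImM /cderiv /=.
  have -> : (fun w => Re (h w * g w)) =
      (fun w => Re (h w) * Re (g w) - Im (h w) * Im (g w)).
    by apply/funext => y; rewrite ReM.
  by rewrite dderivB; [rewrite !dderivM //; ring|exact: M|exact: M].
have -> : (fun w => Im (h w * g w)) =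
    (fun w => Re (h w) * Im (g w) + Im (h w) * Re (g w)).
  by apply/funext => y; rewrite ImM.
by rewrite dderivD; [rewrite !dderivM //; ring|exact: M|exact: M].
Qed.

Lemma cderiv_cst (c : C) z v : cderiv (fun=> c) z v = 0.
Proof. by apply: complex_ext => /=; exact: dderiv_cst. Qed.

Lemma cderiv_real (f : V -> R) z v :
  cderiv (fun y => (f y)%:C) z v = ('D_v f z)%:C.
Proof. by apply: complex_ext => //=; exact: dderiv_cst. Qed.

Lemma cderiv_linv U h z v w (t : R) : csm U h -> U z ->
  cderiv h z (t *: v + w) = t%:C * cderiv h z v + cderiv h z w.
Proof.
move=> sh Uz; have [h1 h2] := csm_diff sh Uz.
have E (f : V -> R) : differentiable f z ->
    'D_(t *: v + w) f z = t * 'D_v f z + 'D_w f z.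
  by move=> df; rewrite (dderivDv _ _ df) (dderivZv _ _ df).
rewrite /cderiv (E _ h1) (E _ h2) {E}.
move: ('D_v _ z) ('D_w _ z) ('D_v _ z) ('D_w _ z) => a b c d.
by apply: complex_ext => /=; ring.
Qed.

Lemma cderiv_swap U h z v w : open U -> csm U h -> U z ->
  cderiv (fun y => cderiv h y v) z w = cderiv (fun y => cderiv h y w) z v.
Proof. by move=> oU [h1 h2] Uz; apply: complex_ext => /=; exact: schwarz Uz. Qed.

(* e = -i and e = i give the C-linear and the C-antilinear part. *)
Definition Dp_def e h z v : C := (cderiv h z v + e * cderiv h z (J v)) / 2.
Fact Dp_key : unit. Proof. by []. Qed.
(* Locked: unfolding derivatives makes failing conversion tests explode. *)
Definition Dp := locked_with Dp_key Dp_def.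
Lemma DpE e h z v : Dp e h z v = (cderiv h z v + e * cderiv h z (J v)) / 2.
Proof. by rewrite [Dp]unlock. Qed.

Lemma csm_Dp U e h v : open U -> csm U h -> csm U (fun z => Dp e h z v).
Proof.
move=> oU sh.
apply: (csm_eq oU) (csmZ 2^-1 oU (csmD oU (csm_cderiv v sh)
  (csmZ e oU (csm_cderiv (J v) sh)))) => z _.
by rewrite DpE mulrC.
Qed.

Lemma Dp_near e h g z v : (\forall y \near z, h y = g y) ->
  Dp e h z v = Dp e g z v.
Proof. by move=> hg; rewrite !DpE !(cderiv_near _ hg). Qed.

Lemma Dp_eq e U h g z v : open U -> U z -> (forall y, U y -> h y = g y) ->
  Dp e h z v = Dp e g z v.
Proof. by move=> oU Uz hg; apply: Dp_near; exact: near_open hg. Qed.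

Lemma DpD U e h g z v : csm U h -> csm U g -> U z ->
  Dp e (fun y => h y + g y) z v = Dp e h z v + Dp e g z v.
Proof. by move=> sh sg Uz; rewrite !DpE !(cderivD _ sh sg) //; cring. Qed.

Lemma DpM U e h g z v : csm U h -> csm U g -> U z ->
  Dp e (fun y => h y * g y) z v = Dp e h z v * g z + h z * Dp e g z v.
Proof. by move=> sh sg Uz; rewrite !DpE !(cderivM _ sh sg) //; cring. Qed.

Lemma Dp_cst e (c : C) z v : Dp e (fun=> c) z v = 0.
Proof. by rewrite !DpE !cderiv_cst mulr0 addr0 mul0r. Qed.

Lemma DpZ U e (c : C) h z v : open U -> csm U h -> U z ->
  Dp e (fun y => c * h y) z v = c * Dp e h z v.
Proof.
move=> oU sh Uz; rewrite (@DpM U) //; last exact: csm_cst.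
by rewrite Dp_cst mul0r add0r.
Qed.

Lemma Dp_sum U e (I : Type) (r : seq I) (F : I -> V -> C) z v : open U ->
  (forall i, csm U (F i)) -> U z ->
  Dp e (fun y => \sum_(i <- r) F i y) z v = \sum_(i <- r) Dp e (F i) z v.
Proof.
move=> oU sF Uz; elim: r => [|i r IH].
  rewrite big_nil (_ : (fun y => _) = fun=> 0) ?Dp_cst //.
  by apply/funext => y; rewrite big_nil.
rewrite big_cons -IH -(@DpD U) //; last exact: csm_sum.
rewrite (_ : (fun y => _) = (fun y => F i y + \sum_(j <- r) F j y)) //.
by apply/funext => y; rewrite big_cons.
Qed.

(** Both sides expand into the four mixed real derivatives along [v], [J v] and [w], [J w], to which
    Schwarz's theorem applies. *)
Lemma Dp_swap U e e' h z v w : open U -> csm U h -> U z ->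
  Dp e (fun y => Dp e' h y v) z w = Dp e' (fun y => Dp e h y w) z v.
Proof.
move=> oU sh Uz.
have E a a' b b' : Dp a (fun y => Dp a' h y b) z b' =
   (cderiv (fun y => cderiv h y b) z b' + a' * cderiv (fun y => cderiv h y (J b)) z b'
   + a * (cderiv (fun y => cderiv h y b) z (J b') +
          a' * cderiv (fun y => cderiv h y (J b)) z (J b'))) / 4.
  have S x : csm U (fun y => cderiv h y x) by exact: csm_cderiv.
  have F x : cderiv (fun y => Dp a' h y b) z x =
    (cderiv (fun y => cderiv h y b) z x +
     a' * cderiv (fun y => cderiv h y (J b)) z x) / 2.
    have -> : (fun y => Dp a' h y b) =
      (fun y => 2^-1 * (cderiv h y b + a' * cderiv h y (J b))).
      by apply/funext => y; rewrite DpE mulrC.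
    rewrite (@cderivM U) ?cderiv_cst ?(@cderivD U) ?(@cderivM U) ?cderiv_cst //.
    - by cring.
    - exact: csm_cst.
    - exact: csmZ.
    - exact: csm_cst.
    - by apply: csmD => //; exact: csmZ.
  rewrite {1}DpE !F; cgen; field => //.
rewrite !E; have S x y := @cderiv_swap U h z x y oU sh Uz.
move: (S v w) (S v (J w)) (S (J v) w) (S (J v) (J w)).
by cgen => -> -> -> ->; ring.
Qed.

Lemma cscaleE (zeta : C) v : cscale zeta v = Re zeta *: v + Im zeta *: J v.
Proof.
case: v => x y; rewrite /J /cscale /=; congr pair;
  by rewrite /= ?scale0r ?scale1r ?sub0r ?add0r ?addr0 ?scalerN // addrC.
Qed.

Lemma JJ v : J (J v) = - v.
Proof.
case: v => x y; rewrite /J /cscale /=; congr pair;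
  by rewrite /= !scale0r !scale1r ?sub0r ?add0r ?addr0.
Qed.

Lemma J_lin (t : R) v w : J (t *: v + w) = t *: J v + J w.
Proof.
case: v w => x y [x' y']; rewrite /J /cscale /=; congr pair;
 by rewrite /= !scale0r !scale1r ?sub0r ?add0r ?addr0 ?opprD ?scalerN.
Qed.

Lemma Dp_linv U e h z v w (t : R) : csm U h -> U z ->
  Dp e h z (t *: v + w) = t%:C * Dp e h z v + Dp e h z w.
Proof.
move=> sh Uz; rewrite !DpE J_lin !(@cderiv_linv U) //; cring.
Qed.

(** This is where e^2 = -1 enters: J acts by multiplication by -e, that is by i for e = -i and by -i
    for e = i. *)
Lemma Dp_J U e h z v : e * e = -1 -> csm U h -> U z ->
  Dp e h z (J v) = - e * Dp e h z v.
Proof.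
move=> ee sh Uz; rewrite !DpE JJ.
have -> : - v = (-1) *: v + 0 :> V by rewrite scaleN1r addr0.
have c0 : cderiv h z 0 = 0.
  have := @cderiv_linv U h z 0 0 1 sh Uz.
  rewrite scale1r addr0 mul1r => /eqP.
  by rewrite -[X in X == _]addr0 (inj_eq (addrI _)) eq_sym => /eqP.
rewrite (@cderiv_linv U) // c0 addr0 rmorphN1.
move: (cderiv h z v) (cderiv h z (J v)) => a b.
have -> : b + e * (-1 * a) = - e * (a + e * b).
  by rewrite mulrDr [- e * (e * b)]mulrA [- e * e]mulNr ee; ring.
by rewrite mulrA.
Qed.

Lemma Dp_cscale U e h z (zeta : C) v : e * e = -1 -> csm U h -> U z ->
  Dp e h z (cscale zeta v) = ((Re zeta)%:C - e * (Im zeta)%:C) * Dp e h z v.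
Proof.
move=> ee sh Uz; rewrite cscaleE (@Dp_linv U) //.
have -> : Im zeta *: J v = Im zeta *: J v + 0 by rewrite addr0.
have d0 : Dp e h z 0 = 0.
  have := @Dp_linv U e h z 0 0 1 sh Uz.
  rewrite scale1r addr0 mul1r => /eqP.
  by rewrite -[X in X == _]addr0 (inj_eq (addrI _)) eq_sym => /eqP.
rewrite (@Dp_linv U) // d0 (@Dp_J U) //; move: (Dp _ _ _ _) => d; ring.
Qed.

End ComplexCalculus.

(** * Differential forms in a chart *)

Section LocalForms.
Variables (R : realType) (n : nat).
Local Notation V := (Cn R n).
Local Notation C := R[i].
Implicit Types (U : set V) (a b : V -> seq V -> C) (z v w : V) (s : seq V)
  (e : C).

Definition lsm U a := forall s, csm U (fun z => a z s).

(** The shape of the exterior derivative with the differentiation abstracted away: [F] receives the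
    removed vector and the remaining ones. Its recursion [sumalt_cons] replaces all index
    computations. *)
Definition sumalt (F : V -> seq V -> C) s : C :=
  \sum_(i < size s) (-1) ^+ i * F (nth 0 s i) (take i s ++ drop i.+1 s).

Lemma sumalt_nil F : sumalt F [::] = 0.
Proof. by rewrite /sumalt big_ord0. Qed.

Lemma sumalt_cons F v s :
  sumalt F (v :: s) = F v s - sumalt (fun w t => F w (v :: t)) s.
Proof.
rewrite /sumalt /= big_ord_recl /= expr0 mul1r drop0; congr (_ + _).
rewrite -sumrN; apply: eq_bigr => i _.
by rewrite /bump /= add1n exprS mulN1r mulNr.
Qed.

Lemma sumalt_map (F : V -> seq V -> C) (A : V -> V) s :
  sumalt (fun w t => F (A w) (map A t)) s = sumalt F (map A s).
Proof.
elim: s F => [|v s IH] F; first by rewrite !sumalt_nil.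
by rewrite /= !sumalt_cons -(IH (fun w t => F w (A v :: t))).
Qed.

Lemma sumalt_lin (F G : V -> seq V -> C) (c : C) s :
  sumalt (fun w t => c * F w t + G w t) s = c * sumalt F s + sumalt G s.
Proof.
rewrite /sumalt mulr_sumr -big_split; apply: eq_bigr => i _ /=; ring.
Qed.

Lemma eq_sumalt (F G : V -> seq V -> C) s :
  (forall w t, F w t = G w t) -> sumalt F s = sumalt G s.
Proof. by move=> FG; apply: eq_bigr => i _; rewrite FG. Qed.

(* The local form of del (e = -i) and delbar (e = i). *)
Definition lalt e a z : seq V -> C :=
  sumalt (fun w t => Dp e (fun y => a y t) z w).

Lemma lalt_nil e a z : lalt e a z [::] = 0.
Proof. exact: sumalt_nil. Qed.

(** Cartan's formula for the constant vector field [v]: the contraction of the derivative is the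
    derivative along [v] minus the derivative of the contraction. The Leibniz rule, anticommutation
    and alternation of [lalt] follow from it by induction on the vectors. *)
Lemma lalt_cons e a z v s : lalt e a z (v :: s) =
  Dp e (fun y => a y s) z v - lalt e (fun y => contr v (a y)) z s.
Proof. by rewrite /lalt sumalt_cons. Qed.

Lemma lalt_eq U e a b z s : open U -> U z ->
  (forall y t, U y -> a y t = b y t) -> lalt e a z s = lalt e b z s.
Proof.
move=> oU Uz ab; apply: eq_sumalt => w t; apply: (Dp_eq _ _ oU Uz) => y Uy.
exact: ab.
Qed.

Lemma laltE e a z s :
  lalt e a z s = sumalt (fun w t => Dp e (fun y => a y t) z w) s.
Proof. by []. Qed.

Lemma sumaltE F s : sumalt F s =
  \sum_(i < size s) (-1) ^+ i * F (nth 0 s i) (take i s ++ drop i.+1 s).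
Proof. by []. Qed.

Local Opaque lalt sumalt.

Ltac lring := repeat match goal with
  | |- context [Dp ?e ?h ?z ?v] => generalize (Dp e h z v); intro
  | |- context [lalt ?e ?h ?z ?v] => generalize (lalt e h z v); intro
  | |- context [wedge_alt ?e ?h ?z] => generalize (wedge_alt e h z); intro
  | |- context [real_complex ?R ?t] => generalize (real_complex R t); intro
  end; ring.

Section Fixed.
Variable (U : set V).
Hypothesis (oU : open U).

Lemma lsm_contr a v : lsm U a -> lsm U (fun y => contr v (a y)).
Proof. by move=> sa s; exact: sa. Qed.

Lemma lsm_sgnf a : lsm U a -> lsm U (fun y => sgnf (a y)).
Proof. by move=> sa s; apply: csmZ. Qed.

Lemma lsm_wedge a b : lsm U a -> lsm U b ->
  lsm U (fun y => wedge_alt (a y) (b y)).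
Proof.
move=> sa sb s; rewrite /wedge_alt; apply: csm_sum => // m.
by apply: csmM => //; apply: csmZ.
Qed.

Lemma lsm_Dp e a v : lsm U a -> lsm U (fun y t => Dp e (fun x => a x t) y v).
Proof. by move=> sa s; apply: csm_Dp. Qed.

Lemma lsm_lalt e a : lsm U a -> lsm U (lalt e a).
Proof.
move=> sa s; apply: (csm_eq oU) => [y _|]; first by rewrite laltE sumaltE.
apply: csm_sum => // i.
by apply: csmZ => //; exact: csm_Dp.
Qed.

Lemma lalt_lin e (c : C) a b z s : lsm U a -> lsm U b -> U z ->
  lalt e (fun y t => c * a y t + b y t) z s =
  c * lalt e a z s + lalt e b z s.
Proof.
move=> sa sb Uz; rewrite !laltE -sumalt_lin; apply: eq_sumalt => w t.
by rewrite (@DpD _ _ U) ?(@DpZ _ _ U) //; exact: csmZ.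
Qed.

Lemma lalt0 e z s : lalt e (fun _ _ => 0) z s = 0.
Proof. by rewrite ?laltE ?sumaltE big1 // => i _; rewrite Dp_cst mulr0. Qed.

Lemma laltN e a z s : lsm U a -> U z ->
  lalt e (fun y t => - a y t) z s = - lalt e a z s.
Proof.
move=> sa Uz; have := @lalt_lin e (-1) a (fun _ _ => 0) z s sa.
rewrite lalt0 addr0 mulN1r => <- //; last by move=> ?; exact: csm_cst.
apply: (lalt_eq _ _ oU Uz) => y t _.
by rewrite addr0 mulN1r.
Qed.

Lemma laltD e a b z s : lsm U a -> lsm U b -> U z ->
  lalt e (fun y t => a y t + b y t) z s = lalt e a z s + lalt e b z s.
Proof.
move=> sa sb Uz; have := @lalt_lin e 1 a b z s sa sb Uz.
rewrite mul1r => <-; apply: (lalt_eq _ _ oU Uz) => y t _.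
by rewrite mul1r.
Qed.

Lemma laltB e a b z s : lsm U a -> lsm U b -> U z ->
  lalt e (fun y t => a y t - b y t) z s = lalt e a z s - lalt e b z s.
Proof.
move=> sa sb Uz; rewrite -laltN // -laltD // => t.
apply: (csm_eq oU) (csmZ (-1) oU (sb t)) => y _; exact: mulN1r.
Qed.

Lemma lalt_sgnf e a z s : lsm U a -> U z ->
  lalt e (fun y => sgnf (a y)) z s = - sgnf (lalt e a z) s.
Proof.
move=> sa Uz; elim: s a sa => [|v s IH] a sa.
  by rewrite /sgnf !lalt_nil mulr0 oppr0.
rewrite lalt_cons.
rewrite [X in _ - X](lalt_eq (b := fun y t => - sgnf (contr v (a y)) t) _ _ oU Uz);
  last by move=> y t _; rewrite contr_sgnf.
rewrite laltN //; last by apply: lsm_sgnf; exact: lsm_contr.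
rewrite IH; last exact: lsm_contr.
rewrite opprK /sgnf lalt_cons (DpZ _ _ _ oU (sa s) Uz) /= exprS.
rewrite -[fun y => [eta _]]/(fun y => contr v (a y)); lring.
Qed.

Lemma Dp_wedge e a b z v s : lsm U a -> lsm U b -> U z ->
  Dp e (fun y => wedge_alt (a y) (b y) s) z v =
  wedge_alt (fun t => Dp e (fun y => a y t) z v) (b z) s +
  wedge_alt (a z) (fun t => Dp e (fun y => b y t) z v) s.
Proof.
move=> sa sb Uz; rewrite /wedge_alt (@Dp_sum _ _ U) //; last first.
  by move=> m; apply: csmM => //; apply: csmZ.
rewrite -big_split; apply: eq_bigr => m _ /=.
rewrite (@DpM _ _ U) // ?(@DpZ _ _ U) //; last exact: csmZ.
Qed.

Lemma contr_lalt e a v z : contr v (lalt e a z) = (fun s =>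
  Dp e (fun y => a y s) z v - lalt e (fun y => contr v (a y)) z s).
Proof. by apply/funext => s; rewrite /contr lalt_cons. Qed.

Lemma lalt_wedge e a b z s : lsm U a -> lsm U b -> U z ->
  lalt e (fun y => wedge_alt (a y) (b y)) z s =
  wedge_alt (lalt e a z) (b z) s + wedge_alt (sgnf (a z)) (lalt e b z) s.
Proof.
move=> sa sb Uz; elim: s a b sa sb => [|v s IH] a b sa sb.
  by rewrite !wedge_nil !lalt_nil mulr0 mul0r addr0.
have sca := lsm_contr v sa; have scb := lsm_contr v sb.
have ssa := lsm_sgnf sa.
rewrite lalt_cons Dp_wedge //.
rewrite (lalt_eq (b := fun y t => wedge_alt (contr v (a y)) (b y) t +
  wedge_alt (sgnf (a y)) (contr v (b y)) t) _ _ oU Uz); last first.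
  by move=> y t _; rewrite contr_wedge.
rewrite (@laltD e _ _ z s (lsm_wedge sca sb) (lsm_wedge ssa scb) Uz).
rewrite !IH // !wedge_cons !contr_lalt contr_sgnf !sgnfK.
have -> : lalt e (fun y => sgnf (a y)) z = (fun s => - sgnf (lalt e a z) s).
  by apply/funext => t; rewrite lalt_sgnf.
rewrite !wedgeDl !wedgeDr !wedgeNl !wedgeNr; lring.
Qed.

Lemma Dp_lalt e e' a z v s : lsm U a -> U z ->
  Dp e (fun y => lalt e' a y s) z v =
  lalt e' (fun y t => Dp e (fun x => a x t) y v) z s.
Proof.
move=> sa Uz; rewrite laltE sumaltE.
have -> : (fun y => lalt e' a y s) = (fun y => \sum_(i < size s) (-1) ^+ i *
    Dp e' (fun x => a x (take i s ++ drop i.+1 s)) y (nth 0 s i)).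
  by apply/funext => y; rewrite laltE sumaltE.
rewrite (@Dp_sum _ _ U) //; last first.
  by move=> i; apply: csmZ => //; exact: csm_Dp.
apply: eq_bigr => i _; rewrite (@DpZ _ _ U) //; last exact: csm_Dp.
by rewrite (@Dp_swap _ _ U).
Qed.

(** Applying Cartan's formula twice leaves two cross terms that are exchanged, with opposite signs,
    when e and e' are; the third term is the induction hypothesis. For e = e' this contains the
    vanishing of the square. *)
Lemma lalt_anticomm e e' a z s : lsm U a -> U z ->
  lalt e (lalt e' a) z s = - lalt e' (lalt e a) z s.
Proof.
move=> sa Uz; elim: s a sa => [|v s IH] a sa.
  by rewrite !lalt_nil oppr0.
have E f f' : lalt f (lalt f' a) z (v :: s) =
    lalt f' (fun y t => Dp f (fun x => a x t) y v) z s
    - lalt f (fun y t => Dp f' (fun x => a x t) y v) z s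
    + lalt f (lalt f' (fun y => contr v (a y))) z s.
  rewrite lalt_cons Dp_lalt //.
  rewrite [X in _ - X](lalt_eq (b := fun y t => Dp f' (fun x => a x t) y v -
    lalt f' (fun x => contr v (a x)) y t) _ _ oU Uz); last first.
    by move=> y t _; rewrite contr_lalt.
  rewrite laltB //; [by rewrite opprB addrA addrAC|exact: lsm_Dp|].
  by apply: lsm_lalt; exact: lsm_contr.
by rewrite (E e e') (E e' e) (IH _ (lsm_contr v sa)) opprD opprB.
Qed.

Lemma lalt_homogeneous e k a z : U z -> (forall y, U y -> homogeneous k (a y)) ->
  homogeneous k.+1 (lalt e a z).
Proof.
move=> Uz ha s hs; rewrite ?laltE ?sumaltE big1 // => i _.
rewrite (Dp_eq (g := fun=> 0) _ _ oU Uz) ?Dp_cst ?mulr0 // => y Uy.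
apply: ha => //; apply: contra hs => /eqP <-.
rewrite size_cat size_take size_drop ltn_ord subnS.
by rewrite -[X in _ == X]addnS prednK ?subn_gt0 ?ltn_ord // subnKC // ltnW.
Qed.

Lemma lalt_mlin e a z : lsm U a -> U z -> (forall y, U y -> mlin (a y)) ->
  mlin (lalt e a z).
Proof.
move=> sa Uz ma s1; elim: s1 a sa ma => [|x s1 IH] a sa ma s2 t v w.
  rewrite /= !lalt_cons (@Dp_linv _ _ U) //.
  rewrite (lalt_eq (b := fun y u => t%:C * contr v (a y) u + contr w (a y) u)
    _ _ oU Uz).
    rewrite (@lalt_lin e _ (fun y => contr v (a y)) (fun y => contr w (a y)) z s2
      (lsm_contr v sa) (lsm_contr w sa) Uz).
    by rewrite mulrBr opprD addrACA.
  by move=> y u Uy; exact: (ma _ Uy [::]).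
rewrite /= !lalt_cons IH //; [|exact: lsm_contr|]; last first.
  by move=> y Uy; apply: mlin_contr; exact: ma.
rewrite (Dp_eq (g := fun y => t%:C * a y (s1 ++ v :: s2) + a y (s1 ++ w :: s2))
  _ _ oU Uz); last by move=> y Uy; exact: ma.
rewrite (@DpD _ _ U) ?(@DpZ _ _ U) //; last exact: csmZ.
by rewrite mulrBr opprD addrACA.
Qed.

Lemma lalt_adjalt e a z : lsm U a -> U z -> (forall y, U y -> adjalt (a y)) ->
  adjalt (lalt e a z).
Proof.
move=> sa Uz ma s1; elim: s1 a sa ma => [|x s1 IH] a sa ma s2 v.
  rewrite /= !lalt_cons opprB addrA addrAC subrr add0r.
  rewrite (lalt_eq (b := fun _ _ => 0) _ _ oU Uz) ?lalt0 // => y t Uy.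
  exact: (ma _ Uy [::]).
rewrite /= !lalt_cons IH //; [|exact: lsm_contr|]; last first.
  by move=> y Uy; apply: adjalt_contr; exact: ma.
by rewrite (Dp_eq (g := fun=> 0) _ _ oU Uz) ?Dp_cst ?subr0 // => y Uy; exact: ma.
Qed.

Lemma lalt_alternating e k a z : lsm U a -> U z ->
  (forall y, U y -> alternating k (a y)) -> alternating k.+1 (lalt e a z).
Proof.
move=> sa Uz H; apply/alternatingP; split.
- by apply: lalt_homogeneous => // y /H/alternatingP[].
- by apply: lalt_mlin => // y /H/alternatingP[].
- by apply: lalt_adjalt => // y /H/alternatingP[].
Qed.

(** The differentiated slot contributes the factor Re zeta - e Im zeta, which is zeta for e = -i and
    its conjugate for e = i. This is why one operator raises the first index of the bidegree and the
    other one the second. *)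
Lemma lalt_cscale e a z (zeta c : C) s : e * e = -1 -> lsm U a -> U z ->
  (forall y t, U y -> a y (map (cscale zeta) t) = c * a y t) ->
  lalt e a z (map (cscale zeta) s) =
  ((complex.Re zeta)%:C - e * (complex.Im zeta)%:C) * c * lalt e a z s.
Proof.
move=> ee sa Uz H; rewrite !laltE -sumalt_map.
rewrite -[RHS]addr0 -(sumalt_nil (fun _ _ => 0)).
have -> : sumalt (fun _ _ => 0) [::] = sumalt (fun _ _ => 0) s :> C.
  by rewrite sumalt_nil sumaltE big1 // => i _; rewrite mulr0.
rewrite -sumalt_lin; apply: eq_sumalt => w t; rewrite addr0.
rewrite (Dp_eq (g := fun y => c * a y t) _ _ oU Uz); last by move=> y Uy; exact: H.
rewrite (DpZ e c (cscale zeta w) oU (sa t) Uz).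
rewrite (Dp_cscale zeta w ee (sa t) Uz).
lring.
Qed.

Lemma lalt_bidegree10 p q a z : lsm U a -> U z ->
  (forall y, U y -> bidegree p q (a y)) -> bidegree p.+1 q (lalt (- 'i) a z).
Proof.
move=> sa Uz H; split; first by apply: lalt_alternating => // y /H[].
move=> zeta s; rewrite (lalt_cscale (c := zeta ^+ p * zeta^*%C ^+ q)) //.
2: by rewrite mulrN mulNr opprK -expr2 sqr_i.
2: by move=> y t /H[].
rewrite mulNr opprK exprS; congr (_ * _); rewrite mulrA; congr (_ * _ * _).
by case: zeta => x y; apply/eqP; rewrite eq_complex /=; apply/andP; split;
  apply/eqP; ring.
Qed.

Lemma lalt_bidegree01 p q a z : lsm U a -> U z ->
  (forall y, U y -> bidegree p q (a y)) -> bidegree p q.+1 (lalt 'i a z).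
Proof.
move=> sa Uz H; split; first by rewrite addnS; apply: lalt_alternating => // y /H[].
move=> zeta s; rewrite (lalt_cscale (c := zeta ^+ p * zeta^*%C ^+ q)) //.
2: by rewrite -expr2 sqr_i.
2: by move=> y t /H[].
rewrite exprS; congr (_ * _); rewrite mulrCA; congr (_ * (_ * _)).
by case: zeta => x y; apply/eqP; rewrite eq_complex /=; apply/andP; split;
  apply/eqP; ring.
Qed.

End Fixed.
End LocalForms.

(** * Pullback of forms by holomorphic maps *)

Section Pullback.
Variables (R : realType) (n : nat).
Local Notation V := (Cn R n).
Local Notation C := R[i].

Lemma crd_ext (v w : V) : (forall i, crd i v = crd i w) -> v = w.
Proof. by move=> H; rewrite (crdE v) (crdE w); apply: eq_bigr => i _; rewrite H. Qed.

Lemma dderiv_linear (W W1 W2 : normedModType R) (L : {linear W1 -> W2})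
    (f : W -> W1) z v : continuous L -> differentiable f z ->
  'D_v (fun y => L (f y)) z = L ('D_v f z).
Proof.
move=> cL df; have dL : differentiable L (f z) by exact: linear_differentiable.
by rewrite (dderiv_comp v df dL) (deriveE _ dL) diff_lin.
Qed.

Lemma smooth_linear_comp (W W1 W2 : normedModType R) (L : {linear W1 -> W2})
    (f : W -> W1) U : open U -> continuous L -> smooth_on U f ->
  smooth_on U (fun y => L (f y)).
Proof.
move=> oU cL sf; apply: (@smooth_coind _ _ _ U (fun g => exists f,
  smooth_on U f /\ g = fun y => L (f y))) => //.
- move=> _ [{sf}f [sf ->]] z Uz; apply: differentiable_comp.
    exact: smooth_diff sf Uz.
  exact: linear_differentiable.
- move=> _ v [{sf}f [sf ->]]; exists (fun y => L ('D_v f y)).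
    by exists ('D_v f); split=> //; exact: smooth_deriv.
  by move=> z Uz; apply: dderiv_linear => //; exact: smooth_diff sf Uz.
- by exists f.
Qed.

Lemma dderiv_crd (W : normedModType R) (f : W -> V) z v i :
  differentiable f z -> 'D_v (fun y => crd i (f y)) z = crd i ('D_v f z).
Proof. by apply: dderiv_linear; exact: crd_continuous. Qed.

Lemma smooth_crd (W : normedModType R) (f : W -> V) U i : open U ->
  smooth_on U f -> smooth_on U (fun y => crd i (f y)).
Proof. by move=> oU; apply: smooth_linear_comp => //; exact: crd_continuous. Qed.

Lemma smooth_compV (W : normedModType R) (t : W -> V) (f : V -> R) U U' :
  open U -> (forall z, U z -> U' (t z)) -> smooth_on U t -> smooth_on U' f ->
  smooth_on U (fun y => f (t y)).
Proof.
move=> oU tU st sf.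
apply: (@smooth_comp _ _ _ _ (@bas R n) (@crd R n) t f U U') => //.
- by move=> z Uz; exact: smooth_diff st Uz.
- by move=> i; exact: smooth_crd.
- move=> z v Uz; rewrite {1}(crdE ('D_v t z)); apply: eq_bigr => i _.
  by rewrite -dderiv_crd //; exact: smooth_diff st Uz.
Qed.

Lemma J_is_linear : linear (@J R n).
Proof. by move=> t v w; exact: J_lin. Qed.
HB.instance Definition _ := GRing.isLinear.Build R V V _ (@J R n) J_is_linear.

Lemma J_continuous : continuous (@J R n).
Proof.
apply: nonexpansive_continuous => -[x y]; rewrite /J /cscale /= !prod_normE /=.
by rewrite !scale0r !scale1r sub0r addr0 normrN maxC.
Qed.

Lemma csm_comp (t : V -> V) (h : V -> C) U U' :
  open U -> (forall z, U z -> U' (t z)) -> smooth_on U t -> csm U' h ->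
  csm U (fun y => h (t y)).
Proof.
move=> oU tU st [h1 h2]; split.
  exact: (@smooth_compV _ t (fun y => complex.Re (h y)) U U').
exact: (@smooth_compV _ t (fun y => complex.Im (h y)) U U').
Qed.

Lemma mlin_sum (phi : seq V -> C) x s : mlin phi ->
  phi (x :: s) = \sum_i (crd i x)%:C * phi (bas R i :: s).
Proof.
move=> m; rewrite {1}(crdE x).
have m0 : phi (0 :: s) = 0.
  have := m [::] s 1 0 0; rewrite /= scale1r addr0 mul1r => /eqP.
  by rewrite -[X in X == _]addr0 (inj_eq (addrI _)) eq_sym => /eqP.
elim: (index_enum _) => [|i r IH]; first by rewrite !big_nil.
by rewrite !big_cons (m [::]) IH.
Qed.

Section Map.
Variables (t : V -> V) (U U' : set V).
Hypotheses (oU : open U) (oU' : open U') (tU : forall z, U z -> U' (t z))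
  (st : smooth_on U t)
  (hol : forall z v, U z -> 'D_(J v) t z = J ('D_v t z)).

Implicit Types (z v w : V) (s : seq V) (e : C).

Let dt z : U z -> differentiable t z.
Proof. by move=> Uz; exact: smooth_diff st Uz. Qed.

(* Locked for the same reason as Dp. *)
Fact tder_key : unit. Proof. by []. Qed.
Definition tder : V -> V -> V := locked_with tder_key (fun z v => 'D_v t z).
Lemma tderE z v : tder z v = 'D_v t z.
Proof. by rewrite [tder]unlock. Qed.
Lemma tder_fun w : tder^~ w = 'D_w t.
Proof. by apply/funext => y; exact: tderE. Qed.
Lemma tder_hol z v : U z -> tder z (J v) = J (tder z v).
Proof. by rewrite !tderE; exact: hol. Qed.
Lemma smooth_tder w : smooth_on U (tder^~ w).
Proof. by rewrite tder_fun; exact: smooth_deriv. Qed.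
Lemma tder_diff z w : U z -> differentiable (tder^~ w) z.
Proof. by move=> Uz; apply: smooth_diff Uz; exact: smooth_tder. Qed.

Lemma cderiv_comp (h : V -> C) z v : csm U' h -> U z ->
  cderiv (fun y => h (t y)) z v = cderiv h (t z) ((tder z v)).
Proof.
move=> sh Uz; have [h1 h2] := csm_diff sh (tU Uz).
rewrite tderE /cderiv (dderiv_comp v (dt Uz) h1).
by rewrite (dderiv_comp v (dt Uz) h2).
Qed.

Lemma Dp_comp e (h : V -> C) z v : csm U' h -> U z ->
  Dp e (fun y => h (t y)) z v = Dp e h (t z) ((tder z v)).
Proof.
move=> sh Uz.
by rewrite !DpE (cderiv_comp v sh Uz) (cderiv_comp (J v) sh Uz) (tder_hol v Uz).
Qed.

Lemma Dp_real e (f : V -> R) z v :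
  Dp e (fun y => (f y)%:C) z v = (('D_v f z)%:C + e * ('D_(J v) f z)%:C) / 2.
Proof. by rewrite !DpE !cderiv_real. Qed.

Fact hess_key : unit. Proof. by []. Qed.
Definition hess : V -> V -> V -> V :=
  locked_with hess_key (fun z v w => 'D_v (tder^~ w) z).
Lemma hessE z v w : 'D_v (tder^~ w) z = hess z v w.
Proof. by rewrite [hess]unlock. Qed.

Lemma crd_hess z v w i : U z ->
  crd i (hess z v w) = 'D_v ('D_w (fun y => crd i (t y))) z.
Proof.
move=> Uz; rewrite -hessE; apply: etrans (esym (dderiv_crd v i (tder_diff w Uz))) _.
apply: near_eq_derive; apply: (near_open oU Uz) => y Uy.
by rewrite tderE; apply: esym; apply: dderiv_crd; exact: dt.
Qed.

Lemma hessC z v w : U z -> hess z v w = hess z w v.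
Proof.
move=> Uz; apply: crd_ext => i; apply: etrans (crd_hess v w i Uz) _.
apply: etrans _ (esym (crd_hess w v i Uz)).
by apply: (schwarz _ _ oU _ Uz); exact: smooth_crd.
Qed.

(** The Cauchy-Riemann equation differentiated once, combined with the symmetry of the Hessian. *)
Lemma hessJ z v w : U z -> hess z (J v) w = J (hess z v w).
Proof.
move=> Uz; rewrite (hessC (J v) w Uz) (hessC v w Uz) -!hessE.
rewrite -(dderiv_linear w J_continuous (tder_diff v Uz)).
apply: near_eq_derive; apply: (near_open oU Uz) => y Uy.
exact: tder_hol.
Qed.

(** What [Dp e] produces when it hits a moving first argument whose derivative is [b]: since the map
    is holomorphic, its derivative along the J-rotated direction is [J b]. *)
Definition slot e (phi : seq V -> C) (b : V) s : C :=
  (phi (b :: s) + e * phi (J b :: s)) / 2.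

Lemma lsm_contr_field (phi : V -> seq V -> C) (f : V -> V) : lsm U phi ->
  (forall y, U y -> mlin (phi y)) -> smooth_on U f ->
  lsm U (fun y => contr (f y) (phi y)).
Proof.
move=> sphi mphi sf s; apply: (csm_eq oU) => [y Uy|].
  by rewrite /contr mlin_sum //; exact: mphi.
apply: csm_sum => // i; apply: csmM => //; apply: csm_real => //.
exact: smooth_crd.
Qed.

(** Product rule after expanding the moving vector [tder y w] in the real basis; [hessJ] puts the
    terms in which the coefficients are differentiated into the form [slot]. *)
Lemma Dp_contr_field e (phi : V -> seq V -> C) w z v s : lsm U phi ->
  (forall y, U y -> mlin (phi y)) -> U z ->
  Dp e (fun y => phi y (tder y w :: s)) z v =
  slot e (phi z) (hess z v w) s + Dp e (fun y => phi y (tder z w :: s)) z v.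
Proof.
move=> sphi mphi Uz; have sw := smooth_tder w.
have sc i : csm U (fun y => (crd i (tder y w))%:C).
  by apply: csm_real => //; exact: smooth_crd.
have E1 : Dp e (fun y => phi y (tder y w :: s)) z v =
    \sum_i Dp e (fun y => (crd i (tder y w))%:C * phi y (bas R i :: s)) z v.
  rewrite -(@Dp_sum _ _ U) //; last by move=> i; exact: csmM.
  by apply: (Dp_eq _ _ oU Uz) => y Uy; rewrite (mlin_sum _ _ (mphi _ Uy)).
have E2 : Dp e (fun y => phi y (tder z w :: s)) z v =
    \sum_i Dp e (fun y => (crd i (tder z w))%:C * phi y (bas R i :: s)) z v.
  rewrite -(@Dp_sum _ _ U) //; last by move=> i; exact: csmZ.
  by apply: (Dp_eq _ _ oU Uz) => y Uy; rewrite (mlin_sum _ _ (mphi _ Uy)).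
rewrite {}E1 {}E2 /slot (mlin_sum _ _ (mphi _ Uz)).
rewrite (mlin_sum (J _) _ (mphi _ Uz)) mulr_sumr -big_split mulr_suml.
rewrite -big_split; apply: eq_bigr => i _.
rewrite (DpM e v (sc i) (sphi (bas R i :: s)) Uz).
rewrite (DpZ e _ v oU (sphi (bas R i :: s)) Uz) Dp_real; congr (_ + _).
have dw := tder_diff w Uz.
rewrite (dderiv_crd v i dw) (dderiv_crd (J v) i dw) -(hessJ v w Uz).
rewrite !hessE.
move=> /=; move: (real_complex _ _) (real_complex _ _) (phi _ _) => a b c; ring.
Qed.

(** The part of the derivative of a pullback in which one of the moving arguments is differentiated,
    that is the contribution of the second derivatives of [t]. *)
Fixpoint slots e z v (phi : seq V -> C) (ws : seq V) : C :=
  if ws is w :: ws' then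
    slot e phi (hess z v w) (map (fun w => tder z w) ws') +
    slots e z v (contr (tder z w) phi) ws'
  else 0.

Lemma lsm_pull_gen (phi : V -> seq V -> C) : lsm U phi ->
  (forall y, U y -> mlin (phi y)) ->
  lsm U (fun y s => phi y (map (fun w => tder y w) s)).
Proof.
move=> sphi mphi s; elim: s phi sphi mphi => [|w s IH] phi sphi mphi /=.
  exact: sphi.
apply: (IH (fun y => contr (tder y w) (phi y))).
  by apply: lsm_contr_field => //; exact: smooth_tder.
by move=> y Uy; apply: mlin_contr; exact: mphi.
Qed.

Lemma Dp_pull_gen e (phi : V -> seq V -> C) z v s : lsm U phi ->
  (forall y, U y -> mlin (phi y)) -> U z ->
  Dp e (fun y => phi y (map (fun w => tder y w) s)) z v =
  slots e z v (phi z) s +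
  Dp e (fun y => phi y (map (fun w => tder z w) s)) z v.
Proof.
move=> sphi mphi Uz; elim: s phi sphi mphi => [|w s IH] phi sphi mphi /=.
  by rewrite add0r.
have s1 := lsm_contr_field sphi mphi (smooth_tder w).
have m1 y : U y -> mlin (contr (tder y w) (phi y)).
  by move=> Uy; apply: mlin_contr; exact: mphi.
apply: etrans (IH _ s1 m1) _; rewrite /contr.
rewrite (Dp_contr_field e w v (map (fun w => tder z w) s) sphi mphi Uz).
by rewrite addrCA addrA.
Qed.

(** Alternation moves the differentiated slot to the front, and the Hessian is symmetric; in this
    shape the sum cancels against the one produced by the contracted form in [lalt_pull_gen]. *)
Lemma slots_alt e z v (phi : seq V -> C) s : mlin phi -> adjalt phi -> U z ->
  slots e z v phi s = sumalt (fun w u =>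
    slot e phi (hess z w v) (map (fun w => tder z w) u)) s.
Proof.
move=> m a Uz; elim: s phi m a => [|w s IH] phi m a; first by rewrite sumalt_nil.
rewrite sumalt_cons /=.
rewrite (IH _ (mlin_contr (tder z w) m) (adjalt_contr (tder z w) a)).
rewrite (hessC v w Uz); congr (_ + _).
have s0 : sumalt (fun _ _ => 0) s = 0 :> C.
  by rewrite sumaltE big1 // => i _; rewrite mulr0.
rewrite -mulN1r -[RHS]addr0 -s0.
rewrite -sumalt_lin; apply: eq_sumalt => x u; rewrite addr0 /slot /contr /=.
have sw b := @adjalt_swap _ _ phi [::] (map (fun w => tder z w) u) (tder z w) b m a.
rewrite /= in sw; rewrite (sw (hess z x v)) (sw (J (hess z x v))).
move: (phi _) (phi _) => b c; ring.
Qed.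

(* The second derivatives of t contribute nothing, by symmetry. *)
Lemma lalt_pull_gen e (phi : V -> seq V -> C) z s : lsm U phi ->
  (forall y, U y -> mlin (phi y) /\ adjalt (phi y)) -> U z ->
  lalt e (fun y s => phi y (map (fun w => tder y w) s)) z s =
  lalt e (fun y s => phi y (map (fun w => tder z w) s)) z s.
Proof.
move=> sphi mphi Uz; elim: s phi sphi mphi => [|v s IH] phi sphi mphi.
  by rewrite !lalt_nil.
have m y : U y -> mlin (phi y) by case/mphi.
have sc := lsm_contr_field sphi m (smooth_tder v).
have s1 : lsm U (fun y => contr (tder y v) (phi y)) by exact: sc.
have IH1 := IH _ s1; rewrite !lalt_cons (Dp_pull_gen e v s sphi m Uz).
have -> := slots_alt e v s (m _ Uz) (mphi _ Uz).2 Uz.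
have -> : lalt e (fun y => contr v (fun s0 => phi y
    (map (fun w => tder y w) s0))) z s =
    lalt e (fun y u => phi y (tder y v :: map (fun w => tder z w) u)) z s.
  apply: IH1 => // y /mphi[m1 m2].
  by split; [exact: mlin_contr|exact: adjalt_contr].
have K : lalt e (fun y u => phi y (tder y v :: map (fun w => tder z w) u)) z s
  = sumalt (fun w u => slot e (phi z) (hess z w v) (map (fun w => tder z w) u)) s
  + lalt e (fun y => contr v (fun u => phi y (map (fun w => tder z w) u))) z s.
  rewrite !laltE -[X in _ = X + _]mul1r -sumalt_lin; apply: eq_sumalt => w u.
  by rewrite mul1r; exact: Dp_contr_field.
by rewrite K opprD addrACA subrr add0r.
Qed.

Lemma lalt_pull e (psi : V -> seq V -> C) z s : lsm U' psi ->
  (forall y, U' y -> mlin (psi y) /\ adjalt (psi y)) -> U z ->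
  lalt e (fun y s => psi (t y) (map (fun w => 'D_w t y) s)) z s =
  lalt e psi (t z) (map (fun w => 'D_w t z) s).
Proof.
move=> spsi mpsi Uz.
have -> : (fun y s => psi (t y) (map (fun w => 'D_w t y) s)) =
    (fun y s => psi (t y) (map (fun w => tder y w) s)).
  by apply/funext => y; apply/funext => u; under eq_map do rewrite -tderE.
under eq_map do rewrite -tderE. rewrite (@lalt_pull_gen e (fun y => psi (t y))) //.
- rewrite !laltE -sumalt_map; apply: eq_sumalt => w u.
  by rewrite (@Dp_comp e (fun y => psi y (map (fun w => tder z w) u))).
- move=> u; exact: (@csm_comp t (fun y => psi y u) U U').
- by move=> y Uy; apply: mpsi; exact: tU.
Qed.

End Map.
End Pullback.

(** * Differential forms on a manifold *)

Section AlgebraicPullback.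
Variables (R : realType) (n : nat).
Local Notation V := (Cn R n).
Local Notation C := R[i].
Implicit Types (a : seq V -> C) (A : V -> V).

Lemma alternating_map k a A : (forall t v w, A (t *: v + w) = t *: A v + A w) ->
  alternating k a -> alternating k (a \o map A).
Proof.
move=> lA /alternatingP[h m d]; apply/alternatingP; split.
- by move=> s hs; apply: h; rewrite size_map.
- by move=> s1 s2 t v w; rewrite /= !map_cat /= lA m.
- by move=> s1 s2 v; rewrite /= map_cat d.
Qed.

Lemma bidegree_map p q a A : (forall t v w, A (t *: v + w) = t *: A v + A w) ->
  (forall z v, A (cscale z v) = cscale z (A v)) ->
  bidegree p q a -> bidegree p q (a \o map A).
Proof.
move=> lA cA [h d]; split; first exact: alternating_map.
move=> z s; apply: etrans (congr1 a _) (d z (map A s)).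
by elim: s => //= v s ->; rewrite cA.
Qed.

End AlgebraicPullback.

Lemma eq_map_comp (T T' T'' : Type) (f : T -> T'') (g : T' -> T'') (h : T -> T') :
  (forall v, f v = g (h v)) -> forall s, map f s = map g (map h s).
Proof. by move=> E; elim=> //= v s ->; rewrite E. Qed.

Section ManifoldForms.
Variables (R : realType) (n : nat) (X : complexManifold R n).
Local Notation V := (Cn R n).
Local Notation C := R[i].
Implicit Types (c : chartIdx X) (phi psi : diffForm X) (x y : X) (z : V)
  (s : seq V) (e : C).

Definition trans c c' : V -> V := chart_coord c' \o chart_param c.
Definition overlap c c' : set V := chart_coord c @` (chart_dom c `&` chart_dom c').

Lemma image_open c : open (@chart_image R n X c).
Proof. exact: coord_image_open. Qed.

Lemma image_param c z : chart_image c z -> chart_dom c (chart_param c z).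
Proof. by case=> x dx <-; rewrite coordK. Qed.

Lemma image_coord c z : chart_image c z -> chart_coord c (chart_param c z) = z.
Proof. by case=> x dx <-; rewrite coordK. Qed.

Lemma coord_image c x : chart_dom c x -> chart_image c (chart_coord c x).
Proof. by exists x. Qed.

Lemma overlapP c c' z : overlap c c' z <->
  chart_image c z /\ chart_dom c' (chart_param c z).
Proof.
split; first by case=> x [dx dx'] <-; split; [exists x|rewrite coordK].
case=> -[x dx <-]; rewrite coordK // => dx'; exists x => //.
Qed.

Lemma overlap_open c c' : open (overlap c c').
Proof.
rewrite openE => z /overlapP[cz cz'].
have h1 : \forall w \near z, chart_image c w.
  by apply: open_nbhs_nbhs; split=> //; exact: image_open.
have h2 : \forall w \near z, chart_dom c' (chart_param c w).
  by apply: (param_continuous cz); apply: open_nbhs_nbhs; split=> //;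
    exact: dom_open.
by apply: filterS2 h1 h2 => w w1 w2; apply/overlapP.
Qed.

Lemma trans_image c c' z : overlap c c' z -> chart_image c' (trans c c' z).
Proof. by case/overlapP => _ d; apply: coord_image. Qed.

Lemma trans_param c c' z : overlap c c' z ->
  chart_param c' (trans c c' z) = chart_param c z.
Proof. by case/overlapP => _ d; rewrite /trans /= coordK. Qed.

Lemma trans_smooth c c' : smooth_on (overlap c c') (trans c c').
Proof. exact: (transition_holomorphic c c').1. Qed.

Lemma trans_hol c c' z v : overlap c c' z ->
  'D_(J v) (trans c c') z = J ('D_v (trans c c') z).
Proof. exact: (transition_holomorphic c c').2. Qed.

Lemma trans_diff c c' z : overlap c c' z -> differentiable (trans c c') z.
Proof. by move=> o; apply: smooth_diff o; exact: trans_smooth. Qed.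

Lemma trans_lin c c' z (t : R) v w : overlap c c' z ->
  'D_(t *: v + w) (trans c c') z =
  t *: 'D_v (trans c c') z + 'D_w (trans c c') z.
Proof.
by move=> /trans_diff d; rewrite (dderivDv _ _ d) (dderivZv _ _ d).
Qed.

Lemma trans_cscale c c' z (t : C) v : overlap c c' z ->
  'D_(cscale t v) (trans c c') z = cscale t ('D_v (trans c c') z).
Proof.
move=> o; rewrite cscaleE trans_lin // cscaleE; congr (_ + _).
have d := trans_diff o.
by rewrite (dderivZv _ _ d) trans_hol.
Qed.

Lemma trans_comp c c' c'' z v : overlap c c' z -> chart_dom c'' (chart_param c z) ->
  'D_('D_v (trans c c') z) (trans c' c'') (trans c c' z) =
  'D_v (trans c c'') z.
Proof.
move=> o d; have o' : overlap c' c'' (trans c c' z).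
  by apply/overlapP; split; [exact: trans_image|rewrite trans_param].
have d1 := trans_diff o; have d2 := trans_diff o'.
rewrite -(dderiv_comp v d1 d2).
apply: near_eq_derive; apply: (near_open (@overlap_open c c') o) => w ow.
by rewrite {1}/trans /= trans_param.
Qed.

Lemma trans_id c z v : chart_image c z -> 'D_v (trans c c) z = v.
Proof.
move=> iz; rewrite (near_eq_derive (g := id)) ?derive_id //.
by apply: (near_open (@image_open c) iz) => w iw; rewrite /trans /= image_coord.
Qed.

Lemma local_expr_at phi x s :
  local_expr (chartAt x) phi (chart_coord (chartAt x) x) s = phi x s.
Proof.
rewrite /local_expr coordK; last exact: dom_chartAt.
rewrite (eq_map (g := id)) ?map_id // => v.
by apply: trans_id; apply: coord_image; exact: dom_chartAt.
Qed.

Lemma local_expr_trans c c' phi z s : overlap c c' z ->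
  local_expr c phi z s = local_expr c' phi (trans c c' z)
    (map (fun v => 'D_v (trans c c') z) s).
Proof.
move=> o; rewrite /local_expr.
move: (chart_param c' _) (trans_param o) => y ->.
refine (congr1 (phi (chart_param c z)) (eq_map_comp _ s)) => v.
exact: esym (trans_comp v o (dom_chartAt _)).
Qed.

Lemma local_expr_wedge c phi psi z :
  local_expr c (fwedge phi psi) z =
  wedge_alt (local_expr c phi z) (local_expr c psi z).
Proof. by apply/funext => s; rewrite /local_expr /fwedge wedge_map. Qed.

Lemma overlap_chartAt c z : chart_image c z ->
  overlap c (chartAt (chart_param c z)) z.
Proof. by move=> iz; apply/overlapP; split => //; exact: dom_chartAt. Qed.

Lemma local_expr_alt k c phi z : chart_image c z ->
  (forall x, alternating k (phi x)) -> alternating k (local_expr c phi z).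
Proof.
move=> /overlap_chartAt o h.
have := @alternating_map R n k (phi (chart_param c z))
  (fun v => 'D_v (trans c (chartAt (chart_param c z))) z).
by apply => // t v w; exact: trans_lin.
Qed.

Lemma local_expr_bidegree p q c phi z : chart_image c z ->
  (forall x, bidegree p q (phi x)) -> bidegree p q (local_expr c phi z).
Proof.
move=> /overlap_chartAt o h.
have := @bidegree_map R n p q (phi (chart_param c z))
  (fun v => 'D_v (trans c (chartAt (chart_param c z))) z).
by apply => // *; [exact: trans_lin|exact: trans_cscale].
Qed.

Definition kform k phi := smooth_form phi /\ forall x, alternating k (phi x).

Lemma kform_bidegree p q phi : form_bidegree p q phi -> kform (p + q) phi.
Proof. by case=> s h; split => // x; have [] := h x. Qed.

Definition fderiv e phi : diffForm X := fun x s =>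
  lalt e (local_expr (chartAt x) phi) (chart_coord (chartAt x) x) s.

Lemma delE phi : del phi = fderiv (- 'i) phi.
Proof.
apply/funext => x; apply/funext => s; apply: eq_bigr => i _.
by rewrite DpE mulNr.
Qed.

Lemma delbarE phi : delbar phi = fderiv 'i phi.
Proof.
by apply/funext => x; apply/funext => s; apply: eq_bigr => i _; rewrite DpE.
Qed.

Lemma fderiv_near e phi psi x (W : set X) : open W -> W x ->
  (forall y, W y -> phi y = psi y) -> fderiv e phi x = fderiv e psi x.
Proof.
move=> oW Wx h; apply/funext => s; rewrite /fderiv.
have ix := coord_image (dom_chartAt x).
apply: eq_sumalt => w t; apply: Dp_near.
have : \forall z \near chart_coord (chartAt x) x,
    W (chart_param (chartAt x) z).
  apply: (param_continuous ix); rewrite coordK; last exact: dom_chartAt.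
  exact: open_nbhs_nbhs.
by apply: filterS => z Wz; rewrite /local_expr h.
Qed.

(** [fderiv] is computed at each point in the chart selected there. That it has the same expression
    in an arbitrary chart is the naturality [lalt_pull] under the holomorphic transition map; every
    later local computation rests on this. *)
Lemma local_expr_fderiv e k phi c z s : kform k phi -> chart_image c z ->
  local_expr c (fderiv e phi) z s = lalt e (local_expr c phi) z s.
Proof.
move=> [sphi aphi] iz; have o := overlap_chartAt iz.
set c0 := chartAt (chart_param c z) in o.
transitivity (lalt e (local_expr c0 phi) (trans c c0 z)
  (map (fun v => 'D_v (trans c c0) z) s)) => //.
have H := @lalt_pull R n (trans c c0) (overlap c c0) (chart_image c0)
   (@overlap_open c c0) (@trans_image c c0) (@trans_smooth c c0)
   (fun z v => @trans_hol c c0 z v) e (local_expr c0 phi) z s.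
apply: (etrans (esym (H _ _ o))); last first.
- apply: (lalt_eq _ _ (@overlap_open c c0) o) => y t oy.
  by rewrite (local_expr_trans _ _ oy).
- by move=> y iy; have /alternatingP[] := local_expr_alt iy aphi.
- exact: sphi.
Qed.

Lemma lsm_local c phi : smooth_form phi -> lsm (chart_image c) (local_expr c phi).
Proof. by move=> sphi s; exact: sphi. Qed.

Lemma kform_fderiv e k phi : kform k phi -> kform k.+1 (fderiv e phi).
Proof.
move=> kphi; have [sphi aphi] := kphi; split.
  move=> c s; apply: (csm_eq (@image_open c)) => [z iz|].
    by rewrite (local_expr_fderiv _ _ kphi iz).
  apply: lsm_lalt; first exact: image_open.
  exact: lsm_local.
move=> x; apply: (@lalt_alternating _ _ (chart_image (chartAt x))).
- exact: image_open.
- exact: lsm_local.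
- by apply: coord_image; exact: dom_chartAt.
- by move=> y iy; exact: local_expr_alt.
Qed.

Lemma del_bidegree p q phi : form_bidegree p q phi -> form_bidegree p.+1 q (del phi).
Proof.
move=> h; have kphi := kform_bidegree h; have [sphi bphi] := h.
rewrite delE; split; first by have [] := kform_fderiv (- 'i) kphi.
move=> x; apply: (@lalt_bidegree10 _ _ (chart_image (chartAt x))).
- exact: image_open.
- exact: lsm_local.
- by apply: coord_image; exact: dom_chartAt.
- by move=> y iy; exact: local_expr_bidegree.
Qed.

Lemma delbar_bidegree p q phi : form_bidegree p q phi ->
  form_bidegree p q.+1 (delbar phi).
Proof.
move=> h; have kphi := kform_bidegree h; have [sphi bphi] := h.
rewrite delbarE; split; first by have [] := kform_fderiv 'i kphi.
move=> x; apply: (@lalt_bidegree01 _ _ (chart_image (chartAt x))).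
- exact: image_open.
- exact: lsm_local.
- by apply: coord_image; exact: dom_chartAt.
- by move=> y iy; exact: local_expr_bidegree.
Qed.

Definition fopp phi : diffForm X := fun x s => - phi x s.
Definition fsgn phi : diffForm X := fun x => sgnf (phi x).

Let at_image x : chart_image (chartAt x) (chart_coord (chartAt x) x).
Proof. by apply: coord_image; exact: dom_chartAt. Qed.

Lemma fderiv_anticomm e e' k phi : kform k phi ->
  fderiv e (fderiv e' phi) = fopp (fderiv e' (fderiv e phi)).
Proof.
move=> kphi; apply/funext => x; apply/funext => s; rewrite /fopp.
have oI := @image_open (chartAt x); have ix := at_image x.
have E f f' : fderiv f (fderiv f' phi) x s =
    lalt f (lalt f' (local_expr (chartAt x) phi)) (chart_coord (chartAt x) x) s.
  by apply: (lalt_eq _ _ oI ix) => y t iy; exact: local_expr_fderiv kphi iy.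
rewrite !E (lalt_anticomm oI) //; apply: lsm_local; exact: kphi.1.
Qed.

Lemma fderiv_sq e k phi : kform k phi -> fderiv e (fderiv e phi) = @fzero R n X.
Proof.
move=> kphi; have E := fderiv_anticomm e e kphi.
apply/funext => x; apply/funext => s.
have := congr1 (fun f => f x s) E; rewrite /fopp => /eqP.
by rewrite -subr_eq0 opprK -mulr2n mulrn_eq0 /= => /eqP.
Qed.

Lemma fderiv_wedge e phi psi : smooth_form phi -> smooth_form psi ->
  fderiv e (fwedge phi psi) = fadd (fwedge (fderiv e phi) psi)
    (fwedge (fsgn phi) (fderiv e psi)).
Proof.
move=> sphi spsi; apply/funext => x; apply/funext => s.
have oI := @image_open (chartAt x); have ix := at_image x.
rewrite /fderiv (lalt_eq (b := fun z t => wedge_alt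
  (local_expr (chartAt x) phi z) (local_expr (chartAt x) psi z) t) _ _ oI ix);
  last by move=> y t _; rewrite local_expr_wedge.
rewrite (lalt_wedge oI) //; try exact: lsm_local.
rewrite /fadd /fwedge /fsgn; congr (wedge_alt _ _ s + wedge_alt (sgnf _) _ s);
  by apply/funext => t; rewrite local_expr_at.
Qed.

Lemma fderiv_lin e (t : C) phi psi : smooth_form phi -> smooth_form psi ->
  fderiv e (fadd (fscale t phi) psi) = fadd (fscale t (fderiv e phi)) (fderiv e psi).
Proof.
move=> sphi spsi; apply/funext => x; apply/funext => s.
have oI := @image_open (chartAt x); have ix := at_image x.
by rewrite /fderiv; apply: (lalt_lin oI) => //; exact: lsm_local.
Qed.

Lemma smooth_fadd phi psi : smooth_form phi -> smooth_form psi ->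
  smooth_form (fadd phi psi).
Proof. by move=> h1 h2 c s; exact: csmD (@image_open c) (h1 c s) (h2 c s). Qed.

Lemma smooth_fscale (t : C) phi : smooth_form phi -> smooth_form (fscale t phi).
Proof. by move=> h1 c s; exact: csmZ (@image_open c) (h1 c s). Qed.

Lemma smooth_fmul f phi : smooth_fun f -> smooth_form phi ->
  smooth_form (fmul f phi).
Proof.
move=> sf h1 c s; have oI := @image_open c; apply: (csmM oI); last exact: h1.
by apply: csm_real => //; exact: sf.
Qed.

Lemma smooth_fwedge phi psi : smooth_form phi -> smooth_form psi ->
  smooth_form (fwedge phi psi).
Proof.
move=> h1 h2 c s; have oI := @image_open c.
apply: (csm_eq oI) => [z _|]; first by rewrite local_expr_wedge.
by apply: (lsm_wedge oI); exact: lsm_local.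
Qed.

Lemma smooth_fzero : smooth_form (@fzero R n X).
Proof. by move=> c s; apply: csm_cst; exact: image_open. Qed.

Lemma smooth_fone : smooth_form (@fone R n X).
Proof.
move=> c s; have oI := @image_open c.
by apply: (csm_eq oI) (csm_cst (@unit_form R n s) oI) => z _; case: s.
Qed.

Lemma bid_fadd p q phi psi : form_bidegree p q phi -> form_bidegree p q psi ->
  form_bidegree p q (fadd phi psi).
Proof.
move=> [h1 h2] [h3 h4]; split; first exact: smooth_fadd.
move=> x; have := bidegree_lin 1 (h2 x) (h4 x); congr bidegree.
by apply/funext => s; rewrite mul1r.
Qed.

Lemma bid_fscale p q (t : C) phi : form_bidegree p q phi ->
  form_bidegree p q (fscale t phi).
Proof.
move=> [h1 h2]; split; first exact: smooth_fscale.
by move=> x; exact: bidegreeZ.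
Qed.

Lemma bid_fmul p q f phi : smooth_fun f -> form_bidegree p q phi ->
  form_bidegree p q (fmul f phi).
Proof.
move=> sf [h1 h2]; split; first exact: smooth_fmul.
by move=> x; exact: bidegreeZ.
Qed.

Lemma bid_fwedge p q p' q' phi psi : form_bidegree p q phi ->
  form_bidegree p' q' psi -> form_bidegree (p + p') (q + q') (fwedge phi psi).
Proof.
move=> [h1 h2] [h3 h4]; split; first exact: smooth_fwedge.
by move=> x; exact: bidegree_wedge.
Qed.

Lemma bid_fzero p q : form_bidegree p q (@fzero R n X).
Proof. by split; [exact: smooth_fzero|move=> x; exact: bidegree0]. Qed.

Lemma bid_fone : form_bidegree 0 0 (@fone R n X).
Proof. by split; [exact: smooth_fone|move=> x; exact: bidegree_unit]. Qed.

Lemma bid_fpow phi r : form_bidegree 1 1 phi -> form_bidegree r r (fpow phi r).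
Proof.
move=> h; elim: r => [|r IH]; first exact: bid_fone.
exact: (bid_fwedge h IH).
Qed.

Lemma fmul_wedge f phi : fmul f phi = fwedge (fmul f (@fone R n X)) phi.
Proof.
apply/funext => x; apply/funext => s; apply: esym.
apply: etrans (wedgeZl (f x)%:C (@unit_form R n) (phi x) s) _.
by rewrite wedge1l.
Qed.

Lemma fmul_fwedger f phi psi :
  fmul f (fwedge phi psi) = fwedge phi (fmul f psi).
Proof.
by apply/funext => x; apply/funext => s; rewrite /fwedge /fmul wedgeZr.
Qed.

Lemma fwedgeA a b d :
  fwedge a (fwedge b d) = fwedge (fwedge a b) d :> diffForm X.
Proof. by apply/funext => x; exact: wedgeA. Qed.

Lemma fwedge1 phi : fwedge (@fone R n X) phi = phi.
Proof. by apply/funext => x; exact: wedge1l. Qed.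

Lemma fwedge0l phi : fwedge (@fzero R n X) phi = @fzero R n X.
Proof. by apply/funext => x; apply/funext => s; exact: wedge0l. Qed.

Lemma fwedge0r phi : fwedge phi (@fzero R n X) = @fzero R n X.
Proof. by apply/funext => x; apply/funext => s; exact: wedge0r. Qed.

Lemma fsgn_even k phi : (forall x, alternating k (phi x)) -> ~~ odd k ->
  fsgn phi = phi.
Proof.
move=> h ok; apply/funext => x; have /alternatingP[hk _ _] := h x.
rewrite /fsgn (sgnf_hom hk) -signr_odd (negbTE ok).
by apply/funext => s; rewrite mul1r.
Qed.

Lemma fsgn_odd k phi : (forall x, alternating k (phi x)) -> odd k ->
  fsgn phi = fopp phi.
Proof.
move=> h ok; apply/funext => x; have /alternatingP[hk _ _] := h x.
rewrite /fsgn (sgnf_hom hk) -signr_odd ok.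
by apply/funext => s; rewrite mulN1r.
Qed.

Lemma fwedgeC_even k l phi psi : (forall x, alternating k (phi x)) ->
  (forall x, alternating l (psi x)) -> ~~ odd (k * l) ->
  fwedge phi psi = fwedge psi phi.
Proof.
move=> h1 h2 o; apply/funext => x; have /alternatingP[hk _ _] := h1 x.
by have /alternatingP[hl _ _] := h2 x; apply: (wedgeC_even o).
Qed.

End ManifoldForms.

(** * Bump functions on C^n *)

Section Bumps.
Variables (R : realType) (n : nat).
Local Notation V := (Cn R n).

(** The squared Euclidean norm: smooth and invariant under [J], and comparable with the square of
    the sup norm carried by [V]. *)
Definition qd (z : V) : R := \sum_i crd i z ^+ 2.

Lemma qd_ge0 z : 0 <= qd z.
Proof. by apply: sumr_ge0 => i _; exact: sqr_ge0. Qed.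

Lemma norm_crd_le (z : V) (t : R) : 0 <= t -> (forall i, `|crd i z| <= t) ->
  `|z| <= t.
Proof.
move=> t0 H; rewrite prod_normE ge_max; apply/andP; split;
  rewrite {1}/Num.norm /= mx_normrE; apply/bigmax_leP; split => // -[i j] _ /=;
  rewrite (ord1 i); [exact: (H (inl j))|exact: (H (inr j))].
Qed.

Lemma norm_le_qd z : `|z| ^+ 2 <= qd z.
Proof.
rewrite -[leRHS]sqr_sqrtr ?qd_ge0 // lerXn2r ?nnegrE ?sqrtr_ge0 //.
apply: norm_crd_le; first exact: sqrtr_ge0.
move=> i; rewrite -sqrtr_sqr ler_sqrt ?qd_ge0 // /qd (bigD1 i) //= lerDl.
by apply: sumr_ge0 => j _; exact: sqr_ge0.
Qed.

Lemma smooth_id (W : normedModType R) (U : set W) : open U ->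
  smooth_on U (fun z : W => z).
Proof.
move=> oU; apply: (@smooth_coind _ _ _ U (fun f => f = id \/ exists c, f = fun=> c)).
- by [].
- by move=> f [->|[c ->]] z _; [exact: ex_diff|
    exact: differentiable_cst].
- move=> f v [->|[c ->]].
    exists (fun=> v); first by right; exists v.
    by move=> z _; exact: derive_id.
  exists (fun=> 0); first by right; exists 0.
  by move=> z _; exact: dderiv_cst.
- by left.
Qed.

Lemma smooth_qd (z0 : V) U : open U -> smooth_on U (fun z => qd (z - z0)).
Proof.
move=> oU; apply: (smooth_eq (f := fun z => \sum_i (crd i z - crd i z0) ^+ 2)) => //.
  by move=> z _; apply: eq_bigr => i _; rewrite -linearB.
apply: smooth_sum => // i; apply: smooth_exp => //.
apply: smoothB => //; last exact: smooth_cst.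
by apply: smooth_crd => //; exact: smooth_id.
Qed.

Lemma ball_compact (z0 : V) r : compact [set z : V | `|z0 - z| <= r].
Proof.
have H (a : 'rV[R]_n) : compact [set b | `|a - b| <= r].
  apply: bounded_closed_compact; last exact: closed_closed_ball_.
  exists (`|a| + r); split; first exact: num_real.
  move=> M /= hM b /= hb; apply: le_trans (ltW hM).
  rewrite -[b](subKr a) (le_trans (ler_normB _ _)) // lerD2l //.
have -> : [set z : V | `|z0 - z| <= r] =
    [set b | `|z0.1 - b| <= r] `*` [set b | `|z0.2 - b| <= r].
  apply/seteqP; split=> -[a b] /=; rewrite prod_normE /= ge_max;
    [by move/andP|by move=> [-> ->]].
exact: compact_setX.
Qed.

(** The factor 2 sends qd = r^2 to the point 2 where [plateau] reaches 0, so the support lies in the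
    sup-norm ball of radius [r]. *)
Definition vbump (z0 : V) (r : R) (z : V) : R := plateau (2 * qd (z - z0) / r ^+ 2).

Lemma vbump_smooth z0 r U : open U -> smooth_on U (vbump z0 r).
Proof.
move=> oU; apply: (@smooth_comp1 R _ (fun z => 2 * qd (z - z0) / r ^+ 2)
  (@plateau R) U setT) => //; last exact: plateau_smooth.
apply: smoothM => //; last exact: smooth_cst.
by apply: smoothZ => //; exact: smooth_qd.
Qed.

Lemma vbump_supp z0 r z : 0 < r -> r < `|z0 - z| -> vbump z0 r z = 0.
Proof.
move=> r0 rz; apply: plateau0; rewrite -mulrA ler_pMr // ler_pdivlMr ?exprn_gt0 //.
rewrite mul1r (le_trans _ (norm_le_qd _)) // distrC lerXn2r ?nnegrE ?ltW //.
exact: lt_trans rz.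
Qed.

Lemma qd_continuous (z0 : V) : {for z0, continuous (fun z : V => qd (z - z0))}.
Proof.
apply: differentiable_continuous; apply: (smooth_diff (U := setT)) => //.
by apply: smooth_qd; exact: openT.
Qed.

Lemma vbump1 z0 r : 0 < r -> \forall z \near z0, vbump z0 r z = 1.
Proof.
move=> r0; have r2 : 0 < r ^+ 2 / 2 by rewrite divr_gt0 // exprn_gt0.
have := @qd_continuous z0; rewrite /continuous_at => /cvgrPdist_lt/(_ _ r2).
apply: filterS => z; rewrite subrr.
have -> : qd (0 : V) = 0 by rewrite /qd big1 // => i _; rewrite linear0 expr0n.
rewrite sub0r normrN ger0_norm ?qd_ge0 // => h; apply: plateau1.
rewrite ler_pdivrMr ?exprn_gt0 // mul1r mulrC -ler_pdivlMr //; exact: ltW.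
Qed.

End Bumps.

(** * Smooth functions on a manifold *)

Section SmoothFunctions.
Variables (R : realType) (n : nat) (X : complexManifold R n).
Local Notation V := (Cn R n).
Implicit Types (c : chartIdx X) (f g : X -> R) (x : X).

Lemma sfun_cst (k : R) : smooth_fun (fun _ : X => k).
Proof. by move=> c; exact: (smooth_cst k (@image_open _ _ X c)). Qed.

Lemma sfunD f g : smooth_fun f -> smooth_fun g -> smooth_fun (fun x => f x + g x).
Proof. by move=> sf sg c; exact: (smoothD (@image_open _ _ X c) (sf c) (sg c)). Qed.

Lemma sfunM f g : smooth_fun f -> smooth_fun g -> smooth_fun (fun x => f x * g x).
Proof. by move=> sf sg c; exact: (smoothM (@image_open _ _ X c) (sf c) (sg c)). Qed.

Lemma sfunZ (k : R) f : smooth_fun f -> smooth_fun (fun x => k * f x).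
Proof. by move=> sf; apply: sfunM => //; exact: sfun_cst. Qed.

Lemma sfunN f : smooth_fun f -> smooth_fun (fun x => - f x).
Proof. by move=> sf c; exact: (smoothN (@image_open _ _ X c) (sf c)). Qed.

Lemma sfunB f g : smooth_fun f -> smooth_fun g -> smooth_fun (fun x => f x - g x).
Proof. by move=> sf sg; apply: sfunD => //; exact: sfunN. Qed.

Lemma sfun_prod (I : Type) (r : seq I) (F : I -> X -> R) :
  (forall i, smooth_fun (F i)) -> smooth_fun (fun x => \prod_(i <- r) F i x).
Proof.
move=> sF c; apply: (smooth_prod r (@image_open _ _ X c)
  (F := fun i => F i \o chart_param c)) => i; exact: sF.
Qed.

Lemma sfun_continuous f : smooth_fun f -> continuous f.
Proof.
move=> sf x; pose c := chartAt x; have dx := dom_chartAt x.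
have ix := coord_image dx.
have h1 : {for chart_coord c x, continuous (f \o chart_param c)}.
  by apply: differentiable_continuous; exact: smooth_diff (sf c) ix.
have h2 : {for x, continuous ((f \o chart_param c) \o chart_coord c)}.
  by apply: continuous_comp => //; exact: coord_continuous.
have h3 : ((f \o chart_param c) \o chart_coord c) y @[y --> x] --> f x.
  by rewrite -[X in _ --> f X](coordK dx); exact: h2.
apply: (cvg_trans _ h3); apply: near_eq_cvg.
have : \forall y \near x, chart_dom c y.
  by apply: open_nbhs_nbhs; split=> //; exact: dom_open.
by apply: filterS => y dy /=; rewrite coordK.
Qed.

Definition extend c (f : V -> R) x : R :=
  if pselect (chart_dom c x) then f (chart_coord c x) else 0.

(** The value 0 outside the chart domain is harmless only for functions with compact support in the
    chart. In [extend_smooth] a point outside the domain has a neighbourhood avoiding the image of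
    the support, because that image is compact, hence closed in a Hausdorff space. *)
Lemma extend_in c (f : V -> R) x : chart_dom c x ->
  extend c f x = f (chart_coord c x).
Proof. by rewrite /extend; case: pselect. Qed.

Lemma extend_smooth c (f : V -> R) (K : set V) :
  smooth_on (chart_image c) f -> compact K -> K `<=` chart_image c ->
  (forall z, chart_image c z -> ~ K z -> f z = 0) -> smooth_fun (extend c f).
Proof.
move=> sf cK KI f0 c' l z iz.
have clK : closed (chart_param c @` K).
  apply: compact_closed; first exact: manifold_hausdorff.
  apply: continuous_compact => //; apply: continuous_in_subspaceT => w.
  by rewrite inE => /KI; exact: param_continuous.
have [dz|ndz] := pselect (chart_dom c (chart_param c' z)).
  have o : overlap c' c z by apply/overlapP.
  suff : smooth_on (overlap c' c) (extend c f \o chart_param c') by apply.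
  apply: (smooth_eq (f := fun w => f (trans c' c w))); first exact: overlap_open.
    by move=> w /overlapP[_ dw]; rewrite /= extend_in.
  apply: (@smooth_compV _ _ _ (trans c' c) f (overlap c' c) (chart_image c)) => //.
  - exact: overlap_open.
  - exact: trans_image.
  - exact: trans_smooth.
have nK : ~ (chart_param c @` K) (chart_param c' z).
  by case=> w Kw e; apply: ndz; rewrite -e; apply: image_param; exact: KI.
pose O := [set w | chart_image c' w /\ ~ (chart_param c @` K) (chart_param c' w)].
have oO : open O.
  rewrite openE => w [iw nw].
  have h1 : \forall y \near w, chart_image c' y.
    by apply: open_nbhs_nbhs; split=> //; exact: image_open.
  have h2 : \forall y \near w, (~` (chart_param c @` K)) (chart_param c' y).
    apply: (param_continuous iw); apply: open_nbhs_nbhs; split=> //.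
    exact: closed_openC.
  by apply: filterS2 h1 h2.
suff : smooth_on O (extend c f \o chart_param c') by apply.
apply: (smooth_eq (f := fun=> 0)) => //; last exact: smooth_cst.
move=> w [iw nw]; rewrite /= /extend; case: pselect => // dw.
rewrite f0 //; first by apply: coord_image.
by move=> Kw; apply: nw; exists (chart_coord c (chart_param c' w)) => //;
  rewrite coordK.
Qed.

Lemma bump_exists x (W : set X) : open W -> W x -> exists (b : X -> R) (K : set X),
  [/\ smooth_fun b, forall y, 0 <= b y <= 1, \forall y \near x, b y = 1,
      compact K & K `<=` (W `&` chart_dom (chartAt x)) /\ forall y, ~ K y -> b y = 0].
Proof.
move=> oW Wx; pose c := chartAt x; have dx := dom_chartAt x.
have ix := coord_image dx; set z0 := chart_coord c x in ix.
have : \forall z \near z0, chart_image c z /\ W (chart_param c z).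
  apply: filterI; first by apply: open_nbhs_nbhs; split=> //; exact: image_open.
  apply: (param_continuous ix); rewrite coordK //.
  exact: open_nbhs_nbhs.
move=> /nbhs_ballP[r /= r0 hr].
have r2 : 0 < r / 2 by rewrite divr_gt0.
pose K := [set z : V | `|z0 - z| <= r / 2].
have KI z : K z -> chart_image c z /\ W (chart_param c z).
  move=> Kz; apply: hr; rewrite -ball_normE /=; apply: le_lt_trans Kz _.
  by rewrite ltr_pdivrMr // ltr_pMr // ltr1n.
have cK : compact K by exact: ball_compact.
exists (extend c (vbump z0 (r / 2))), (chart_param c @` K); split.
- apply: (@extend_smooth c _ K) => //; first by apply: vbump_smooth; exact: image_open.
    by move=> z /KI[].
  by move=> z iz nK; apply: vbump_supp => //; rewrite ltNge; apply/negP.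
- move=> y; rewrite /extend; case: pselect => [dy|ndy]; last by rewrite lexx ler01.
  by rewrite plateau_ge0 plateau_le1.
- have h1 : \forall y \near x, chart_dom c y.
    by apply: open_nbhs_nbhs; split=> //; exact: dom_open.
  have h2 : \forall y \near x, vbump z0 (r / 2) (chart_coord c y) = 1.
    have h : chart_coord c y @[y --> x] --> z0 := coord_continuous dx.
    exact: (h _ (vbump1 z0 r2)).
  by apply: filterS2 h1 h2 => y dy e; rewrite (extend_in _ dy); exact: e.
- apply: continuous_compact => //; apply: continuous_in_subspaceT => w.
  by rewrite inE => /KI[iw _]; exact: param_continuous.
split; first by move=> _ [z /KI[iz Wz] <-]; split=> //; exact: image_param.
move=> y nK; rewrite /extend; case: pselect => // dy.
apply: vbump_supp => //; rewrite ltNge; apply/negP => h; apply: nK.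
by exists (chart_coord c y) => //; rewrite coordK.
Qed.

(** A countable base provides countably many bumps below the indicator of [U], at least one of them
    equal to 1 at each point of [U]. They are combined by 1 - prod (1 - chi_i), which is smooth and
    increasing where a maximum would not be smooth, and which is exactly 1 as soon as one chi_i
    is. *)
Lemma approx_open (U : set X) : open U -> exists f : nat -> X -> R,
  [/\ forall k, smooth_fun (f k), forall k x, 0 <= f k x <= 1,
      forall k x, f k x <= f k.+1 x,
      forall x, U x -> exists N, forall k, (N <= k)%N -> f k x = 1
    & forall k x, ~ U x -> f k x = 0].
Proof.
move=> oU; have [B cB [oB bB]] := @manifold_second_countable _ _ X.
have [e eB] : exists e : nat -> set X, forall A, B A -> exists i, e i = A.
  have /pcard_leP/unsquash g := cB.
  exists (fun i => 'pinv_(fun=> set0) B g i) => A BA; exists (g A).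
  by rewrite pinvKV ?inE.
pose good i (b : X -> R) := [/\ smooth_fun b, forall y, 0 <= b y <= 1,
  forall y, e i y -> b y = 1 & forall y, ~ U y -> b y = 0].
(* Not every basic open set admits a suitable bump; those that do not contribute 0. *)
pose chi i : X -> R := if pselect (exists b, good i b) is left h
  then projT1 (cid h) else fun=> 0.
have chiP i : [/\ smooth_fun (chi i), forall y, 0 <= chi i y <= 1 &
    forall y, ~ U y -> chi i y = 0].
  rewrite /chi; case: pselect => [h|_]; first by case: (cid h) => b [].
  by split=> // [|y]; [exact: sfun_cst|rewrite lexx ler01].
have chi1 x : U x -> exists i, chi i x = 1.
  move=> Ux; have [b [K [sb b01 b1 cK [KU b0]]]] := bump_exists oU Ux.
  have [A [BA Ax] hA] := bB x _ b1.
  have [i ei] := eB A BA; exists i; rewrite /chi; case: pselect => [h|[]].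
    by case: (cid h) => b' [_ _ h1 _] /=; apply: h1; rewrite ei.
  exists b; split=> // y; first by rewrite ei => /hA.
  by move=> nU; apply: b0 => /KU[].
pose f k (x : X) : R := 1 - \prod_(i < k) (1 - chi i x).
have p01 k x : 0 <= \prod_(i < k) (1 - chi i x) <= 1.
  have h i : 0 <= 1 - chi i x <= 1.
    by have [_ /(_ x) + _] := chiP i; lra.
  apply/andP; split; first by apply: prodr_ge0 => i _; have /andP[] := h i.
  by apply: prodr_ile1 => i _; exact: h.
exists f; split.
- move=> k; apply: sfunB; first exact: sfun_cst.
  apply: sfun_prod => i; apply: sfunB; first exact: sfun_cst.
  by have [] := chiP i.
- by move=> k x; have := p01 k x; rewrite /f; lra.
- move=> k x; rewrite /f big_ord_recr /= lerD2l lerN2.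
  have /andP[p0 _] := p01 k x; have [_ /(_ x)/andP[c0 _] _] := chiP k.
  by rewrite ler_piMr // gerBl.
- move=> x Ux; have [i ci] := chi1 x Ux; exists i.+1 => k ik.
  by rewrite /f (bigD1 (Ordinal ik)) //= ci subrr mul0r subr0.
- move=> k x nU; rewrite /f big1 ?subrr // => i _.
  by have [_ _ ->] := chiP i; rewrite ?subr0.
Qed.

Hypothesis X_compact : compact [set: X].

Lemma finite_bumps (Q : X -> (X -> R) -> Prop) :
  (forall x, exists b, [/\ \forall y \near x, b y = 1 & Q x b]) ->
  exists l : seq (X -> R), (forall k, (k < size l)%N -> exists x, Q x (nth (fun=> 0) l k))
    /\ forall y, exists2 k, (k < size l)%N & nth (fun=> 0) l k y = 1.
Proof.
move=> H; pose b x := projT1 (cid (H x)).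
have hb x : (\forall y \near x, b x y = 1) /\ Q x (b x).
  by rewrite /b; case: (cid _) => ? [].
have := X_compact; rewrite compact_cover => /(_ X setT
  (fun x => interior [set y | b x y = 1])) [].
- by move=> x _; exact: open_interior.
- by move=> x _; exists x => //; exact: (hb x).1.
move=> D _ cD; exists [seq b x | x <- finmap.enum_fset D]; split.
  move=> k; rewrite size_map => hk; exists (nth point (finmap.enum_fset D) k).
  by rewrite (nth_map point) //; exact: (hb _).2.
move=> y; have [x xD hx] := cD y I; have hk : (index x (finmap.enum_fset D) < size (finmap.enum_fset D))%N.
  by rewrite index_mem.
exists (index x (finmap.enum_fset D)); first by rewrite size_map.
by rewrite (nth_map point) // nth_index //; exact: interior_subset hx.
Qed.

End SmoothFunctions.

(** * Borel measures and functionals of order 0 *)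

Section BoundedIntegral.
Context d (T : measurableType d) (R : realType).
Variable mu : {finite_measure set T -> \bar R}.
Implicit Types f g : T -> R.

Definition bmeas f := measurable_fun setT f /\ exists B, forall x, `|f x| <= B.

Lemma bmeas_cst (k : R) : bmeas (fun=> k).
Proof. by split; [exact: measurable_cst|exists `|k|]. Qed.

Lemma bmeasD f g : bmeas f -> bmeas g -> bmeas (fun x => f x + g x).
Proof.
move=> [mf [B hB]] [mg [C hC]]; split; first exact: measurable_funD.
by exists (B + C) => x; rewrite (le_trans (ler_normD _ _)) // lerD.
Qed.

Lemma bmeasM f g : bmeas f -> bmeas g -> bmeas (fun x => f x * g x).
Proof.
move=> [mf [B hB]] [mg [C hC]]; split; first exact: measurable_funM.
by exists (B * C) => x; rewrite normrM ler_pM.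
Qed.

Lemma bmeasZ (k : R) f : bmeas f -> bmeas (fun x => k * f x).
Proof. by move=> bf; apply: bmeasM => //; exact: bmeas_cst. Qed.

Lemma bmeas_indic (A : set T) : measurable A -> bmeas (\1_A : T -> R).
Proof.
move=> mA; split; first exact: measurable_indic.
by exists 1 => x; rewrite indicE; case: (_ \in _); rewrite ?normr1 ?normr0.
Qed.

Lemma bmeas_integrable f : bmeas f -> mu.-integrable setT (EFin \o f).
Proof.
move=> [mf [B hB]]; apply: measurable_bounded_integrable => //.
  by apply: fin_num_fun_lty; exact: fin_num_measure.
exists B; split; first exact: num_real.
by move=> M BM x _; exact: le_trans (hB x) (ltW BM).
Qed.

Lemma RintD f g : bmeas f -> bmeas g ->
  \int[mu]_(x in setT) (f x + g x) = \int[mu]_(x in setT) f x + \int[mu]_(x in setT) g x.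
Proof. by move=> bf bg; apply: RintegralD => //; exact: bmeas_integrable. Qed.

Lemma RintZ (k : R) f : bmeas f ->
  \int[mu]_(x in setT) (k * f x) = k * \int[mu]_(x in setT) f x.
Proof. by move=> bf; apply: RintegralZl => //; exact: bmeas_integrable. Qed.

Lemma Rint_cst (k : R) : \int[mu]_(x in setT) k = k * fine (mu setT).
Proof. by rewrite Rintegral_cst. Qed.

Lemma Rint_ge0 f : (forall x, 0 <= f x) -> 0 <= \int[mu]_(x in setT) f x.
Proof. by move=> f0; apply: Rintegral_ge0. Qed.

Lemma Rint_le f g : bmeas f -> bmeas g -> (forall x, f x <= g x) ->
  \int[mu]_(x in setT) f x <= \int[mu]_(x in setT) g x.
Proof.
move=> bf bg fg; rewrite -subr_ge0 -mulN1r -RintZ // -RintD //; last exact: bmeasZ.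
by apply: Rint_ge0 => x; rewrite mulN1r subr_ge0.
Qed.

Lemma Rint_indic (A : set T) : measurable A ->
  \int[mu]_(x in setT) (\1_A x : R) = fine (mu A).
Proof.
by move=> mA; rewrite /Rintegral integral_indic // setIT.
Qed.

Lemma Rint_sum (I : Type) (r : seq I) (F : I -> T -> R) : (forall i, bmeas (F i)) ->
  bmeas (fun x => \sum_(i <- r) F i x) /\
  \int[mu]_(x in setT) (\sum_(i <- r) F i x) = \sum_(i <- r) \int[mu]_(x in setT) F i x.
Proof.
move=> bF; elim: r => [|i r [IHb IHi]].
  rewrite big_nil; under eq_fun do rewrite big_nil; split; first exact: bmeas_cst.
  by rewrite Rint_cst mul0r.
rewrite big_cons; under eq_fun do rewrite big_cons.
by split; [exact: bmeasD|rewrite RintD // IHi].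
Qed.

Lemma bmeas_cvg (F : nat -> T -> R) f (B : R) : (forall k, measurable_fun setT (F k)) ->
  (forall k x, `|F k x| <= B) -> (forall x, F k x @[k --> \oo] --> f x) -> bmeas f.
Proof.
move=> mF hB cF.
have mf : measurable_fun setT f.
  by apply: (measurable_fun_cvg (h := F)) => // x _; exact: cF.
split=> //; exists B => x; apply: (@closed_cvg _ _ _ _ (F ^~ x) (fun y : R => `|y| <= B) _ _ _ (cF x)).
  have -> : (fun y : R => is_true (`|y| <= B)) = closed_ball_ Num.norm 0 B.
    by apply/funext => y; rewrite /closed_ball_ /= sub0r normrN.
  exact: closed_closed_ball_.
by apply: nearW => k; exact: hB.
Qed.

Lemma Rint_cvg (F : nat -> T -> R) f (B : R) : (forall k, measurable_fun setT (F k)) ->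
  (forall k x, `|F k x| <= B) -> (forall x, F k x @[k --> \oo] --> f x) ->
  \int[mu]_(x in setT) F k x @[k --> \oo] --> \int[mu]_(x in setT) f x.
Proof.
move=> mF hB cF; have bf := bmeas_cvg mF hB cF.
have mf := bf.1.
have [_ _ h] : [/\ mu.-integrable setT (EFin \o f), True &
    (\int[mu]_(x in setT) (F k x)%:E)%E @[k --> \oo] --> (\int[mu]_(x in setT) (f x)%:E)%E].
  suff [h1 _ h2] : [/\ mu.-integrable setT (EFin \o f),
      [sequence (\int[mu]_x `|(F k x)%:E - (f x)%:E|)%E]_k @ \oo --> 0%E &
      (\int[mu]_(x in setT) (F k x)%:E)%E @[k --> \oo] --> (\int[mu]_(x in setT) (f x)%:E)%E].
    by split.
  apply: (dominated_convergence measurableT (g := fun=> B%:E)).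
  - by move=> k; apply/measurable_EFinP; exact: mF.
  - exact/measurable_EFinP.
  - by apply: aeW => x _; apply: cvg_EFin; [exact: nearW|exact: cF].
  - exact: (bmeas_integrable (bmeas_cst B)).
  - by apply: aeW => x k _; rewrite lee_fin.
have := bmeas_integrable bf => /integrable_fin_num -/(_ measurableT) fin.
move: h; rewrite -(fineK fin) => /fine_cvgP[_]; exact.
Unshelve. all: by end_near. Qed.
End BoundedIntegral.

Lemma pick_fun (A B : Type) (P : A -> B -> Prop) :
  (forall x, exists y, P x y) -> exists f : A -> B, forall x, P x (f x).
Proof.
by move=> H; exists (fun x => projT1 (cid (H x))) => x; case: cid.
Qed.

(** * Riesz representation on a compact manifold, after Daniell *)

Section Riesz.
Variables (R : realType) (n : nat) (X : complexManifold R n).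
Hypothesis X_compact : compact [set: X].
Implicit Types (f g h : X -> R) (x : X) (L : (X -> R) -> R).
Local Notation Borel := (g_sigma_algebraType (@open X)).

Lemma finite_cover (W : X -> set X) : (forall x, open (W x) /\ W x x) ->
  exists l : seq X, forall y, exists2 x, x \in l & W x y.
Proof.
move=> H; have := X_compact; rewrite compact_cover => /(_ X setT W) [].
- by move=> x _; exact: (H x).1.
- by move=> x _; exists x => //; exact: (H x).2.
move=> D _ cD; exists (finmap.enum_fset D) => y.
by have [x xD hx] := cD y I; exists x.
Qed.

Definition posfun L := [/\ forall f g, smooth_fun f -> smooth_fun g ->
    L (fun x => f x + g x) = L f + L g,
  forall k f, smooth_fun f -> L (fun x => k * f x) = k * L f
  & forall f, smooth_fun f -> (forall x, 0 <= f x) -> 0 <= L f].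

Lemma posfunD L f g : posfun L -> smooth_fun f -> smooth_fun g ->
  L (fun x => f x + g x) = L f + L g.
Proof. by move=> [h _ _]; exact: h. Qed.

Lemma posfunZ L k f : posfun L -> smooth_fun f -> L (fun x => k * f x) = k * L f.
Proof. by move=> [_ h _]; exact: h. Qed.

Lemma posfun_ge0 L f : posfun L -> smooth_fun f -> (forall x, 0 <= f x) -> 0 <= L f.
Proof. by move=> [_ _ h]; exact: h. Qed.

Lemma posfunB L f g : posfun L -> smooth_fun f -> smooth_fun g ->
  L (fun x => f x - g x) = L f - L g.
Proof.
move=> HL sf sg; have -> : (fun x => f x - g x) = fun x => f x + (-1) * g x.
  by apply/funext => x; rewrite mulN1r.
by rewrite posfunD ?posfunZ ?mulN1r //; exact: sfunZ.
Qed.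

Lemma posfun_le L f g : posfun L -> smooth_fun f -> smooth_fun g ->
  (forall x, f x <= g x) -> L f <= L g.
Proof.
move=> HL sf sg fg; rewrite -subr_ge0 -posfunB //; apply: posfun_ge0 => //.
  exact: sfunB.
by move=> x; rewrite subr_ge0.
Qed.

Lemma posfun_cst L k : posfun L -> L (fun=> k) = k * L (fun=> 1).
Proof.
move=> HL; rewrite -(posfunZ k HL (@sfun_cst R n X 1)); congr (L _).
by apply/funext => x; rewrite mulr1.
Qed.

Lemma posfun_sum L (N : nat) (F : nat -> X -> R) : posfun L -> (forall i, smooth_fun (F i)) ->
  smooth_fun (fun x => \sum_(i < N) F i x) /\
  L (fun x => \sum_(i < N) F i x) = \sum_(i < N) L (F i).
Proof.
move=> HL sF; elim: N => [|N [IHs IHL]].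
  rewrite big_ord0; under eq_fun do rewrite big_ord0.
  by split; [exact: sfun_cst|rewrite posfun_cst // mul0r].
rewrite big_ord_recr; under eq_fun do rewrite big_ord_recr.
by split; [exact: sfunD|rewrite posfunD //= IHL].
Qed.

Lemma open_ray (a : R) f : smooth_fun f -> open [set x | a < f x].
Proof.
move=> sf; have -> : [set x | a < f x] = f @^-1` [set t | a < t] by [].
by apply: open_comp; [move=> x _; exact: sfun_continuous|exact: open_gt].
Qed.

Section Outer.
Variable L : (X -> R) -> R.
Hypothesis HL : posfun L.

(* Daniell's upper integral of h is at most M. *)
Definition upper h (M : R) := exists G : nat -> X -> R,
  [/\ forall k, smooth_fun (G k), forall k x, 0 <= G k x,
      forall k x, G k x <= G k.+1 x,
      forall x a, a < h x -> exists k, a < G k x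
    & forall k, L (G k) <= M].

Lemma incr_le (G : nat -> X -> R) : (forall k x, G k x <= G k.+1 x) ->
  forall k l x, (k <= l)%N -> G k x <= G l x.
Proof.
move=> h k l x; elim: l => [|l IH]; first by rewrite leqn0 => /eqP ->.
rewrite leq_eqVlt => /predU1P[->//|]; rewrite ltnS => /IH kl.
exact: le_trans kl (h _ _).
Qed.

Lemma upper_ge0 h M : upper h M -> 0 <= M.
Proof.
by move=> [G [sG G0 _ _ GM]]; apply: le_trans (GM 0%N); exact: posfun_ge0.
Qed.

Lemma upper_le h h' M : (forall x, h x <= h' x) -> upper h' M -> upper h M.
Proof.
move=> hh [G [sG G0 Gi Gh GM]]; exists G; split=> // x a ah.
by apply: Gh; exact: lt_le_trans ah (hh x).
Qed.

Lemma upper_smooth f : smooth_fun f -> (forall x, 0 <= f x) -> upper f (L f).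
Proof. by move=> sf f0; exists (fun=> f); split=> // x a af; exists 0%N. Qed.

(** Countable subadditivity of the upper integral, in a form that avoids infinite sums of functions:
    the partial sums of the [H k] are only required to exceed every number below [h]. *)
Lemma upper_series h (H : nat -> X -> R) (A : nat -> R) M :
  (forall x a, a < h x -> exists K, a < \sum_(k < K) H k x) ->
  (forall k, upper (H k) (A k)) -> (forall K, \sum_(k < K) A k <= M) -> upper h M.
Proof.
move=> hH uH hM; pose G k := projT1 (cid (uH k)).
have hG k : [/\ forall i, smooth_fun (G k i), forall i x, 0 <= G k i x,
      forall i x, G k i x <= G k i.+1 x,
      forall x a, a < H k x -> exists i, a < G k i x
    & forall i, L (G k i) <= A k] by rewrite /G; case: cid.
have sG k i : smooth_fun (G k i) by have [] := hG k.
have G0 k i x : 0 <= G k i x by have [] := hG k.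
have Gi k := incr_le (let: And5 _ _ h _ _ := hG k in h).
(* Diagonal choice: the N-th approximants of the first N terms. It is increasing in N because the
   added term is nonnegative. *)
exists (fun N x => \sum_(k < N) G k N x); split.
- by move=> N; exact: (posfun_sum N HL (fun k => sG k N)).1.
- by move=> N x; apply: sumr_ge0.
- move=> N x; rewrite big_ord_recr /=; apply: ler_wpDr => //.
  by apply: ler_sum => k _; exact: Gi.
- move=> x a /hH[K]; have : exists2 N, (K <= N)%N &
      forall a, a < \sum_(k < K) H k x -> exists2 N, (K <= N)%N & a < \sum_(k < K) G k N x.
    exists K => // {}a; elim: K a => [|K IH] a.
      by rewrite !big_ord0; exists 0%N; rewrite // big_ord0.
    rewrite big_ord_recr /= => aS; pose e := (\sum_(k < K) H k x + H K x - a) / 2.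
    have [|N1 KN1 h1] := IH (a - H K x + e); first by rewrite /e; lra.
    have [_ _ _ /(_ x (H K x - e)) + _] := hG K; case; first by rewrite /e; lra.
    move=> N2 h2; exists (maxn K.+1 (maxn N1 N2)); first exact: leq_maxl.
    set N := maxn _ _; have N1N : (N1 <= N)%N by rewrite /N !leq_max leqnn orbT.
    have N2N : (N2 <= N)%N by rewrite /N !leq_max leqnn !orbT.
    rewrite big_ord_recr /=; have := Gi K _ _ x N2N.
    have : \sum_(k < K) G k N1 x <= \sum_(k < K) G k N x by apply: ler_sum => k _; exact: Gi.
    lra.
  move=> [_ _ IH] /IH[N KN aN]; exists N; apply: lt_le_trans aN _.
  by rewrite -(subnKC KN) big_split_ord /= lerDl sumr_ge0.
- move=> N; rewrite (posfun_sum N HL (fun k => sG k N)).2; apply: le_trans (hM N).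
  by apply: ler_sum => k _; have [_ _ _ _] := hG k.
Qed.

(* Dini's argument. *)
Lemma upper_smooth_le f M : smooth_fun f -> upper f M -> L f <= M.
Proof.
move=> sf [G [sG G0 Gi Gf GM]]; apply/ler_addgt0Pr => e e0.
have L1 : 0 <= L (fun=> 1) by apply: posfun_ge0 => //; exact: sfun_cst.
(* A uniform loss [d] costs d * L 1, which is at most [e]. *)
pose d := e / (L (fun=> 1) + 1); have d0 : 0 < d by rewrite divr_gt0 // ltr_wpDl.
have [k hk] : exists k : X -> nat, forall x, f x - d < G (k x) x.
  apply: (@pick_fun _ _ (fun x k => f x - d < G k x)) => x; apply: Gf; by rewrite gtrBl.
have [|l hl] := @finite_cover (fun x => [set y | 0 < G (k x) y - f y + d]).
  move=> x; split; last by have := hk x; rewrite /=; lra.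
  apply: open_ray; apply: sfunD; last exact: sfun_cst.
  exact: sfunB.
pose K := \max_(x <- l) k x.
have fG y : f y <= G K y + d.
  have [x xl] := hl y; have kK : (k x <= K)%N by exact: leq_bigmax_seq.
  by have := incr_le Gi y kK; rewrite /=; lra.
have := posfun_le HL sf (sfunD (sG K) (@sfun_cst R n X d)) fG.
rewrite (posfunD HL (sG K) (@sfun_cst R n X d)) (posfun_cst d HL).
move=> /le_trans; apply; apply: lerD => //; rewrite /d -mulrA ler_piMr ?(ltW e0) //.
by rewrite mulrC ler_pdivrMr ?ltr_wpDl // mul1r lerDl.
Qed.

Definition riesz_outer of posfun L := fun A : set X =>
  ereal_inf [set M%:E | M in upper \1_A].

Local Notation mu := (riesz_outer HL).

Lemma riesz_outer_le A M : upper \1_A M -> (mu A <= M%:E)%E.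
Proof. by move=> uM; apply: ereal_inf_lbound; exists M. Qed.

Lemma riesz_outer_ge0 A : (0 <= mu A)%E.
Proof.
by apply: le_ereal_inf_tmp => _ [M uM <-]; rewrite lee_fin; exact: upper_ge0 uM.
Qed.

Lemma upper_indic A : upper \1_A (L (fun=> 1)).
Proof.
apply: (@upper_le _ (fun=> 1)); first by move=> x; rewrite indicE; case: (_ \in _).
by apply: upper_smooth => //; exact: sfun_cst.
Qed.

Lemma riesz_outer_fin A : mu A \is a fin_num.
Proof.
rewrite ge0_fin_numE ?riesz_outer_ge0 //.
by apply: le_lt_trans (riesz_outer_le (upper_indic A)) _; exact: ltry.
Qed.

Lemma riesz_outer_lt A (e : R) : 0 < e -> exists M, upper \1_A M /\ (M%:E <= mu A + e%:E)%E.
Proof.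
move=> e0; have [_ [M uM <-] h] := lb_ereal_inf_adherent e0 (riesz_outer_fin A).
by exists M; split=> //; exact: ltW.
Qed.

Lemma riesz_outer0 : mu set0 = 0%E.
Proof.
apply/eqP; rewrite eq_le riesz_outer_ge0 andbT; apply: riesz_outer_le.
apply: (@upper_le _ (fun=> 0)); first by move=> x; rewrite indic0.
exists (fun=> fun=> 0); split=> //.
  by move=> k; exact: sfun_cst.
by move=> k; rewrite posfun_cst // mul0r.
Qed.

Lemma le_riesz_outer : {homo mu : A B / A `<=` B >-> (A <= B)%E}.
Proof.
move=> A B AB; apply: le_ereal_inf_tmp => _ [M uM <-]; apply: riesz_outer_le.
apply: upper_le uM => x; rewrite !indicE.
by case: (boolP (x \in A)) => // /set_mem/AB/mem_set ->.
Qed.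

Lemma riesz_outer_subadditive : sigma_subadditive mu.
Proof.
move=> F; apply/lee_addgt0Pr => e e0.
apply: le_trans (epsilon_trick _ (fun k => riesz_outer_ge0 (F k)) (ltW e0)).
have [A hA] : exists A : nat -> R, forall k, upper \1_(F k) (A k) /\
    ((A k)%:E <= mu (F k) + (e / (2 ^ k.+1)%:R)%:E)%E.
  apply: (@pick_fun _ _ (fun k M => upper \1_(F k) M /\ (M%:E <= mu (F k) + (e / (2 ^ k.+1)%:R)%:E)%E)) => k; apply: riesz_outer_lt; by rewrite divr_gt0 // ltr0n expn_gt0.
have pos k : (0 <= mu (F k) + (e / (2 ^ k.+1)%:R)%:E)%E.
  by rewrite adde_ge0 ?riesz_outer_ge0 // lee_fin divr_ge0 ?ltW // ltr0n expn_gt0.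
have [foo|] := boolP ((\sum_(0 <= k <oo) (mu (F k) + (e / (2 ^ k.+1)%:R)%:E))%E \is a fin_num); last first.
  rewrite ge0_fin_numE ?nneseries_ge0 // ltey negbK => /eqP ->; exact: leey.
rewrite -(fineK foo); apply: riesz_outer_le.
apply: (upper_series (H := fun k => \1_(F k)) (A := A)).
- move=> x a; rewrite indicE; case: (boolP (x \in _)) => [/set_mem[k _ Fx]|_] ha.
    exists k.+1; rewrite big_ord_recr /= indicE mem_set //.
    by apply: lt_le_trans ha _; rewrite lerDr sumr_ge0.
  by exists 0%N; rewrite big_ord0.
- by move=> k; exact: (hA k).1.
- move=> K; rewrite -lee_fin fineK // -sumEFin -(big_mkord xpredT (fun k => (A k)%:E)).
  apply: le_trans (nneseries_lim_ge K (P := xpredT) (m := 0%N) (fun k _ _ => pos k)).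
  by apply: lee_sum => k _; exact: (hA k).2.
Qed.

HB.instance Definition _ := isOuterMeasure.Build R X mu riesz_outer0
  riesz_outer_ge0 le_riesz_outer riesz_outer_subadditive.

(** Let G_k increase above the indicator of A, with L G_k <= M, and let f_k increase to that of U.
    Then G_k f_k serves for A inside U, while for fixed m the functions G_(m+k) - G_m f_m serve for
    A outside U. The two upper bounds add up to M. *)
Lemma open_caratheodory (U : set X) : open U -> mu.-caratheodory U.
Proof.
move=> oU; apply: le_caratheodory_measurable => A.
have [f [sf f01 fi f1 f0]] := approx_open oU.
apply: le_ereal_inf_tmp => _ [M [G [sG G0 Gi GA GM]] <-].
have cut m : upper \1_(A `&` ~` U) (M - L (fun x => G m x * f m x)).
  exists (fun k x => G (m + k)%N x - G m x * f m x); split.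
  - by move=> k; apply: sfunB => //; exact: sfunM.
  - move=> k x; rewrite subr_ge0; apply: le_trans (incr_le Gi x (leq_addr k m)).
    by rewrite ler_piMr //; have /andP[] := f01 m x.
  - by move=> k x; rewrite addnS lerD2r.
  - move=> x a; rewrite indicE; case: (boolP (x \in _)) => [/set_mem[Ax nU] a1|_ a0].
      have [|k hk] := GA x a; first by rewrite indicE mem_set.
      exists k; rewrite f0 // mulr0 subr0; apply: lt_le_trans hk _.
      exact: (incr_le Gi x (leq_addl m k)).
    exists 0%N; rewrite addn0; apply: lt_le_trans a0 _; rewrite subr_ge0.
    by rewrite ler_piMr //; have /andP[] := f01 m x.
  by move=> k; rewrite posfunB // ?lerD2r //; exact: sfunM.
change (mu (A `&` U) + mu (A `&` ~` U) <= M%:E)%E.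
rewrite -(fineK (riesz_outer_fin (A `&` ~` U))).
rewrite -leeBrDr // -EFinB; apply: riesz_outer_le.
exists (fun k x => G k x * f k x); split.
- by move=> k; exact: sfunM.
- by move=> k x; rewrite mulr_ge0 //; have /andP[] := f01 k x.
- by move=> k x; apply: ler_pM => //; have /andP[] := f01 k x.
- move=> x a; rewrite indicE; case: (boolP (x \in _)) => [/set_mem[Ax Ux] a1|_ a0].
    have [|k hk] := GA x a; first by rewrite indicE mem_set.
    have [N hN] := f1 x Ux; exists (maxn k N); rewrite hN ?leq_maxr // mulr1.
    by apply: lt_le_trans hk _; exact: (incr_le Gi x (leq_maxl k N)).
  by exists 0%N; apply: lt_le_trans a0 _; rewrite mulr_ge0 //; have /andP[] := f01 0%N x.
move=> k; rewrite lerBrDr addrC -lerBrDr -lee_fin fineK ?riesz_outer_fin //.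
exact: riesz_outer_le.
Qed.

Definition riesz_measure : set Borel -> \bar R := mu.

Lemma borel_caratheodory (A : set Borel) : measurable A -> mu.-caratheodory A.
Proof.
have h : sigma_algebra setT mu.-caratheodory.
  split; first exact: caratheodory_measurable_set0.
    by move=> B cB; rewrite setTD; exact: caratheodory_measurable_setC.
  by move=> F cF; exact: caratheodory_measurable_bigcup.
by apply: (smallest_sub h); exact: open_caratheodory.
Qed.

Lemma riesz_measure_additive : semi_sigma_additive riesz_measure.
Proof.
move=> F mF tF mUF; apply: (@caratheodory_measure_sigma_additive _ _
  (riesz_outer HL : {outer_measure set X -> \bar R})) => //.
- by move=> k; exact: borel_caratheodory.
- exact: borel_caratheodory.
Qed.

HB.instance Definition _ := isMeasure.Build _ Borel R riesz_measure
  riesz_outer0 riesz_outer_ge0 riesz_measure_additive.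

Lemma riesz_measure_finite : fin_num_fun riesz_measure.
Proof. by move=> A _; exact: riesz_outer_fin. Qed.

HB.instance Definition _ := @Measure_isFinite.Build _ Borel R riesz_measure
  riesz_measure_finite.

End Outer.

Lemma open_borel (U : set X) : open U -> measurable (U : set Borel).
Proof. by move=> oU; exact: sub_sigma_algebra. Qed.

Lemma closed_borel (U : set X) : closed U -> measurable (U : set Borel).
Proof.
by move=> /closed_openC/open_borel/measurableC; rewrite setCK.
Qed.

Lemma rays_measurable d (T : measurableType d) (f : T -> R) :
  (forall a : R, measurable [set x | a < f x]) -> measurable_fun setT f.
Proof.
move=> H; apply: (measurability (@RGenOInfty.G R)).
  exact: RGenOInfty.measurableE.
move=> _ [_ [a ->] <-]; rewrite setTI.
have -> : f @^-1` `]a, +oo[ = [set x | a < f x] by apply/seteqP; split => x /=;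
  rewrite in_itv /= andbT.
exact: H.
Qed.

Lemma smooth_bmeas f : smooth_fun f -> bmeas (f : Borel -> R).
Proof.
move=> sf; split.
  by apply: rays_measurable => a; apply: open_borel; exact: open_ray.
have [|l hl] := @finite_cover (fun x => [set y | 0 < `|f x| + 1 - f y] `&` [set y | 0 < `|f x| + 1 + f y]).
  move=> x; split.
    apply: openI; apply: open_ray; [apply: sfunB|apply: sfunD] => //; exact: sfun_cst.
  by split => /=; [have := ler_norm (f x)|have := ler_norm (- f x); rewrite normrN]; lra.
exists (\sum_(x <- l) (`|f x| + 1)) => y; have [x xl [h1 h2]] := hl y.
apply: (@le_trans _ _ (`|f x| + 1)).
  by rewrite ler_norml; move: h1 h2 => /=; lra.
by rewrite (big_rem x) //= lerDl sumr_ge0.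
Qed.

(** The sum counts the positive integers below [t]. Scaled by a step size, it gives the layer-cake
    approximation of a bounded function from below. *)
Lemma steps_bound (N : nat) (t : R) : 0 <= t -> t <= N%:R ->
  t - 1 <= \sum_(j < N) (if j.+1%:R < t then 1 else 0) <= t.
Proof.
elim: N t => [|N IH] t t0 tN; first by rewrite big_ord0; lra.
have [tN'|tN'] := leP t N%:R.
  rewrite big_ord_recr /=; have -> : N.+1%:R < t = false.
    by apply/negbTE; rewrite -leNgt -natr1; lra.
  by rewrite addr0; exact: IH.
have h (j : 'I_N) : j.+1%:R < t.
  by apply: le_lt_trans tN'; rewrite ler_nat.
rewrite big_ord_recr /= (eq_bigr (fun=> 1)); last by move=> j _; rewrite h.
rewrite sumr_const card_ord; move: tN; rewrite -natr1 => tN.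
have -> : (N%:R + 1 < t) = false by apply/negbTE; rewrite -leNgt.
by rewrite addr0; lra.
Qed.

Section Representation.
Variable L : (X -> R) -> R.
Hypothesis HL : posfun L.

Let mu : {finite_measure set Borel -> \bar R} := riesz_measure HL.

Lemma upperD h h' M M' : upper L h M -> upper L h' M' ->
  upper L (fun x => h x + h' x) (M + M').
Proof.
move=> [G [sG G0 Gi Gh GM]] [G' [sG' G0' Gi' Gh' GM']].
exists (fun k x => G k x + G' k x); split.
- by move=> k; exact: sfunD.
- by move=> k x; rewrite addr_ge0.
- by move=> k x; rewrite lerD.
- move=> x a hh; pose e := (h x + h' x - a) / 2.
  have [|k hk] := Gh x (h x - e); first by rewrite /e; lra.
  have [|k' hk'] := Gh' x (h' x - e); first by rewrite /e; lra.
  exists (maxn k k'); have := incr_le Gi x (leq_maxl k k').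
  have := incr_le Gi' x (leq_maxr k k'); move: hk hk'; rewrite /e; lra.
by move=> k; rewrite posfunD // lerD.
Qed.

Lemma upperZ (d : R) h M : 0 < d -> upper L h M -> upper L (fun x => d * h x) (d * M).
Proof.
move=> d0 [G [sG G0 Gi Gh GM]]; exists (fun k x => d * G k x); split.
- by move=> k; exact: sfunZ.
- by move=> k x; rewrite mulr_ge0 // ltW.
- by move=> k x; rewrite ler_pM2l.
- move=> x a; rewrite mulrC -ltr_pdivrMr // => /Gh[k hk]; exists k.
  by rewrite mulrC -ltr_pdivrMr.
by move=> k; rewrite posfunZ // ler_pM2l.
Qed.

(** Layer cake: [f] is at most [d] plus [d] times the sum of the indicators of its superlevel sets
    at multiples of [d]. The upper integral of the right side dominates L f by Dini's argument, and
    the weighted sum of the measures of the level sets is at most the integral. *)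
Lemma riesz_le f : smooth_fun f -> (forall x, 0 <= f x) ->
  L f <= \int[mu]_(x in setT) f x.
Proof.
move=> sf f0; apply/ler_addgt0Pr => e e0.
have [mf [B hB]] := smooth_bmeas sf.
have L1 : 0 <= L (fun=> 1) by apply: posfun_ge0 => //; exact: sfun_cst.
(* The error has two parts, d * L 1 from the constant [d] and [d] from the level sets; together they
   are [e]. *)
pose d := e / (L (fun=> 1) + 1); have d0 : 0 < d by rewrite divr_gt0 // ltr_wpDl.
have dL : d * L (fun=> 1) + d = e.
  by rewrite -[X in _ + X]mulr1 -mulrDr /d divfK // gt_eqF // ltr_wpDl.
pose N := (Num.truncn (B / d)).+1.
have fN x : f x / d <= N%:R.
  apply: (@le_trans _ _ (B / d)); last exact/ltW/truncnS_gt.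
  by rewrite ler_pM2r ?invr_gt0 // (le_trans (ler_norm _)).
pose U (j : nat) : set X := [set x | j.+1%:R < f x / d].
have U1 j x : (if j.+1%:R < f x / d then 1 else 0) = \1_(U j) x :> R.
  by rewrite indicE; case: ifPn => h; [rewrite mem_set|rewrite memNset //; apply/negP].
have mU j : measurable (U j : set Borel).
  apply: open_borel; have -> : U j = [set x | j.+1%:R * d < f x].
    by apply/seteqP; split => x; rewrite /U /= ltr_pdivlMr.
  exact: open_ray.
(* Each of the N upper integrals is taken with precision 1/(N+1), so that after multiplication by
   [d] the total error is at most [d]. *)
have e'0 : 0 < (N.+1%:R)^-1 :> R by rewrite invr_gt0.
have [A hA] := pick_fun (fun j => riesz_outer_lt HL (U j) e'0).
have up K : upper L (fun x => d + \sum_(j < K) d * \1_(U j) x)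
    (d * L (fun=> 1) + \sum_(j < K) d * A j).
  elim: K => [|K IH]; last first.
    have := upperD IH (upperZ d0 (hA K).1).
    rewrite big_ord_recr /= addrA; apply: upper_le => x.
    by rewrite big_ord_recr /= addrA.
  rewrite big_ord0 addr0 -posfun_cst //.
  apply: upper_le (@upper_smooth L (fun=> d) _ _) => [x||x].
  - by rewrite big_ord0 addr0.
  - exact: sfun_cst.
  - exact: ltW.
have := upper_smooth_le HL sf.
move/(_ (d * L (fun=> 1) + \sum_(j < N) d * A j)); move=> h.
apply: le_trans (h _) _.
  apply: upper_le (up N) => x; rewrite -mulr_sumr.
  have /andP[+ _] := steps_bound (divr_ge0 (f0 x) (ltW d0)) (fN x).
  under eq_bigr do rewrite U1.
  rewrite lerBlDr ler_pdivrMr // mulrDl mul1r => h'.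
  by rewrite addrC mulrC.
have bI j : bmeas (fun x : Borel => d * \1_(U j) x) by apply: bmeasZ; exact: bmeas_indic.
have [bS iS] := Rint_sum mu (enum 'I_N) bI.
have hAj j : A j <= fine (mu (U j)) + N.+1%:R^-1.
  rewrite -lee_fin EFinD fineK; first exact: (hA j).2.
  exact: riesz_outer_fin.
have S1 : \sum_(j < N) d * A j <= \sum_(j < N) d * fine (mu (U j)) + d.
  apply: (@le_trans _ _ (\sum_(j < N) (d * fine (mu (U j)) + d * N.+1%:R^-1))).
    by apply: ler_sum => j _; rewrite -mulrDr ler_pM2l.
  rewrite big_split /= lerD2l sumr_const card_ord -mulrnAr ler_piMr ?(ltW d0) //.
  by rewrite -[X in X *+ _]mul1r -mulrnAl ler_pdivrMr // mul1r ler_nat.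
have S2 : \sum_(j < N) d * fine (mu (U j)) <= \int[mu]_(x in setT) f x.
  have -> : \sum_(j < N) d * fine (mu (U j)) =
      \int[mu]_(x in setT) (\sum_(j < N) d * \1_(U j) x).
    rewrite -big_enum /=; under eq_Rintegral do rewrite -big_enum /=.
    rewrite (Rint_sum mu (enum 'I_N) (fun j : 'I_N => bI j)).2.
    apply: eq_bigr => j _; rewrite RintZ; last exact: bmeas_indic.
    by rewrite Rint_indic.
  apply: Rint_le => //.
  - have := (Rint_sum mu (enum 'I_N) (fun j : 'I_N => bI j)).1.
    by under eq_fun do rewrite big_enum /=.
  - exact: smooth_bmeas.
  move=> x; rewrite -mulr_sumr.
  have /andP[_ +] := steps_bound (divr_ge0 (f0 x) (ltW d0)) (fN x).
  by under eq_bigr do rewrite U1; rewrite ler_pdivlMr // mulrC.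
by move: S1 S2 dL; lra.
Qed.

Lemma riesz_total : fine (mu setT) = L (fun=> 1).
Proof.
apply/eqP; rewrite eq_le; apply/andP; split.
  rewrite -lee_fin fineK ?riesz_outer_fin //; apply: riesz_outer_le.
  exact: upper_indic.
have := riesz_le (@sfun_cst R n X 1) (fun=> ler01).
by rewrite Rint_cst mul1r.
Qed.

(** The inequality of [riesz_le] extends to functions of any sign by adding a constant, because the
    total mass equals L 1; applied to -f it gives the reverse inequality. *)
Lemma riesz_integral f : smooth_fun f -> L f = \int[mu]_(x in setT) f x.
Proof.
have H g : smooth_fun g -> L g <= \int[mu]_(x in setT) g x.
  move=> sg; have [mg [B hB]] := smooth_bmeas sg.
  have := @riesz_le (fun x => g x + B) (sfunD sg (@sfun_cst R n X B)).
  rewrite (posfunD HL sg (@sfun_cst R n X B)) (posfun_cst B HL).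
  rewrite RintD; [|exact: smooth_bmeas|exact: bmeas_cst].
  rewrite Rint_cst riesz_total lerD2r; apply=> x.
  by have := hB x; rewrite ler_norml; lra.
move=> sf; apply/eqP; rewrite eq_le H //=.
have := H _ (sfunZ (-1) sf); rewrite posfunZ // RintZ; last exact: smooth_bmeas.
by rewrite !mulN1r lerN2.
Qed.

End Representation.

Theorem riesz L : posfun L -> exists mu : {finite_measure set Borel -> \bar R},
  fine (mu setT) = L (fun=> 1) /\
  forall f, smooth_fun f -> L f = \int[mu]_(x in setT) f x.
Proof.
move=> HL; exists (riesz_measure HL); split; first exact: riesz_total.
exact: riesz_integral.
Qed.


(** Linearity and bounded convergence on bounded Borel functions: the properties of integration
    against a finite signed measure that determine it from its values on smooth functions. *)
Definition extfun (I : (X -> R) -> R) := [/\ forall f g, bmeas (f : Borel -> R) ->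
    bmeas (g : Borel -> R) -> I (fun x => f x + g x) = I f + I g,
  forall k f, bmeas (f : Borel -> R) -> I (fun x => k * f x) = k * I f
  & forall (F : nat -> X -> R) f (B : R),
      (forall k, measurable_fun setT (F k : Borel -> R)) ->
      (forall k x, `|F k x| <= B) -> (forall x, F k x @[k --> \oo] --> f x) ->
      I (F k) @[k --> \oo] --> I f].

Lemma bmeas_lim (F : nat -> X -> R) f (B : R) :
  (forall k, measurable_fun setT (F k : Borel -> R)) ->
  (forall k x, `|F k x| <= B) -> (forall x, F k x @[k --> \oo] --> f x) ->
  bmeas (f : Borel -> R).
Proof.
exact: bmeas_cvg.
Qed.

Lemma extfun_Rint (m : {finite_measure set Borel -> \bar R}) :
  extfun (fun g => \int[m]_(x in setT) g x).
Proof.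
split=> [f g bf bg|k f bf|F f B mF bF cF]; [exact: RintD|exact: RintZ|].
exact: (@Rint_cvg _ Borel R m F f B mF bF cF).
Qed.

Lemma extfun_comb a b I J : extfun I -> extfun J -> extfun (fun g => a * I g + b * J g).
Proof.
move=> [ID IZ IC] [JD JZ JC]; split=> [f g bf bg|k f bf|F f B mF bF cF].
- by rewrite ID // JD //; ring.
- by rewrite IZ // JZ //; ring.
- apply: cvgD; (apply: cvgM; first exact: cvg_cst); [exact: IC cF|exact: JC cF].
Qed.

Lemma extfun_eq I J : (forall g, bmeas (g : Borel -> R) -> I g = J g) ->
  extfun I -> extfun J.
Proof.
move=> e [ID IZ IC]; split=> [f g bf bg|k f bf|F f B mF bF cF].
- by rewrite -!e ?ID //; exact: bmeasD.
- by rewrite -!e ?IZ //; exact: bmeasZ.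
- have bf := bmeas_lim mF bF cF; rewrite -e //.
  have -> : (fun k => J (F k)) = fun k => I (F k).
    by apply/funext => k; rewrite e //; split=> //; exists B => x; exact: bF.
  exact: IC cF.
Qed.

Lemma extfun_mul I h : bmeas (h : Borel -> R) -> extfun I -> extfun (fun g => I (fun x => h x * g x)).
Proof.
move=> bh [ID IZ IC]; split=> [f g bf bg|k f bf|F f B mF bF cF].
- rewrite -ID; try exact: bmeasM.
  by congr I; apply/funext => x; rewrite mulrDr.
- rewrite -IZ; last exact: bmeasM.
  by congr I; apply/funext => x; rewrite mulrCA.
- have [mh [C hC]] := bh; apply: (IC (fun k x => h x * F k x) _ (C * B)).
  + by move=> k; exact: measurable_funM.
  + by move=> k x; rewrite normrM ler_pM.
  + by move=> x; apply: cvgM; [exact: cvg_cst|exact: cF].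
Qed.

Lemma extfun0 I : extfun I -> I (fun=> 0) = 0.
Proof.
move=> [_ IZ _]; have := IZ 0 _ (@bmeas_cst _ Borel R 0); rewrite mul0r => e.
by rewrite e mul0r.
Qed.

(** Bounded convergence passes from smooth functions to indicators of open sets through
    [approx_open]; Dynkin's theorem extends this to Borel sets. Step functions with step 1/(k+1)
    reach nonnegative bounded functions, and adding a constant the general case. *)
Lemma extfun_unique I : extfun I -> (forall f, smooth_fun f -> I f = 0) ->
  forall g, bmeas (g : Borel -> R) -> I g = 0.
Proof.
move=> eI H; have [ID IZ IC] := eI.
have lim0 (F : nat -> X -> R) f (B : R) : (forall k, measurable_fun setT (F k : Borel -> R)) ->
    (forall k x, `|F k x| <= B) -> (forall x, F k x @[k --> \oo] --> f x) ->
    (forall k, I (F k) = 0) -> I f = 0.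
  move=> mF bF cF IF; have := IC _ _ _ mF bF cF.
  have -> : (fun k => I (F k)) = fun=> 0 by apply/funext => k; exact: IF.
  by move=> /(cvg_lim (@Rhausdorff R)) <-; rewrite lim_cst.
have indicP (A : set X) : measurable (A : set Borel) -> I \1_A = 0.
  apply: (@dynkin_induction _ Borel (@open X) (fun A => I \1_A = 0)) => //.
  - by move=> U U'; exact: openI.
  - have -> : \1_setT = (fun=> 1) :> (X -> R) by apply/funext => x; rewrite indicT.
    by apply: H; exact: sfun_cst.
  - move=> U oU; have [f [sf f01 fi f1 f0]] := approx_open oU.
    apply: (lim0 f _ 1).
    + by move=> k; have [] := smooth_bmeas (sf k).
    + by move=> k x; have /andP[? ?] := f01 k x; rewrite ger0_norm.
    + move=> x; apply: cvg_near_cst; rewrite indicE; have [Ux|nU] := pselect (U x).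
        by have [N hN] := f1 x Ux; exists N => //= k Nk; rewrite mem_set // hN.
      by apply: nearW => k; rewrite f0 // memNset.
    + by move=> k; exact: H.
  - move=> C mC IC'; have -> : \1_(~` C) = (fun x => 1 + (-1) * \1_C x) :> (X -> R).
      by apply/funext => x; rewrite indicC indicE; case: (x \in C); rewrite /=; ring.
    have bC := bmeas_indic R mC.
    rewrite ID; [|exact: bmeas_cst|exact: bmeasZ].
    by rewrite IZ // IC' mulr0 addr0; apply: H; exact: sfun_cst.
  move=> F mF tF IF; pose G k : set X := \big[setU/set0]_(i < k) F i.
  have mG k : measurable (G k : set Borel) by apply: bigsetU_measurable.
  apply: (lim0 (fun k => \1_(G k)) _ 1).
  + by move=> k; exact: (bmeas_indic R (mG k)).1.
  + by move=> k x; rewrite indicE; case: (_ \in _); rewrite ?normr1 ?normr0.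
  + move=> x; apply: cvg_near_cst; rewrite [\1_(\bigcup_k _) x]indicE.
    have [[i _ Fi]|nF] := pselect ((\bigcup_k F k) x).
      exists i.+1 => //= k ik; rewrite indicE !mem_set //; first by exists i.
      by rewrite /G -bigcup_mkord; exists i.
    apply: nearW => k; rewrite indicE !memNset // /G -bigcup_mkord => -[i _ Fi].
    by apply: nF; exists i.
  elim=> [|k IH].
    by rewrite /G big_ord0 indic0; apply: H; exact: sfun_cst.
  have -> : \1_(G k.+1) = (fun x => \1_(G k) x + \1_(F k) x) :> (X -> R).
    apply/funext => x; rewrite /G big_ord_recr /= -/(G k) !indicE in_setU.
    have [Fx|nF] := pselect (F k x); last by rewrite (memNset nF) orbF addr0.
    rewrite (mem_set Fx) orbT memNset ?add0r // /G -bigcup_mkord => -[i /= ik Fi].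
    have e : i = k by apply: tF => //; exists x.
    by rewrite e ltnn in ik.
  by rewrite ID ?IH ?IF ?addr0 //; exact: (bmeas_indic R).
have pos g (B : R) : measurable_fun setT (g : Borel -> R) -> (forall x, 0 <= g x <= B) -> I g = 0.
  move=> mg gB; pose d (k : nat) : R := k.+1%:R^-1.
  have d0 k : 0 < d k by rewrite invr_gt0.
  pose N k := (Num.truncn (B / d k)).+1.
  have g0 k x : 0 <= g x / d k by apply: divr_ge0; [have /andP[] := gB x|exact: ltW].
  have gN k x : g x / d k <= (N k)%:R.
    apply: (@le_trans _ _ (B / d k)); last exact/ltW/truncnS_gt.
    by rewrite ler_pM2r ?invr_gt0 //; have /andP[] := gB x.
  pose U k (j : nat) : set X := [set x | j.+1%:R < g x / d k].
  have mU k j : measurable (U k j : set Borel).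
    have -> : U k j = g @^-1` `]j.+1%:R * d k, +oo[.
      by apply/seteqP; split => x; rewrite /U /= in_itv /= andbT ltr_pdivlMr.
    by rewrite -[_ @^-1` _]setTI; exact: mg.
  have U1 k j x : (if j.+1%:R < g x / d k then 1 else 0) = \1_(U k j) x :> R.
    by rewrite indicE; case: ifPn => h; [rewrite mem_set|rewrite memNset //; apply/negP].
  pose F k x := \sum_(j < N k) d k * \1_(U k j) x.
  have Fb k x : g x - d k <= F k x <= g x.
    have /andP[] := steps_bound (g0 k x) (gN k x).
    under eq_bigr do rewrite U1.
    rewrite lerBlDr ler_pdivrMr // mulrDl mul1r ler_pdivlMr // /F -mulr_sumr mulrC.
    by rewrite lerBlDr => -> ->.
  have bF K k : bmeas (fun x : Borel => \sum_(j < K) d k * \1_(U k j) x) /\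
      I (fun x => \sum_(j < K) d k * \1_(U k j) x) = 0.
    elim: K => [|K [bK IK]].
      by under eq_fun do rewrite big_ord0; split; [exact: bmeas_cst|exact: extfun0].
    have bU := bmeasZ (d k) (bmeas_indic R (mU k K)).
    under eq_fun do rewrite big_ord_recr /=; split; first exact: bmeasD.
    by rewrite ID // IK IZ ?indicP ?mulr0 ?addr0 //; exact: bmeas_indic.
  apply: (lim0 F _ B).
  - by move=> k; exact: (bF (N k) k).1.1.
  - move=> k x; have /andP[_ h] := Fb k x; have /andP[_ h'] := gB x.
    rewrite ger0_norm ?(le_trans h) //; apply: sumr_ge0 => j _.
    by apply: mulr_ge0; [exact: ltW|rewrite -U1; case: ifP].
  - move=> x; apply: (@squeeze_cvgr _ _ _ _ (fun k => g x - d k) (fun=> g x)).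
    + by apply: nearW => k; exact: Fb.
    + rewrite -[X in _ --> X]subr0; apply: cvgB; first exact: cvg_cst.
      exact: cvg_harmonic.
    + exact: cvg_cst.
  - by move=> k; exact: (bF (N k) k).2.
move=> g [mg [B hB]].
have e : I (fun x => g x + B) = 0.
  apply: (pos _ (B + B)); first by apply: measurable_funD => //; exact: measurable_cst.
  by move=> x; have := hB x; rewrite ler_norml; lra.
move: e; rewrite ID; [|by split=> //; exists B|exact: bmeas_cst].
by rewrite (H (fun=> B)) ?addr0 //; exact: sfun_cst.
Qed.

Lemma extfun_signed mu : extfun (signed_integral mu).
Proof.
have := extfun_comb 1 (-1) (extfun_Rint mu.1) (extfun_Rint mu.2).
by apply: extfun_eq => g _; rewrite mul1r mulN1r.
Qed.

Lemma extfun_eqP I J : extfun I -> extfun J -> (forall f, smooth_fun f -> I f = J f) ->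
  forall g, bmeas (g : Borel -> R) -> I g = J g.
Proof.
move=> eI eJ e g bg; have := extfun_unique (extfun_comb 1 (-1) eI eJ).
move=> h; apply/eqP; rewrite -subr_eq0 -mulN1r -[I g]mul1r; apply/eqP; apply: h => //.
by move=> f sf; rewrite e // mul1r mulN1r subrr.
Qed.

(** The Jordan form of order 0. It is stable under the operations used below, and [riesz] turns it
    into the pair of measures that [order0_ext] looks for. *)
Definition order0 L := exists P N, [/\ posfun P, posfun N &
  forall f, smooth_fun f -> L f = P f - N f].

Lemma order0_represented L : order0 L -> exists mu, forall f, smooth_fun f ->
  L f = signed_integral mu f.
Proof.
move=> [P [N [pP pN e]]]; have [m [_ hm]] := riesz pP; have [m' [_ hm']] := riesz pN.
by exists (m, m') => f sf; rewrite e // hm // hm'.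
Qed.

Lemma order0_ext_spec L : order0 L ->
  extfun (order0_ext L) /\ forall f, smooth_fun f -> order0_ext L f = L f.
Proof.
move=> /order0_represented h; rewrite /order0_ext; case: pselect => // {}h.
by case: (cid h) => mu /= e; split; [exact: extfun_signed|move=> f sf; rewrite -e].
Qed.

(** The tool for computing [order0_ext]: by uniqueness, any functional with bounded convergence that
    agrees with [L] on smooth functions is the extension, whichever measures were chosen. *)
Lemma order0_extE L I : order0 L -> extfun I -> (forall f, smooth_fun f -> L f = I f) ->
  forall g, bmeas (g : Borel -> R) -> order0_ext L g = I g.
Proof.
move=> /order0_ext_spec[eL hL] eI e; apply: extfun_eqP => // f sf.
by rewrite hL // e.
Qed.

Lemma posfun_comb a b L L' : 0 <= a -> 0 <= b -> posfun L -> posfun L' ->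
  posfun (fun f => a * L f + b * L' f).
Proof.
move=> a0 b0 HL HL'; split=> [f g sf sg|k f sf|f sf f0].
- by rewrite (posfunD HL sf sg) (posfunD HL' sf sg); ring.
- by rewrite (posfunZ k HL sf) (posfunZ k HL' sf); ring.
- by rewrite addr_ge0 // mulr_ge0 // posfun_ge0.
Qed.

Lemma posfun_Rint (m : {finite_measure set Borel -> \bar R}) h :
  bmeas (h : Borel -> R) -> (forall x, 0 <= h x) ->
  posfun (fun f => \int[m]_(x in setT) (h x * f x)).
Proof.
move=> bh h0; have [ID IZ _] := extfun_mul bh (extfun_Rint m).
split=> [f g sf sg|k f sf|f sf f0].
- by apply: ID; exact: smooth_bmeas.
- by apply: IZ; exact: smooth_bmeas.
- by apply: Rint_ge0 => x; rewrite mulr_ge0.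
Qed.

Lemma posfun_order0 L : posfun L -> order0 L.
Proof.
move=> HL; exists L, (fun=> 0); split=> //; last by move=> f _; rewrite subr0.
by split=> [f g _ _|k f _|//]; rewrite ?addr0 ?mulr0.
Qed.

Lemma order0_eq L L' : (forall f, smooth_fun f -> L f = L' f) -> order0 L -> order0 L'.
Proof.
by move=> e [P [N [pP pN h]]]; exists P, N; split=> // f sf; rewrite -e // h.
Qed.

Lemma order0_comb a b L L' : order0 L -> order0 L' -> order0 (fun f => a * L f + b * L' f).
Proof.
have Z c M : order0 M -> order0 (fun f => c * M f).
  have HZ c' P : 0 <= c' -> posfun P -> posfun (fun f => c' * P f).
    move=> c0 pP; have := posfun_comb c0 (lexx 0) pP pP.
    by under eq_fun do rewrite mul0r addr0.
  move=> [P [N [pP pN e]]]; have [c0|/ltW c0] := leP 0 c.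
    by exists (fun f => c * P f), (fun f => c * N f); split; [exact: HZ|exact: HZ|
      move=> f sf; rewrite e // mulrBr].
  exists (fun f => - c * N f), (fun f => - c * P f).
  split; [apply: HZ => //; lra|apply: HZ => //; lra|].
  by move=> f sf; rewrite e //; ring.
move=> /(Z a)[P [N [pP pN e]]] /(Z b)[P' [N' [pP' pN' e']]].
have HD Q Q' : posfun Q -> posfun Q' -> posfun (fun f => Q f + Q' f).
  move=> pQ pQ'; have := posfun_comb ler01 ler01 pQ pQ'.
  by under eq_fun do rewrite !mul1r.
exists (fun f => P f + P' f), (fun f => N f + N' f); split; [exact: HD|exact: HD|].
by move=> f sf; rewrite e // e' //; ring.
Qed.

(** Adding a bound [B] of |h| makes the density nonnegative, so the part with density h + B is a
    difference of positive functionals; then B times [L] is subtracted. *)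
Lemma order0_mul L h : order0 L -> bmeas (h : Borel -> R) ->
  order0 (fun f => order0_ext L (fun x => h x * f x)).
Proof.
move=> oL bh; have [mu hmu] := order0_represented oL.
have [mh [B hB]] := bh.
have bB : bmeas (fun x : Borel => h x + B) by apply: bmeasD => //; exact: bmeas_cst.
have h0 x : 0 <= h x + B by have := hB x; rewrite ler_norml; lra.
pose J (m : {finite_measure set Borel -> \bar R}) f :=
  \int[m]_(x in [set: Borel]) ((h x + B) * f x).
have Jo m : order0 (J m) by apply: posfun_order0; exact: (posfun_Rint m bB h0).
have o1 := order0_comb 1 (-1) (Jo mu.1) (Jo mu.2).
have := order0_comb 1 (- B) o1 oL; apply: order0_eq => f sf.
have bf := smooth_bmeas sf; have bhf := bmeasM bh bf.
rewrite (order0_extE oL (extfun_signed mu)) //.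
have JE (m : {finite_measure set Borel -> \bar R}) :
    J m f = \int[m]_(x in setT) (h x * f x) + B * \int[m]_(x in setT) f x.
  rewrite -RintZ // -RintD //; last exact: bmeasZ.
  by apply: eq_Rintegral => x _; rewrite mulrDl.
by rewrite !JE hmu // /signed_integral; ring.
Qed.

(** The source of the mass bound: the integral of [h] against the negative part is nonnegative and
    is dropped, and h <= 1 bounds the positive part by its total mass. *)
Lemma order0_ext_le L P N h : posfun P -> posfun N ->
  (forall f, smooth_fun f -> L f = P f - N f) ->
  bmeas (h : Borel -> R) -> (forall x, 0 <= h x <= 1) ->
  order0_ext L h <= P (fun=> 1).
Proof.
move=> pP pN e bh h01; have [m [m1 hm]] := riesz pP; have [m' [_ hm']] := riesz pN.
have oL : order0 L by exists P, N.
rewrite (order0_extE oL (extfun_signed (m, m'))) //; last first.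
  by move=> f sf; rewrite e // hm // hm'.
rewrite /signed_integral /= lerBlDr -m1.
apply: (@le_trans _ _ (\int[m]_(x in setT) 1)).
  by apply: Rint_le => // [|x]; [exact: bmeas_cst|have /andP[] := h01 x].
rewrite Rint_cst mul1r lerDl; apply: Rint_ge0 => x.
by have /andP[] := h01 x.
Qed.

End Riesz.

(** * Linear algebra of strongly positive forms *)

Section StrongPositivity.
Variables (R : realType) (n : nat).
Local Notation V := (Cn R n).
Local Notation C := R[i].
Local Notation Re := complex.Re.
Local Notation Im := complex.Im.
Local Notation W := (@wedge_alt R n).
Local Notation cov := (@covector R n).
Implicit Types (a b : seq V -> C) (s u : seq V) (v w : V) (e : C) (al be : V -> C).

Lemma ii : 'i * 'i = -1 :> C.
Proof. by rewrite -expr2 sqr_i. Qed.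

Lemma cov_cons al a v s :
  W (cov al) a (v :: s) = al v * a s - W (cov al) (contr v a) s.
Proof.
rewrite wedge_cons; congr (_ + _).
  have -> : contr v (cov al) = fun t => al v * @unit_form R n t.
    by apply/funext => -[|x t]; rewrite /contr /= ?mulr1 ?mulr0.
  by rewrite wedgeZl wedge1l.
rewrite -wedgeNl; congr wedge_alt.
by apply/funext => -[|x [|y t]]; rewrite /sgnf /= ?mulr0 ?oppr0 // expr1 mulN1r.
Qed.

Lemma cov_cov al be s : W (cov al) (cov be) s =
  if s is [:: v; w] then al v * be w - al w * be v else 0.
Proof.
case: s => [|v [|w [|x s]]]; first by rewrite wedge_nil /= mul0r.
- by rewrite cov_cons wedge_nil /= mulr0 mul0r subrr.
- rewrite !cov_cons /contr /= wedge_nil /= mul0r subr0.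
  by congr (_ - _); rewrite mulrC.
rewrite !cov_cons /contr /= !(mulr0, sub0r, oppr0).
by rewrite wedge0r !oppr0.
Qed.

Lemma iabE al s : i_alpha_bar al s =
  if s is [:: v; w] then 'i * (al v * conjc (al w) - al w * conjc (al v)) else 0.
Proof.
by rewrite /i_alpha_bar cov_cov; case: s => [|v [|w [|x s]]]; rewrite ?mulr0.
Qed.

Lemma iab_real al v w : i_alpha_bar al [:: v; w] =
  (2 * (Re (al v) * Im (al w) - Im (al v) * Re (al w)))%:C.
Proof.
rewrite iabE; case: (al v) => x y; case: (al w) => x' y'.
by apply: complex_ext; rewrite /=; ring.
Qed.

(** Written for a product with [be], while the squares contain its conjugate: in the application
    [al] is C-linear and [be] is C-antilinear, so that the four forms [al + i^k conj be] are
    C-linear. *)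
Lemma polarization al be s : 4 * W (cov al) (cov be) s =
  \sum_(k < 4) (- 'i * 'i ^+ k) *
    i_alpha_bar (fun v => al v + 'i ^+ k * conjc (be v)) s.
Proof.
rewrite cov_cov; under eq_bigr do rewrite iabE.
case: s => [|v [|w [|x s]]]; try by rewrite big1 ?mulr0 // => k _; rewrite mulr0.
rewrite !big_ord_recl big_ord0 /bump /= expr0 expr1 !mul1r mulr1.
have -> : 'i ^+ 2 = -1 :> C by exact: sqr_i.
have -> : 'i ^+ 3 = - 'i :> C by rewrite exprS sqr_i mulrN1.
case: (al v) (al w) (be v) (be w) => [x1 y1] [x2 y2] [x3 y3] [x4 y4].
by apply: complex_ext; rewrite /=; ring.
Qed.

(** For e = -i this is z_j, for e = i its conjugate. *)
Definition zcrd e (j : 'I_n) v : C := (crd (inl j) v)%:C - e * (crd (inr j) v)%:C.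

(* For e = -i resp. e = i: contraction with d/dz_j resp. d/dzbar_j. *)
Definition zcontr e (j : 'I_n) a : seq V -> C := fun s =>
  (a (bas R (inl j) :: s) + e * a (bas R (inr j) :: s)) / 2.

Fixpoint zdegree e a s : C :=
  if s is v :: t then (a (v :: t) + e * a (J v :: t)) / 2 + zdegree e (contr v a) t else 0.

Lemma J_bas (j : 'I_n) : J (bas R (inl j)) = bas R (inr j).
Proof. by rewrite /J /cscale /bas /= !(scale0r, scale1r, scaler0, subr0, addr0). Qed.

Lemma mlin_head a v w (t : R) s : mlin a ->
  a (t *: v + w :: s) = t%:C * a (v :: s) + a (w :: s).
Proof. by move=> /(_ [::] s t v w). Qed.

Lemma mlin0 a s : mlin a -> a (0 :: s) = 0.
Proof.
move=> la; have := la [::] s 1 0 0; rewrite /= scaler0 addr0 mul1r => h.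
by apply: (addrI (a (0 :: s))); rewrite -h addr0.
Qed.

Lemma mlinZ a v (t : R) s : mlin a -> a (t *: v :: s) = t%:C * a (v :: s).
Proof. by move=> la; rewrite -[t *: v]addr0 mlin_head // mlin0 // addr0. Qed.

Lemma mlinN a v s : mlin a -> a (- v :: s) = - a (v :: s).
Proof. by move=> la; rewrite -scaleN1r mlinZ // rmorphN mulN1r. Qed.

Lemma mlin_crd a v s : mlin a -> a (v :: s) = \sum_i (crd i v)%:C * a (bas R i :: s).
Proof.
move=> la; rewrite {1}(crdE v); elim: (index_enum _) => [|i r IH].
  by rewrite !big_nil mlin0.
by rewrite !big_cons mlin_head // IH.
Qed.

Lemma mlin_head_sum a v s : mlin a -> a (v :: s) =
  \sum_j ((crd (inl j) v)%:C * a (bas R (inl j) :: s) + (crd (inr j) v)%:C * a (bas R (inr j) :: s)).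
Proof. by move=> la; rewrite mlin_crd // big_sumType big_split. Qed.

Lemma crdJ (j : 'I_n) v : (crd (inl j) (J v) = - crd (inr j) v) *
  (crd (inr j) (J v) = crd (inl j) v).
Proof.
case: v => x y; rewrite /crd /J /cscale /= !mxE; split; ring.
Qed.

(** Euler's identity for forms: the sum of the products of dz_j with the contraction by d/dz_j (or
    their conjugates) is the derivation induced by the projection to the corresponding type of
    vectors. *)
Lemma zdegreeE e a s : e * e = -1 -> mlin a -> adjalt a ->
  \sum_j W (cov (zcrd e j)) (zcontr e j a) s = zdegree e a s.
Proof.
move=> ee; elim: s a => [|v s IH] a la aa.
  by rewrite big1 // => j _; rewrite wedge_nil mul0r.
under eq_bigr do rewrite cov_cons.
rewrite sumrB /= -[zdegree e (contr v a) s]IH; [|exact: mlin_contr|exact: adjalt_contr].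
congr (_ + _); last first.
  rewrite -sumrN; apply: eq_bigr => j _; rewrite -wedgeNr; congr wedge_alt.
  apply/funext => t; rewrite /contr /zcontr.
  by rewrite (adjalt_swap [::] t _ v la aa) (adjalt_swap [::] t (bas R (inr j)) v la aa) /=; ring.
rewrite (mlin_head_sum _ _ la) (mlin_head_sum (J v) _ la) mulr_sumr -big_split [RHS]mulr_suml.
apply: eq_bigr => j _; rewrite !crdJ /zcrd /zcontr rmorphN /=.
move: (a _) (a _) (_%:C) (_%:C) => B A y x.
have -> : (x - e * y) * ((A + e * B) / 2) = (x * A + e * x * B - e * y * A - (e * e) * y * B) / 2 by ring.
by rewrite ee; ring.
Qed.

Fixpoint Jdegree a s : C :=
  if s is v :: t then a (J v :: t) + Jdegree (contr v a) t else 0.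

Lemma zdegreeJ e a s : zdegree e a s = ((size s)%:R * a s + e * Jdegree a s) / 2.
Proof.
elim: s a => [|v s IH] a; first by rewrite /= mul0r mulr0 addr0 mul0r.
by rewrite /= IH /contr -natr1; ring.
Qed.

(** The polynomial in t expanding [a] on the vectors v + t J v. Its linear coefficient is the
    derivation induced by J, so the derivative at t = 0 can be read off algebraically. *)
Fixpoint Jpoly a s : {poly C} :=
  if s is v :: t then Jpoly (contr v a) t + 'X * Jpoly (contr (J v) a) t else (a [::])%:P.

Lemma Jpoly_horner a s (t : R) : mlin a ->
  (Jpoly a s).[t%:C] = a (map (fun v => v + t *: J v) s).
Proof.
elim: s a => [|v s IH] a la /=; first by rewrite hornerC.
rewrite hornerD hornerM hornerX !IH; try exact: mlin_contr.
by rewrite /contr addrC [v + _]addrC mlin_head.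
Qed.

Lemma Jpoly_coef a s : (Jpoly a s)`_0 = a s /\ (Jpoly a s)`_1 = Jdegree a s.
Proof.
elim: s a => [|v s IH] a /=; first by rewrite !coefC.
by rewrite !coefD !coefXM /= (IH _).1 (IH _).2 (IH _).1 addr0 addrC.
Qed.

Lemma poly_eq_real (P Q : {poly C}) : (forall t : R, P.[t%:C] = Q.[t%:C]) -> P = Q.
Proof.
move=> h; apply/eqP; rewrite -subr_eq0; apply: contraT => nz.
have := max_poly_roots nz (rs := [seq (k%:R : C) | k <- iota 0 (size (P - Q))]).
rewrite size_map size_iota ltnn => -> //.
  apply/allP => _ /mapP[k _ ->]; rewrite rootE hornerD hornerN.
  by have := h k%:R; rewrite rmorph_nat => ->; rewrite subrr.
rewrite map_inj_uniq ?iota_uniq // => k l /eqP; rewrite eqr_nat => /eqP.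
exact.
Qed.

Lemma cscale_map t s : map (fun v => v + t *: J v) s = map (cscale (1 +i* t : C)) s :> seq V.
Proof. by apply: eq_map => v; rewrite cscaleE /= scale1r. Qed.

Lemma coef1_prod (c d : C) (p q : nat) (k : C) :
  (((1 + c *: 'X) ^+ p * (1 + d *: 'X) ^+ q * k%:P) : {poly C})`_1 = (p%:R * c + q%:R * d) * k.
Proof.
have H (P Q : {poly C}) : (P * Q)`_1 = P`_0 * Q`_1 + P`_1 * Q`_0.
  by rewrite coefM !big_ord_recl big_ord0 /= addr0.
have H0 (P Q : {poly C}) : (P * Q)`_0 = P`_0 * Q`_0 by rewrite coefM big_ord1.
have E (x : C) m : ((1 + x *: 'X) ^+ m : {poly C})`_0 = 1 /\
    ((1 + x *: 'X) ^+ m : {poly C})`_1 = m%:R * x.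
  elim: m => [|m [IH0 IH1]]; first by rewrite expr0 !coef1 mul0r.
  rewrite exprS H H0 IH0 IH1 !coefD !coefZ !coefX !coef1 /= mulr0 mulr1 addr0 add0r -natr1.
  by split; ring.
by rewrite H H H0 !coefC /= (E c p).1 (E c p).2 (E d q).1 (E d q).2; ring.
Qed.

(** On real t the vector v + t J v is (1 + it) v, so the bidegree gives (1 + it)^p (1 - it)^q a(s);
    comparing the coefficients of t yields i(p - q). *)
Lemma Jdegree_bidegree p q a s : bidegree p q a -> Jdegree a s = 'i * (p%:R - q%:R) * a s.
Proof.
move=> [/alternatingP[_ la _] ha].
have : Jpoly a s = (1 + 'i *: 'X) ^+ p * (1 + (- 'i) *: 'X) ^+ q * (a s)%:P.
  apply: poly_eq_real => t; rewrite Jpoly_horner // cscale_map ha.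
  have c1 : (1 +i* t : C) = 1 + 'i * t%:C by apply: complex_ext; rewrite /=; ring.
  have c2 : conjc (1 +i* t : C) = 1 + - 'i * t%:C by apply: complex_ext; rewrite /=; ring.
  by rewrite c2 c1 !hornerM !horner_exp !hornerD !hornerZ hornerX !hornerC.
move=> /(congr1 (fun P : {poly C} => P`_1)); rewrite (Jpoly_coef a s).2 coef1_prod => ->.
by congr (_ * _); ring.
Qed.

Lemma zdegree_bidegree p q a s : bidegree p q a ->
  zdegree (- 'i) a s = p%:R * a s /\ zdegree 'i a s = q%:R * a s.
Proof.
move=> ba; rewrite !zdegreeJ (Jdegree_bidegree s ba).
have -> : (size s)%:R * a s = (p%:R + q%:R) * a s.
  have [[h _ _] _] := ba; have [->|/h ->] := eqVneq (size s) (p + q)%N.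
    by rewrite natrD.
  by rewrite !mulr0.
have H (D A : C) : 'i * ('i * D * A) = - (D * A) by rewrite -mulrA mulrA ii mulN1r.
rewrite mulNr !H; move: (a s) (p%:R) (q%:R) => A x y.
have n2 : (2 : C) != 0 by rewrite pnatr_eq0.
by split; apply: (mulIf n2); rewrite divfK //; ring.
Qed.


(** The weight of a contraction is computed by writing a basis vector as zeta times zeta^-1 times
    it, which excludes zeta = 0. That case follows from multilinearity alone. *)
Lemma bidegree_nonzero p q a : alternating (p + q) a ->
  (forall (z : C) s, z != 0 -> a (map (cscale z) s) = z ^+ p * conjc z ^+ q * a s) ->
  bidegree p q a.
Proof.
move=> aa h; split=> // z s; have [->|/h//] := eqVneq z 0.
have [a1 a2 _] := aa.
have [pq|pq] := boolP (p + q == 0)%N.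
  move: pq a1; rewrite addn_eq0 => /andP[/eqP -> /eqP ->] a1; rewrite !expr0 !mul1r.
  by case: s => [//|v s]; rewrite !a1.
have -> : 0 ^+ p * conjc 0 ^+ q = 0 :> C.
  by rewrite conjc0 -exprD expr0n (negbTE pq).
rewrite mul0r; case: s => [|v s]; first by rewrite a1 // eq_sym.
rewrite /=; have -> : cscale 0 v = 0 by rewrite cscaleE /= !scale0r addr0.
have := a2 [::] (map (cscale 0) s) 1 0 0; rewrite /= scaler0 addr0 mul1r => e.
by apply: (addrI (a (0 :: map (cscale 0) s))); rewrite -e addr0.
Qed.

Lemma zcontr_alternating k e a (j : 'I_n) : alternating k.+1 a -> alternating k (zcontr e j a).
Proof.
move=> /alternatingP[ha la aa]; apply/alternatingP.
have hc i := @contr_homogeneous _ _ k (bas R i) a ha.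
have lc i := mlin_contr (bas R i) la; have ac i := adjalt_contr (bas R i) aa.
split.
- move=> s hs; rewrite /zcontr.
  have -> : a (bas R (inl j) :: s) = 0 by exact: hc.
  have -> : a (bas R (inr j) :: s) = 0 by exact: hc.
  by rewrite mulr0 addr0 mul0r.
- move=> s1 s2 t v w; rewrite /zcontr.
  have := lc (inl j) s1 s2 t v w; rewrite /contr => ->.
  have := lc (inr j) s1 s2 t v w; rewrite /contr => ->.
  by ring.
- move=> s1 s2 v; rewrite /zcontr.
  have := ac (inl j) s1 s2 v; rewrite /contr => ->.
  have := ac (inr j) s1 s2 v; rewrite /contr => ->.
  by rewrite mulr0 addr0 mul0r.
Qed.

Lemma cscaleA (z w : C) v : cscale z (cscale w v) = cscale (z * w) v.
Proof.
case: v => x y; case: z w => [a b] [c d]; rewrite /cscale /=.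
by congr pair; apply/rowP => i; rewrite !mxE; ring.
Qed.

Lemma zcontr_map p q e a (j : 'I_n) (z : C) s : e * e = -1 -> bidegree p q a -> z != 0 ->
  zcontr e j a (map (cscale z) s) =
  z ^+ p * conjc z ^+ q * ((Re z^-1)%:C - e * (Im z^-1)%:C) * zcontr e j a s.
Proof.
move=> ee [/alternatingP[_ la _] ha] z0; rewrite /zcontr.
have H i : a (bas R i :: map (cscale z) s) = z ^+ p * conjc z ^+ q *
    ((Re z^-1)%:C * a (bas R i :: s) + (Im z^-1)%:C * a (J (bas R i) :: s)).
  have {1}-> : bas R i = cscale z (cscale z^-1 (bas R i)).
    by rewrite cscaleA divff // cscaleE /= scale1r scale0r addr0.
  by rewrite -(map_cons (cscale z)) ha [cscale z^-1 _]cscaleE mlin_head // mlinZ.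
rewrite !H -J_bas JJ J_bas mlinN // mulrN.
set K := z ^+ p * _; move: (a _) (a _) (_%:C) (_%:C) K => B A y x K.
have -> : K * (x - e * y) * ((A + e * B) / 2) =
  (K * (x * A + e * x * B - e * y * A - (e * e) * y * B)) / 2 by ring.
by rewrite ee; ring.
Qed.

Lemma zcontr_bidegree p q a (j : 'I_n) :
  (bidegree p.+1 q a -> bidegree p q (zcontr (- 'i) j a)) /\
  (bidegree p q.+1 a -> bidegree p q (zcontr 'i j a)).
Proof.
have cE (w : C) : w = (Re w)%:C - (- 'i) * (Im w)%:C.
  by case: w => x y; apply: complex_ext; rewrite /=; ring.
have cE' (w : C) : conjc w = (Re w)%:C - 'i * (Im w)%:C.
  by case: w => x y; apply: complex_ext; rewrite /=; ring.
split=> ba; apply: bidegree_nonzero.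
- by apply: zcontr_alternating; exact: ba.1.
- move=> z s z0; rewrite (zcontr_map j s _ ba z0); last by rewrite mulrNN ii.
  by rewrite -cE; congr (_ * _); rewrite exprSr mulrAC -(mulrA (z ^+ p)) mulfV // mulr1.
- by have := ba.1; rewrite addnS => h; exact: zcontr_alternating.
- move=> z s z0; rewrite (zcontr_map j s ii ba z0) -cE'; congr (_ * _).
  rewrite -mulrA; congr (_ * _).
  by rewrite exprSr -mulrA -rmorphM mulfV // rmorph1 mulr1.
Qed.

Definition Eform (gs : seq (V -> C)) : seq V -> C :=
  foldr (fun g b => W (i_alpha_bar g) b) (@unit_form R n) gs.

Lemma clinearD al (t : R) v w : clinear al -> al (t *: v + w) = t%:C * al v + al w.
Proof. by move=> /(_ t%:C v w); rewrite cscaleE /= scale0r addr0. Qed.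

Lemma clinearM al (z : C) v : clinear al -> al (cscale z v) = z * al v.
Proof.
move=> la; have al0 : al 0 = 0.
  have := clinearD 1 0 0 la; rewrite scaler0 addr0 mul1r => h.
  by apply: (addrI (al 0)); rewrite -h addr0.
by have := la z v 0; rewrite addr0 al0 addr0.
Qed.

Lemma cov_alternating al : (forall (t : R) v w, al (t *: v + w) = t%:C * al v + al w) ->
  alternating 1 (cov al).
Proof.
move=> la; apply/alternatingP; split.
- by case=> [|v [|w s]].
- move=> [|x s1] s2 t v w.
    by case: s2 => [|y s2]; [exact: la|rewrite /= mulr0 addr0].
  by case: s1 => [|y s1]; rewrite /= mulr0 addr0.
by move=> [|x [|y s1]] s2 v.
Qed.

Lemma iab_bidegree al : clinear al -> bidegree 1 1 (i_alpha_bar al).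
Proof.
move=> la; split.
  have h1 : alternating 1 (cov al) by apply: cov_alternating => t v w; exact: clinearD.
  have h2 : alternating 1 (cov (conjc \o al)).
    by apply: cov_alternating => t v w /=; rewrite clinearD // rmorphD rmorphM; congr (_ * _ + _); apply: complex_ext; rewrite /= ?oppr0.
  have := alternating_lin 'i (alternating_wedge h1 h2) (bidegree0 R n 1 1).1.
  by under [fun s => _ + 0]eq_fun do rewrite addr0.
move=> z [|v [|w [|x s]]]; rewrite /= !iabE ?mulr0 //.
rewrite !clinearM // !rmorphM /= !expr1; ring.
Qed.

Lemma Eform_bidegree gs : (forall k, (k < size gs)%N -> clinear (nth (fun=> 0) gs k)) ->
  bidegree (size gs) (size gs) (Eform gs).
Proof.
elim: gs => [_|g gs IH h]; first exact: bidegree_unit.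
apply: (@bidegree_wedge _ _ 1 1 (size gs) (size gs)).
  by apply: iab_bidegree; exact: (h 0%N).
by apply: IH => k kg; exact: (h k.+1).
Qed.

(** Coefficient functionals are kept as finite combinations of evaluations on fixed vectors, so that
    they yield smooth functions when applied to the local expression of a smooth form. *)
Definition evalform (c : (seq V -> C) -> C) :=
  exists l : seq (C * seq V), forall a, c a = \sum_(x <- l) x.1 * a x.2.

Lemma evalform_zcontr e j c : evalform c -> evalform (fun a => c (zcontr e j a)).
Proof.
move=> [l hl]; exists ([seq (x.1 / 2, bas R (inl j) :: x.2) | x <- l] ++
  [seq (x.1 * e / 2, bas R (inr j) :: x.2) | x <- l]) => a.
rewrite hl big_cat !big_map /= -big_split /=; apply: eq_bigr => x _.
by rewrite /zcontr /=; ring.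
Qed.

Lemma evalformZ (k : C) c : evalform c -> evalform (fun a => k * c a).
Proof.
move=> [l hl]; exists [seq (k * x.1, x.2) | x <- l] => a.
by rewrite hl big_map mulr_sumr; apply: eq_bigr => x _; rewrite mulrA.
Qed.

Lemma crdD i v w : crd i (v + w) = crd i v + crd i w.
Proof. by rewrite linearD. Qed.

Lemma crd_cscale (j : 'I_n) (z : C) v :
  crd (inl j) (cscale z v) = Re z * crd (inl j) v - Im z * crd (inr j) v /\
  crd (inr j) (cscale z v) = Im z * crd (inl j) v + Re z * crd (inr j) v.
Proof. by case: v => x y; rewrite /crd /cscale /= !mxE. Qed.

Lemma zcrd_clinear (j : 'I_n) : clinear (zcrd (- 'i) j) /\
  clinear (fun v => conjc (zcrd 'i j v)).
Proof.
have H z v w : zcrd (- 'i) j (cscale z v + w) = z * zcrd (- 'i) j v + zcrd (- 'i) j w.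
  rewrite /zcrd !crdD (crd_cscale j z v).1 (crd_cscale j z v).2.
  move: (crd _ v) (crd _ v) (crd _ w) (crd _ w) => y x y' x'.
  by case: z => a b; apply: complex_ext; rewrite /=; ring.
have E v : conjc (zcrd 'i j v) = zcrd (- 'i) j v.
  rewrite /zcrd; move: (crd _ v) (crd _ v) => y x.
  by apply: complex_ext; rewrite /=; ring.
by split=> z v w; rewrite ?E ?H.
Qed.

Lemma span_sp r : exists (I : finType) (g : I -> seq (V -> C)) (c : I -> (seq V -> C) -> C),
  [/\ forall i, size (g i) = r,
      forall i k, (k < r)%N -> clinear (nth (fun=> 0) (g i) k),
      forall i, evalform (c i)
    & forall a, bidegree r r a -> forall s, a s = \sum_i c i a * Eform (g i) s].
Proof.
elim: r => [|r [I [g [c [gr gl gc gE]]]]].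
  exists unit, (fun=> [::]), (fun _ a => a [::]); split=> //.
    by move=> i; exists [:: (1, [::])] => a; rewrite big_seq1 mul1r.
  move=> a [/alternatingP[ha _ _] _] s; rewrite (big_pred1 tt) /=; last by case.
  by case: s => [|v s]; rewrite /= ?mulr1 // mulr0 ha.
pose gg (i : 'I_n * 'I_n * 'I_4 * I) := (fun v => zcrd (- 'i) i.1.1.1 v +
  'i ^+ i.1.2 * conjc (zcrd 'i i.1.1.2 v)) :: g i.2.
(* The divisor 4 comes from polarization, and each of the two Euler identities contributes one
   factor r + 1. *)
pose cc (i : 'I_n * 'I_n * 'I_4 * I) a := (- 'i * 'i ^+ i.1.2 / 4 / r.+1%:R ^+ 2) *
  c i.2 (zcontr 'i i.1.1.2 (zcontr (- 'i) i.1.1.1 a)).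
exists ('I_n * 'I_n * 'I_4 * I)%type, gg, cc; split.
- by move=> i; rewrite /= gr.
- move=> i [|k] kr; last exact: gl.
  move=> z v w; have h1 := (zcrd_clinear i.1.1.1).1 z v w.
  have h2 : conjc (zcrd 'i i.1.1.2 (cscale z v + w)) =
    z * conjc (zcrd 'i i.1.1.2 v) + conjc (zcrd 'i i.1.1.2 w) := (zcrd_clinear i.1.1.2).2 z v w.
  have -> : nth (fun=> 0) (gg i) 0 = fun v => zcrd (- 'i) i.1.1.1 v +
    'i ^+ i.1.2 * conjc (zcrd 'i i.1.1.2 v) by [].
  rewrite h1 h2; move: (zcrd _ _ v) (zcrd _ _ w) => x y.
  by move: (conjc _) (conjc _) (_ ^+ _) => x' y' k; ring.
- move=> i; apply: evalformZ.
  by apply: (@evalform_zcontr _ _ (fun a => c i.2 (zcontr 'i i.1.1.2 a))); apply: evalform_zcontr.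
move=> a ba s.
have r0 : r.+1%:R != 0 :> C by rewrite pnatr_eq0.
have ba' j : bidegree r r.+1 (zcontr (- 'i) j a) by exact: (zcontr_bidegree r r.+1 a j).1.
have ba2 j k : bidegree r r (zcontr 'i k (zcontr (- 'i) j a)).
  exact: (zcontr_bidegree r r _ k).2.
have D1 t : r.+1%:R * a t = \sum_j W (cov (zcrd (- 'i) j)) (zcontr (- 'i) j a) t.
  have /alternatingP[_ la aa] := ba.1.
  by rewrite zdegreeE ?mulrNN ?ii // (zdegree_bidegree t ba).1.
have D2 j t : r.+1%:R * zcontr (- 'i) j a t =
    \sum_k W (cov (zcrd 'i k)) (zcontr 'i k (zcontr (- 'i) j a)) t.
  have /alternatingP[_ la aa] := (ba' j).1.
  by rewrite zdegreeE ?ii // (zdegree_bidegree t (ba' j)).2.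
have D j k t : W (W (cov (zcrd (- 'i) j)) (cov (zcrd 'i k))) (zcontr 'i k (zcontr (- 'i) j a)) t =
    \sum_(m < 4) \sum_(i : I) (- 'i * 'i ^+ m / 4) *
      c i (zcontr 'i k (zcontr (- 'i) j a)) * Eform (gg (j, k, m, i)) t.
  have -> : W (cov (zcrd (- 'i) j)) (cov (zcrd 'i k)) = fun t => \sum_(m < 4)
      (- 'i * 'i ^+ m / 4) * i_alpha_bar (fun v => zcrd (- 'i) j v + 'i ^+ m * conjc (zcrd 'i k v)) t.
    apply/funext => t'; have n4 : 4 != 0 :> C by rewrite pnatr_eq0.
    apply: (mulfI n4); rewrite polarization mulr_sumr; apply: eq_bigr => m _.
    by move: (- 'i * _) (i_alpha_bar _ t') => x y; rewrite mulrA (mulrC 4) divfK.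
  rewrite wedge_suml; apply: eq_bigr => m _; rewrite wedgeZl.
  have -> : zcontr 'i k (zcontr (- 'i) j a) =
      fun t => \sum_i c i (zcontr 'i k (zcontr (- 'i) j a)) * Eform (g i) t.
    by apply/funext => t'; exact: gE.
  rewrite wedge_sumr mulr_sumr; apply: eq_bigr => i _; rewrite wedgeZr mulrA.
  by have -> : (fun t => \sum_i c i (zcontr 'i k (zcontr (- 'i) j a)) * Eform (g i) t) =
    zcontr 'i k (zcontr (- 'i) j a) by apply/funext => t'; rewrite -gE.
apply: (mulfI (expf_neq0 2 r0)); rewrite expr2 -mulrA D1 mulr_sumr.
rewrite -(pair_bigA _ (fun x i => cc (x, i) a * Eform (gg (x, i)) s)) /=.
rewrite -(pair_bigA _ (fun x m => \sum_i cc (x, m, i) a * Eform (gg (x, m, i)) s)) /=.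
rewrite -(pair_bigA _ (fun j k => \sum_m \sum_i cc (j, k, m, i) a * Eform (gg (j, k, m, i)) s)) /=.
rewrite mulr_sumr; apply: eq_bigr => j _.
rewrite -wedgeZr; have -> : (fun t => r.+1%:R * zcontr (- 'i) j a t) = fun t =>
  \sum_k W (cov (zcrd 'i k)) (zcontr 'i k (zcontr (- 'i) j a)) t by apply/funext => t; exact: D2.
rewrite wedge_sumr mulr_sumr; apply: eq_bigr => k _.
rewrite wedgeA D mulr_sumr; apply: eq_bigr => m _.
rewrite mulr_sumr; apply: eq_bigr => i _.
have -> : cc (j, k, m, i) a = - 'i * 'i ^+ m / 4 / r.+1%:R ^+ 2 *
  c i (zcontr 'i k (zcontr (- 'i) j a)) by [].
have -> : W (i_alpha_bar (fun v => zcrd (- 'i) j v + 'i ^+ m * conjc (zcrd 'i k v)))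
  (Eform (g i)) s = Eform (gg (j, k, m, i)) s by [].
move: (c i _) (Eform _ s) ('i ^+ m) => x y w.
by field.
Qed.


Lemma sp_Eform r gs : size gs = r -> (forall k, (k < r)%N -> clinear (nth (fun=> 0) gs k)) ->
  strongly_positive r (Eform gs).
Proof.
move=> sg lg; exists 1%N, (fun=> 1), (fun _ j => nth (fun=> 0) gs j); split=> [//|k j|s].
  exact: lg.
rewrite big_ord1 mul1r /Eform -[in LHS](@mkseq_nth _ (fun=> 0) gs) sg.
rewrite /mkseq -val_enum_ord -map_comp.
by elim: (enum _) s => [//|j l IH] s /=; congr wedge_alt; apply/funext => t; exact: IH.
Qed.

Lemma strongly_positiveE r a : strongly_positive r a <->
  exists (N : nat) (lam : 'I_N -> R) (g : 'I_N -> seq (V -> C)),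
    [/\ forall k, 0 <= lam k, forall k, size (g k) = r,
      forall k j, (j < r)%N -> clinear (nth (fun=> 0) (g k) j)
    & forall s, a s = \sum_(k < N) (lam k)%:C * Eform (g k) s].
Proof.
split=> [[N [lam [al [l0 cl aE]]]]|[N [lam [g [l0 sg cl aE]]]]].
  exists N, lam, (fun k => [seq al k j | j <- enum 'I_r]); split=> // [k|k j jr|s].
  - by rewrite size_map size_enum_ord.
  - by rewrite (nth_map (Ordinal jr)) ?size_enum_ord.
  rewrite aE; apply: eq_bigr => k _; congr (_ * _); rewrite /Eform.
  by elim: (enum _) s => [//|j l IH] s /=; congr wedge_alt; apply/funext => t; exact: IH.
exists N, lam, (fun k j => nth (fun=> 0) (g k) j); split=> [//|k j|s].
  exact: cl.
rewrite aE; apply: eq_bigr => k _; congr (_ * _).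
rewrite /Eform -[in LHS](@mkseq_nth _ (fun=> 0) (g k)) sg.
rewrite /mkseq -val_enum_ord -map_comp.
by elim: (enum _) s => [//|j l IH] s /=; congr wedge_alt; apply/funext => t; exact: IH.
Qed.

Lemma sp_wedge r h a : strongly_positive 1 h -> strongly_positive r a ->
  strongly_positive r.+1 (W h a).
Proof.
move=> /strongly_positiveE[N [lam [g [l0 sg cl hE]]]].
move=> /strongly_positiveE[N' [lam' [g' [l0' sg' cl' aE]]]].
apply/strongly_positiveE; exists (#|{: 'I_N * 'I_N'}|).
exists (fun k => lam (enum_val k).1 * lam' (enum_val k).2).
exists (fun k => nth (fun=> 0) (g (enum_val k).1) 0 :: g' (enum_val k).2); split.
- by move=> k; rewrite mulr_ge0.
- by move=> k; rewrite /= sg'.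
- by move=> k [|j] jr; [exact: cl|exact: cl'].
move=> s; have -> : h = fun s => \sum_(k < N) (lam k)%:C * Eform (g k) s by apply/funext.
have -> : a = fun s => \sum_(k < N') (lam' k)%:C * Eform (g' k) s by apply/funext.
rewrite wedge_suml; under eq_bigr do rewrite wedge_sumr.
rewrite pair_bigA /= (reindex (@enum_val _ {: 'I_N * 'I_N'})) /=; last first.
  by apply: onW_bij; exact: enum_val_bij.
apply: eq_bigr => k _; rewrite wedgeZl wedgeZr mulrA -rmorphM; congr (_ * _).
rewrite [in RHS]/Eform /= -/(Eform _); congr wedge_alt.
case: (g _) (sg (enum_val k).1) => [//|x [|//]] _.
by rewrite /Eform /= wedge1r.
Qed.

Lemma spZ r a (t : R) : 0 <= t -> strongly_positive r a ->
  strongly_positive r (fun s => t%:C * a s).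
Proof.
move=> t0 [N [lam [al [l0 cl aE]]]]; exists N, (fun k => t * lam k), al; split=> //.
  by move=> k; rewrite mulr_ge0.
move=> s; rewrite aE mulr_sumr; apply: eq_bigr => k _.
by rewrite rmorphM mulrA.
Qed.

Lemma sp0 r : strongly_positive r (fun _ : seq V => 0).
Proof.
by exists 0%N, (fun=> 0), (fun _ _ _ => 0); split=> [||s]; [case|case|rewrite big_ord0].
Qed.

Definition psd11 (h : V -> V -> R) := [/\ forall (t : R) v v' w, h (t *: v + v') w = t * h v w + h v' w,
  forall v w, h w v = - h v w, forall v w, h (J v) (J w) = h v w & forall v, 0 <= h v (J v)].

Definition iabR al v w : R := 2 * (Re (al v) * Im (al w) - Im (al v) * Re (al w)).

Lemma psd11_linr h (t : R) v w w' : psd11 h -> h v (t *: w + w') = t * h v w + h v w'.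
Proof. by move=> [l a _ _]; rewrite a l a (a w'); ring. Qed.

Lemma psd11_J h v w : psd11 h -> h (J v) w = - h v (J w).
Proof.
move=> p; have [l a j _] := p; rewrite -j JJ.
have -> : - v = (-1) *: v + 0 :> V by rewrite scaleN1r addr0.
by rewrite l; have := l (-1) 0 0 (J w); rewrite scaler0 addr0 => h0; lra.
Qed.

(** Cauchy-Schwarz for the Hermitian form whose real and imaginary parts are, up to sign, h(v, J u)
    and h(v, u). It follows from positivity at r v + s u + t J u. *)
Lemma psd11_CS h v (u : V) : psd11 h ->
  h v u ^+ 2 + h v (J u) ^+ 2 <= h v (J v) * h u (J u).
Proof.
move=> p; have [l a j pos] := p.
have huu w : h w w = 0 by have := a w w; lra.
have l0 (t : R) x y : h (t *: x) y = t * h x y.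
  have -> : t *: x = t *: x + 0 by rewrite addr0.
  by rewrite l; have := l (-1) 0 0 y; rewrite scaler0 addr0 => h0; lra.
have l0r (t : R) x y : h y (t *: x) = t * h y x by rewrite a l0 a mulrN opprK.
have exp (s t r : R) : h (r *: v + (s *: u + t *: J u)) (J (r *: v + (s *: u + t *: J u))) =
    r ^+ 2 * h v (J v) + 2 * r * s * h v (J u) - 2 * r * t * h v u +
    (s ^+ 2 + t ^+ 2) * h u (J u).
  rewrite !J_lin [J (t *: J u)]linearZ /= !l !l0 !psd11_linr // !l0r JJ.
  have e1 x y : h x (- y) = - h x y by rewrite -scaleN1r l0r mulN1r.
  rewrite !e1 j !huu (a v u).
  have -> : h u (J v) = h v (J u) by rewrite a psd11_J // opprK.
  have -> : h (J u) u = - h u (J u) by exact: a.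
  by ring.
set A := h v (J v) in exp *; set c := h u (J u) in exp *.
set B := h v (J u) in exp *; set D := h v u in exp *.
have c0 : 0 <= c by exact: pos.
have P (s t r : R) : 0 <= r ^+ 2 * A + 2 * r * s * B - 2 * r * t * D + (s ^+ 2 + t ^+ 2) * c.
  by rewrite -exp; exact: pos.
have [cp|cn] := ltP 0 c.
  (* The minimizing coefficients, multiplied by [c] to avoid division. *)
  have := P (- B) D c; rewrite -(ler_pM2l cp) => h1.
  rewrite -subr_ge0 -(pmulr_rge0 _ cp); move: h1.
  have -> : c ^+ 2 * A + 2 * c * - B * B - 2 * c * D * D + ((- B) ^+ 2 + D ^+ 2) * c =
    c * (A * c - (D ^+ 2 + B ^+ 2)) by ring.
  by rewrite mulr0 => h2; rewrite -(pmulr_rge0 _ cp).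
have c00 : c = 0 by apply/eqP; rewrite eq_le cn c0.
rewrite c00 mulr0 leNgt; apply/negP => Q.
set q := D ^+ 2 + B ^+ 2 in Q.
(* When c = 0 the expression is affine in (s, t); the chosen multiple of the gradient makes its
   value -1. *)
have := P (- (A + 1) / (2 * q) * B) ((A + 1) / (2 * q) * D) 1.
rewrite c00 mulr0 addr0; apply/negP; rewrite -ltNge.
have -> : 1 ^+ 2 * A + 2 * 1 * (- (A + 1) / (2 * q) * B) * B -
  2 * 1 * ((A + 1) / (2 * q) * D) * D = A - (A + 1) * (2 * q / (2 * q)) by rewrite /q; ring.
by rewrite divff ?gt_eqF ?mulr_gt0 // mulr1; lra.
Qed.

(** Schur complement at [u]. The form [al] is the Hermitian pairing with [u] divided by the square
    root of 2c, where the 2 compensates the factor 2 in [iabR]. Cauchy-Schwarz keeps the remainder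
    positive, [u] becomes a null vector, and earlier null vectors remain null. *)
Lemma clinear_iab h (u : V) : psd11 h -> 0 < h u (J u) ->
  exists al, [/\ clinear al, psd11 (fun v w => h v w - iabR al v w),
    forall w, h u w - iabR al u w = 0 &
    forall x, (forall w, h x w = 0) -> forall w, h x w - iabR al x w = 0].
Proof.
move=> p c0; have [l a j pos] := p; set c := h u (J u) in c0.
pose k := (Num.sqrt (2 * c))^-1.
have kk : 2 * (k * k) = c^-1.
  rewrite /k -invfM -expr2 sqr_sqrtr ?mulr_ge0 ?(ltW c0) // invfM mulrA divff ?mul1r //.
pose al v : C := (k * h v (J u)) +i* (- (k * h v u)).
have iE v w : iabR al v w = (h v u * h w (J u) - h v (J u) * h w u) / c.
  rewrite /iabR /al /= -kk; ring.
have Ju v : h (J v) u = - h v (J u) by exact: psd11_J.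
have l1 (x y : R) v w z : h (x *: v + y *: J v + w) z = x * h v z + y * h (J v) z + h w z.
  by rewrite -addrA l l addrA.
exists al; split.
- move=> [x y] v w; rewrite cscaleE /al !l1 !Ju !j /=.
  by apply: complex_ext; rewrite /=; ring.
- split.
  + by move=> t v v' w; rewrite !iE !l; ring.
  + by move=> v w; rewrite !iE (a v w); ring.
  + by move=> v w; rewrite !iE !Ju !j; ring.
  + move=> v; rewrite iE Ju j subr_ge0 ler_pdivrMr //.
    have -> : h v u * h v u - h v (J u) * - h v (J u) = h v u ^+ 2 + h v (J u) ^+ 2 by ring.
    exact: psd11_CS.
- move=> w; rewrite iE; have -> : h u u = 0 by have := a u u; lra.
  by rewrite mul0r sub0r -/c mulNr mulrAC divff ?gt_eqF // mul1r (a u w) opprK subrr.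
- move=> x hx w; rewrite iE !hx; ring.
Qed.

(* Cholesky: clinear_iab splits off one square at a time. *)
Lemma psd11_decomp h : psd11 h -> exists (L : seq (V -> C)),
  (forall k, (k < size L)%N -> clinear (nth (fun=> 0) L k)) /\
  forall v w, h v w = \sum_(al <- L) iabR al v w.
Proof.
move=> p.
have [L [h' [cL p' hE h0]]] : exists (L : seq (V -> C)) h',
    [/\ forall k, (k < size L)%N -> clinear (nth (fun=> 0) L k), psd11 h',
     forall v w, h v w = h' v w + \sum_(al <- L) iabR al v w
     & forall j : 'I_n, j \in enum 'I_n -> forall w, h' (bas R (inl j)) w = 0].
  elim: (enum 'I_n) => [|j l [L [h' [cL p' hE h0]]]].
    by exists [::], h; split=> // v w; rewrite big_nil addr0.
  set u := bas R (inl j); have [_ _ _ /(_ u)] := p'; rewrite le_eqVlt => /orP[/eqP e|pos].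
    exists L, h'; split=> // k; rewrite inE => /predU1P[-> w|]; last exact: h0.
    have := psd11_CS w u p'; rewrite -e mulr0 => q.
    have [_ a _ _] := p'; rewrite a; apply/eqP; rewrite oppr_eq0 -sqrf_eq0 eq_le sqr_ge0 andbT.
    by apply: le_trans q; rewrite lerDl sqr_ge0.
  have [al [cal pal al0 alk]] := clinear_iab p' pos.
  exists (al :: L), (fun v w => h' v w - iabR al v w); split=> //.
  - by case=> [|k] kL; [exact: cal|exact: cL].
  - by move=> v w; rewrite hE big_cons addrA subrK.
  - by move=> k; rewrite inE => /predU1P[-> //|kl]; apply: alk; exact: h0.
exists L; split=> // v w; rewrite hE; have -> : h' v w = 0; last by rewrite add0r.
have [l a j _] := p'.
have b0 i : h' (bas R i) w = 0.
  case: i => i; first by apply: h0; rewrite mem_enum.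
  by rewrite -J_bas psd11_J // h0 ?oppr0 ?mem_enum.
rewrite (crdE v); elim: (index_enum _) => [|i r IH]; last by rewrite big_cons l b0 IH mulr0 addr0.
by rewrite big_nil; have := l (-1) 0 0 w; rewrite scaler0 addr0; lra.
Qed.

(** In bidegree (1, 1) positivity on complex lines already gives strong positivity, by
    diagonalization. *)
Lemma sp_psd11 a : bidegree 1 1 a -> (forall s, Im (a s) = 0) ->
  (forall v, 0 <= Re (a [:: v; J v])) -> strongly_positive 1 a.
Proof.
move=> [/alternatingP[ha la aa] ba] ra pa.
pose h v w := Re (a [:: v; w]).
have aE v w : a [:: v; w] = (h v w)%:C.
  by apply: complex_ext => /=.
have p : psd11 h.
  split=> [t v v' w|v w|v w|//].
  - by rewrite /h mlin_head // ReD ReM /= mul0r subr0.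
  - by rewrite /h (adjalt_swap [::] [::] v w la aa) /= ReN opprK.
  - have := ba 'i [:: v; w]; rewrite /h /= => ->; rewrite !expr1.
    have -> : 'i * conjc 'i = 1 :> C by apply: complex_ext; rewrite /=; ring.
    by rewrite mul1r.
have [L [cL hE]] := psd11_decomp p.
apply/strongly_positiveE; exists (size L), (fun=> 1), (fun k => [:: nth (fun=> 0) L k]).
split=> // [k [|//] _|s]; first exact: cL.
have -> : \sum_(k < size L) 1%:C * Eform [:: nth (fun=> 0) L k] s =
    \sum_(al <- L) i_alpha_bar al s.
  rewrite (big_nth (fun=> 0)) big_mkord; apply: eq_bigr => k _.
  by rewrite mul1r /Eform /= wedge1r.
case: s => [|v [|w [|x s]]]; try by rewrite big1_seq ?ha // => al _; rewrite iabE.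
rewrite aE hE rmorph_sum; apply: eq_bigr => al _; by rewrite iab_real.
Qed.

End StrongPositivity.

(** * Currents of order 0 *)

Section Glue.
Variables (R : realType) (n : nat) (X : complexManifold R n).
Local Notation V := (Cn R n).
Local Notation C := R[i].
Local Notation Re := complex.Re.
Local Notation Im := complex.Im.
Implicit Types (c : chartIdx X) (f g b : X -> R) (x y : X) (phi psi : diffForm X)
  (s : seq V).

Lemma open_off c (K : set X) : compact K ->
  open [set w | chart_image c w /\ ~ K (chart_param c w)].
Proof.
move=> cK; have clK : closed K by apply: compact_closed => //; exact: manifold_hausdorff.
rewrite openE => w [iw nw].
have h1 : \forall y \near w, chart_image c y.
  by apply: open_nbhs_nbhs; split=> //; exact: image_open.
have h2 : \forall y \near w, (~` K) (chart_param c y).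
  by apply: (param_continuous iw); apply: open_nbhs_nbhs; split=> //; exact: closed_openC.
exact: filterS2 h1 h2.
Qed.

Lemma smooth_form_glue c (K : set X) phi : compact K -> K `<=` chart_dom c ->
  (forall x, ~ K x -> forall s, phi x s = 0) ->
  (forall z, chart_image c z -> mlin (local_expr c phi z)) ->
  lsm (chart_image c) (local_expr c phi) -> smooth_form phi.
Proof.
move=> cK KD phi0 ml sl c' s.
suff H z : chart_image c' z -> exists U : set V, [/\ open U, U z &
    csm U (fun w => local_expr c' phi w s)].
  by split=> l z iz; have [U [_ Uz [h1 h2]]] := H z iz; [exact: h1|exact: h2].
move=> iz; have [dz|ndz] := pselect (chart_dom c (chart_param c' z)).
  exists (overlap c' c); split; [exact: overlap_open|exact/overlapP|].
  have oO := @overlap_open _ _ X c' c.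
  apply: (@csm_eq _ _ _ (fun w => local_expr c phi (trans c' c w)
      (map (fun v => tder (trans c' c) w v) s)) _ oO) => [w ow|].
    rewrite (local_expr_trans phi s ow); congr (local_expr c phi _ _).
    by apply: eq_map => v; exact: tderE.
  apply: (@lsm_pull_gen R n (trans c' c) (overlap c' c) oO (@trans_smooth _ _ X c' c)
    (fun w => local_expr c phi (trans c' c w))) => [t|w ow].
    apply: (@csm_comp _ _ (trans c' c) (fun w => local_expr c phi w t) _ (chart_image c)) => //.
    + exact: trans_image.
    + exact: trans_smooth.
  by apply: ml; exact: trans_image.
exists [set w | chart_image c' w /\ ~ K (chart_param c' w)].
have oU := @open_off c' K cK; split=> //; first by split=> // /KD.
apply: (csm_eq oU) (csm_cst (0 : C) oU) => w [_ nK].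
by rewrite /local_expr phi0.
Qed.

(** Transports constant-coefficient forms of a chart to the manifold, so that [span_sp] yields
    strongly positive test forms. The factor [b] is meant to have compact support in the chart. *)
Definition pform c (a : seq V -> C) b : diffForm X := fun x s =>
  if pselect (chart_dom c x) then (b x)%:C * a (map (fun v =>
    'D_v (trans (chartAt x) c) (chart_coord (chartAt x) x)) s) else 0.

Lemma local_pform c a b z s : chart_image c z ->
  local_expr c (pform c a b) z s = (b (chart_param c z))%:C * a s.
Proof.
move=> iz; have dz := image_param iz.
rewrite /local_expr /pform; case: pselect => // dz'; congr (_ * a _).
rewrite -map_comp -[RHS]map_id; apply: eq_map => v /=.
have o := overlap_chartAt iz.
have -> : chart_coord (chartAt (chart_param c z)) (chart_param c z) =
  trans c (chartAt (chart_param c z)) z by [].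
have e := trans_comp v o dz.
by apply: etrans e _; exact: trans_id.
Qed.


Lemma pform_smooth c k a b (K : set X) : alternating k a -> smooth_fun b ->
  compact K -> K `<=` chart_dom c -> (forall x, ~ K x -> b x = 0) ->
  smooth_form (pform c a b).
Proof.
move=> /alternatingP[_ la _] sb cK KD b0; apply: (smooth_form_glue cK KD).
- by move=> x /b0 bx s; rewrite /pform bx mul0r; case: pselect.
- move=> z iz s1 s2 t v w; rewrite !local_pform // la; ring.
- move=> s; have oI := @image_open _ _ X c.
  apply: (csm_eq oI) => [z iz|]; first by rewrite local_pform.
  by apply: csmM (csm_cst _ oI) => //; apply: csm_real => //; exact: sb.
Qed.

Lemma chartAt_trans_lin c x : chart_dom c x ->
  (forall (t : R) v w, 'D_(t *: v + w) (trans (chartAt x) c) (chart_coord (chartAt x) x) =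
    t *: 'D_v (trans (chartAt x) c) (chart_coord (chartAt x) x) +
    'D_w (trans (chartAt x) c) (chart_coord (chartAt x) x)) /\
  (forall (z : C) v, 'D_(cscale z v) (trans (chartAt x) c) (chart_coord (chartAt x) x) =
    cscale z ('D_v (trans (chartAt x) c) (chart_coord (chartAt x) x))).
Proof.
move=> dx; have o : overlap (chartAt x) c (chart_coord (chartAt x) x).
  by exists x => //; split=> //; exact: dom_chartAt.
by split=> *; [exact: trans_lin|exact: trans_cscale].
Qed.

Lemma pform_bidegree c p q a b (K : set X) : bidegree p q a -> smooth_fun b ->
  compact K -> K `<=` chart_dom c -> (forall x, ~ K x -> b x = 0) ->
  form_bidegree p q (pform c a b).
Proof.
move=> ba sb cK KD b0; split; first exact: (pform_smooth ba.1 sb cK KD b0).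
move=> x; rewrite /pform; case: pselect => [dx|ndx]; last exact: bidegree0.
have [h1 h2] := chartAt_trans_lin dx.
exact: bidegreeZ (bidegree_map h1 h2 ba).
Qed.

Lemma Eform_map (A : V -> V) (gs : seq (V -> C)) s :
  Eform gs (map A s) = Eform [seq (fun v => g (A v)) | g : V -> C <- gs] s.
Proof.
elim: gs s => [|g gs IH] s; first by case: s.
rewrite /Eform /= -!/(Eform _) wedge_map; congr (wedge_alt _ _ s).
  apply/funext => t; rewrite /= !iabE; by case: t => [|v [|w [|y t]]].
by apply/funext => t; rewrite /= IH.
Qed.

Lemma pform_sp c r gs b (K : set X) : size gs = r ->
  (forall k, (k < r)%N -> clinear (nth (fun=> 0) gs k)) -> smooth_fun b ->
  (forall x, 0 <= b x) ->
  compact K -> K `<=` chart_dom c -> (forall x, ~ K x -> b x = 0) ->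
  sp_test_form r (pform c (Eform gs) b).
Proof.
move=> sg cg sb bp cK KD b0; split.
  apply: pform_bidegree KD b0 => //; have := @Eform_bidegree R n gs.
  by rewrite sg; apply.
move=> x; rewrite /pform; case: pselect => [dx|ndx]; last exact: sp0.
apply: spZ => //; have [h1 h2] := chartAt_trans_lin dx.
set A := fun v => 'D_v _ _ in h1 h2 *.
have -> : (fun s => Eform gs (map A s)) = Eform [seq (fun v => g (A v)) | g : V -> C <- gs].
  by apply/funext => s; exact: Eform_map.
apply: sp_Eform; first by rewrite size_map.
move=> k kr; rewrite (nth_map (fun=> 0)) ?sg // => z v w /=.
have -> : A (cscale z v + w) = cscale z (A v) + A w.
  by rewrite -h2; have := h1 1 (cscale z v) w; rewrite !scale1r.
exact: cg.
Qed.

Hypothesis X_compact : compact [set: X].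

(** The weights h_k = prod_(i<k) (1 - b_i^2) make the sum of the h_k b_k^2 telescope to 1 - prod (1
    - b_i^2), which is 1 since some b_k equals 1 at each point. The square lets one factor b_k
    localize a test form and the other its coefficient. *)
Lemma partition_unity (W : X -> set X) : (forall x, open (W x) /\ W x x) ->
  exists (N : nat) (x : 'I_N -> X) (b h : 'I_N -> X -> R) (K : 'I_N -> set X),
  [/\ forall k, smooth_fun (b k) /\ (forall y, 0 <= b k y),
      forall k, smooth_fun (h k) /\ (forall y, 0 <= h k y),
      forall k, compact (K k) /\ K k `<=` W (x k) `&` chart_dom (chartAt (x k)),
      forall k y, ~ K k y -> b k y = 0
    & forall y, \sum_k h k y * b k y * b k y = 1].
Proof.
move=> WP.
pose Q x b := [/\ smooth_fun b, forall y, 0 <= b y <= 1 & exists K : set X,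
  [/\ compact K, K `<=` W x `&` chart_dom (chartAt x) & forall y, ~ K y -> b y = 0]].
have [|l [lQ lc]] := @finite_bumps _ _ X X_compact Q.
  move=> x; have [oW Wx] := WP x; have [b [K [sb b01 b1 cK [KW b0]]]] := bump_exists oW Wx.
  by exists b; split=> //; split=> //; exists K.
pose b (k : 'I_(size l)) := nth (fun=> 0) l k.
have [x bx] : exists x : 'I_(size l) -> X, forall k, Q (x k) (b k).
  by apply: (@pick_fun _ _ (fun k x => Q x (b k))) => k; exact: lQ.
have [K bK] : exists K : 'I_(size l) -> set X, forall k,
    [/\ compact (K k), K k `<=` W (x k) `&` chart_dom (chartAt (x k)) & forall y, ~ K k y -> b k y = 0].
  apply: (@pick_fun _ _ (fun k K => [/\ compact K, K `<=` W (x k) `&` chart_dom (chartAt (x k))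
    & forall y, ~ K y -> b k y = 0])) => k.
  by have [_ _] := bx k.
pose bb (i : nat) : X -> R := nth (fun=> 0) l i.
have sbb i : smooth_fun (bb i) /\ forall y, 0 <= bb i y <= 1.
  have [il|il] := ltnP i (size l); first by have [y [s1 s2 _]] := lQ i il.
  rewrite /bb nth_default //; split; first exact: sfun_cst.
  by move=> y; rewrite lexx ler01.
pose h (k : 'I_(size l)) y := \prod_(i < k) (1 - bb i y * bb i y).
have h1 i y : 0 <= 1 - bb i y * bb i y.
  by have /andP[u0 u1] := (sbb i).2 y; rewrite subr_ge0 mulr_ile1.
exists (size l), x, b, h, K; split.
- by move=> k; have [s1 s2 _] := bx k; split=> // y; have /andP[] := s2 y.
- move=> k; split=> [|y]; last by apply: prodr_ge0 => i _; exact: h1.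
  apply: sfun_prod => i; apply: sfunB; first exact: sfun_cst.
  by apply: sfunM; exact: (sbb i).1.
- by move=> k; have [? ? _] := bK k.
- by move=> k; have [_ _] := bK k.
move=> y; have tel N : \sum_(k < N) (\prod_(i < k) (1 - bb i y * bb i y)) * bb k y * bb k y =
    1 - \prod_(i < N) (1 - bb i y * bb i y).
  elim: N => [|N IH]; first by rewrite !big_ord0 subrr.
  by rewrite big_ord_recr /= IH big_ord_recr /=; ring.
rewrite tel; have [k kl e] := lc y.
by rewrite (bigD1 (Ordinal kl)) //= /bb e mulr1 subrr mul0r subr0.
Qed.

End Glue.

(** * Positive currents have order 0 *)

Section Currents.
Variables (R : realType) (n : nat) (X : complexManifold R n).
Local Notation V := (Cn R n).
Local Notation C := R[i].
Local Notation Re := complex.Re.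
Local Notation Im := complex.Im.
Local Notation Borel := (g_sigma_algebraType (@open X)).
Hypothesis X_compact : compact [set: X].
Implicit Types (c : chartIdx X) (f g b u v : X -> R) (x y : X) (phi psi sg : diffForm X)
  (s : seq V) (S : current X).

(** These properties are indexed by the bidegree of the test forms rather than by that of the
    current, so that shifts in the products are successors instead of truncated subtractions. *)
Definition linc r S := forall (a : C) phi psi, form_bidegree r r phi ->
  form_bidegree r r psi -> S (fadd (fscale a phi) psi) = a * S phi + S psi.

Definition posc r S := forall phi, sp_test_form r phi -> 0 <= S phi.

Definition ordc r S := forall phi, form_bidegree r r phi ->
  order0 (fun f => Re (S (fmul f phi))) /\ order0 (fun f => Im (S (fmul f phi))).

Lemma linc0 r S : linc r S -> S (@fzero R n X) = 0.
Proof.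
move=> lS; have := lS 1 _ _ (bid_fzero X r r) (bid_fzero X r r).
have -> : fadd (fscale 1 (@fzero R n X)) (@fzero R n X) = @fzero R n X.
  by apply/funext => x; apply/funext => s; rewrite /fadd /fscale /fzero mulr0 addr0.
by rewrite mul1r => h; apply: (addrI (S (@fzero R n X))); rewrite -h addr0.
Qed.

Lemma lincD r S phi psi : linc r S -> form_bidegree r r phi -> form_bidegree r r psi ->
  S (fadd phi psi) = S phi + S psi.
Proof.
move=> lS h1 h2; have := lS 1 _ _ h1 h2; rewrite mul1r => <-; congr (S _).
by apply/funext => x; apply/funext => s; rewrite /fadd /fscale mul1r.
Qed.

Lemma lincZ r S (a : C) phi : linc r S -> form_bidegree r r phi ->
  S (fscale a phi) = a * S phi.
Proof.
move=> lS h1; have := lS a _ _ h1 (bid_fzero X r r); rewrite (linc0 lS) addr0 => <-.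
by congr (S _); apply/funext => x; apply/funext => s; rewrite /fadd /fzero addr0.
Qed.

Lemma linc_sum r S (I : Type) (l : seq I) (F : I -> diffForm X) : linc r S ->
  (forall i, form_bidegree r r (F i)) ->
  form_bidegree r r (fun x s => \sum_(i <- l) F i x s) /\
  S (fun x s => \sum_(i <- l) F i x s) = \sum_(i <- l) S (F i).
Proof.
move=> lS bF; elim: l => [|i l [IHb IHS]].
  have -> : (fun x s => \sum_(i <- [::]) F i x s) = @fzero R n X.
    by apply/funext => x; apply/funext => s; rewrite big_nil.
  by rewrite big_nil; split; [exact: bid_fzero|exact: linc0 lS].
have -> : (fun x s => \sum_(j <- i :: l) F j x s) =
    fadd (F i) (fun x s => \sum_(j <- l) F j x s).
  by apply/funext => x; apply/funext => s; rewrite big_cons.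
by rewrite big_cons; split; [exact: bid_fadd|rewrite (lincD lS) // IHS].
Qed.

Lemma Re_sum (I : Type) (l : seq I) (F : I -> C) :
  Re (\sum_(i <- l) F i) = \sum_(i <- l) Re (F i).
Proof. by elim: l => [|i l IH]; rewrite ?big_nil // !big_cons ReD IH. Qed.

Lemma Im_sum (I : Type) (l : seq I) (F : I -> C) :
  Im (\sum_(i <- l) F i) = \sum_(i <- l) Im (F i).
Proof. by elim: l => [|i l IH]; rewrite ?big_nil // !big_cons ImD IH. Qed.

Lemma sp_fmul r f phi : smooth_fun f -> (forall x, 0 <= f x) -> sp_test_form r phi ->
  sp_test_form r (fmul f phi).
Proof.
by move=> sf f0 [bphi sphi]; split; [exact: bid_fmul|move=> x; exact: spZ].
Qed.

Lemma fmulA f g phi : fmul f (fmul g phi) = fmul (fun x => f x * g x) phi.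
Proof. by apply/funext => x; apply/funext => s; rewrite /fmul mulrA rmorphM. Qed.

Lemma fmulDl f g phi : fmul (fun x => f x + g x) phi = fadd (fmul f phi) (fmul g phi).
Proof. by apply/funext => x; apply/funext => s; rewrite /fmul /fadd rmorphD mulrDl. Qed.

Lemma fmulZl (k : R) f phi : fmul (fun x => k * f x) phi = fscale k%:C (fmul f phi).
Proof. by apply/funext => x; apply/funext => s; rewrite /fmul /fscale rmorphM mulrA. Qed.

Lemma fmul_lin f (a : C) phi psi :
  fmul f (fadd (fscale a phi) psi) = fadd (fscale a (fmul f phi)) (fmul f psi).
Proof.
by apply/funext => x; apply/funext => s; rewrite /fmul /fadd /fscale mulrDr mulrCA.
Qed.

Lemma order0_0 : order0 (fun _ : X -> R => 0).
Proof.
have p : posfun (fun _ : X -> R => 0 : R).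
  by split=> [f g _ _|k f _|//]; rewrite ?addr0 ?mulr0.
by exists (fun=> 0), (fun=> 0); split=> // f _; rewrite subr0.
Qed.

Lemma order0_sum (I : Type) (l : seq I) (L : I -> (X -> R) -> R) :
  (forall i, order0 (L i)) -> order0 (fun f => \sum_(i <- l) L i f).
Proof.
move=> oL; elim: l => [|i l IH].
  by apply: order0_eq order0_0 => f _; rewrite big_nil.
have := order0_comb 1 1 (oL i) IH; apply: order0_eq => f sf.
by rewrite big_cons !mul1r.
Qed.

Section Positive.
Variables (r : nat) (S : current X).
Hypotheses (lS : linc r S) (pS : posc r S).

Lemma posc_posfun sg : sp_test_form r sg -> posfun (fun f => Re (S (fmul f sg))).
Proof.
move=> ssg; have bsg := ssg.1; split=> [f g sf sg'|k f sf|f sf f0].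
- by rewrite fmulDl (lincD lS) ?ReD //; exact: bid_fmul.
- rewrite fmulZl (lincZ _ lS) ?ReM /= ?mul0r ?subr0 //; exact: bid_fmul.
- by have := pS (sp_fmul sf f0 ssg); rewrite lecE => /andP[].
Qed.

Lemma smooth_bounded f : smooth_fun f -> exists2 B : R, 0 <= B & forall x, `|f x| <= B.
Proof.
move=> sf; have [_ [B hB]] := smooth_bmeas X_compact sf; exists B => //.
exact: le_trans (hB point).
Qed.

Lemma posc_real sg u : sp_test_form r sg -> smooth_fun u -> Im (S (fmul u sg)) = 0.
Proof.
move=> ssg su; have bsg := ssg.1; have [B B0 hB] := smooth_bounded su.
have h1 : 0 <= S (fmul (fun x => u x + B) sg).
  apply: pS; apply: sp_fmul => //; first by apply: sfunD => //; exact: sfun_cst.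
  by move=> x; have := hB x; rewrite ler_norml; lra.
have h2 : 0 <= S (fmul (fun=> B) sg) by apply: pS; apply: sp_fmul => //; exact: sfun_cst.
move: h1 h2; rewrite fmulDl (lincD lS); [|exact: bid_fmul|exact: (bid_fmul (sfun_cst B))].
rewrite !lecE ImD => /andP[/eqP /= h1 _] /andP[/eqP /= h2 _].
by rewrite h2 addr0 in h1.
Qed.

(** With B a bound of |u|, the form u sg is (u + B) sg - B sg, a difference of strongly positive
    forms. *)
Lemma posc_order0 sg u : sp_test_form r sg -> smooth_fun u ->
  order0 (fun f => Re (S (fmul f (fmul u sg)))).
Proof.
move=> ssg su; have bsg := ssg.1; have [B B0 hB] := smooth_bounded su.
have suB : smooth_fun (fun x => u x + B) by apply: sfunD => //; exact: sfun_cst.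
have p1 : posfun (fun f => Re (S (fmul f (fmul (fun x => u x + B) sg)))).
  apply: posc_posfun; apply: sp_fmul => // x.
  by have := hB x; rewrite ler_norml; lra.
have p2 : posfun (fun f => Re (S (fmul f (fmul (fun=> B) sg)))).
  by apply: posc_posfun; apply: sp_fmul => //; exact: sfun_cst.
exists (fun f => Re (S (fmul f (fmul (fun x => u x + B) sg)))).
exists (fun f => Re (S (fmul f (fmul (fun=> B) sg)))); split=> // f sf.
rewrite !fmulA; have -> : fmul (fun x => f x * (u x + B)) sg =
    fadd (fmul (fun x => f x * u x) sg) (fmul (fun x => f x * B) sg).
  by rewrite -fmulDl; congr fmul; apply/funext => x; rewrite mulrDr.
have sfB : smooth_fun (fun x => f x * B) by apply: sfunM => //; exact: sfun_cst.
rewrite (lincD lS) ?ReD ?addrK //; apply: bid_fmul => //; exact: sfunM.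
Qed.

(** A test form is a finite combination, with smooth coefficients, of localized strongly positive
    forms: [span_sp] in each chart, glued by the partition of unity. Each term has order 0 by
    [posc_order0], and the current is real on it, which separates real and imaginary parts. *)
Lemma posc_ordc : ordc r S.
Proof.
move=> phi bphi.
have [I [g [c [gr gl gc gE]]]] := span_sp R n r.
have [x0|N [x [b [h [K [sb sh cK b0 bh]]]]]] :=
  @partition_unity _ _ X X_compact (fun x => chart_dom (chartAt x)).
  by split; [exact: dom_open|exact: dom_chartAt].
pose ck k := chartAt (x k).
have KD k : K k `<=` chart_dom (ck k) by move=> y /(cK k).2[].
pose ta k i := pform (ck k) (Eform (g i)) (b k).
have spta k i : sp_test_form r (ta k i).
  apply: (@pform_sp _ _ X (ck k) r (g i) (b k) (K k)) => //.
  - by move=> j jr; exact: gl.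
  - exact: (sb k).1.
  - exact: (sb k).2.
  - exact: (cK k).1.
  - exact: b0.
(* One factor [b k] is absorbed here, so that the coefficient extends smoothly by 0 outside the
   chart; the other one is in [ta]. *)
pose co (part : C -> R) k i (y : X) : R :=
  h k y * extend (ck k) (fun z => b k (chart_param (ck k) z) * part (c i (local_expr (ck k) phi z))) y.
have cs k i : csm (chart_image (ck k)) (fun z => c i (local_expr (ck k) phi z)).
  have [l hl] := gc i; have oI := @image_open _ _ X (ck k).
  apply: (csm_eq oI) => [z iz|]; first by rewrite hl.
  by apply: csm_sum => // y; apply: csmZ => //; exact: bphi.1.
have ext k (q : V -> R) : smooth_on (chart_image (ck k)) q ->
    smooth_fun (extend (ck k) (fun z => b k (chart_param (ck k) z) * q z)).
  move=> sq; have oI := @image_open _ _ X (ck k).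
  apply: (@extend_smooth _ _ X (ck k) _ (chart_coord (ck k) @` K k)).
  - apply: smoothM => //; exact: (sb k).1.
  - apply: continuous_compact; last exact: (cK k).1.
    apply: continuous_in_subspaceT => y; rewrite inE => /KD; exact: coord_continuous.
  - by move=> _ [y Ky <-]; apply: coord_image; exact: KD.
  - move=> z iz nK; rewrite b0 ?mul0r // => Kz; apply: nK.
    by exists (chart_param (ck k) z) => //; exact: image_coord.
have sRe k i : smooth_fun (co (@complex.Re R) k i).
  by apply: sfunM; [exact: (sh k).1|apply: ext; exact: (cs k i).1].
have sIm k i : smooth_fun (co (@complex.Im R) k i).
  by apply: sfunM; [exact: (sh k).1|apply: ext; exact: (cs k i).2].
have phiE y s : phi y s = \sum_k \sum_i
    (fmul (co (@complex.Re R) k i) (ta k i) y s + 'i * fmul (co (@complex.Im R) k i) (ta k i) y s).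
  rewrite -[LHS]mul1r -[X in X * _](rmorph1 (real_complex R)) -(bh y) rmorph_sum mulr_suml.
  apply: eq_bigr => k _; rewrite /ta /pform /fmul /co /extend.
  case: pselect => [dy|ndy]; last first.
    rewrite b0; last by move=> /KD.
    by rewrite !mulr0 mul0r big1 // => i _; rewrite !mulr0 addr0.
  set z := chart_coord (ck k) y; have o : overlap (chartAt y) (ck k) (chart_coord (chartAt y) y).
    by exists y => //; split=> //; exact: dom_chartAt.
  have tz : trans (chartAt y) (ck k) (chart_coord (chartAt y) y) = z.
    by rewrite /trans /= coordK //; exact: dom_chartAt.
  have pz : chart_param (ck k) z = y by exact: coordK.
  have iz : chart_image (ck k) z by exact: coord_image.
  rewrite -local_expr_at (local_expr_trans _ _ o) tz.
  rewrite (gE _ (local_expr_bidegree iz bphi.2)) mulr_sumr; apply: eq_bigr => i _.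
  rewrite pz; set m := map _ s; set e := Eform _ _; set q := c i _.
  have qE : q = (Re q)%:C + 'i * (Im q)%:C.
    by case: (q) => a1 a2; apply: complex_ext; rewrite /=; ring.
  have rM (t u : R) : (t * u)%:C = t%:C * u%:C :> C by exact: rmorphM.
  clearbody q e; rewrite /= !rM {1}qE.
  by move: ((h k y)%:C) ((b k y)%:C) ((Re q)%:C) ((Im q)%:C) => a1 a2 a3 a4; ring.
have bt f k i : smooth_fun f -> form_bidegree r r (fmul f (ta k i)).
  by move=> sf; apply: bid_fmul => //; exact: (spta k i).1.
have SE f : smooth_fun f -> S (fmul f phi) = \sum_k \sum_i
    (S (fmul f (fmul (co (@complex.Re R) k i) (ta k i))) + 'i * S (fmul f (fmul (co (@complex.Im R) k i) (ta k i)))).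
  move=> sf; pose F k i := fadd (fscale 'i (fmul f (fmul (co (@complex.Im R) k i) (ta k i))))
    (fmul f (fmul (co (@complex.Re R) k i) (ta k i))).
  have bF1 k i : form_bidegree r r (fmul f (fmul (co (@complex.Re R) k i) (ta k i))).
    by apply: bid_fmul => //; exact: bt.
  have bF2 k i : form_bidegree r r (fmul f (fmul (co (@complex.Im R) k i) (ta k i))).
    by apply: bid_fmul => //; exact: bt.
  have bF k i : form_bidegree r r (F k i) by apply: bid_fadd => //; exact: bid_fscale.
  have -> : fmul f phi = fun y s => \sum_k (fun y s => \sum_i F k i y s) y s.
    apply/funext => y; apply/funext => s; rewrite /fmul phiE mulr_sumr.
    apply: eq_bigr => k _; rewrite mulr_sumr; apply: eq_bigr => i _.
    rewrite /F /fadd /fscale /fmul; move: (ta k i y s) => t.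
    by move: ((f y)%:C) ((_ k i y)%:C) ((_ k i y)%:C) => a1 a2 a3; ring.
  have sumF k := linc_sum (index_enum I) lS (bF k).
  rewrite (linc_sum (index_enum _) lS (fun k => (sumF k).1)).2.
  apply: eq_bigr => k _; rewrite (sumF k).2; apply: eq_bigr => i _.
  by rewrite /F (lS _ (bF2 k i) (bF1 k i)) addrC.
split.
- have o := @order0_sum _ (index_enum _) _ (fun k => @order0_sum _ (index_enum I) _
    (fun i => posc_order0 (spta k i) (sRe k i))).
  apply: order0_eq o => f sf; rewrite SE // Re_sum; apply: eq_bigr => k _.
  rewrite Re_sum; apply: eq_bigr => i _; rewrite ReD ReM /=.
  rewrite fmulA [in RHS](fmulA f (co (@complex.Im R) k i)) (posc_real (spta k i)) ?fmulA; last exact: sfunM.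
  by rewrite mul0r mul1r subrr addr0.
- have o := @order0_sum _ (index_enum _) _ (fun k => @order0_sum _ (index_enum I) _
    (fun i => posc_order0 (spta k i) (sIm k i))).
  apply: order0_eq o => f sf; rewrite SE // Im_sum; apply: eq_bigr => k _.
  rewrite Im_sum; apply: eq_bigr => i _; rewrite ImD ImM /=.
  rewrite [X in _ = Im (S X) + _]fmulA (posc_real (spta k i)); last exact: sfunM.
  by rewrite mul0r mul1r !add0r.
Qed.

End Positive.
End Currents.

(** * Multiplication by Borel functions, and integration by parts *)

Section MulCurrent.
Variables (R : realType) (n : nat) (X : complexManifold R n).
Local Notation V := (Cn R n).
Local Notation C := R[i].
Local Notation Re := complex.Re.
Local Notation Im := complex.Im.
Local Notation Borel := (g_sigma_algebraType (@open X)).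
Hypothesis X_compact : compact [set: X].
Implicit Types (f g u v : X -> R) (x y : X) (phi psi : diffForm X) (s : seq V).

Section Mul.
Variables (r : nat) (S : current X).
Hypotheses (lS : linc r S) (oS : ordc r S).

Lemma mul_linc v : bmeas (v : Borel -> R) -> linc r (mul_current v S).
Proof.
move=> bv a phi psi bphi bpsi.
have [[r1 i1] [r2 i2]] := (oS bphi, oS bpsi).
have blin := bid_fadd (bid_fscale a bphi) bpsi.
have [r3 i3] := oS blin.
have E f : smooth_fun f -> S (fmul f (fadd (fscale a phi) psi)) =
    a * S (fmul f phi) + S (fmul f psi).
  by move=> sf; rewrite fmul_lin lS //; exact: bid_fmul.
have [e1 _] := order0_ext_spec X_compact r1; have [e1' _] := order0_ext_spec X_compact i1.
have [e2 _] := order0_ext_spec X_compact r2; have [e2' _] := order0_ext_spec X_compact i2.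
have hr := extfun_comb 1 1 (extfun_comb (Re a) (- Im a) e1 e1') e2.
have hi := extfun_comb 1 1 (extfun_comb (Re a) (Im a) e1' e1) e2'.
rewrite /mul_current (order0_extE X_compact r3 hr) //; last first.
  move=> f sf; rewrite E // ReD ReM (order0_ext_spec X_compact r1).2 //.
  by rewrite (order0_ext_spec X_compact i1).2 // (order0_ext_spec X_compact r2).2 //; ring.
rewrite (order0_extE X_compact i3 hi) //; last first.
  move=> f sf; rewrite E // ImD ImM (order0_ext_spec X_compact r1).2 //.
  by rewrite (order0_ext_spec X_compact i1).2 // (order0_ext_spec X_compact i2).2 //; ring.
move: (order0_ext _ v) (order0_ext _ v) (order0_ext _ v) (order0_ext _ v) => a1 a2 a3 a4.
by case: a {E blin r3 i3 hr hi} => x y; apply: complex_ext; rewrite /=; ring.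
Qed.

Lemma mul_smooth v phi : smooth_fun v -> form_bidegree r r phi ->
  mul_current v S phi = S (fmul v phi).
Proof.
move=> sv bphi; have [r1 i1] := oS bphi; rewrite /mul_current.
rewrite (order0_ext_spec X_compact r1).2 // (order0_ext_spec X_compact i1).2 //.
by case: (S _).
Qed.

Lemma mul_cvg (F : nat -> X -> R) v (B : R) phi : form_bidegree r r phi ->
  (forall k, measurable_fun setT (F k : Borel -> R)) -> (forall k x, `|F k x| <= B) ->
  (forall x, F k x @[k --> \oo] --> v x) ->
  Re (mul_current (F k) S phi) @[k --> \oo] --> Re (mul_current v S phi) /\
  Im (mul_current (F k) S phi) @[k --> \oo] --> Im (mul_current v S phi).
Proof.
move=> bphi mF bF cF; have [r1 i1] := oS bphi.
have [[_ _ c1] _] := order0_ext_spec X_compact r1.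
have [[_ _ c2] _] := order0_ext_spec X_compact i1.
by split; [exact: c1 cF|exact: c2 cF].
Qed.

Lemma mul_fmul v f phi : bmeas (v : Borel -> R) -> smooth_fun f -> form_bidegree r r phi ->
  mul_current v S (fmul f phi) = mul_current (fun x => f x * v x) S phi.
Proof.
move=> bv sf bphi; have [r1 i1] := oS bphi; have [r2 i2] := oS (bid_fmul sf bphi).
have bf := smooth_bmeas X_compact sf.
rewrite /mul_current; congr (_ +i* _).
- apply: (order0_extE X_compact r2 (extfun_mul bf (order0_ext_spec X_compact r1).1)) => // g sg.
  rewrite (order0_ext_spec X_compact r1).2 ?fmulA; last exact: sfunM.
  by congr (Re (S (fmul _ _))); apply/funext => x; rewrite mulrC.
- apply: (order0_extE X_compact i2 (extfun_mul bf (order0_ext_spec X_compact i1).1)) => // g sg.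
  rewrite (order0_ext_spec X_compact i1).2 ?fmulA; last exact: sfunM.
  by congr (Im (S (fmul _ _))); apply/funext => x; rewrite mulrC.
Qed.

Lemma mul_ordc v : bmeas (v : Borel -> R) -> ordc r (mul_current v S).
Proof.
move=> bv phi bphi; have [r1 i1] := oS bphi; split.
- apply: order0_eq (order0_mul X_compact r1 bv) => f sf; rewrite mul_fmul //=.
  by congr (order0_ext _ _); apply/funext => x; rewrite mulrC.
- apply: order0_eq (order0_mul X_compact i1 bv) => f sf; rewrite mul_fmul //=.
  by congr (order0_ext _ _); apply/funext => x; rewrite mulrC.
Qed.

End Mul.

Definition clos r (S : current X) := forall psi,
  (form_bidegree r r.+1 psi -> S (del psi) = 0) /\
  (form_bidegree r.+1 r psi -> S (delbar psi) = 0).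

Lemma alt_of p q phi : form_bidegree p q phi -> forall x, alternating (p + q) (phi x).
Proof. by move=> [_ h] x; have [] := h x. Qed.

(** The two components have bidegrees (2, 1) and (1, 2). Scaling the vectors by i multiplies them by
    i and -i respectively, so the vanishing of the sum separates. *)
Lemma del_closed theta : closed_real11 theta ->
  del theta = @fzero R n X /\ delbar theta = @fzero R n X.
Proof.
move=> [b11 _ d0]; have [_ b21] := del_bidegree b11; have [_ b12] := delbar_bidegree b11.
suff H x s : del theta x s = 0 /\ delbar theta x s = 0.
  by split; apply/funext => x; apply/funext => s; have [] := H x s.
have e t : del theta x t + delbar theta x t = 0.
  by have := congr1 (fun phi : diffForm X => phi x t) d0.
have := e (map (cscale 'i) s); rewrite (b21 x).2 (b12 x).2.
have := e s; move: (del _ x s) (delbar _ x s) => a b ab.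
have i0 : 'i != 0 :> C by rewrite -sqrf_eq0 sqr_i oppr_eq0 oner_eq0.
have c1 : 'i ^+ 2 * conjc 'i ^+ 1 = 'i :> C by apply: complex_ext; rewrite /=; ring.
have c2 : 'i ^+ 1 * conjc 'i ^+ 2 = - 'i :> C by apply: complex_ext; rewrite /=; ring.
rewrite c1 c2 mulNr -mulrBr => /eqP; rewrite mulf_eq0 (negbTE i0) /= => /eqP ab'.
have n2 : 2 != 0 :> C by rewrite pnatr_eq0.
split; apply: (mulfI n2); rewrite mulr0.
  have -> : 2 * a = (a + b) + (a - b) by ring.
  by rewrite ab ab' addr0.
have -> : 2 * b = (a + b) - (a - b) by ring.
by rewrite ab ab' subr0.
Qed.

Lemma fderiv_wedge_even e p q phi psi : form_bidegree p q phi -> ~~ odd (p + q) ->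
  smooth_form psi -> fderiv e (fwedge phi psi) =
  fadd (fwedge (fderiv e phi) psi) (fwedge phi (fderiv e psi)).
Proof.
move=> bphi ev spsi; rewrite fderiv_wedge //; last exact: bphi.1.
by rewrite (fsgn_even (alt_of bphi)).
Qed.

Lemma fderiv_wedge_odd e p q phi psi : form_bidegree p q phi -> odd (p + q) ->
  smooth_form psi -> fderiv e (fwedge phi psi) =
  fadd (fwedge (fderiv e phi) psi) (fopp (fwedge phi (fderiv e psi))).
Proof.
move=> bphi od spsi; rewrite fderiv_wedge //; last exact: bphi.1.
rewrite (fsgn_odd (alt_of bphi)) //; congr fadd.
by apply/funext => x; apply/funext => s; rewrite /fwedge /fopp wedgeNl.
Qed.

Lemma fadd0 phi : fadd (@fzero R n X) phi = phi.
Proof. by apply/funext => x; apply/funext => s; rewrite /fadd add0r. Qed.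

Lemma fadd0r phi : fadd phi (@fzero R n X) = phi.
Proof. by apply/funext => x; apply/funext => s; rewrite /fadd addr0. Qed.

Section Ddc.
Variable kappa : R.

Lemma ddc_bidegree r phi : form_bidegree r r phi ->
  form_bidegree r.+1 r.+1 (ddc kappa phi).
Proof.
by move=> b; apply: bid_fscale; apply: del_bidegree; exact: delbar_bidegree.
Qed.

Lemma ddc_lin r (a : C) phi psi : form_bidegree r r phi -> form_bidegree r r psi ->
  ddc kappa (fadd (fscale a phi) psi) = fadd (fscale a (ddc kappa phi)) (ddc kappa psi).
Proof.
move=> b1 b2; have := (delbar_bidegree b1).1; have := (delbar_bidegree b2).1.
rewrite /ddc !delE !delbarE => s2 s1; rewrite (fderiv_lin _ _ b1.1 b2.1) (fderiv_lin _ _ s1 s2).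
by apply/funext => x; apply/funext => s; rewrite /fscale /fadd mulrDr mulrCA.
Qed.

Lemma fscale0 (a : C) : fscale a (@fzero R n X) = @fzero R n X.
Proof. by apply/funext => x; apply/funext => s; rewrite /fscale /fzero mulr0. Qed.

Lemma fderiv0 e : fderiv e (@fzero R n X) = @fzero R n X.
Proof.
have := fderiv_lin e (-1) (@smooth_fzero R n X) (@smooth_fzero R n X).
have -> : fadd (fscale (-1) (@fzero R n X)) (@fzero R n X) = @fzero R n X.
  by rewrite fscale0 fadd0.
by move=> ->; apply/funext => x; apply/funext => s; rewrite /fadd /fscale mulN1r addNr.
Qed.

Lemma ddc_del p q phi : form_bidegree p q phi ->
  ddc kappa (del phi) = @fzero R n X /\ ddc kappa (delbar phi) = @fzero R n X.
Proof.
move=> b; have k1 := kform_bidegree b.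
rewrite /ddc !delE !delbarE (fderiv_anticomm (- 'i) 'i (kform_fderiv (- 'i) k1)).
rewrite (fderiv_sq _ k1) (fderiv_sq 'i k1) !fderiv0 fscale0; split=> //.
by apply/funext => x; apply/funext => s; rewrite /fscale /fopp /fzero oppr0 mulr0.
Qed.

Lemma ddc_wedge_closed r theta phi : form_bidegree 1 1 theta -> del theta = @fzero R n X ->
  delbar theta = @fzero R n X -> form_bidegree r r phi ->
  ddc kappa (fwedge theta phi) = fwedge theta (ddc kappa phi).
Proof.
rewrite /ddc !delE !delbarE => bt d1 d2 b.
have s1 := (kform_fderiv 'i (kform_bidegree b)).1.
rewrite (fderiv_wedge_even 'i bt isT b.1) d2 fwedge0l fadd0.
rewrite (fderiv_wedge_even (- 'i) bt isT s1) d1 fwedge0l fadd0.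
by apply/funext => x; apply/funext => s; rewrite /fscale /fwedge wedgeZr.
Qed.

(** Two applications of the Leibniz rule move del delbar from [phi] to [v]; the error consists of a
    del-exact and a delbar-exact form, on which the closed current vanishes. This needs a smooth
    [v]. *)
Lemma ddc_by_parts r (S : current X) v phi : linc r.+1 S -> clos r S -> smooth_fun v ->
  form_bidegree r r phi ->
  S (fmul v (ddc kappa phi)) = S (fwedge (ddc kappa (fmul v (@fone R n X))) phi).
Proof.
move=> lS cS sv b; set F := fmul v (@fone R n X).
have bF : form_bidegree 0 0 F by apply: bid_fmul => //; exact: bid_fone.
have bdF : form_bidegree 1 0 (del F) := del_bidegree bF.
have bbF : form_bidegree 0 1 (delbar F) := delbar_bidegree bF.
have bb : form_bidegree r r.+1 (delbar phi) := delbar_bidegree b.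
have e1 : del (fwedge F (delbar phi)) =
    fadd (fwedge (del F) (delbar phi)) (fwedge F (del (delbar phi))).
  by rewrite !delE; apply: (fderiv_wedge_even _ bF isT); exact: bb.1.
have e2 : delbar (fwedge (del F) phi) =
    fadd (fwedge (delbar (del F)) phi) (fopp (fwedge (del F) (delbar phi))).
  by rewrite !delbarE; apply: (fderiv_wedge_odd _ bdF isT); exact: b.1.
have e3 : delbar (del F) = fopp (del (delbar F)).
  by rewrite !delE !delbarE; exact: (fderiv_anticomm _ _ (kform_bidegree bF)).
have c1 : S (del (fwedge F (delbar phi))) = 0.
  by apply: (cS _).1; exact: (bid_fwedge bF bb).
have c2 : S (delbar (fwedge (del F) phi)) = 0.
  by apply: (cS _).2; exact: (bid_fwedge bdF b).
have k1 : form_bidegree r.+1 r.+1 (del (fwedge F (delbar phi))).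
  by apply: del_bidegree; exact: (bid_fwedge bF bb).
have k2 : form_bidegree r.+1 r.+1 (delbar (fwedge (del F) phi)).
  by apply: delbar_bidegree; exact: (bid_fwedge bdF b).
have k3 : form_bidegree r.+1 r.+1 (fwedge (del (delbar F)) phi).
  exact: (bid_fwedge (del_bidegree bbF) b).
(* The products of del F with delbar phi in the two exact forms cancel, and anticommutation turns
   delbar del F into - del delbar F. *)
have -> : fmul v (ddc kappa phi) = fscale (0 +i* kappa) (fadd (fwedge (del (delbar F)) phi)
    (fadd (del (fwedge F (delbar phi))) (delbar (fwedge (del F) phi)))).
  rewrite e1 e2 e3 fmul_wedge -/F; apply/funext => x; apply/funext => s.
  rewrite /ddc /fscale /fadd /fwedge /fopp wedgeZr wedgeNl; congr (_ * _).
  by move: (wedge_alt _ _ s) (wedge_alt _ _ s) (wedge_alt _ _ s) => a1 a2 a3; ring.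
rewrite (lincZ _ lS); last by do 2! apply: bid_fadd => //.
rewrite (lincD lS) //; last exact: bid_fadd.
rewrite (lincD lS k1 k2) c1 c2 !addr0 -(lincZ _ lS k3); congr (S _).
by apply/funext => x; apply/funext => s; rewrite /ddc /fscale /fwedge wedgeZl.
Qed.

Section Bedford.
Variables (r : nat) (S : current X) (v : X -> R) (theta : diffForm X).
Hypotheses (lS : linc r.+1 S) (oS : ordc r.+1 S) (cS : forall t, (t.+1 = r.+1)%N -> clos t S)
  (bv : bmeas (v : Borel -> R)) (ct : closed_real11 theta).

Let bt := bedford_taylor kappa v theta S.

Lemma bt_linc : linc r bt.
Proof.
move=> a phi psi b1 b2; have bth : form_bidegree 1 1 theta by case: ct.
have lv := mul_linc lS oS bv.
rewrite /bt /bedford_taylor /ddc_current /wedge_current (ddc_lin a b1 b2).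
rewrite lv; [|exact: ddc_bidegree|exact: ddc_bidegree].
have -> : fwedge theta (fadd (fscale a phi) psi) =
    fadd (fscale a (fwedge theta phi)) (fwedge theta psi).
  by apply/funext => x; apply/funext => s; rewrite /fwedge /fadd /fscale wedgeDr wedgeZr.
rewrite lS; [|exact: (bid_fwedge bth b1)|exact: (bid_fwedge bth b2)].
by rewrite mulrDr addrACA.
Qed.

(** The dd^c term is closed since dd^c annihilates del- and delbar-exact forms; in the other term
    the closed form [theta] passes through del and delbar. *)
Lemma bt_clos t : (t.+1 = r)%N -> clos t bt.
Proof.
move=> tr psi; have bth : form_bidegree 1 1 theta by case: ct.
have [d1 d2] := del_closed ct.
have lv := mul_linc lS oS bv; have m0 : mul_current v S (@fzero R n X) = 0 := linc0 lv.
rewrite /bt /bedford_taylor /ddc_current /wedge_current; split=> b.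
  rewrite (ddc_del b).1 m0 add0r.
  have e : del (fwedge theta psi) = fwedge theta (del psi).
    rewrite !delE; move: d1; rewrite delE => d1.
    by rewrite (fderiv_wedge_even _ bth isT b.1) d1 fwedge0l fadd0.
  by rewrite -e; apply: (cS (t := r) erefl _).1; rewrite -tr; exact: (bid_fwedge bth b).
rewrite (ddc_del b).2 m0 add0r.
have e : delbar (fwedge theta psi) = fwedge theta (delbar psi).
  rewrite !delbarE; move: d2; rewrite delbarE => d2.
  by rewrite (fderiv_wedge_even _ bth isT b.1) d2 fwedge0l fadd0.
by rewrite -e; apply: (cS (t := r) erefl _).2; rewrite -tr; exact: (bid_fwedge bth b).
Qed.

(** Against a dd^c-closed form the term with [v] disappears, and the new test form is again
    dd^c-closed, so the step can be iterated. This is how integrals become independent of the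
    truncation level. *)
Lemma bt_stokes phi : form_bidegree r r phi -> ddc kappa phi = @fzero R n X ->
  bt phi = S (fwedge theta phi) /\ ddc kappa (fwedge theta phi) = @fzero R n X.
Proof.
move=> b d; have bth : form_bidegree 1 1 theta by case: ct.
have [d1 d2] := del_closed ct.
rewrite /bt /bedford_taylor /ddc_current /wedge_current d (linc0 (mul_linc lS oS bv)) add0r.
by rewrite (ddc_wedge_closed bth d1 d2 b) d fwedge0r.
Qed.

End Bedford.

Section Omega.
Variable omega : diffForm X.
Hypotheses (bom : form_bidegree 1 1 omega) (om1 : del (delbar omega) = @fzero R n X)
  (om2 : fwedge (del omega) (delbar omega) = @fzero R n X).

(** The induction needs the mixed products of del omega with delbar omega^r, and of delbar omega
    with del omega^r, to vanish as well. In the Leibniz expansion of del delbar omega^(r+1) the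
    hypotheses and these products kill every term. *)
Lemma ddc_fpow r : ddc kappa (fpow omega r) = @fzero R n X.
Proof.
suff [_ _ h] : [/\ fwedge (del omega) (delbar (fpow omega r)) = @fzero R n X,
    fwedge (delbar omega) (del (fpow omega r)) = @fzero R n X
    & del (delbar (fpow omega r)) = @fzero R n X] by rewrite /ddc h fscale0.
have bd := del_bidegree bom; have bb := delbar_bidegree bom.
have bp := bid_fpow _ bom.
have om3 : fwedge (delbar omega) (del omega) = @fzero R n X.
  apply/funext => x; apply/funext => s.
  have [[h1 _ _] _] := bb.2 x; have [[h2 _ _] _] := bd.2 x.
  rewrite /fwedge (wedgeC s h1 h2).
  by have := congr1 (fun phi : diffForm X => phi x s) om2; rewrite /fwedge => ->; rewrite mulr0.
elim: r => [|r [IH1 IH2 IH3]].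
  have d0 e : fderiv e (@fone R n X) = @fzero R n X.
    apply/funext => x; apply/funext => s; rewrite /fderiv laltE sumaltE big1 // => i _.
    have -> : local_expr (chartAt x) (@fone R n X) = fun _ => @unit_form R n.
      by apply/funext => z; apply/funext => -[].
    by rewrite Dp_cst mulr0.
  by rewrite /= !delE !delbarE !d0 !fwedge0r fderiv0.
have eb : delbar (fpow omega r.+1) =
    fadd (fwedge (delbar omega) (fpow omega r)) (fwedge omega (delbar (fpow omega r))).
  by rewrite !delbarE; apply: (fderiv_wedge_even _ bom isT); exact: (bp r).1.
have ed : del (fpow omega r.+1) =
    fadd (fwedge (del omega) (fpow omega r)) (fwedge omega (del (fpow omega r))).
  by rewrite !delE; apply: (fderiv_wedge_even _ bom isT); exact: (bp r).1.
have wD a b d : fwedge a (fadd b d) = fadd (fwedge a b) (fwedge a d).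
  by apply/funext => x; apply/funext => s; rewrite /fwedge wedgeDr.
have cd : fwedge (del omega) omega = fwedge omega (del omega).
  by apply: (fwedgeC_even (alt_of bd) (alt_of bom)).
have cb : fwedge (delbar omega) omega = fwedge omega (delbar omega).
  by apply: (fwedgeC_even (alt_of bb) (alt_of bom)).
have bpb := delbar_bidegree (bp r).
split.
- by rewrite eb wD !fwedgeA om2 fwedge0l fadd0 cd -fwedgeA IH1 fwedge0r.
- by rewrite ed wD !fwedgeA om3 fwedge0l fadd0 cb -fwedgeA IH2 fwedge0r.
rewrite eb delE.
have s1 : smooth_form (fwedge (delbar omega) (fpow omega r)).
  by apply: smooth_fwedge; [exact: bb.1|exact: (bp r).1].
have s2 : smooth_form (fwedge omega (delbar (fpow omega r))).
  by apply: smooth_fwedge; [exact: bom.1|exact: bpb.1].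
have fD a b e : smooth_form a -> smooth_form b ->
    fderiv e (fadd a b) = fadd (fderiv e a) (fderiv e b).
  move=> sa sb; have := fderiv_lin e 1 sa sb.
  have sc1 d : fscale 1 d = d by apply/funext => x; apply/funext => s; rewrite /fscale mul1r.
  by rewrite !sc1.
rewrite fD // (fderiv_wedge_odd _ bb isT (bp r).1) (fderiv_wedge_even _ bom isT bpb.1).
move: om1 IH2 IH1 IH3; rewrite !delE => -> -> -> ->.
rewrite fwedge0l fwedge0r !fadd0 fadd0r; apply/funext => x; apply/funext => s.
by rewrite /fopp /fzero oppr0.
Qed.

End Omega.
End Ddc.
End MulCurrent.

(** * Smoothing of plurisubharmonic functions *)

Section LineIntegral.
Variable R : realType.
Local Notation lam := (@lebesgue_measure R).
Implicit Types f g : R -> R.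

(** Supports lie in [-2, 2] although kernels live on [-1, 1]: this leaves room for translating a
    kernel by at most 1. *)
Definition bcs f := [/\ measurable_fun (setT : set (measurableTypeR R)) f,
  exists B, forall t, `|f t| <= B & forall t, 2 < `|t| -> f t = 0].

Definition lint f : R := \int[lam]_(t in setT) f t.

Lemma bcs_integrable f : bcs f -> lam.-integrable setT (EFin \o f).
Proof.
move=> [mf [B hB] f0].
have [B0 Bf] : 0 <= B /\ forall t, `|f t| <= B * \1_(`[-2, 2]%classic : set R) t.
  split=> [|t]; first exact: le_trans (hB 0).
  rewrite indicE; have [t2|t2] := leP `|t| 2; last by rewrite f0 // normr0 mulr_ge0 // (le_trans _ (hB 0)).
  rewrite mem_set ?mulr1 //= in_itv /=; by rewrite -ler_norml.
have m2 : measurable (`[-2, 2]%classic : set (measurableTypeR R)) by exact: measurable_itv.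
apply: (@le_integrable _ _ R lam setT _ _ (EFin \o (fun t => B * \1_(`[-2, 2]%classic : set R) t))) => //.
- exact/measurable_EFinP.
- by move=> t _ /=; rewrite lee_fin (le_trans (Bf t)) // ler_norm.
rewrite (_ : EFin \o _ = (fun t => B%:E * (\1_(`[-2, 2]%classic : set R) t)%:E)%E); last first.
  by apply/funext => t /=; rewrite EFinM.
by apply: integrableZl => //; exact: (integrable_indic_itv (-2) 2 true false).
Qed.

Lemma bcsD f g : bcs f -> bcs g -> bcs (fun t => f t + g t).
Proof.
move=> [mf [B hB] f0] [mg [B' hB'] g0]; split; first exact: measurable_funD.
- by exists (B + B') => t; rewrite (le_trans (ler_normD _ _)) // lerD.
- by move=> t t2; rewrite f0 // g0 // addr0.
Qed.

Lemma bcsZ (k : R) f : bcs f -> bcs (fun t => k * f t).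
Proof.
move=> [mf [B hB] f0]; split; first by apply: measurable_funM => //; exact: measurable_cst.
- by exists (`|k| * B) => t; rewrite normrM ler_wpM2l.
- by move=> t t2; rewrite f0 // mulr0.
Qed.

Lemma lintD f g : bcs f -> bcs g -> lint (fun t => f t + g t) = lint f + lint g.
Proof. by move=> /bcs_integrable bf /bcs_integrable bg; exact: RintegralD. Qed.

Lemma lintZ (k : R) f : bcs f -> lint (fun t => k * f t) = k * lint f.
Proof. by move=> /bcs_integrable bf; exact: RintegralZl. Qed.

Lemma lint_ge0 f : (forall t, 0 <= f t) -> 0 <= lint f.
Proof. by move=> f0; exact: Rintegral_ge0. Qed.

Lemma lint_le f g : bcs f -> bcs g -> (forall t, f t <= g t) -> lint f <= lint g.
Proof.
move=> bf bg fg; rewrite -subr_ge0 -mulN1r -lintZ // -lintD //; last exact: bcsZ.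
by apply: lint_ge0 => t; rewrite mulN1r subr_ge0.
Qed.

Lemma bcs_box : bcs (\1_(`[-2, 2]%classic : set R)).
Proof.
split; first by apply: measurable_indic; exact: measurable_itv.
- by exists 1 => t; rewrite indicE; case: (_ \in _); rewrite ?normr1 ?normr0.
move=> t t2; rewrite indicE memNset //= in_itv /= -ler_norml.
by apply/negP; rewrite -ltNge.
Qed.

Definition lbox := lint \1_(`[-2, 2]%classic : set R).

Lemma lbox_ge0 : 0 <= lbox.
Proof. by apply: lint_ge0 => t; rewrite indicE. Qed.

Lemma lint_bound f (B : R) : bcs f -> (forall t, `|f t| <= B) -> `|lint f| <= B * lbox.
Proof.
move=> bf fB; have [_ _ f0] := bf; have B0 : 0 <= B := le_trans (normr_ge0 _) (fB 0).
have H t : `|f t| <= B * \1_(`[-2, 2]%classic : set R) t.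
  rewrite indicE; have [t2|t2] := leP `|t| 2; last by rewrite f0 // normr0 mulr_ge0.
  by rewrite mem_set ?mulr1 //= in_itv /= -ler_norml.
rewrite -lintZ; last exact: bcs_box.
have bB := bcsZ B bcs_box; rewrite ler_norml; apply/andP; split.
  rewrite -[leLHS]mulN1r -lintZ //; apply: lint_le => // [|t]; first exact: bcsZ.
  by rewrite mulN1r lerNl; apply: le_trans (H t); rewrite -normrN ler_norm.
by apply: lint_le => // t; apply: le_trans (H t); rewrite ler_norm.
Qed.

(** Both measures agree on half-open intervals, which determine Lebesgue measure. *)
Lemma lebesgue_shift (s : R) (A : set (measurableTypeR R)) : measurable A ->
  pushforward lam (fun t : measurableTypeR R => (t + s : measurableTypeR R)) A = lam A.
Proof.
have ms : measurable_fun setT (fun t : measurableTypeR R => (t + s : measurableTypeR R)).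
  by apply: measurable_funD => //; exact: measurable_cst.
move=> mA; apply/esym/lebesgue_measure_unique => //= _ [[a b]] _ <-.
rewrite /pushforward /= (_ : _ @^-1` _ = `](a - s), (b - s)]%classic); last first.
  by apply/seteqP; split => t /=; rewrite !in_itv /= ltrBlDr lerBrDr.
rewrite !lebesgue_measure_itv /= !lte_fin ltrD2r; case: ifP => // _.
by rewrite -!EFinB; congr EFin; ring.
Qed.

Lemma lint_shift (s : R) f : bcs f -> bcs (fun t => f (t + s)) ->
  lint (fun t => f (t + s)) = lint f.
Proof.
move=> bf bfs; have fi := bcs_integrable bf; have fsi := bcs_integrable bfs.
have [mf _ _] := bf.
pose phi (t : measurableTypeR R) : measurableTypeR R := (t : R) + s.
have ms : measurable_fun setT phi by apply: measurable_funD => //; exact: measurable_cst.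
rewrite /lint /Rintegral; congr fine.
have mE : measurable_fun [set: measurableTypeR R] (EFin \o f) by exact/measurable_EFinP.
rewrite -(@integral_pushforward _ _ _ _ _ phi ms lam setT (EFin \o f)) //.
by apply: eq_measure_integral => A mA _; exact: lebesgue_shift.
Qed.

Lemma bcs_cont f (B : R) : continuous f -> (forall t, `|f t| <= B) ->
  (forall t, 2 < `|t| -> f t = 0) -> bcs f.
Proof.
by move=> cf fB f0; split=> //; [exact: continuous_measurable_fun|exists B].
Qed.

Definition kern f := smooth_on [set: R] f /\ forall t, 1 < `|t| -> f t = 0.

Lemma kern_continuous f : kern f -> continuous f.
Proof.
by move=> [sf _] t; apply: differentiable_continuous; exact: (smooth_diff (U := setT)).
Qed.

Lemma kern_bounded f : kern f -> exists2 B : R, 0 <= B & forall t, `|f t| <= B.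
Proof.
move=> kf; have cf := kern_continuous kf; have [_ f0] := kf.
have [||c _ hc] := @EVT_max R (fun t => `|f t|) (-1) 1; first by lra.
  by apply: continuous_subspaceT => t; apply: continuous_comp; [exact: cf|exact: norm_continuous].
exists `|f c| => // t; have [t1|t1] := ltP 1 `|t|; first by rewrite f0 ?normr0.
by apply: hc; rewrite in_itv /= -ler_norml.
Qed.

Lemma kern_deriv f : kern f -> kern ('D_1 f).
Proof.
move=> [sf f0]; split=> [|t t1]; first exact: smooth_deriv.
have oU : open [set y : R | 1 < `|y|].
  have -> : [set y : R | 1 < `|y|] = Num.norm @^-1` [set u : R | 1 < u] by [].
  by apply: open_comp; [move=> y _; exact: norm_continuous|exact: open_gt].
have -> : 'D_1 f t = 'D_1 (fun=> 0 : R) t.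
  by apply: near_eq_derive; apply: (near_open oU t1).
exact: dderiv_cst.
Qed.

Lemma kern_second f (B : R) : kern f -> (forall t, `|'D_1 ('D_1 f) t| <= B) ->
  forall t s, `|f (t + s) - f t - s * 'D_1 f t| <= B * s ^+ 2.
Proof.
move=> [sf _] hB t s.
have [c [d [c01 d01]]] := @line_MVT2 R R f t s setT sf (fun _ _ => I).
have D1 u : 'D_s f u = s * 'D_1 f u.
  by rewrite -[in LHS](mulr1 s) -[s * 1]/(s *: 1) dderivZv //; exact: (smooth_diff sf).
have D2 u : 'D_s ('D_s f) u = s ^+ 2 * 'D_1 ('D_1 f) u.
  have -> : 'D_s f = fun u => s * 'D_1 f u by apply/funext => y; exact: D1.
  have d2 y : differentiable ('D_1 f) y by apply: (smooth_diff (U := setT)) => //; exact: smooth_deriv.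
  rewrite (dderivM s (differentiable_cst s u) (d2 u)) dderiv_cst mul0r add0r.
  have -> : 'D_s ('D_1 f) u = s * 'D_1 ('D_1 f) u.
    by rewrite -[in LHS](mulr1 s) -[s * 1]/(s *: 1) dderivZv.
  by rewrite expr2 mulrA.
rewrite D1 D2 => ->; have /andP[d0 d1] := d01.
rewrite mulrCA normrM (ger0_norm (sqr_ge0 s)) [B * _]mulrC.
apply: ler_wpM2l; first exact: sqr_ge0.
rewrite normrM (ger0_norm (ltW d0)) -[leRHS]mul1r.
by apply: ler_pM => //; exact: ltW.
Qed.

Lemma kern_bump : exists rho : R -> R, [/\ kern rho, forall t, 0 <= rho t & lint rho = 1].
Proof.
pose f (t : R) := plateau (2 * t ^+ 2).
have oT := @openT R.
have sf : smooth_on [set: R] f.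
  change (smooth_on [set: R] (@plateau R \o (fun t : R => 2 * t ^+ 2))).
  apply: (@smooth_comp1 R R (fun t => 2 * t ^+ 2) (@plateau R) setT setT) => //; last exact: plateau_smooth.
  by apply: smoothZ => //; apply: smooth_exp => //; exact: smooth_id.
have f0 t : 1 < `|t| -> f t = 0.
  move=> t1; apply: plateau0; rewrite -real_normK ?num_real // ler_pMr //.
  by rewrite expr_ge1 // ltW.
have fp t : 0 <= f t by exact: plateau_ge0.
have f1 t : `|t| <= 1 / 2 -> f t = 1.
  move=> t2; apply: plateau1; rewrite -real_normK ?num_real //.
  have : `|t| ^+ 2 <= (1 / 2) ^+ 2 by rewrite lerXn2r ?nnegrE.
  by rewrite (_ : (1 / 2) ^+ 2 = 1 / 4 :> R); [lra|field].
have kf : kern f by [].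
have bf : bcs f.
  have [B _ hB] := kern_bounded kf; apply: (bcs_cont (kern_continuous kf) hB) => t t2.
  by apply: f0; lra.
have pos : 0 < lint f.
  have bi : bcs (\1_(`[- (1 / 2), 1 / 2]%classic : set R)).
    split; first by apply: measurable_indic; exact: measurable_itv.
    - by exists 1 => t; rewrite indicE; case: (_ \in _); rewrite ?normr1 ?normr0.
    - move=> t t2; rewrite indicE memNset //= in_itv /= -ler_norml.
      by apply/negP; rewrite -ltNge; lra.
  apply: (@lt_le_trans _ _ (lint \1_(`[- (1 / 2), 1 / 2]%classic : set R))).
    rewrite /lint /Rintegral integral_indic //=.
    rewrite setIT lebesgue_measure_itv /= lte_fin ifT /=; lra.
  apply: lint_le => // t; rewrite indicE; case: (boolP (t \in _)) => [|_]; last exact: fp.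
  by rewrite inE /= in_itv /= -ler_norml => /f1 ->.
exists (fun t => (lint f)^-1 * f t); split.
- split; first by apply: smoothZ.
  by move=> t /f0 ->; rewrite mulr0.
- by move=> t; rewrite mulr_ge0 // invr_ge0 ltW.
- by rewrite lintZ // mulVf // gt_eqF.
Qed.

End LineIntegral.

(** * Mollification along one direction *)

Section Mollifier.
Variables (R : realType) (n : nat).
Local Notation V := (Cn R n).
Implicit Types (phi h F : V -> R) (z v w e : V) (rho : R -> R).

Definition blip phi := exists B L : R, (forall z, `|phi z| <= B) /\
  forall z w, `|phi z - phi w| <= L * `|z - w|.

Lemma blip_continuous phi : blip phi -> continuous phi.
Proof.
move=> [B [L [_ hL]]] z; apply/cvgrPdist_lt => r r0.
have L1 : 0 < `|L| + 1 by rewrite ltr_wpDl.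
have : \forall w \near z, `|z - w| < r / (`|L| + 1).
  by have := nbhsx_ballx z _ (divr_gt0 r0 L1); rewrite -ball_normE.
apply: filterS => w; rewrite ltr_pdivlMr // => h; apply: le_lt_trans (hL z w) _.
apply: le_lt_trans h; rewrite mulrC ler_wpM2l //.
by apply: le_trans (ler_norm L) _; rewrite lerDl.
Qed.

(** Convolution along the line spanned by [e]. The kernel is never rescaled; the scale is the length
    of [e]. *)
Definition avg e rho phi z : R := lint (fun t => phi (z + t *: e) * rho t).

Lemma avg_bcs e rho phi z : kern rho -> blip phi -> bcs (fun t => phi (z + t *: e) * rho t).
Proof.
move=> kr bp; have [B [L [hB _]]] := bp; have [C _ hC] := kern_bounded kr.
apply: (@bcs_cont _ _ (B * C)).
- move=> t; apply: cvgM; last exact: kern_continuous.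
  apply: (@continuous_comp _ _ _ (fun t : R => z + t *: e) phi); last exact: blip_continuous.
  apply: cvgD; first exact: cvg_cst.
  by apply: cvgZr_tmp; exact: cvg_id.
- by move=> t; rewrite normrM ler_pM.
- by move=> t t2; rewrite kr.2 ?mulr0 //; lra.
Qed.

Lemma avg_blip e rho phi : kern rho -> blip phi -> blip (avg e rho phi).
Proof.
move=> kr bp; have [B [L [hB hL]]] := bp; have [C C0 hC] := kern_bounded kr.
have B0 : 0 <= B := le_trans (normr_ge0 _) (hB 0).
exists (B * C * lbox R), (L * C * lbox R); split=> [z|z w].
  apply: lint_bound; first exact: avg_bcs.
  by move=> t; rewrite normrM ler_pM.
have b1 := avg_bcs e z kr bp; have b2 := avg_bcs e w kr bp.
rewrite /avg -mulN1r -lintZ // -lintD //; last exact: bcsZ.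
rewrite (_ : L * C * lbox R * `|z - w| = L * `|z - w| * C * lbox R); last by ring.
apply: lint_bound; first by apply: bcsD => //; exact: bcsZ.
move=> t; rewrite mulN1r -mulrBl normrM; apply: ler_pM => //.
by apply: le_trans (hL _ _) _; rewrite opprD addrACA subrr addr0.
Qed.

Lemma avgD e rho phi h z : kern rho -> blip phi -> blip h ->
  avg e rho (fun z => phi z + h z) z = avg e rho phi z + avg e rho h z.
Proof.
move=> kr bp bh; rewrite /avg -lintD; try exact: avg_bcs.
by congr lint; apply/funext => t; rewrite mulrDl.
Qed.

Lemma avgZ e rho phi (k : R) z : kern rho -> blip phi ->
  avg e rho (fun z => k * phi z) z = k * avg e rho phi z.
Proof.
move=> kr bp; rewrite /avg -lintZ; last exact: avg_bcs.
by congr lint; apply/funext => t; rewrite mulrA.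
Qed.

Lemma avg_le e rho phi h z : kern rho -> (forall t, 0 <= rho t) -> blip phi -> blip h ->
  (forall t : R, `|t| <= 1 -> phi (z + t *: e) <= h (z + t *: e)) ->
  avg e rho phi z <= avg e rho h z.
Proof.
move=> kr r0 bp bh H; apply: lint_le; try exact: avg_bcs.
move=> t; have [t1|t1] := leP `|t| 1; last by rewrite kr.2 // !mulr0.
by rewrite ler_wpM2r // H.
Qed.

Lemma blip_cst (k : R) : blip (fun=> k).
Proof. by exists `|k|, 0; split=> // z w; rewrite subrr normr0 mul0r. Qed.

Lemma avg_cst e rho (k : R) z : kern rho -> lint rho = 1 -> avg e rho (fun=> k) z = k.
Proof.
move=> kr r1; rewrite /avg lintZ ?r1 ?mulr1 //.
have := avg_bcs e z kr (blip_cst 1).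
by under eq_fun do rewrite mul1r.
Qed.

Lemma avg_close e rho phi (L : R) z : kern rho -> (forall t, 0 <= rho t) -> lint rho = 1 ->
  blip phi -> (forall z w, `|phi z - phi w| <= L * `|z - w|) ->
  `|avg e rho phi z - phi z| <= L * `|e|.
Proof.
move=> kr r0 r1 bp hL.
have H (t : R) : `|t| <= 1 -> `|phi (z + t *: e) - phi z| <= L * `|e|.
  move=> t1; apply: le_trans (hL _ _) _.
  have Le : 0 <= L * `|e|.
    apply: (le_trans (normr_ge0 (phi (z + e) - phi z))).
    by have := hL (z + e) z; rewrite addrAC subrr add0r.
  rewrite addrAC subrr add0r normrZ mulrCA.
  by rewrite -[leRHS]mul1r ler_wpM2r.
rewrite ler_norml; apply/andP; split.
  rewrite lerBrDr addrC -(avg_cst e (phi z - L * `|e|) z kr r1).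
  apply: avg_le => //; first exact: blip_cst.
  by move=> t /H; rewrite ler_norml; lra.
rewrite lerBlDr addrC -[leRHS](avg_cst e (phi z + L * `|e|) z kr r1).
apply: avg_le => //; first exact: blip_cst.
by move=> t /H; rewrite ler_norml; lra.
Qed.

Lemma avg_bound e rho phi (B : R) : kern rho -> (forall t, 0 <= rho t) -> lint rho = 1 ->
  blip phi -> (forall z, `|phi z| <= B) -> forall z, `|avg e rho phi z| <= B.
Proof.
move=> kr r0 r1 bp hB z; rewrite ler_norml; apply/andP; split.
  rewrite -(avg_cst e (- B) z kr r1); apply: avg_le => //; first exact: blip_cst.
  by move=> t _; have := hB (z + t *: e); rewrite ler_norml => /andP[].
rewrite -[leRHS](avg_cst e B z kr r1); apply: avg_le => //; first exact: blip_cst.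
by move=> t _; have := hB (z + t *: e); rewrite ler_norml => /andP[].
Qed.

Lemma avg_lip e rho phi (L : R) : kern rho -> (forall t, 0 <= rho t) -> lint rho = 1 ->
  blip phi -> (forall z w, `|phi z - phi w| <= L * `|z - w|) ->
  forall z w, `|avg e rho phi z - avg e rho phi w| <= L * `|z - w|.
Proof.
move=> kr r0 r1 bp hL z w.
have H x y : avg e rho phi x <= avg e rho phi y + L * `|x - y|.
  have -> : avg e rho phi x = avg e rho (fun u => phi (u + (x - y))) y.
    by rewrite /avg; congr lint; apply/funext => t; rewrite addrAC addrA [y + x]addrC addrK.
  have bs : blip (fun u => phi (u + (x - y))).
    have [B [L' [hB hL']]] := bp; exists B, L'; split=> // u u'.
    by apply: le_trans (hL' _ _) _; rewrite opprD addrACA subrr addr0.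
  have bc := blip_cst (L * `|x - y|).
  have bD : blip (fun u => phi u + L * `|x - y|).
    have [B [L' [hB hL']]] := bp; exists (B + `|L * `|x - y| |), L'; split=> [u|u u'].
      by apply: le_trans (ler_normD _ _) _; rewrite lerD2r.
    by rewrite opprD addrACA subrr addr0.
  have e1 := avg_cst e (L * `|x - y|) y kr r1.
  rewrite -[in leRHS]e1 -avgD //; apply: avg_le => // t _.
  rewrite -lerBlDl; apply: le_trans (ler_norm _) _; apply: le_trans (hL _ _) _.
  by rewrite addrAC subrr add0r.
have := H z w; have := H w z; rewrite (distrC w z) ler_norml; lra.
Qed.

(** Differentiability along [e] with a quadratic remainder uniform in the point. Uniformity makes it
    survive averaging in other directions and, over all coordinate directions, yields total
    differentiability without partial derivatives being known to be continuous beforehand. *)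
Definition qderiv e F F' := exists2 C : R, 0 <= C & forall z (s : R), `|s| <= 1 ->
  `|F (z + s *: e) - F z - s * F' z| <= C * s ^+ 2.

Lemma qderiv_avg e e' rho F F' : kern rho -> blip F -> blip F' -> qderiv e F F' ->
  qderiv e (avg e' rho F) (avg e' rho F').
Proof.
move=> kr bF bF' [C C0 hC]; have [B B0 hB] := kern_bounded kr.
exists (C * B * lbox R); first by rewrite !mulr_ge0 // lbox_ge0.
move=> z s s1.
have b1 := avg_bcs e' (z + s *: e) kr bF; have b2 := avg_bcs e' z kr bF.
have b3 := avg_bcs e' z kr bF'.
have -> : avg e' rho F (z + s *: e) - avg e' rho F z - s * avg e' rho F' z =
    lint (fun t => F (z + s *: e + t *: e') * rho t + (-1) * (F (z + t *: e') * rho t) +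
      (- s) * (F' (z + t *: e') * rho t)).
  rewrite lintD; [|by apply: bcsD => //; exact: bcsZ|exact: bcsZ].
  by rewrite lintD ?lintZ //; [rewrite mulN1r mulNr|exact: bcsZ].
rewrite (_ : C * B * lbox R * s ^+ 2 = C * s ^+ 2 * B * lbox R); last by ring.
apply: lint_bound; first by do 2! (apply: bcsD; last exact: bcsZ).
move=> t; rewrite (_ : _ + _ = (F (z + t *: e' + s *: e) - F (z + t *: e') - s * F' (z + t *: e')) * rho t).
  by rewrite normrM ler_pM // hC.
by rewrite (addrAC z); ring.
Qed.

(** A translation of the variable moves the increment from [phi], which is only Lipschitz, to the
    kernel, where Taylor's formula applies; the translation changes the sign, hence the kernel -
    rho'. *)
Lemma qderiv_kern e rho phi : kern rho -> blip phi ->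
  qderiv e (avg e rho phi) (avg e (fun t => - 'D_1 rho t) phi).
Proof.
move=> kr bp; have [B [L [hB _]]] := bp.
have k1 := kern_deriv kr; have k2 := kern_deriv k1.
have [C C0 hC] := kern_bounded k2.
have B0 : 0 <= B := le_trans (normr_ge0 _) (hB 0).
exists (B * C * lbox R); first by rewrite !mulr_ge0 // lbox_ge0.
move=> z s s1.
have bs (r : R -> R) : continuous r -> (exists D, forall t, `|r t| <= D) ->
    (forall t, 2 < `|t| -> r t = 0) -> bcs (fun t => phi (z + t *: e) * r t).
  move=> cr [D hD] r0; apply: (@bcs_cont _ _ (B * D)).
  - move=> t; apply: cvgM; last exact: cr.
    apply: (@continuous_comp _ _ _ (fun t : R => z + t *: e) phi); last exact: blip_continuous.
    apply: cvgD; first exact: cvg_cst.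
    by apply: cvgZr_tmp; exact: cvg_id.
  - by move=> t; rewrite normrM ler_pM.
  - by move=> t /r0 ->; rewrite mulr0.
have [D _ hD] := kern_bounded kr; have [D' _ hD'] := kern_bounded k1.
have crs : continuous (fun t => rho (t - s)).
  move=> t; apply: (@continuous_comp _ _ _ (fun t : R => t - s) rho); last exact: kern_continuous.
  by apply: cvgB; [exact: cvg_id|exact: cvg_cst].
have b1 : bcs (fun t => phi (z + t *: e) * rho (t - s)).
  apply: bs => //; first by exists D => t; exact: hD.
  by move=> t t2; apply: kr.2; have := ler_normD (t - s) s; rewrite subrK; lra.
have b2 : bcs (fun t => phi (z + t *: e) * rho t) by exact: avg_bcs.
have b3 : bcs (fun t => phi (z + t *: e) * 'D_1 rho t) by exact: avg_bcs.
have -> : avg e rho phi (z + s *: e) = lint (fun t => phi (z + t *: e) * rho (t - s)).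
  rewrite /avg -(@lint_shift _ s _ b1).
    by congr lint; apply/funext => t; rewrite addrK scalerDl addrA [z + _ + _]addrAC.
  have := avg_bcs e (z + s *: e) kr bp; congr bcs; apply/funext => t.
  by rewrite addrK scalerDl addrA [z + _ + _]addrAC.
have -> : avg e (fun t => - 'D_1 rho t) phi z = - lint (fun t => phi (z + t *: e) * 'D_1 rho t).
  rewrite -mulN1r -lintZ //; congr lint; apply/funext => t; ring.
have -> : lint (fun t => phi (z + t *: e) * rho (t - s)) - avg e rho phi z -
    s * - lint (fun t => phi (z + t *: e) * 'D_1 rho t) =
    lint (fun t => phi (z + t *: e) * rho (t - s) + (-1) * (phi (z + t *: e) * rho t) +
      s * (phi (z + t *: e) * 'D_1 rho t)).
  rewrite lintD; [|by apply: bcsD => //; exact: bcsZ|exact: bcsZ].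
  by rewrite lintD ?lintZ //; [rewrite mulN1r mulrN opprK|exact: bcsZ].
rewrite (_ : B * C * lbox R * s ^+ 2 = B * (C * s ^+ 2) * lbox R); last by ring.
apply: lint_bound; first by do 2! (apply: bcsD; last exact: bcsZ).
move=> t; rewrite (_ : _ + _ = phi (z + t *: e) * (rho (t + - s) - rho t - (- s) * 'D_1 rho t)); last by ring.
rewrite normrM ler_pM // -(sqrrN s); exact: kern_second.
Qed.

End Mollifier.

Section MultiMollifier.
Variables (R : realType) (n : nat).
Local Notation V := (Cn R n).
Local Notation I := ('I_n + 'I_n)%type.
Local Notation bas := (@bas R n).
Implicit Types (phi h F : V -> R) (z v w e : V) (rho : R -> R) (P : I -> R -> R).

Definition crdsum (c : I -> R) v : R := \sum_i crd i v * c i.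

Fact crdsum_is_linear c : linear (crdsum c).
Proof.
move=> t v w; rewrite /crdsum scaler_sumr -big_split /=.
by apply: eq_bigr => i _; rewrite linearP /= /GRing.scale /= mulrDl mulrA.
Qed.
HB.instance Definition _ c := GRing.isLinear.Build R V R _ (crdsum c)
  (crdsum_is_linear c).

Lemma crdsum_continuous c : continuous (crdsum c).
Proof.
move=> z; apply: differentiable_continuous; apply: (smooth_diff (U := setT)) => //.
apply: smooth_sum => [|i]; first exact: openT.
apply: smoothM; [exact: openT| |exact: smooth_cst openT].
by apply: smooth_crd; [exact: openT|exact: smooth_id openT].
Qed.

Lemma bas_norm i : `|bas i| <= 1.
Proof.
apply: norm_crd_le => // j; rewrite /crd /bas.
by case: i => i; case: j => j /=; rewrite !mxE ?normr0 // eqxx /=; case: (_ == _);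
  rewrite ?normr1 ?normr0.
Qed.

Lemma sum_bas_norm (r : seq I) v :
  `|\sum_(i <- r) crd i v *: bas i| <= (size r)%:R * `|v|.
Proof.
elim: r => [|i r IH]; first by rewrite big_nil normr0 mul0r.
rewrite big_cons (le_trans (ler_normD _ _)) //= -natr1 mulrDl mul1r addrC lerD //.
by rewrite normrZ -[leRHS]mulr1 ler_pM ?crd_le ?bas_norm.
Qed.

(* Telescoping along the coordinate directions. *)
Lemma qderiv_diff (a : R) F (F' : I -> V -> R) : 0 < a ->
  (forall i, blip (F' i)) -> (forall i, qderiv (a *: bas i) F (F' i)) ->
  forall z, differentiable F z /\
    'd F z = (fun v => \sum_i crd i v * (F' i z / a)) :> (V -> R).
Proof.
move=> a0 bF qF z.
have T (r : seq I) : exists2 K : R, 0 <= K & forall v, `|v| <= a ->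
    `|F (z + \sum_(i <- r) crd i v *: bas i) - F z - \sum_(i <- r) crd i v * (F' i z / a)|
      <= K * `|v| ^+ 2.
  elim: r => [|i r [K K0 hK]].
    by exists 0 => // v _; rewrite !big_nil addr0 !subrr normr0 mul0r.
  have [C C0 hC] := qF i; have [B [L [_ hL]]] := bF i.
  (* The three summands: the quadratic remainder in direction i, the variation of F' i between the
     intermediate point and [z], and the constant for the remaining directions. *)
  exists (C / a ^+ 2 + `|L| * (size r)%:R / a + K) => [|v va].
    apply: addr_ge0 => //; apply: addr_ge0.
      by apply: divr_ge0 => //; apply: exprn_ge0; exact: ltW.
    by apply: divr_ge0; [exact: mulr_ge0|exact: ltW].
  rewrite !big_cons [_ *: _ + _]addrC addrA.
  set y := z + _.
  set Sg := \sum_(j <- r) _ * _.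
  have h1 : `|F (y + crd i v *: bas i) - F y - crd i v / a * F' i y| <= C / a ^+ 2 * `|v| ^+ 2.
    have s1 : `|crd i v / a| <= 1.
      rewrite normrM normfV (gtr0_norm a0) ler_pdivrMr // mul1r.
      exact: le_trans (crd_le _ _) va.
    have := hC y _ s1; rewrite scalerA divfK ?gt_eqF // => H; apply: le_trans H _.
    rewrite expr_div_n mulrCA [leRHS]mulrC ler_wpM2r //; first by apply: divr_ge0 => //; apply: exprn_ge0; exact: ltW.
    by rewrite -real_normK ?num_real // lerXn2r ?nnegrE // crd_le.
  have h2 : `|crd i v / a * (F' i y - F' i z)| <= `|L| * (size r)%:R / a * `|v| ^+ 2.
    have := hL y z; rewrite {2}/y addrAC subrr add0r => H.
    rewrite normrM normrM normfV (gtr0_norm a0).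
    have H' : `|F' i y - F' i z| <= `|L| * ((size r)%:R * `|v|).
      apply: le_trans H _; apply: (@le_trans _ _ (`|L| * `|y - z|)).
        by rewrite /y addrAC subrr add0r ler_wpM2r // ler_norm.
      by rewrite /y addrAC subrr add0r ler_wpM2l // sum_bas_norm.
    rewrite (_ : `|L| * (size r)%:R / a * `|v| ^+ 2 = `|v| / a * (`|L| * ((size r)%:R * `|v|))); last by ring.
    apply: ler_pM => //; first by apply: divr_ge0 => //; exact: ltW.
    by rewrite ler_pM2r ?invr_gt0 // crd_le.
  have h3 := hK v va; rewrite -/y -/Sg in h3.
  rewrite (_ : _ - _ - _ = (F (y + crd i v *: bas i) - F y - crd i v / a * F' i y) +
    crd i v / a * (F' i y - F' i z) + (F y - F z - Sg)); last by ring.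
  rewrite !mulrDl; apply: le_trans (ler_normD _ _) _; apply: lerD => //.
  by apply: le_trans (ler_normD _ _) _; apply: lerD.
have [K K0 hK] := T (index_enum I).
apply: (@diff_eps _ _ _ F (crdsum (fun i => F' i z / a)) z); first exact: crdsum_continuous.
move=> e e0; have K1 : 0 < K + 1 by rewrite ltr_wpDl.
have d0 : 0 < Num.min a (e / (K + 1)) by rewrite lt_min a0 divr_gt0.
have := nbhsx_ballx (0 : V) _ d0; rewrite -ball_normE /=; apply: filterS => v.
rewrite /= sub0r normrN lt_min => /andP[va ve].
have := hK v (ltW va); rewrite -crdE [z + v]addrC => H; apply: le_trans H _.
rewrite expr2 mulrA ler_wpM2r //; move: ve; rewrite ltr_pdivlMr // => /ltW.
by apply: le_trans; rewrite mulrC ler_wpM2l // lerDl.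
Qed.

Definition Mol (a : R) P (s : seq I) h : V -> R :=
  foldr (fun i phi => avg (a *: bas i) (P i) phi) h s.

Lemma Mol_blip a P s h : (forall i, kern (P i)) -> blip h -> blip (Mol a P s h).
Proof. by move=> kP bh; elim: s => //= i s IH; exact: avg_blip. Qed.

(** Each direction carries its own kernel, so that a derivative in direction i only replaces the
    i-th kernel by minus its derivative. The new kernel has neither sign nor mass 1, which is why
    smoothness is proved for arbitrary kernels. *)
Definition upd P i : I -> R -> R := fun j => if j == i then (fun t => - 'D_1 (P i) t) else P j.

Lemma kernN rho : kern rho -> kern (fun t => - rho t).
Proof.
move=> [sr r0]; split=> [|t t1]; first by apply: smoothN => //; exact: openT.
by rewrite r0 ?oppr0.
Qed.

Lemma upd_kern P i : (forall i, kern (P i)) -> forall j, kern (upd P i j).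
Proof.
move=> kP j; rewrite /upd; case: ifP => // _.
by apply: (kernN (kern_deriv (kP i))).
Qed.

Lemma Mol_qderiv a P s h i : (forall i, kern (P i)) -> blip h -> uniq s -> i \in s ->
  qderiv (a *: bas i) (Mol a P s h) (Mol a (upd P i) s h).
Proof.
move=> kP bh; elim: s => //= j s IH /andP[js us]; rewrite inE => ijs.
have [eij|nij] := eqVneq i j; last first.
  rewrite (negbTE nij) /= in ijs; rewrite /upd eq_sym (negbTE nij).
  have bM := Mol_blip a s kP bh.
  have bU := Mol_blip a s (upd_kern i kP) bh.
  exact: (qderiv_avg (a *: bas j) (kP j) bM bU (IH us ijs)).
have -> : Mol a (upd P i) s h = Mol a P s h.
  rewrite eij; elim: s js {IH us ijs} => //= k s IH; rewrite inE negb_or => /andP[jk js].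
  by rewrite IH // /upd eq_sym (negbTE jk).
by rewrite /upd eij eqxx; apply: qderiv_kern => //; exact: Mol_blip.
Qed.

(** Multiples of mollifications of [h], with all choices of kernels, form up to sums a class closed
    under derivation; coinduction concludes. *)
Lemma Mol_smooth a P h : 0 < a -> (forall i, kern (P i)) -> blip h ->
  smooth_on [set: V] (Mol a P (enum {: I}) h).
Proof.
move=> a0 kP bh.
pose G f := exists c Q, (forall i, kern (Q i)) /\ f = fun z => c * Mol a Q (enum {: I}) h z.
have Q Q0 (kQ : forall i, kern (Q0 i)) z : differentiable (Mol a Q0 (enum {: I}) h) z /\
   'd (Mol a Q0 (enum {: I}) h) z =
     (fun v => \sum_i crd i v * (Mol a (upd Q0 i) (enum {: I}) h z / a)) :> (V -> R).
  apply: (qderiv_diff (F' := fun i => Mol a (upd Q0 i) (enum {: I}) h)) => // i.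
    by apply: Mol_blip => //; exact: upd_kern.
  by apply: Mol_qderiv => //; [exact: enum_uniq|rewrite mem_enum].
apply: (@smooth_coind_span _ _ setT G openT).
- move=> f [c [Q0 [kQ ->]]] z _.
  by apply: differentiableM; [exact: differentiable_cst|exact: (Q Q0 kQ z).1].
- move=> f v [c [Q0 [kQ ->]]].
  exists (fun z => \sum_i (c * crd i v / a) * Mol a (upd Q0 i) (enum {: I}) h z).
    by apply: fspan_sum => i; apply: fspan1; exists (c * crd i v / a), (upd Q0 i); split=> //; exact: upd_kern.
  move=> z _; have [dM EM] := Q Q0 kQ z.
  rewrite (dderivM v (differentiable_cst c z) dM) dderiv_cst mul0r add0r deriveE // EM /= mulr_sumr.
  apply: eq_bigr => i _; rewrite /cst.
  by ring.
- by apply: fspan1; exists 1, P; split=> //; apply/funext => z; rewrite mul1r.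
Qed.

Section Average.
Variables (a : R) (P : I -> R -> R).
Hypotheses (kP : forall i, kern (P i)) (P0 : forall i t, 0 <= P i t)
  (P1 : forall i, lint (P i) = 1).

Lemma Mol_lip s h (L : R) : blip h -> (forall z w, `|h z - h w| <= L * `|z - w|) ->
  forall z w, `|Mol a P s h z - Mol a P s h w| <= L * `|z - w|.
Proof.
move=> bh hL; elim: s => //= i s IH; apply: avg_lip => //.
exact: Mol_blip.
Qed.

Lemma Mol_bound s h (B : R) : blip h -> (forall z, `|h z| <= B) ->
  forall z, `|Mol a P s h z| <= B.
Proof.
move=> bh hB; elim: s => //= i s IH; apply: avg_bound => //.
exact: Mol_blip.
Qed.

Lemma Mol_close s h (L : R) z : 0 <= a -> blip h -> 0 <= L ->
  (forall z w, `|h z - h w| <= L * `|z - w|) ->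
  `|Mol a P s h z - h z| <= (size s)%:R * (L * a).
Proof.
move=> a0 bh L0 hL; elim: s => /= [|i s IH]; first by rewrite subrr normr0 mul0r.
have bM := Mol_blip a s kP bh; have lM := Mol_lip s bh hL.
have := avg_close (a *: bas i) z (kP i) (P0 i) (P1 i) bM lM => H.
rewrite -natr1 mulrDl mul1r [leRHS]addrC.
rewrite (_ : _ - _ = (avg (a *: bas i) (P i) (Mol a P s h) z - Mol a P s h z) +
  (Mol a P s h z - h z)); last by rewrite addrA subrK.
apply: le_trans (ler_normD _ _) _; apply: lerD => //; apply: le_trans H _.
rewrite ler_wpM2l // normrZ (ger0_norm a0) -[leRHS]mulr1 ler_wpM2l //.
exact: bas_norm.
Qed.
End Average.

End MultiMollifier.

(** * Circle means and Riemann sums *)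

Section CircleMean.
Variable R : realType.
Local Notation lam := (@lebesgue_measure R).
Implicit Types f g : R -> R.

Lemma itv_integrable f (a b : R) : continuous f ->
  lam.-integrable `[a, b] (EFin \o f).
Proof.
move=> cf; apply: continuous_compact_integrable; first exact: segment_compact.
exact: continuous_subspaceT.
Qed.

Lemma lipschitz_continuous f (L : R) : (forall s t, `|f s - f t| <= L * `|s - t|) ->
  continuous f.
Proof.
move=> hL z; apply/cvgrPdist_lt => r r0.
have L1 : 0 < `|L| + 1 by rewrite ltr_wpDl.
have : \forall w \near z, `|z - w| < r / (`|L| + 1).
  by have := nbhsx_ballx z _ (divr_gt0 r0 L1); rewrite -ball_normE.
apply: filterS => w; rewrite ltr_pdivlMr // => h; apply: le_lt_trans (hL z w) _.
apply: le_lt_trans h; rewrite mulrC ler_wpM2l //.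
by apply: le_trans (ler_norm L) _; rewrite lerDl.
Qed.

Definition cint f : R := \int[lam]_(t in `[0, 2 * pi]) f t.

Lemma itv_le f (a b B : R) : continuous f -> a <= b -> (forall t, a <= t <= b -> f t <= B) ->
  \int[lam]_(t in `]a, b]) f t <= (b - a) * B.
Proof.
move=> cf ab fB.
have mI : measurable (`]a, b]%classic : set (measurableTypeR R)) by exact: measurable_itv.
have -> : (b - a) * B = \int[lam]_(t in `]a, b]) B.
  apply: esym; apply: etrans (Rintegral_cst _ mI B) _; rewrite mulrC; congr (_ * _).
  apply: etrans (congr1 fine (lebesgue_measure_itv `]a, b])) _; rewrite /= lte_fin; move: ab.
  by rewrite le_eqVlt => /orP[/eqP ->|->//]; rewrite ltxx subrr.
apply: le_Rintegral => //.
- apply: integrableS (itv_integrable a b cf) => //.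
  by move=> t; rewrite /= !in_itv /= => /andP[/ltW -> ->].
- apply: integrableS (itv_integrable a b (f := fun=> B) _) => //.
    by move=> t; rewrite /= !in_itv /= => /andP[/ltW -> ->].
  by move=> x; exact: cvg_cst.
- by move=> t /=; rewrite in_itv /= => /andP[h1 h2]; apply: fB; rewrite h2 ltW.
Qed.

Lemma riemann_sum f (L h : R) (m : nat) : 0 < h -> (forall s t, `|f s - f t| <= L * `|s - t|) ->
  \int[lam]_(t in `[0, m%:R * h]) f t <= \sum_(j < m) h * (f (j%:R * h) + L * h).
Proof.
move=> h0 hL; have cf := lipschitz_continuous hL.
have L0 : 0 <= L by have := le_trans (normr_ge0 _) (hL 1 0); rewrite subr0 normr1 mulr1.
elim: m => [|m IH].
  rewrite big_ord0 mul0r set_itv1; rewrite le_eqVlt; apply/orP; left; apply/eqP.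
  exact: Rintegral_set1.
rewrite big_ord_recr /=.
have I1 := itv_integrable 0 (m.+1%:R * h) cf.
have le1 : (m%:R * h : R) <= m.+1%:R * h by rewrite ler_wpM2r ?ler_nat ?ltW.
have := Rintegral_itvB (x := m%:R * h) I1.
rewrite !bnd_simp => /(_ _ le1) -/(_ (mulr_ge0 (ler0n _ _) (ltW h0))) E.
have : \int[lam]_(t in `](m%:R * h), (m.+1%:R * h)]) f t <= h * (f (m%:R * h) + L * h).
  apply: le_trans (itv_le (B := f (m%:R * h) + L * h) cf le1 _) _ => [t /andP[t1 t2]|].
    rewrite -lerBlDl; apply: le_trans (ler_norm _) _; apply: le_trans (hL _ _) _.
    rewrite ler_wpM2l // ger0_norm ?subr_ge0 // lerBlDl.
    by move: t2; rewrite -natr1 mulrDl mul1r.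
  by rewrite -natr1 (_ : (m%:R + 1) * h - m%:R * h = h :> R) //; ring.
by rewrite -E; lra.
Qed.

Lemma pi2_gt0 : 0 < 2 * pi :> R.
Proof. by rewrite mulr_gt0 // pi_gt0. Qed.

(* The sample points depend only on the Lipschitz constant. *)
Lemma riemann (L d : R) : 0 < d -> exists s : seq R, (0 < size s)%N /\
  forall f, (forall s t, `|f s - f t| <= L * `|s - t|) ->
    (size s)%:R * cint f <= 2 * pi * (\sum_(t <- s) f t + (size s)%:R * d).
Proof.
move=> d0; have p0 := pi2_gt0.
(* With m points the Lipschitz error of a left Riemann sum is |L| 2 pi / m per point, which this
   choice makes at most [d]. *)
pose m := (Num.bound (`|L| * (2 * pi) / d)).+1.
have m0 : 0 < m%:R :> R by rewrite ltr0n.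
have Lm : `|L| * (2 * pi) / d <= m%:R.
  rewrite ltW //; apply: lt_trans (archi_boundP _) _; last by rewrite ltr_nat.
  by apply: divr_ge0; [apply: mulr_ge0 => //; exact: ltW|exact: ltW].
pose h : R := 2 * pi / m%:R.
have h0 : 0 < h by rewrite divr_gt0.
exists [seq j%:R * h | j <- iota 0 m]; rewrite size_map size_iota; split => // f hL.
have := riemann_sum m h0 hL.
have -> : m%:R * h = 2 * pi by rewrite /h mulrC divfK ?gt_eqF.
rewrite -/(cint f) => H.
rewrite big_map -[iota 0 m]/(index_iota 0 m) big_mkord.
apply: le_trans (ler_wpM2l (ltW m0) H) _.
have -> : m%:R * d = \sum_(j < m) d by rewrite sumr_const card_ord mulr_natl.
rewrite -big_split /= !mulr_sumr.
apply: ler_sum => j _ /=; rewrite mulrA (_ : m%:R * h = 2 * pi); last by rewrite /h mulrC divfK ?gt_eqF.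
rewrite ler_wpM2l ?(ltW p0) // lerD2l /h mulrA ler_pdivrMr //.
move: Lm; rewrite ler_pdivrMr // [_ * d]mulrC; apply: le_trans.
by rewrite ler_wpM2r ?(ltW p0) // ler_norm.
Qed.

(* No measurability of [f] is required. *)
Lemma mean_le (f : R -> \bar R) (g : R -> R) (r : R) : continuous g ->
  (forall t, (f t <= (g t)%:E)%E) ->
  (r%:E <= ((2 * pi)^-1)%:E * \int[lam]_(t in `[0%R, (2 * pi)%R]) f t)%E ->
  2 * pi * r <= cint g.
Proof.
move=> cg fg H; have p0 := pi2_gt0.
have ig := itv_integrable 0 (2 * pi) cg.
(* The integral of a nonnegative function is a supremum over simple functions below it, so it is
   monotone without any measurability. *)
have mono (h1 h2 : R -> \bar R) : (forall t, (0 <= h1 t)%E) -> (forall t, (h1 t <= h2 t)%E) ->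
    (\int[lam]_(t in `[0%R, (2 * pi)%R]) h1 t <= \int[lam]_(t in `[0%R, (2 * pi)%R]) h2 t)%E.
  move=> h10 h12; rewrite !ge0_integralE //; last by move=> t _; exact: le_trans (h12 t).
  apply: ereal_sup_le => _ [q hq <-]; exists q => // t.
  by apply: le_trans (hq t) _; rewrite /patch; case: ifP.
have leI : (\int[lam]_(t in `[0%R, (2 * pi)%R]) f t <= (cint g)%:E)%E.
  rewrite /cint /Rintegral fineK; last by apply: integrable_fin_num => //; exact: measurable_itv.
  rewrite (integralE lam _ f) (integralE lam _ (fun t => (g t)%:E)); apply: leeB.
    apply: mono => t; first by rewrite !funeposE le_max lexx orbT.
    rewrite !funeposE ge_max; apply/andP; split; last by rewrite le_max lexx orbT.
    by rewrite le_max fg.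
  apply: mono => t; first by rewrite !funenegE le_max lexx orbT.
  rewrite !funenegE ge_max; apply/andP; split; last by rewrite le_max lexx orbT.
  by rewrite le_max leeN2 fg.
rewrite mulrC -ler_pdivlMr // -lee_fin mulrC EFinM; apply: le_trans H _.
by apply: lee_wpmul2l => //; rewrite lee_fin invr_ge0 ltW.
Qed.

Lemma cintD f g : continuous f -> continuous g -> cint (fun t => f t + g t) = cint f + cint g.
Proof.
move=> cf cg; apply: RintegralD; [exact: measurable_itv|exact: itv_integrable|exact: itv_integrable].
Qed.

Lemma cint_cst (k : R) : cint (fun=> k) = 2 * pi * k.
Proof.
have mI : measurable (`[0, 2 * pi]%classic : set (measurableTypeR R)) by exact: measurable_itv.
apply: etrans (Rintegral_cst _ mI k) _; rewrite mulrC; congr (_ * _).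
apply: etrans (congr1 fine (lebesgue_measure_itv `[0, 2 * pi])) _.
by rewrite /= lte_fin pi2_gt0 /= subr0.
Qed.

Lemma cint_le f g : continuous f -> continuous g -> (forall t, f t <= g t) -> cint f <= cint g.
Proof.
move=> cf cg fg; by apply: le_Rintegral => //; exact: itv_integrable.
Qed.

End CircleMean.

(** * Sup-convolution *)

Section SupConvolution.
Variables (R : realType) (n : nat).
Local Notation V := (Cn R n).
Variables (h : V -> R) (B : R).
Hypothesis hB : forall z, `|h z| <= B.

Definition supc (N : R) (z : V) : R := sup [set h w - N * `|z - w| | w in [set: V]].

Lemma supc_has_sup N z : 0 <= N -> has_sup [set h w - N * `|z - w| | w in [set: V]].
Proof.
move=> N0; split; first by exists (h z - N * `|z - z|), z.
exists B => _ [w _ <-]; rewrite lerBlDr (le_trans (ler_norm _)) // (le_trans (hB w)) //.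
by rewrite lerDl mulr_ge0.
Qed.

Lemma supc_ub N z w : 0 <= N -> h w - N * `|z - w| <= supc N z.
Proof.
move=> N0; apply: ub_le_sup; first by case: (supc_has_sup z N0).
by exists w.
Qed.

Lemma supc_le N z (M : R) : (forall w, h w - N * `|z - w| <= M) -> supc N z <= M.
Proof.
move=> H; apply: ge_sup; first by exists (h z - N * `|z - z|), z.
by move=> _ [w _ <-].
Qed.

Lemma supc_near N z e : 0 <= N -> 0 < e -> exists w, supc N z - e < h w - N * `|z - w|.
Proof.
by move=> N0 e0; have [_ [w _ <-] H] := sup_adherent e0 (supc_has_sup z N0); exists w.
Qed.

Lemma supc_ge N z : 0 <= N -> h z <= supc N z.
Proof. by move=> N0; have := supc_ub z z N0; rewrite subrr normr0 mulr0 subr0. Qed.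

Lemma supc_bound N z : 0 <= N -> `|supc N z| <= B.
Proof.
move=> N0; rewrite ler_norml; apply/andP; split.
  by apply: le_trans (supc_ge z N0); have := hB z; rewrite ler_norml => /andP[].
apply: supc_le => w; rewrite lerBlDr (le_trans (ler_norm _)) // (le_trans (hB w)) //.
by rewrite lerDl mulr_ge0.
Qed.

Lemma supc_lip N z w : 0 <= N -> `|supc N z - supc N w| <= N * `|z - w|.
Proof.
move=> N0; have H x y : supc N x <= supc N y + N * `|x - y|.
  apply: supc_le => u; rewrite lerBlDr; apply: le_trans (_ : supc N y + N * `|y - u| <= _).
    by rewrite -lerBlDr; exact: supc_ub.
  rewrite -addrA lerD2l -mulrDr ler_wpM2l // addrC.
  by have := ler_distD x y u; rewrite addrC [`|y - x|]distrC.
by rewrite ler_norml; have := H z w; have := H w z; rewrite (distrC w z); lra.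
Qed.

Lemma supc_blip N : 0 <= N -> blip (supc N).
Proof. by move=> N0; exists B, N; split=> *; [exact: supc_bound|exact: supc_lip]. Qed.

(** Near-maximizers lie within (2B + e)/N of [z]: sup-convolution only sees the function locally
    when N is large, so a local submean property can be transported. *)
Lemma supc_close N z e : 0 < N -> 0 < e -> exists w, [/\ supc N z - e < h w - N * `|z - w|,
  supc N z - e <= h w & N * `|z - w| <= 2 * B + e].
Proof.
move=> N0 e0; have [w hw] := supc_near z (ltW N0) e0; exists w.
have k0 : 0 <= N * `|z - w| by rewrite mulr_ge0 // ltW.
have b1 := supc_bound z (ltW N0); have b2 := hB w.
move: b1 b2; rewrite !ler_norml => /andP[b1 _] /andP[_ b2].
by split=> //; lra.
Qed.

Lemma supc_cvg z e : 0 < e -> (forall a, h z < a -> \forall w \near z, h w < a) ->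
  exists N0, forall N, N0 <= N -> supc N z <= h z + e.
Proof.
move=> e0 usc; have : \forall w \near z, h w < h z + e by apply: usc; rewrite ltrDl.
rewrite -near_nbhs; case/nbhs_ballP=> d /= d0 hd.
have B0 : 0 <= B := le_trans (normr_ge0 _) (hB z).
exists (2 * B / d) => N hN; have N0 : 0 <= N by apply: le_trans hN; apply: divr_ge0; [exact: mulr_ge0|exact: ltW].
apply: supc_le => w; have [wd|wd] := ltP `|z - w| d.
  rewrite lerBlDr ltW // (@lt_le_trans _ _ (h z + e)) ?lerDl ?mulr_ge0 //.
  by apply: hd; rewrite -ball_normE.
have : 2 * B <= N * `|z - w|.
  by apply: (@le_trans _ _ (N * d)); [rewrite -ler_pdivrMr|rewrite ler_wpM2l].
have := hB z; have := hB w; rewrite !ler_norml => /andP[_ b1] /andP[b2 _]; lra.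
Qed.

End SupConvolution.

Section Rotation.
Variables (R : realType) (n : nat).
Local Notation V := (Cn R n).
Implicit Types (u v w z : V) (H : V -> R).

Definition rot (t : R) v : V := cscale (cos t +i* sin t) v.

Lemma rotE t v : rot t v = cos t *: v + sin t *: J v.
Proof. by rewrite /rot cscaleE. Qed.

Lemma J_norm v : `|J v| <= `|v|.
Proof.
apply: norm_crd_le => // -[j|j]; have [c1 c2] := crdJ j v.
  by rewrite c1 normrN crd_le.
by rewrite c2 crd_le.
Qed.

Lemma rotN t v : rot t (- v) = - rot t v.
Proof. by rewrite !rotE [J (- v)]linearN !scalerN opprD. Qed.

Lemma rotZ (t a : R) v : rot t (a *: v) = a *: rot t v.
Proof. by rewrite !rotE [J (a *: v)]linearZ scalerDr !scalerA ![_ * a]mulrC. Qed.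

Lemma rotJ t v : rot t (J v) = J (rot t v).
Proof. by rewrite !rotE J_lin [J (sin t *: _)]linearZ. Qed.

Lemma cos_lip (s t : R) : `|cos s - cos t| <= `|s - t| /\ `|sin s - sin t| <= `|s - t|.
Proof.
wlog st : s t / t <= s => [H|].
  have [/H//|/ltW/H] := leP t s.
  by rewrite (distrC (cos t)) (distrC (sin t)) (distrC t).
split.
  have [|c _ ->] := @MVT_segment R cos (fun x => - sin x) t s st.
    by apply: continuous_subspaceT; exact: continuous_cos.
  by rewrite normrM normrN -[leRHS]mul1r ler_wpM2r // ler_norml sin_geN1 sin_le1.
have [|c _ ->] := @MVT_segment R sin (fun x => cos x) t s st.
  by apply: continuous_subspaceT; exact: continuous_sin.
by rewrite normrM -[leRHS]mul1r ler_wpM2r // ler_norml cos_geN1 cos_le1.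
Qed.

Lemma rot_lip v (s t : R) : `|rot s v - rot t v| <= 2 * `|v| * `|s - t|.
Proof.
have [c1 c2] := cos_lip s t.
rewrite !rotE opprD addrACA -!scalerBl (le_trans (ler_normD _ _)) // !normrZ.
have h1 : `|cos s - cos t| * `|v| <= `|s - t| * `|v| by rewrite ler_wpM2r.
have h2 : `|sin s - sin t| * `|J v| <= `|s - t| * `|v| by rewrite ler_pM // J_norm.
by lra.
Qed.

Lemma rot_norm (t : R) v : `|rot t v| <= 2 * `|v|.
Proof.
rewrite rotE (le_trans (ler_normD _ _)) // !normrZ mulrDl mul1r lerD //.
  by rewrite -[leRHS]mul1r ler_wpM2r // ler_norml cos_geN1 cos_le1.
by rewrite -[leRHS]mul1r ler_pM ?J_norm // ler_norml sin_geN1 sin_le1.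
Qed.

Lemma cscale_norm (zeta : R[i]) v : `|zeta| <= 1 -> `|cscale zeta v| <= 2 * `|v|.
Proof.
move=> z1.
have a1 : `|complex.Re zeta| <= 1.
  by have := le_trans (normc_ge_Re zeta) z1; rewrite -[1]/(1%:C) lecR.
have a2 : `|complex.Im zeta| <= 1.
  have := normc_ge_Re ('i * zeta); rewrite normrM normCi mul1r => /le_trans/(_ z1).
  by rewrite -[1]/(1%:C) lecR; case: zeta {z1 a1} => a b; rewrite /= mul0r mul1r sub0r normrN.
rewrite cscaleE (le_trans (ler_normD _ _)) // !normrZ mulrDl mul1r lerD //.
  by rewrite -[leRHS]mul1r ler_wpM2r.
by rewrite -[leRHS]mul1r ler_pM ?J_norm.
Qed.

(* Four times the mean of H over the orbit of v under J, recentred at z. *)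
Definition quad H z v : R := H (z + v) + H (z - v) + H (z + J v) + H (z - J v).

Lemma qdJ v : qd (J v) = qd v.
Proof.
rewrite /qd; apply: etrans (big_sumType _ _ _) _; apply: etrans (addrC _ _) _.
apply: etrans _ (esym (big_sumType _ _ _)); congr (_ + _); apply: eq_bigr => j _;
  have [c1 c2] := crdJ j v; first by rewrite c2.
by rewrite c1 sqrrN.
Qed.

Lemma qd_par (z v : V) : qd (z + v) + qd (z - v) = 2 * qd z + 2 * qd v.
Proof.
rewrite /qd !mulr_sumr -!big_split /=; apply: eq_bigr => i _.
by rewrite !linearD linearN /=; ring.
Qed.

Lemma quad_qd (z0 z v : V) : quad (fun y => qd (y - z0)) z v = 4 * qd (z - z0) + 4 * qd v.
Proof.
have := qd_par (z - z0) v; have := qd_par (z - z0) (J v); rewrite qdJ /quad.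
by rewrite (addrAC z v) (addrAC z (- v)) (addrAC z (J v)) (addrAC z (- J v)); lra.
Qed.

Lemma quad_rot_lip H (L : R) z v : 0 <= L -> (forall x y, `|H x - H y| <= L * `|x - y|) ->
  forall s t, `|quad H z (rot s v) - quad H z (rot t v)| <= 8 * L * `|v| * `|s - t|.
Proof.
move=> L0 hL s t.
have K (f : V -> V) : (forall x y, `|f x - f y| <= `|x - y|) ->
    `|H (z + f (rot s v)) - H (z + f (rot t v))| <= 2 * L * `|v| * `|s - t|.
  move=> hf; apply: le_trans (hL _ _) _; rewrite opprD addrACA subrr add0r.
  rewrite [2 * L]mulrC -!mulrA ler_wpM2l //; apply: le_trans (hf _ _) _.
  by rewrite mulrA rot_lip.
have k1 := K id (fun x y => lexx _).
have k2 : `|H (z - rot s v) - H (z - rot t v)| <= 2 * L * `|v| * `|s - t|.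
  by apply: (K (fun x => - x)) => x y; rewrite -opprD normrN.
have k3 : `|H (z + J (rot s v)) - H (z + J (rot t v))| <= 2 * L * `|v| * `|s - t|.
  by apply: (K (fun x => J x)) => x y; rewrite -linearB J_norm.
have k4 : `|H (z - J (rot s v)) - H (z - J (rot t v))| <= 2 * L * `|v| * `|s - t|.
  by apply: (K (fun x => - J x)) => x y; rewrite -opprD normrN -linearB J_norm.
move: k1 k2 k3 k4; rewrite /quad (_ : 8 * L * `|v| * `|s - t| = 4 * (2 * L * `|v| * `|s - t|)); last by ring.
move: (2 * L * _ * _) (H (z + rot s v)) (H (z + rot t v)) (H (z - rot s v)) (H (z - rot t v)).
move: (H (z + J (rot s v))) (H (z + J (rot t v))) (H (z - J (rot s v))) (H (z - J (rot t v))).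
move=> a1 a2 a3 a4 b a5 a6 a7 a8; rewrite !ler_norml => /andP[? ?] /andP[? ?] /andP[? ?] /andP[? ?].
by apply/andP; split; lra.
Qed.

End Rotation.

(** * Submean inequality and the Levi form *)

Section Submean.
Variables (R : realType) (n : nat).
Local Notation V := (Cn R n).
Local Notation I := ('I_n + 'I_n)%type.
Implicit Types (u v w z : V) (H : V -> R) (e : V) (rho : R -> R).

(** The submean inequality is stated for Lipschitz majorants of [h] instead of [h], so that the
    circle integral only involves continuous functions. *)
Definition sub_at (h : V -> R) w v := forall H (L : R), 0 <= L ->
  (forall x y, `|H x - H y| <= L * `|x - y|) -> (forall y, h y <= H y) ->
  2 * pi * (4 * h w) <= cint (fun t => quad H w (rot t v)).

(* The mean is taken over finitely many points, the same for all z, so that the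
   property is preserved by averaging over translates. *)
Definition submean z0 (r : R) H := forall v (d : R), `|v| <= r -> 0 < d ->
  exists s : seq R, (0 < size s)%N /\ forall z, `|z - z0| <= r ->
    (size s)%:R * (4 * H z) <= \sum_(t <- s) quad H z (rot t v) + (size s)%:R * d.

(** At [z] one takes a near-maximizer [w] and applies the hypothesis at [w] to the translate of the
    sup-convolution by z - w, raised by N |z - w|. The Lipschitz bound then permits a Riemann sum
    with sample points independent of [z]. *)
Lemma supc_submean h (B N : R) z0 r : (forall z, `|h z| <= B) -> 0 < N ->
  2 * B + 1 <= N * r -> (forall w v, `|w - z0| <= 2 * r -> `|v| <= r -> sub_at h w v) ->
  submean z0 r (supc h N).
Proof.
move=> hB N0 Nr hs v d vr d0; have p0 := pi2_gt0 R.
have [s [s0 hR]] := riemann (8 * N * `|v|) d0; exists s; split=> // z zr.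
have lS := supc_lip hB (N := N); have lH := quad_rot_lip z v (ltW N0) (fun x y => lS x y (ltW N0)).
rewrite -(ler_pM2l p0); apply: le_trans (hR _ lH).
rewrite mulrCA ler_wpM2l //.
set c := cint _.
apply/ler_addgt0Pr => e e0.
(* The bound 1 keeps [w] within [r] of [z], by 2B + 1 <= N r; the other one keeps the final error
   below [e]. *)
pose e1 := Num.min 1 (e / (2 * pi * 4)).
have e10 : 0 < e1 by rewrite lt_min ltr01 divr_gt0 // mulr_gt0.
have [w [h1 _ h3]] := supc_close hB z N0 e10.
have wr : `|z - w| <= r.
  rewrite -(ler_pM2l N0); apply: le_trans h3 _; apply: le_trans Nr.
  by rewrite lerD2l ge_min lexx.
have wz : `|w - z0| <= 2 * r.
  by have := ler_distD z w z0; rewrite (distrC w z); lra.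
have NL := mulr_ge0 (ltW N0) (normr_ge0 (z - w)).
(* It majorizes [h] by the definition of the supremum at y + (z - w), with [y] as competitor. *)
pose H y := supc h N (y + (z - w)) + N * `|z - w|.
have HL x y : `|H x - H y| <= N * `|x - y|.
  rewrite /H opprD addrACA subrr addr0; have := lS (x + (z - w)) (y + (z - w)) (ltW N0).
  by rewrite opprD addrACA subrr addr0.
have hH y : h y <= H y.
  have := supc_ub hB (y + (z - w)) y (ltW N0).
  by rewrite addrAC subrr add0r lerBlDr.
have S := hs w v wz vr H N (ltW N0) HL hH.
have E : cint (fun t => quad H w (rot t v)) = c + 2 * pi * (4 * (N * `|z - w|)).
  rewrite -cint_cst -cintD; [|exact: lipschitz_continuous lH|by move=> x; exact: cvg_cst].
  have sh x : w + x + (z - w) = z + x by rewrite addrAC [w + _]addrC subrK.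
  congr cint; apply/funext => t; rewrite /quad /H !sh.
  move: (supc _ _ _) (supc _ _ _) (supc _ _ _) (supc _ _ _) (N * _) => a1 a2 a3 a4 a5; ring.
rewrite E in S.
have e1e : 2 * pi * (4 * e1) <= e.
  have : e1 <= e / (2 * pi * 4) by rewrite /e1 ge_min lexx orbT.
  have p4 : 0 < 2 * pi * 4 :> R by rewrite mulr_gt0.
  by rewrite ler_pdivlMr //; apply: le_trans; rewrite mulrA mulrC.
have : 2 * pi * (4 * (supc h N z - e1)) <= 2 * pi * (4 * (h w - N * `|z - w|)).
  by rewrite ler_pM2l // ler_pM2l // ltW.
by rewrite !mulrBr; lra.
Qed.

Lemma blipD H H' : blip H -> blip H' -> blip (fun z => H z + H' z).
Proof.
move=> [B [L [hB hL]]] [B' [L' [hB' hL']]]; exists (B + B'), (L + L'); split=> [z|z w].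
  by rewrite (le_trans (ler_normD _ _)) // lerD.
by rewrite opprD addrACA mulrDl (le_trans (ler_normD _ _)) // lerD.
Qed.

Lemma blipZ (k : R) H : blip H -> blip (fun z => k * H z).
Proof.
move=> [B [L [hB hL]]]; exists (`|k| * B), (`|k| * L); split=> [z|z w].
  by rewrite normrM ler_wpM2l.
by rewrite -mulrBr normrM -mulrA ler_wpM2l.
Qed.

Lemma blip_shift u H : blip H -> blip (fun z => H (z + u)).
Proof.
move=> [B [L [hB hL]]]; exists B, L; split=> // z w.
by apply: le_trans (hL _ _) _; rewrite opprD addrACA subrr addr0.
Qed.

Lemma blip_quad v H : blip H -> blip (fun z => quad H z v).
Proof. by move=> bH; do 3! (apply: blipD; last exact: blip_shift); exact: blip_shift. Qed.

Lemma avg_shift e rho H u z : avg e rho (fun z => H (z + u)) z = avg e rho H (z + u).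
Proof. by rewrite /avg; congr lint; apply/funext => t; rewrite addrAC. Qed.

Lemma avg_quad e rho H v z : kern rho -> blip H ->
  avg e rho (fun z => quad H z v) z = quad (avg e rho H) z v.
Proof.
move=> kr bH; rewrite /quad !avgD ?avg_shift //; do ?[exact: blip_shift|apply: blipD].
Qed.

(** The sample points serve all nearby centres simultaneously, so the finite inequality can be
    integrated against the kernel. Only the radius shrinks, by the length of the averaging
    segment. *)
Lemma avg_submean e rho H z0 (r b : R) : kern rho -> (forall t, 0 <= rho t) -> lint rho = 1 ->
  blip H -> `|e| <= b -> submean z0 r H -> submean z0 (r - b) (avg e rho H).
Proof.
move=> kr r0 r1 bH eb sH v d vr d0; have b0 := le_trans (normr_ge0 e) eb.
have [|s [s0 hs]] := sH v d _ d0; first by lra.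
exists s; split=> // z zr.
have bS : blip (fun z => \sum_(t <- s) quad H z (rot t v)) /\
    avg e rho (fun z => \sum_(t <- s) quad H z (rot t v)) z = \sum_(t <- s) quad (avg e rho H) z (rot t v).
  elim: s {s0 hs} => [|t s [b1 E1]].
    rewrite big_nil; split; last first.
      by rewrite -[RHS](avg_cst e 0 z kr r1); congr avg; apply/funext => y; rewrite big_nil.
    by rewrite (_ : (fun z => _) = (fun=> 0)); [exact: blip_cst|apply/funext => y; rewrite big_nil].
  have bq := blip_quad (rot t v) bH.
  rewrite (_ : (fun z => _) = (fun z => quad H z (rot t v) + \sum_(t <- s) quad H z (rot t v))); last first.
    by apply/funext => y; rewrite big_cons.
  by split; [exact: blipD|rewrite avgD // E1 avg_quad // big_cons].
have [bS1 <-] := bS.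
rewrite -(avg_cst e ((size s)%:R * d) z kr r1) -avgD //; last exact: blip_cst.
rewrite mulrA -avgZ //; apply: avg_le => //; first exact: blipZ.
  by apply: blipD => //; exact: blip_cst.
move=> t t1; rewrite -mulrA; apply: hs.
have : `|t *: e| <= b by rewrite normrZ -[leRHS]mul1r ler_pM.
by rewrite addrAC => te; apply: le_trans (ler_normD _ _) _; lra.
Qed.

Lemma Mol_submean (a : R) (P : I -> R -> R) s H z0 r : 0 <= a -> (forall i, kern (P i)) ->
  (forall i t, 0 <= P i t) -> (forall i, lint (P i) = 1) -> blip H -> submean z0 r H ->
  submean z0 (r - (size s)%:R * a) (Mol a P s H).
Proof.
move=> a0 kP P0 P1 bH sH; elim: s => /= [|i s IH]; first by rewrite mul0r subr0.
rewrite -natr1 mulrDl mul1r opprD addrA; apply: avg_submean => //.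
  exact: Mol_blip.
by rewrite normrZ (ger0_norm a0) -[leRHS]mulr1 ler_wpM2l // bas_norm.
Qed.

Lemma dderiv_crdsum (f : V -> R) y u : differentiable f y ->
  'D_u f y = \sum_i crd i u * 'D_(bas R i) f y.
Proof.
move=> df; rewrite deriveE // {1}(crdE u) linear_sum; apply: eq_bigr => i _.
by rewrite linearZ deriveE.
Qed.

Fact hes_key : unit. Proof. by []. Qed.
Definition hes : (V -> R) -> V -> V -> V -> R :=
  locked_with hes_key (fun F z p q => 'D_p ('D_q F) z).
Lemma hesE F z p q : 'D_p ('D_q F) z = hes F z p q.
Proof. by rewrite [hes]unlock. Qed.

Section Hessian.
Variables (U : set V) (F : V -> R).
Hypotheses (oU : open U) (sF : smooth_on U F).

Lemma hesC z p q : U z -> hes F z p q = hes F z q p.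
Proof.
move=> Uz; apply: etrans (esym (hesE _ _ _ _)) _; apply: etrans _ (hesE _ _ _ _).
exact: (schwarz p q oU sF Uz).
Qed.

Lemma hes_diff p z : U z -> differentiable ('D_p F) z.
Proof. exact: smooth_diff (smooth_deriv _ sF). Qed.

Lemma hesL z p q u (a b : R) : U z ->
  hes F z p (a *: q + b *: u) = a * hes F z p q + b * hes F z p u.
Proof.
move=> Uz; have dp := hes_diff p Uz.
apply: etrans (hesC p _ Uz) _; apply: etrans (esym (hesE _ _ _ _)) _.
apply: etrans (dderivDv (a *: q) (b *: u) dp) _.
apply: etrans (congr2 +%R (dderivZv q a dp) (dderivZv u b dp)) _.
by rewrite (hesE F z q p) (hesE F z u p) (hesC q p Uz) (hesC u p Uz).
Qed.

Lemma hes_scale z u (c : R) : U z -> hes F z (c *: u) (c *: u) = c ^+ 2 * hes F z u u.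
Proof.
move=> Uz; have H p : hes F z p (c *: u) = c * hes F z p u.
  by have := hesL p u u c 0 Uz; rewrite scale0r addr0 mul0r addr0.
by rewrite H (hesC _ _ Uz) H mulrA expr2.
Qed.

Lemma hes_crdl z p u : U z -> hes F z u p = \sum_i crd i u * hes F z (bas R i) p.
Proof.
move=> Uz; apply: etrans (esym (hesE _ _ _ _)) _.
apply: etrans (dderiv_crdsum u (hes_diff p Uz)) _.
by apply: eq_bigr => i _; rewrite (hesE F z (bas R i) p).
Qed.

Lemma hes_crd y u : U y -> hes F y u u =
  \sum_j crd j u * \sum_i crd i u * hes F y (bas R i) (bas R j).
Proof.
move=> Uy; rewrite (hes_crdl u u Uy); apply: eq_bigr => j _; congr (_ * _).
by rewrite (hesC _ _ Uy) (hes_crdl _ u Uy).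
Qed.

Lemma hes_bound y u : U y -> `|hes F y u u| <=
  `|u| ^+ 2 * \sum_j \sum_i `|hes F y (bas R i) (bas R j)|.
Proof.
move=> Uy; rewrite (hes_crd u Uy) (le_trans (ler_norm_sum _ _ _)) // mulr_sumr ler_sum // => j _.
rewrite normrM expr2 -mulrA ler_pM ?crd_le // (le_trans (ler_norm_sum _ _ _)) // mulr_sumr ler_sum // => i _.
by rewrite normrM ler_wpM2r // crd_le.
Qed.

Lemma hes_dist y z u : U y -> U z -> `|hes F y u u - hes F z u u| <=
  `|u| ^+ 2 * \sum_j \sum_i `|hes F y (bas R i) (bas R j) - hes F z (bas R i) (bas R j)|.
Proof.
move=> Uy Uz; rewrite (hes_crd u Uy) (hes_crd u Uz) -sumrB.
rewrite (le_trans (ler_norm_sum _ _ _)) // mulr_sumr ler_sum // => j _.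
rewrite -mulrBr normrM expr2 -mulrA ler_pM ?crd_le //.
rewrite -sumrB (le_trans (ler_norm_sum _ _ _)) // mulr_sumr ler_sum // => i _.
by rewrite -mulrBr normrM ler_wpM2r // crd_le.
Qed.

Lemma hes_continuous p q z : U z -> {for z, continuous (fun y => hes F y p q)}.
Proof.
move=> Uz; have -> : (fun y => hes F y p q) = 'D_p ('D_q F).
  by apply/funext => y; rewrite -hesE.
apply: differentiable_continuous; apply: smooth_diff Uz.
by do 2! apply: smooth_deriv.
Qed.

Lemma hes_close z (e : R) : U z -> 0 < e -> exists2 r : R, 0 < r &
  forall y, `|y - z| < r -> U y /\ forall u, `|hes F y u u - hes F z u u| <= e * `|u| ^+ 2.
Proof.
move=> Uz e0; pose K := (#|{: I * I}|.+1)%:R : R.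
have K0 : 0 < K by rewrite ltr0n.
pose f (ij : I * I) y := `|hes F y (bas R ij.1) (bas R ij.2) - hes F z (bas R ij.1) (bas R ij.2)| < e / K.
have nf ij : \forall y \near z, f ij y.
  have := @hes_continuous (bas R ij.1) (bas R ij.2) z Uz.
  move=> /cvgrPdist_lt/(_ _ (divr_gt0 e0 K0)); apply: filterS => y.
  by rewrite /f distrC.
have : \forall y \near z, U y /\ forall ij, f ij y.
  apply: filterI; first exact: (near_open oU Uz).
  exact: (@filter_forall V (I * I)%type (fun ij y => f ij y) (nbhs z) _ nf).
rewrite -near_nbhs; case/nbhs_ballP=> r /= r0 hr; exists r => // y yr.
have [|Uy hy] := hr y; first by rewrite -ball_normE /= distrC.
split=> // u; apply: le_trans (hes_dist u Uy Uz) _.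
rewrite mulrC ler_wpM2r ?exprn_ge0 // pair_big /=.
apply: (@le_trans _ _ (\sum_(p : I * I) e / K)).
  by apply: ler_sum => -[j i] _; exact: ltW (hy (i, j)).
rewrite sumr_const -mulr_natr -mulrA ler_piMr ?(ltW e0) // mulrC ler_pdivrMr // mul1r ler_nat.
exact: leqnSn.
Qed.

(** The mean value theorem for F(y) - F(y - u), and then for the derivative of F along [u]. *)
Lemma second_diff a u : (forall s : R, -1 <= s <= 1 -> U (a + s *: u)) ->
  exists2 s : R, `|s| <= 1 & F (a + u) + F (a - u) - 2 * F a = hes F (a + s *: u) u u.
Proof.
move=> hU.
have dsh y : differentiable F (y - u) -> differentiable (fun y => F (y - u)) y /\
    'D_u (fun y => F (y - u)) y = 'D_u F (y - u).
  move=> dF; have dt : differentiable (fun y : V => y - u) y.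
    have st : smooth_on [set: V] (fun y : V => y + - u).
      by apply: smoothD; [exact: openT|exact: smooth_id openT|exact: smooth_cst openT].
    exact: smooth_diff st Logic.I.
  split; first exact: (differentiable_comp dt dF).
  apply: (congr1 (fun f : R -> R => lim (f @ 0^'))); apply/funext => s /=.
  by rewrite addrA.
have sub (s : R) : a + s *: u - u = a + (s - 1) *: u by rewrite scalerBl scale1r addrA.
have [|c c01] := @line_MVT _ _ (fun y => F y - F (y - u)) a u.
  move=> s s01; have [s0 s1] := andP s01.
  apply: differentiableB; first by apply: (smooth_diff sF); apply: hU; lra.
  apply: (dsh _ _).1; rewrite sub; apply: (smooth_diff sF); apply: hU; lra.
have [c0 c1] := andP c01.
have d0 : differentiable F (a + c *: u) by apply: (smooth_diff sF); apply: hU; lra.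
have [d1 e1] : differentiable (fun y => F (y - u)) (a + c *: u) /\
    'D_u (fun y => F (y - u)) (a + c *: u) = 'D_u F (a + c *: u - u).
  by apply: dsh; rewrite sub; apply: (smooth_diff sF); apply: hU; lra.
rewrite (dderivB u d0 d1) e1 addrK => E1.
have [|d d01 E2] := @line_MVT _ _ ('D_u F) (a + c *: u - u) u.
  move=> s /andP[s0 s1]; apply: hes_diff.
  by rewrite sub -addrA -scalerDl; apply: hU; lra.
have [d0' d1'] := andP d01.
exists (c - 1 + d); first by rewrite ler_norml; lra.
rewrite scalerDl addrA -sub -hesE; apply: etrans E2; rewrite subrK -E1.
move: (F _) (F _) (F _) => f1 f2 f3; ring.
Qed.

Definition levi (G : V -> R) z v : R := hes G z v v + hes G z (J v) (J v).

(** By bilinearity and cos^2 + sin^2 = 1. Consequently every sample point of the circle contributes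
    the same second-order term, however the finite sample is distributed. *)
Lemma levi_rot z v t : U z -> levi F z (rot t v) = levi F z v.
Proof.
move=> Uz; rewrite /levi -rotJ !rotE JJ scalerN -scaleNr.
have L p q u a b := hesL p q u a b Uz; have S p q := hesC p q Uz.
rewrite !L ![hes F z (_ + _) _]S !L (S (J v) v).
have := cos2Dsin2 t; move: (cos t) (sin t) => c s; rewrite !expr2 => cs.
move: (hes F z v v) (hes F z (J v) (J v)) (hes F z v (J v)) => p q m.
rewrite [LHS](_ : _ = (c * c + s * s) * (p + q)); last by ring.
by rewrite cs mul1r.
Qed.

End Hessian.

(** In [quad] the first-order terms cancel and the second-order term at each sample point is c^2
    times the Levi form, up to a small error. Summing, dividing by the number of sample points and
    by c^2, and letting the error tend to 0 gives the sign. *)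
Lemma levi_ge0 F z0 (r : R) z v : smooth_on [set: V] F -> 0 < r -> submean z0 r F ->
  `|z - z0| <= r -> 0 <= levi F z v.
Proof.
move=> sF r0 sm zr; have oT := @openT V.
suff H (e : R) : 0 < e -> 0 <= levi F z v + e * (8 * `|v| ^+ 2 + 1).
  have k0 : 0 < 8 * `|v| ^+ 2 + 1 by rewrite ltr_wpDl // mulr_ge0 // exprn_ge0.
  apply/ler_addgt0Pr => e e0; have := H _ (divr_gt0 e0 k0).
  by rewrite divfK ?gt_eqF.
move=> e0; have [d d0 hd] := hes_close oT sF (z := z) Logic.I e0.
have v1 : 0 < 2 * `|v| + 1 by rewrite ltr_wpDl // mulr_ge0.
(* The first bound makes [c *: v] admissible in [submean]; the second, with [rot_norm], keeps the
   rotated vectors where the Hessian varies by at most [e]. *)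
pose c := Num.min (r / (`|v| + 1)) (d / (2 * `|v| + 1)).
have c0 : 0 < c by rewrite lt_min !divr_gt0 // ltr_wpDl.
have c1 : `|c *: v| <= r.
  have : c <= r / (`|v| + 1) by rewrite ge_min lexx.
  rewrite ler_pdivlMr ?ltr_wpDl // normrZ (gtr0_norm c0); apply: le_trans.
  by rewrite ler_wpM2l ?(ltW c0) // lerDl.
have c2 t : `|c *: rot t v| < d.
  have : c <= d / (2 * `|v| + 1) by rewrite ge_min lexx orbT.
  rewrite ler_pdivlMr // normrZ (gtr0_norm c0); apply: lt_le_trans.
  by rewrite ltr_pM2l // (le_lt_trans (rot_norm _ _)) // ltrDl.
have D u : `|c *: u| < d -> `|u| <= 2 * `|v| ->
    F (z + c *: u) + F (z - c *: u) - 2 * F z <= c ^+ 2 * (hes F z u u + e * (4 * `|v| ^+ 2)).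
  move=> cu uv; have [//|s s1 ->] := second_diff sF (a := z) (u := c *: u).
  have yd : `|z + s *: (c *: u) - z| < d.
    rewrite addrAC subrr add0r normrZ; apply: le_lt_trans cu.
    by rewrite -[leRHS]mul1r ler_wpM2r.
  have [_ /(_ u)] := hd _ yd; move: (z + _) => y.
  rewrite (hes_scale oT sF u c Logic.I).
  move=> hy; rewrite ler_wpM2l ?exprn_ge0 ?(ltW c0) //.
  have : `|u| ^+ 2 <= 4 * `|v| ^+ 2.
    rewrite (_ : 4 * `|v| ^+ 2 = (2 * `|v|) ^+ 2); last by ring.
    by rewrite lerXn2r ?nnegrE ?mulr_ge0.
  move=> /(ler_wpM2l (ltW e0)); move: hy; rewrite ler_norml; lra.
have Q t : quad F z (rot t (c *: v)) - 4 * F z <= c ^+ 2 * (levi F z v + e * (8 * `|v| ^+ 2)).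
  rewrite rotZ /quad [J (c *: _)]linearZ.
  have h1 := D _ (c2 t) (rot_norm t v).
  have h2 := D (J (rot t v)).
  rewrite -(levi_rot oT sF v t Logic.I) /levi.
  have /h2/(_ (le_trans (J_norm _) (rot_norm t v))) : `|c *: J (rot t v)| < d.
    by apply: le_lt_trans (c2 t); rewrite !normrZ ler_wpM2l // J_norm.
  move: h1; rewrite !mulrDr; lra.
(* The error allowed in [submean] is taken of the order c^2 of the second differences. *)
have ce0 : 0 < c ^+ 2 * e by rewrite mulr_gt0 // exprn_gt0.
have [s [s0 hs]] := sm _ _ c1 ce0.
have := hs z zr.
have : \sum_(t <- s) quad F z (rot t (c *: v)) <=
    (size s)%:R * (4 * F z + c ^+ 2 * (levi F z v + e * (8 * `|v| ^+ 2))).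
  elim: s {s0 hs} => [|t s IH]; first by rewrite big_nil mul0r.
  by rewrite big_cons /= -natr1 mulrDl mul1r addrC lerD //; have := Q t; lra.
move=> h1 h2; have := le_trans h2 (lerD h1 (lexx _)).
rewrite -mulrDr ler_pM2l ?ltr0n // -addrA lerDl -mulrDr pmulr_rge0 ?exprn_gt0 //.
by rewrite mulrDr mulr1 addrA.
Qed.

End Submean.

(** * Upper semicontinuity and truncation *)

Section Semicontinuity.
Variables (R : realType) (T : topologicalType).
Implicit Types (u : T -> \bar R) (x y : T).

Definition usc_at u x := forall b : R, (u x < b%:E)%E -> \forall y \near x, (u y < b%:E)%E.

Lemma lt_fin_ex (a : \bar R) : (a < +oo)%E -> exists b : R, (a < b%:E)%E.
Proof. by case: a => [r _| |_] //; [exists (r + 1); rewrite lte_fin ltrDl|exists 0; exact: ltNyr]. Qed.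

Lemma usc_bounded (K : set T) u : compact K ->
  (forall x, K x -> usc_at u x /\ (u x < +oo)%E) ->
  exists M : R, forall x, K x -> (u x <= M%:E)%E.
Proof.
move=> /compact_near_coveringP cK hu.
have := cK R (pinfty_nbhs R) (fun M x => (u x < M%:E)%E) _.
case=> [x Kx|M [_ H]].
  have [us /lt_fin_ex[b ub]] := hu x Kx.
  exists ([set y | (u y < b%:E)%E], [set M | b < M]) => /=; first split.
  - exact: us.
  - by exists b; split=> //; rewrite num_real.
  by move=> [y M] /= [h1 h2]; apply: lt_trans h1 _; rewrite lte_fin.
exists (M + 1) => x Kx; apply: ltW; apply: (H (M + 1)) => //.
by rewrite ltrDl.
Qed.

Lemma usc_add u (g : T -> R) x : usc_at u x -> (u x < +oo)%E -> {for x, continuous g} ->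
  usc_at (fun y => (u y + (g y)%:E)%E) x.
Proof.
move=> us ux cg b ub.
have [a ua ab] : exists2 a : R, (u x < a%:E)%E & a + g x < b.
  move: ub ux; case: (u x) => [r| |] //= ub _.
    rewrite -EFinD lte_fin in ub; exists (r + (b - g x - r) / 2); rewrite ?lte_fin; lra.
  by exists (b - g x - 1); [exact: ltNyr|lra].
have d0 : 0 < b - a - g x by lra.
have H2 : \forall y \near x, `|g x - g y| < b - a - g x by move/cvgrPdist_lt: cg => /(_ _ d0).
apply: filterS2 (us a ua) H2 => y h1; rewrite distrC ltr_norml => /andP[_ h2].
apply: (@lt_trans _ _ (a%:E + (g y)%:E)%E); first by rewrite lteD2rE.
by rewrite -EFinD lte_fin; lra.
Qed.

Lemma usc_max u (c : \bar R) x : usc_at u x -> usc_at (fun y => maxe (u y) c) x.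
Proof.
move=> us b; rewrite gt_max => /andP[/us ub cb].
by apply: filterS ub => y yb; rewrite gt_max yb cb.
Qed.

Lemma usc_fin (h : T -> R) x : usc_at (EFin \o h) x ->
  forall a, h x < a -> \forall y \near x, h y < a.
Proof. by move=> us a; have := us a; rewrite /= lte_fin => H /H; apply: filterS => y; rewrite lte_fin. Qed.

Lemma fine_max_bound (a : \bar R) (k M : R) : (a <= M%:E)%E ->
  [/\ maxe a (- k)%:E \is a fin_num, - k <= fine (maxe a (- k)%:E)
    & fine (maxe a (- k)%:E) <= Num.max M (- k)].
Proof.
move=> aM; have fa : maxe a (- k)%:E \is a fin_num.
  rewrite fin_numE; apply/andP; split.
    by rewrite gt_eqF // lt_max ltNyr orbT.
  by rewrite lt_eqF // gt_max ltry andbT (le_lt_trans aM) // ltry.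
split=> //; rewrite -lee_fin fineK ?le_max ?lexx ?orbT //.
rewrite ge_max; apply/andP; split; last by rewrite lee_fin le_max lexx orbT.
by apply: le_trans aM _; rewrite lee_fin le_max lexx.
Qed.

End Semicontinuity.

Section HessianSum.
Variables (R : realType) (n : nat).
Local Notation V := (Cn R n).
Implicit Types (u v w z : V) (F G : V -> R).

Lemma hesD F G (c : R) z p q (U : set V) : open U -> smooth_on U F -> smooth_on U G -> U z ->
  hes (fun y => F y + c * G y) z p q = hes F z p q + c * hes G z p q.
Proof.
move=> oU sF sG Uz.
have sE H y : smooth_on U H -> U y -> differentiable H y by move=> sH; exact: smooth_diff sH.
have D1 (H K : V -> R) y v : differentiable H y -> differentiable K y ->
    'D_v (fun y => H y + c * K y) y = 'D_v H y + c * 'D_v K y.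
  move=> dH dK; have dcK : differentiable (fun y => cst c y * K y) y.
    by apply: differentiableM => //; exact: differentiable_cst.
  apply: etrans (dderivD v dH dcK) _; congr (_ + _).
  by rewrite (dderivM v (differentiable_cst c y) dK) dderiv_cst mul0r add0r.
apply: etrans (esym (hesE _ _ _ _)) _.
have -> : 'D_p ('D_q (fun y => F y + c * G y)) z = 'D_p (fun y => 'D_q F y + c * 'D_q G y) z.
  apply: near_eq_derive; apply: (near_open oU Uz) => y Uy.
  by apply: D1; exact: sE Uy.
have dF := smooth_diff (smooth_deriv q sF) Uz; have dG := smooth_diff (smooth_deriv q sG) Uz.
by rewrite (D1 _ _ z p dF dG) (hesE F) (hesE G).
Qed.

Lemma hes_sq (l : V -> R) (c : R) z v : smooth_on [set: V] l ->
  (forall y, 'D_v l y = c) -> hes (fun y => l y * l y) z v v = 2 * c ^+ 2.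
Proof.
move=> sl lc; have dl y : differentiable l y by exact: (smooth_diff sl).
apply: etrans (esym (hesE _ _ _ _)) _.
have -> : 'D_v (fun y => l y * l y) = (fun y => cst (2 * c) y * l y).
  by apply/funext => y; rewrite (dderivM v (dl y) (dl y)) lc /cst; ring.
by rewrite (dderivM v (differentiable_cst _ z) (dl z)) dderiv_cst lc mul0r add0r /cst; ring.
Qed.

Lemma hes_qd z0 z v : hes (fun y => qd (y - z0)) z v v = 2 * qd v.
Proof.
have oT := @openT V.
have sl i : smooth_on [set: V] (fun y : V => crd i (y - z0)).
  apply: (@smooth_crd R n _ (fun y : V => y + - z0) setT i oT).
  by apply: smoothD => //; [exact: smooth_id|exact: smooth_cst].
have Dl i y : 'D_v (fun y : V => crd i (y - z0)) y = crd i v.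
  have dt : differentiable (fun y : V => y + - z0) y.
    have st : smooth_on [set: V] (fun y : V => y + - z0).
      by apply: smoothD => //; [exact: smooth_id|exact: smooth_cst].
    exact: smooth_diff st Logic.I.
  apply: etrans (dderiv_crd v i dt) _; congr (crd i _).
  have di : differentiable (fun y : V => y) y by exact: (smooth_diff (smooth_id oT) Logic.I).
  apply: etrans (dderivD v di (differentiable_cst (- z0) y)) _.
  by rewrite dderiv_cst addr0 derive_id.
have S r : smooth_on [set: V] (fun y : V => \sum_(i <- r) crd i (y - z0) * crd i (y - z0)) /\
    hes (fun y : V => \sum_(i <- r) crd i (y - z0) * crd i (y - z0)) z v v = 2 * \sum_(i <- r) crd i v ^+ 2.
  elim: r => [|i r [sr hr]].
    rewrite big_nil mulr0; split.
      by rewrite (_ : (fun y => _) = fun=> 0); [exact: smooth_cst|apply/funext => y; rewrite big_nil].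
    rewrite (_ : (fun y => _) = fun=> 0); last by apply/funext => y; rewrite big_nil.
    apply: etrans (esym (hesE _ _ _ _)) _.
    have -> : 'D_v (fun=> 0 : R) = (fun=> 0) by apply/funext => y; rewrite dderiv_cst.
    by rewrite dderiv_cst.
  have E : (fun y : V => \sum_(i <- i :: r) crd i (y - z0) * crd i (y - z0)) =
      (fun y : V => crd i (y - z0) * crd i (y - z0) + 1 * \sum_(i <- r) crd i (y - z0) * crd i (y - z0)).
    by apply/funext => y; rewrite big_cons mul1r.
  have s1 : smooth_on [set: V] (fun y : V => crd i (y - z0) * crd i (y - z0)) by exact: smoothM.
  split.
    by rewrite E; apply: smoothD => //; apply: smoothZ.
  by rewrite E (hesD 1 v v oT s1 sr Logic.I) (hes_sq z (sl i) (Dl i)) hr big_cons mul1r mulrDr.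
by have [_ <-] := S (index_enum _).
Qed.

Lemma qd_le v : qd v <= (n + n)%:R * `|v| ^+ 2.
Proof.
rewrite /qd (_ : (n + n)%N = #|{: 'I_n + 'I_n}|); last by rewrite card_sum card_ord.
rewrite mulr_natl -sumr_const ler_sum // => i _.
by rewrite -real_normK ?num_real // lerXn2r ?nnegrE // crd_le.
Qed.

End HessianSum.

(** * Local smoothing of truncated quasi-psh functions *)

Section LocalSmoothing.
Variables (R : realType) (n : nat).
Local Notation V := (Cn R n).
Implicit Types (u v w z : V) (H : V -> R).

Lemma rot_continuous w v : continuous (fun t : R => w + rot t v).
Proof.
move=> t; under eq_fun do rewrite rotE; apply: cvgD; first exact: cvg_cst.
apply: cvgD; apply: cvgZr_tmp; [exact: continuous_cos|exact: continuous_sin].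
Qed.

Lemma four_sub (a1 a2 a3 a4 b b1 b2 b3 b4 : R) : 4 * b <= b1 + b2 + b3 + b4 ->
  a1 - b1 + (a2 - b2) + (a3 - b3) + (a4 - b4) <= a1 + a2 + a3 + a4 + - (4 * b).
Proof. lra. Qed.

Lemma four_mean (i1 i2 i3 i4 i5 a b p : R) : i1 + i2 + i3 + i4 <= i5 - p * (4 * b) ->
  p * a <= i4 -> p * a <= i3 -> p * a <= i2 -> p * a <= i1 -> p * (4 * (a + b)) <= i5.
Proof. by rewrite [4 * (a + b)]mulrDr mulrDr ![p * (4 * _)]mulrCA; lra. Qed.

(** If the maximum at [w] is -k, the bound below by -k on the circle and the quadratic term suffice.
    If it is f + g, the submean inequality of [f] is used on the four circles through v, -v, J v and
    -J v, while [A] compensates the possibly negative Levi form of [g]. *)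
Lemma psh_sub_at (U : set V) (f : V -> \bar R) (g h : V -> R) z0 (r A k : R) w v :
  psh_on U f -> smooth_on U g -> (forall y, `|y - z0| <= r -> U y) ->
  (forall y, `|y - z0| <= r ->
    h y = fine (maxe (f y + (g y)%:E)%E (- k)%:E) + A * qd (y - z0)) ->
  (forall y u, `|y - z0| + `|u| <= r -> - (4 * A) * qd u <= quad g y u - 4 * g y) ->
  0 <= A -> `|w - z0| + 2 * `|v| <= r -> sub_at h w v.
Proof.
move=> [fy _ fm] sg rU hE gq A0 wv H L L0 HL hH; have p0 := pi2_gt0 R.
have disc x : `|x| <= 2 * `|v| -> `|w + x - z0| <= r.
  by move=> xv; rewrite addrAC (le_trans (ler_normD _ _)) //; lra.
have fb y : `|y - z0| <= r -> [/\ maxe (f y + (g y)%:E)%E (- k)%:E \is a fin_num,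
    - k <= fine (maxe (f y + (g y)%:E)%E (- k)%:E) &
    (f y + (g y)%:E <= (fine (maxe (f y + (g y)%:E) (- k)%:E))%:E)%E].
  move=> /rU Uy; have := fy y Uy; case E : (f y) => [a| |] // _.
    have [h1 h2 _] := fine_max_bound k (lexx (a + g y)%:E).
    by split=> //; rewrite fineK // le_max lexx.
  have [h1 h2 _] := fine_max_bound k (leNye 0%:E).
  by split=> //; rewrite fineK // le_max lexx.
(* The smooth part together with its correction: [gq] says exactly that P satisfies the submean
   inequality for [quad]. *)
pose P y := g y + A * qd (y - z0).
have quadP t : 4 * P w <= quad P w (rot t v).
  have := gq w (rot t v) _; have rn := rot_norm t v.
  have := quad_qd z0 w (rot t v).
  rewrite /quad /P => E1 E2; have := E2 _; clear E2.
  move: E1; rewrite mulNr -mulrA.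
  move: (qd (w - z0)) (qd (rot t v)) (qd _) (qd _) (qd _) (qd _) => q0 q1 q2 q3 q4 q5 E.
  move=> /(_ ltac:(lra)); move: (g _) (g _) (g _) (g _) (g _) => g1 g2 g3 g4 g5.
  have : A * (q5 + q4 + q3 + q2) = A * (4 * q0 + 4 * q1) by rewrite E.
  by rewrite !mulrDr; lra.
have cq : continuous (fun t => quad H w (rot t v)) := lipschitz_continuous (quad_rot_lip w v L0 HL).
have wr : `|w - z0| <= r by have := disc 0; rewrite normr0 addr0; apply; rewrite mulr_ge0.
have disc4 (Q : V -> Prop) : (forall y, `|y - z0| <= r -> Q y) -> forall t,
    [/\ Q (w + rot t v), Q (w - rot t v), Q (w + J (rot t v)) & Q (w - J (rot t v))].
  move=> HQ t; have rn := rot_norm t v; have jn := le_trans (J_norm (rot t v)) rn.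
  by split; apply: HQ; apply: disc; rewrite ?normrN.
rewrite (hE w wr); have [fk|fk] := leP (f w + (g w)%:E)%E (- k)%:E.
  rewrite /= -cint_cst; apply: cint_le => // [t|t]; first exact: cvg_cst.
  have low y : `|y - z0| <= r -> - k + A * qd (y - z0) <= H y.
    move=> yr; apply: le_trans (hH y); rewrite hE // lerD2r.
    by have [_ -> _] := fb y yr.
  have [h1 h2 h3 h4] := disc4 _ low t.
  have := quad_qd z0 w (rot t v); rewrite /quad.
  have : 0 <= A * qd (rot t v) by rewrite mulr_ge0 // qd_ge0.
  move: h1 h2 h3 h4; move: (H _) (H _) (H _) (H _) => a1 a2 a3 a4.
  move: (qd (w - z0)) (qd (rot t v)) (qd _) (qd _) (qd _) (qd _) => q0 q1 q2 q3 q4 q5 h1 h2 h3 h4 h5 E.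
  have : A * (q5 + q4 + q3 + q2) = A * (4 * q0 + 4 * q1) by rewrite E.
  by rewrite !mulrDr; lra.
have [c fc] : exists c, f w = c%:E.
  move: fk (fy w (rU w wr)); case: (f w) => [c| |] //=; first by exists c.
have cP x : `|x| <= `|v| -> continuous (fun t => P (w + rot t x)).
  move=> xv t; apply: (@continuous_comp _ _ _ (fun t : R => w + rot t x) P).
    exact: rot_continuous.
  have Uy : U (w + rot t x) by apply: rU; apply: disc; have := rot_norm t x; lra.
  apply: cvgD.
    by apply: differentiable_continuous; exact: smooth_diff sg Uy.
  apply: cvgM; first exact: cvg_cst.
  have sq := smooth_qd z0 (@openT V).
  exact: (differentiable_continuous (smooth_diff (z := w + rot t x) sq Logic.I)).
(* It dominates [f] along the circle, so the extended-real mean of [f] is compared with the mean of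
   a continuous function. *)
pose G x t := H (w + rot t x) - P (w + rot t x).
have cG x : `|x| <= `|v| -> continuous (G x).
  move=> xv t; apply: cvgB; last exact: cP.
  apply: (@lipschitz_continuous _ (fun t => H (w + rot t x)) (L * (2 * `|x|))) => s s'.
  apply: le_trans (HL _ _) _; rewrite opprD addrACA subrr add0r -mulrA ler_wpM2l //.
  exact: rot_lip.
have mG x : `|x| <= `|v| -> 2 * pi * c <= cint (G x).
  move=> xv; apply: (@mean_le R (fun t => f (w + rot t x)) (G x) c (cG x xv)).
    move=> t; have yr : `|w + rot t x - z0| <= r by apply: disc; have := rot_norm t x; lra.
    have [_ _ h3] := fb _ yr; have := hH (w + rot t x); rewrite (hE _ yr) => h4.
    move: h3 h4; rewrite /G /P; move: (w + rot t x) => y h3 h4.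
    rewrite -(@leeD2rE _ (g y)%:E) // -EFinD; apply: le_trans h3 _.
    by rewrite lee_fin; lra.
  rewrite -fc; apply: fm => zeta zeta1; apply: rU; apply: disc.
  by have := cscale_norm x zeta1; lra.
have n1 : `|- v| <= `|v| by rewrite normrN.
have n2 := J_norm v; have n3 : `|- J v| <= `|v| by rewrite normrN.
have := mG v (lexx _); have := mG _ n1; have := mG _ n2; have := mG _ n3.
have c1 := cG v (lexx _); have c2 := cG _ n1; have c3 := cG _ n2; have c4 := cG _ n3.
have c12 : continuous (fun t => G v t + G (- v) t) by move=> t; apply: cvgD; [exact: c1|exact: c2].
have c123 : continuous (fun t => G v t + G (- v) t + G (J v) t) by move=> t; apply: cvgD; [exact: c12|exact: c3].
have c1234 : continuous (fun t => G v t + G (- v) t + G (J v) t + G (- J v) t) by move=> t; apply: cvgD; [exact: c123|exact: c4].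
have E : cint (G v) + cint (G (- v)) + cint (G (J v)) + cint (G (- J v)) =
    cint (fun t => G v t + G (- v) t + G (J v) t + G (- J v) t).
  by rewrite -cintD // -cintD // -cintD.
have : cint (fun t => G v t + G (- v) t + G (J v) t + G (- J v) t) <=
    cint (fun t => quad H w (rot t v) + - (4 * P w)).
  apply: cint_le => // [t|t]; first by apply: cvgD; [exact: cq|exact: cvg_cst].
  have := quadP t; rewrite /G /quad !rotN rotJ.
  exact: four_sub.
have cc : continuous (fun _ : R => - (4 * P w)) by move=> x; exact: cvg_cst.
rewrite (etrans (cintD cq cc) (congr1 _ (cint_cst _))).
rewrite -E fc /= mulrN -/(P w).
have -> : c + g w + A * qd (w - z0) = c + P w by rewrite /P addrA.
exact: four_mean.
Qed.


(** The radius and [A] depend on [f] and [g] only, whereas the bound [B] and the functions may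
    depend on [k]: uniformity in [k] is needed for the curvature loss alone. *)
Lemma psh_smoothing (U : set V) (f : V -> \bar R) (g : V -> R) z0 :
  open U -> U z0 -> psh_on U f -> smooth_on U g ->
  exists r A : R, [/\ 0 < r, 0 <= A, forall y, `|y - z0| <= r -> U y &
    forall k : R, exists (B : R) (F : nat -> V -> R),
    [/\ forall N, smooth_on [set: V] (F N),
        forall N z, `|z - z0| <= r -> `|F N z| <= B,
        forall z, `|z - z0| <= r ->
          F ^~ z @ \oo --> fine (maxe (f z + (g z)%:E)%E (- k)%:E)
      & forall N z v, `|z - z0| <= r -> - (A * qd v) <= levi (F N) z v]].
Proof.
move=> oU Uz0 pf sg; have [fy us _] := pf; have oT := @openT V.
have [r1 r10 hr1] := hes_close oU sg Uz0 ltr01.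
pose C := \sum_j \sum_i `|hes g z0 (bas R i) (bas R j)|.
have C0 : 0 <= C by apply: sumr_ge0 => j _; apply: sumr_ge0.
have gh y u : `|y - z0| < r1 -> `|hes g y u u| <= (C + 1) * `|u| ^+ 2.
  move=> /hr1[_ /(_ u)]; have := hes_bound oU sg u Uz0; rewrite -/C => h1 h2.
  rewrite -(subrK (hes g z0 u u) (hes g y u u)); apply: le_trans (ler_normD _ _) _.
  by lra.
pose rho := r1 / 2; have rho0 : 0 < rho by rewrite divr_gt0.
have rr1 : rho < r1 by rewrite /rho; lra.
have rU y : `|y - z0| <= rho -> U y by move=> yr; have [] := hr1 y (le_lt_trans yr rr1).
(* A bound for the Hessian of [g] near [z0], where [C] is its bound at [z0]. *)
pose A := C + 1; have A0 : 0 <= A by rewrite addr_ge0.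
have gq y u : `|y - z0| + `|u| <= rho -> - (4 * A) * qd u <= quad g y u - 4 * g y.
  move=> yu.
  have S x : `|x| <= `|u| -> - (A * `|u| ^+ 2) <= g (y + x) + g (y - x) - 2 * g y.
    move=> xu; have b s : `|s| <= 1 -> `|y + s *: x - z0| < r1.
      move=> s1; rewrite addrAC; apply: le_lt_trans (ler_normD _ _) _.
      apply: le_lt_trans rr1; apply: le_trans yu; rewrite lerD2l normrZ.
      by rewrite -[leRHS]mul1r ler_pM.
    have [s s1|s s1 ->] := second_diff sg (a := y) (u := x).
      have [] // := hr1 (y + s *: x); apply: b; by rewrite ler_norml.
    have := gh _ x (b s s1); rewrite ler_norml => /andP[h _]; apply: le_trans h.
    by rewrite lerN2 ler_wpM2l // lerXn2r ?nnegrE.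
  have := S u (lexx _); have := S (J u) (J_norm u); rewrite /quad.
  have : A * `|u| ^+ 2 <= A * qd u by rewrite ler_wpM2l // norm_le_qd.
  have : 0 <= A * qd u by rewrite mulr_ge0 // qd_ge0.
  rewrite mulNr -mulrA; move: (A * qd u) (A * _) (g _) (g _) (g _) (g _) (g _) => a b g1 g2 g3 g4 g5; lra.
pose uf y := (f y + (g y)%:E)%E.
have uscU z : U z -> usc_at uf z.
  move=> Uz; apply: usc_add; [by move=> b; exact: us|exact: fy|].
  by apply: differentiable_continuous; exact: smooth_diff sg Uz.
have ufy z : U z -> (uf z < +oo)%E by move=> Uz; rewrite /uf lte_add_pinfty // ?fy // ltry.
have cD : compact [set z : V | `|z - z0| <= rho].
  rewrite (_ : [set z | _] = [set z | `|z0 - z| <= rho]); first exact: ball_compact.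
  by apply/seteqP; split=> z /=; rewrite distrC.
have [M hM] := @usc_bounded R V _ uf cD (fun x Kx => conj (uscU x (rU x Kx)) (ufy x (rU x Kx))).
pose K := (n + n)%:R * rho ^+ 2 : R.
have K0 : 0 <= K by rewrite mulr_ge0 ?exprn_ge0 // ltW.
have qK z : `|z - z0| <= rho -> qd (z - z0) <= K.
  move=> zr; apply: le_trans (qd_le _) _; rewrite ler_wpM2l // lerXn2r ?nnegrE // ltW //.
(* Centres within 2 r' of [z0] and vectors of length at most r' satisfy the condition |w - z0| + 2
   |v| <= rho of [psh_sub_at]. *)
pose r' := rho / 4; have r'0 : 0 < r' by rewrite divr_gt0.
pose m : R := (size (enum {: 'I_n + 'I_n}))%:R.
exists (r' / 2), (4 * A); split=> [|||k].
- by rewrite divr_gt0.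
- by rewrite mulr_ge0.
- by move=> y yr; apply: rU; move: yr; rewrite /r'; lra.
pose T z := fine (maxe (uf z) (- k)%:E).
(* Sup-convolution needs a function on the whole space. The value -k is a lower bound of the
   function in the closed ball, so the extension remains upper semicontinuous across the
   boundary. *)
pose h z := if `|z - z0| <= rho then T z + A * qd (z - z0) else - k.
have hT z : `|z - z0| <= rho -> [/\ maxe (uf z) (- k)%:E \is a fin_num, - k <= T z & T z <= Num.max M (- k)].
  by move=> zr; apply: fine_max_bound; exact: hM.
pose B := `|M| + `|k| + A * K.
have TB z : `|z - z0| <= rho -> `|T z| <= `|M| + `|k|.
  move=> /hT[_ h1 h2]; rewrite ler_norml; apply/andP; split.
    by apply: le_trans h1; rewrite lerN2 (le_trans (ler_norm k)) // lerDr.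
  apply: le_trans h2 _; rewrite ge_max (le_trans (ler_norm M)) ?lerDl //=.
  by rewrite (le_trans (ler_norm _)) // normrN lerDr.
have AK0 : 0 <= A * K by rewrite mulr_ge0.
have hB z : `|h z| <= B.
  rewrite /h; case: ifP => zr.
    apply: le_trans (ler_normD _ _) _; apply: lerD; first exact: TB.
    by rewrite ger0_norm ?mulr_ge0 ?qd_ge0 // ler_wpM2l // qK.
  by rewrite normrN /B; have := normr_ge0 M; lra.
have cn z : {for z, continuous (fun y : V => `|y - z0|)}.
  apply: (@continuous_comp _ _ _ (fun y : V => y - z0) Num.norm); last exact: norm_continuous.
  by apply: cvgB; [exact: cvg_id|exact: cvg_cst].
have husc z : usc_at (EFin \o h) z.
  have [zr|zr] := leP `|z - z0| rho; last first.
    have : \forall y \near z, rho < `|y - z0| by exact: (cvgr_gt _ (cn z)).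
    move=> nz b hb; apply: filterS nz => y yr.
    by move: hb; rewrite /= /h !ifF ?leNgt ?yr ?zr.
  have Uz := rU z zr; have [fz Tk _] := hT z zr.
  have cA : {for z, continuous (fun y : V => A * qd (y - z0))}.
    apply: cvgM; first exact: cvg_cst.
    have sq := smooth_qd z0 (@openT V).
    exact: (differentiable_continuous (smooth_diff (z := z) sq Logic.I)).
  have Af : (maxe (uf z) (- k)%:E < +oo)%E by rewrite ltey_eq fz.
  have u1 := usc_add (@usc_max R V uf (- k)%:E z (uscU z Uz)) Af cA.
  move=> b; rewrite /= /h zr lte_fin => hb.
  have : \forall y \near z, (maxe (uf y) (- k)%:E + (A * qd (y - z0))%:E < b%:E)%E.
    by apply: u1 => //; rewrite -(fineK fz) -EFinD lte_fin.
  apply: filterS => y yb; rewrite /= /h; case: ifP => yr; last first.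
    rewrite lte_fin; apply: le_lt_trans Tk _; apply: le_lt_trans hb.
    by rewrite lerDl mulr_ge0 // qd_ge0.
  by have [fy' _ _] := hT y yr; rewrite EFinD /T fineK.
have [rh [krh rh0 rh1]] := kern_bump R.
have L0 N : 0 <= N%:R + (2 * B + 1) / r' + 1 :> R.
  by rewrite !addr_ge0 // divr_ge0 ?(ltW r'0) // addr_ge0 // mulr_ge0 // (le_trans (normr_ge0 (h z0))).
(* It tends to infinity with N, and the middle term ensures 2B + 1 <= L r' from the start. *)
pose L N : R := N%:R + (2 * B + 1) / r' + 1.
have LL N : 2 * B + 1 <= L N * r'.
  by rewrite -ler_pdivrMr // /L addrAC lerDr.
have L1 N : 0 < L N by rewrite /L ltr_wpDl //; have := L0 N; rewrite /L; have := hB z0; have := normr_ge0 (h z0) => *; rewrite addr_ge0 // divr_ge0 ?(ltW r'0) //; lra.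
(* With m directions, the first bound limits the loss of radius to r'/2 and the second one the
   mollification error m L a to 1/(N+1). *)
pose a N : R := Num.min (r' / 2 / (m + 1)) ((N.+1%:R)^-1 / (m * L N + 1)).
have m0 : 0 <= m by [].
have mL N : 0 < m * L N + 1 by rewrite ltr_wpDl // mulr_ge0 // ltW.
have a0 N : 0 < a N.
  by rewrite lt_min !divr_gt0 // ltr_wpDl.
have am N : m * a N <= r' / 2.
  have : a N <= r' / 2 / (m + 1) by rewrite /a ge_min lexx.
  rewrite ler_pdivlMr ?ltr_wpDl // mulrDr mulr1 mulrC; have := a0 N; lra.
have aL N : m * (L N * a N) <= (N.+1%:R)^-1.
  have : a N <= (N.+1%:R)^-1 / (m * L N + 1) by rewrite /a ge_min lexx orbT.
  rewrite ler_pdivlMr // mulrDr mulr1 (_ : a N * (m * L N) = m * (L N * a N)); last by ring.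
  by apply: le_trans; rewrite lerDl ltW.
pose S N := supc h (L N); pose F0 N := Mol (a N) (fun=> rh) (enum {: 'I_n + 'I_n}) (S N).
have bS N : blip (S N) by apply: (supc_blip hB); exact: ltW.
have sF N : smooth_on [set: V] (F0 N) by apply: Mol_smooth.
(* The auxiliary term A qd is removed again; its Levi form 4 A qd v is the loss recorded in the
   statement. *)
exists (B + A * K), (fun N z => F0 N z + (- A) * qd (z - z0)).
have rr z : `|z - z0| <= r' / 2 -> `|z - z0| <= rho by rewrite /r'; lra.
have sq := smooth_qd z0 oT.
split=> [N|N z zr|z zr|N z v zr].
- by apply: smoothD => //; apply: smoothZ.
- apply: le_trans (ler_normD _ _) _; apply: lerD.
    by apply: Mol_bound => // y; apply: (supc_bound hB); exact: ltW.
  rewrite normrM normrN (ger0_norm A0) ger0_norm ?qd_ge0 // ler_wpM2l //.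
  by apply: qK; exact: rr.
- have hz : h z = T z + A * qd (z - z0) by rewrite /h rr.
  apply/cvgrPdist_le => e e0.
  have e2 : 0 < e / 2 by rewrite divr_gt0.
  have [N0 hN0] := supc_cvg hB e2 (usc_fin (husc z)).
  near=> N.
  have Ne : (N.+1%:R)^-1 < e / 2 by near: N; exact: (near_infty_natSinv_lt (PosNum e2)).
  have NL : N0 <= L N.
    apply: (@le_trans _ _ N%:R); first by near: N; exact: nbhs_infty_ger.
    by rewrite /L -addrA lerDl; have := L0 0%N; rewrite add0r.
  have h3 := Mol_close (fun=> krh) (fun=> rh0) (fun=> rh1) (enum {: 'I_n + 'I_n}) z (ltW (a0 N)) (bS N) (ltW (L1 N)) (fun x y => supc_lip hB x y (ltW (L1 N))).
  have h4 : `|F0 N z - S N z| <= e / 2 := le_trans h3 (le_trans (aL N) (ltW Ne)).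
  have h5 : S N z <= T z + A * qd (z - z0) + e / 2 by rewrite -hz; exact: hN0.
  have h6 : T z + A * qd (z - z0) <= S N z by rewrite -hz; apply: (supc_ge hB); exact: ltW.
  change (`|T z - (F0 N z + - A * qd (z - z0))| <= e).
  move: h4 h5 h6; rewrite mulNr; move: (F0 N z) (S N z) (T z) (A * qd _) => q1 q2 q3 q4.
  by rewrite !ler_norml => /andP[? ?] ? ?; apply/andP; split; lra.
- have -> : - (4 * A * qd v) = 0 - 4 * A * qd v by rewrite sub0r.
  have P := levi_ge0 (z0 := z0) (r := r' / 2) v (sF N) _ _ zr.
  have : 0 <= levi (F0 N) z v.
    apply: P; first by rewrite divr_gt0.
    have SM : submean z0 r' (S N).
      apply: (supc_submean hB (L1 N) (LL N)) => w u wr ur.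
      apply: (@psh_sub_at U f g h z0 rho A k w u pf sg rU) => //.
        by move=> y yr; rewrite /h yr.
      by move: wr ur; rewrite /r'; lra.
    have SM' := @Mol_submean R n (a N) (fun=> rh) (enum {: 'I_n + 'I_n}) (S N) z0 r' (ltW (a0 N)) (fun=> krh) (fun=> rh0) (fun=> rh1) (bS N) SM.
    move=> u d ur d0; have [|s [s0 hs]] := SM' u d _ d0.
      by apply: le_trans ur _; have := am N; rewrite -/m; lra.
    exists s; split=> // y yr; apply: hs; apply: le_trans yr _.
    by have := am N; rewrite -/m; lra.
  have Hd p := hesD (- A) p p oT (sF N) sq (Logic.I : [set: V] z).
  rewrite /levi (Hd v) (Hd (J v)) !hes_qd qdJ.
  by move: (hes _ _ _ _) (hes _ _ _ _) (qd v) => h1 h2 q; lra.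
Unshelve. all: by end_near.
Qed.

End LocalSmoothing.

Lemma usc_continuous (R : realType) (T : topologicalType) (g : T -> R) (x : T) :
  {for x, continuous g} -> usc_at (EFin \o g) x.
Proof.
move=> cg b; rewrite /= lte_fin => gb.
have d0 : 0 < b - g x by rewrite subr_gt0.
have H : \forall y \near x, `|g x - g y| < b - g x by move/cvgrPdist_lt: cg => /(_ _ d0).
apply: filterS H => y; rewrite distrC ltr_norml lte_fin => /andP[_]; lra.
Qed.

(** * Levi forms and (1,1)-forms on the manifold *)

Section LeviForm.
Variables (R : realType) (n : nat) (X : complexManifold R n).
Local Notation V := (Cn R n).
Local Notation C := R[i].
Local Notation Re := complex.Re.
Local Notation Im := complex.Im.
Implicit Types (c : chartIdx X) (f g : X -> R) (phi psi : diffForm X)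
  (s : seq V) (F G : V -> R) (p q z v w : V) (e : C).

Lemma hes_near F G z p q (U : set V) : open U -> U z -> (forall y, U y -> F y = G y) ->
  hes F z p q = hes G z p q.
Proof.
move=> oU Uz FG; apply: etrans (esym (hesE _ _ _ _)) _; apply: etrans _ (hesE _ _ _ _).
apply: near_eq_derive; apply: (near_open oU Uz) => y Uy.
by apply: near_eq_derive; apply: (near_open oU Uy).
Qed.

Lemma Dp_Dp_real e e' (F : V -> R) z v w (U : set V) : open U -> smooth_on U F -> U z ->
  Dp e (fun y => Dp e' (fun x => (F x)%:C) y w) z v =
  ((hes F z v w)%:C + e * (hes F z (J v) w)%:C + e' * (hes F z v (J w))%:C +
   e * e' * (hes F z (J v) (J w))%:C) / 4.
Proof.
move=> oU sF Uz.
have c1 u : csm U (fun y => ('D_u F y)%:C) by apply: csm_real => //; exact: smooth_deriv.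
have -> : (fun y => Dp e' (fun x => (F x)%:C) y w) =
    (fun y => 2^-1 * ('D_w F y)%:C + (e' / 2) * ('D_(J w) F y)%:C).
  apply/funext => y; rewrite Dp_real; move: (_%:C) (_%:C) => p q.
  by rewrite mulrDl [q / _]mulrC mulrAC.
rewrite (DpD _ _ (csmZ _ oU (c1 w)) (csmZ _ oU (c1 (J w))) Uz).
rewrite (DpZ _ _ _ oU (c1 w) Uz) (DpZ _ _ _ oU (c1 (J w)) Uz) !Dp_real.
rewrite (hesE F z v w) (hesE F z (J v) w) (hesE F z v (J w)) (hesE F z (J v) (J w)).
have -> : (4 : C)^-1 = 2^-1 * 2^-1 by rewrite -invfM -natrM.
move: (_%:C) (_%:C) (_%:C) (_%:C) (2^-1) => h1 h2 h3 h4 t; ring.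
Qed.

(** On a pair (v, J v) the right side becomes kappa/2 times the Levi form, since J J v = -v. This
    links the form dd^c f with the real second derivatives controlled by the smoothing. *)
Lemma local_ddc (kappa : R) f c z v w : smooth_fun f -> chart_image c z ->
  let F := f \o chart_param c in
  local_expr c (ddc kappa (fmul f (@fone R n X))) z [:: v; w] =
  (kappa / 2 * (hes F z (J v) w - hes F z v (J w)))%:C.
Proof.
move=> sf cz F; have oU := @image_open R n X c; have sF := sf c.
have kf : kform 0 (fmul f (@fone R n X)).
  by apply: (@kform_bidegree R n X 0 0); apply: bid_fmul => //; exact: bid_fone.
have k1 := kform_fderiv 'i kf.
have -> : local_expr c (ddc kappa (fmul f (@fone R n X))) z [:: v; w] =
    (0 +i* kappa) * local_expr c (del (delbar (fmul f (@fone R n X)))) z [:: v; w] by [].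
rewrite delE delbarE (local_expr_fderiv (- 'i) _ k1 cz).
have E u y : chart_image c y -> local_expr c (fderiv 'i (fmul f (@fone R n X))) y [:: u] =
    Dp 'i (fun x => (F x)%:C) y u.
  move=> cy; rewrite (local_expr_fderiv 'i _ kf cy) lalt_cons lalt_nil subr0.
  congr (Dp 'i _ y u); apply/funext => x.
  by rewrite /local_expr /fmul /fone /= mulr1.
rewrite !lalt_cons lalt_nil subr0.
have D1 u u' : Dp (- 'i) (fun y => local_expr c (fderiv 'i (fmul f (@fone R n X))) y [:: u]) z u' =
    Dp (- 'i) (fun y => Dp 'i (fun x => (F x)%:C) y u) z u'.
  by apply: (Dp_eq _ _ oU cz) => y cy; exact: E.
apply: etrans (congr1 (fun t => (0 +i* kappa) * t) (congr2 (fun a b => a - b) (D1 w v) (D1 v w))) _.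
rewrite (Dp_Dp_real _ _ v w oU sF cz) (Dp_Dp_real _ _ w v oU sF cz).
rewrite (hesC oU sF w v cz) (hesC oU sF (J w) v cz) (hesC oU sF w (J v) cz) (hesC oU sF (J w) (J v) cz).
move: (hes F z v w) (hes F z (J v) w) (hes F z v (J w)) (hes F z (J v) (J w)) => h1 h2 h3 h4.
by apply: complex_ext => /=; field.
Qed.


Local Notation I := ('I_n + 'I_n)%type.

Definition hval phi c z v : R := Re (local_expr c phi z [:: v; J v]).

Lemma hval_sum phi c z v : (forall x, bidegree 1 1 (phi x)) -> chart_image c z ->
  hval phi c z v = \sum_i \sum_j crd i v * (crd j (J v) *
    Re (local_expr c phi z [:: bas R i; bas R j])).
Proof.
move=> bp cz; have [[_ ml _] _] := local_expr_bidegree cz bp.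
have ml0 : mlin (local_expr c phi z) by exact: ml.
rewrite /hval (mlin_crd v [:: J v] ml0) Re_sum; apply: eq_bigr => i _.
have ml1 := mlin_contr (bas R i) ml0.
have -> : local_expr c phi z [:: bas R i; J v] = contr (bas R i) (local_expr c phi z) [:: J v] by [].
rewrite (mlin_crd (J v) [::] ml1) mulr_sumr Re_sum; apply: eq_bigr => j _.
by rewrite /contr; case: (local_expr c phi z _) => a b; rewrite /=; ring.
Qed.

Lemma hval_le phi c z v : (forall x, bidegree 1 1 (phi x)) -> chart_image c z ->
  `|hval phi c z v| <= `|v| ^+ 2 * \sum_i \sum_j `|Re (local_expr c phi z [:: bas R i; bas R j])|.
Proof.
move=> bp cz; rewrite hval_sum // (le_trans (ler_norm_sum _ _ _)) // mulr_sumr ler_sum // => i _.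
rewrite mulr_sumr (le_trans (ler_norm_sum _ _ _)) // ler_sum // => j _.
rewrite !normrM expr2 -mulrA ler_pM ?crd_le ?mulr_ge0 // ler_wpM2r //.
exact: le_trans (crd_le _ _) (J_norm _).
Qed.

Lemma hval_close phi c z0 (e : R) : form_bidegree 1 1 phi -> chart_image c z0 -> 0 < e ->
  exists2 r : R, 0 < r & forall z, `|z - z0| < r ->
    chart_image c z /\ forall v, `|hval phi c z v - hval phi c z0 v| <= e * `|v| ^+ 2.
Proof.
move=> [sp bp] cz0 e0; pose K := (#|{: I * I}|.+1)%:R : R.
have K0 : 0 < K by rewrite ltr0n.
pose a (ij : I * I) z : R := Re (local_expr c phi z [:: bas R ij.1; bas R ij.2]).
pose f (ij : I * I) z := `|a ij z0 - a ij z| < e / K.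
have oU := @image_open R n X c.
have nf ij : \forall z \near z0, f ij z.
  have ca : {for z0, continuous (a ij)}.
    by apply: differentiable_continuous; exact: smooth_diff (sp c _).1 cz0.
  by move/cvgrPdist_lt: ca => /(_ _ (divr_gt0 e0 K0)).
have : \forall z \near z0, chart_image c z /\ forall ij, f ij z.
  apply: filterI; first exact: (near_open oU cz0).
  exact: (@filter_forall V (I * I)%type (fun ij y => f ij y) (nbhs z0) _ nf).
rewrite -near_nbhs; case/nbhs_ballP=> r /= r0 hr; exists r => // z zr.
have [|Uz hz] := hr z; first by rewrite -ball_normE /= distrC.
split=> // v; rewrite !hval_sum // -sumrB.
apply: (@le_trans _ _ (`|v| ^+ 2 * \sum_i \sum_j `|a (i, j) z0 - a (i, j) z|)).
  rewrite (le_trans (ler_norm_sum _ _ _)) // mulr_sumr ler_sum // => i _.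
  rewrite -sumrB (le_trans (ler_norm_sum _ _ _)) // mulr_sumr ler_sum // => j _.
  change (`|crd i v * (crd j (J v) * a (i, j) z) - crd i v * (crd j (J v) * a (i, j) z0)| <=
    `|v| ^+ 2 * `|a (i, j) z0 - a (i, j) z|).
  move: (a (i, j) z) (a (i, j) z0) => p q.
  rewrite -!mulrBr (distrC q) !normrM expr2 -mulrA; apply: ler_pM => //; first exact: crd_le.
  by rewrite ler_wpM2r //; exact: le_trans (crd_le _ _) (J_norm _).
rewrite mulrC ler_wpM2r ?exprn_ge0 // pair_big /=.
apply: (@le_trans _ _ (\sum_(p : I * I) e / K)).
  by apply: ler_sum => -[i j] _; exact: ltW (hz (i, j)).
rewrite sumr_const -mulr_natr -mulrA ler_piMr ?(ltW e0) // mulrC ler_pdivrMr // mul1r ler_nat.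
exact: leqnSn.
Qed.

Lemma trans_inj c z v : chart_image c z ->
  'D_v (trans c (chartAt (chart_param c z))) z = 0 -> v = 0.
Proof.
move=> cz; have oz := overlap_chartAt cz => D0.
have E := trans_comp v oz (image_param cz).
rewrite (trans_id v cz) D0 in E; rewrite -E.
have ov : overlap (chartAt (chart_param c z)) c (trans c (chartAt (chart_param c z)) z).
  apply/overlapP; split; first exact: trans_image oz.
  by rewrite trans_param //; exact: image_param.
by rewrite (deriveE _ (trans_diff ov)) linear0.
Qed.

Lemma hval_pos (omega : diffForm X) c z v : hermitian_form omega -> chart_image c z -> v != 0 ->
  0 < hval omega c z v.
Proof.
move=> [_ _ po] cz v0; rewrite /hval /local_expr /= -/(trans c (chartAt (chart_param c z))).
have oz := overlap_chartAt cz; rewrite (trans_hol v oz).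
have D0 : 'D_v (trans c (chartAt (chart_param c z))) z != 0.
  by apply: contra_neq v0; exact: trans_inj.
by have := po (chart_param c z) _ D0; rewrite ltcE => /andP[].
Qed.

Lemma hvalZ phi c z (t : R) v : (forall x, bidegree 1 1 (phi x)) -> chart_image c z ->
  hval phi c z (t *: v) = t ^+ 2 * hval phi c z v.
Proof.
move=> bp cz; rewrite !hval_sum // mulr_sumr; apply: eq_bigr => i _.
rewrite mulr_sumr; apply: eq_bigr => j _.
have cZ k u : crd k (t *: u) = t * crd k u by rewrite linearZ.
rewrite [J (t *: v)]linearZ !cZ.
by move: (crd _ _) (crd _ _) (Re _) => a b d; ring.
Qed.

(** The quadratic form is positive and continuous on the unit sphere, which is compact; a bound for
    its inverse there gives [d], and homogeneity does the rest. *)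
Lemma hval_lower (omega : diffForm X) c z : hermitian_form omega -> chart_image c z ->
  exists2 d : R, 0 < d & forall v, d * `|v| ^+ 2 <= hval omega c z v.
Proof.
move=> hom cz; have [[_ bp] _ _] := hom.
have pos := hval_pos hom cz.
pose S := [set v : V | `|0 - v| <= 1] `&` [set v : V | 1 <= `|v|].
have cS : compact S.
  apply: compact_closedI; first exact: ball_compact.
  have -> : [set v : V | 1 <= `|v|] = Num.norm @^-1` [set t : R | 1 <= t] by [].
  apply: closed_comp; last exact: closed_ge.
  by move=> x _; exact: norm_continuous.
have ch : continuous (hval omega c z).
  move=> v; have -> : hval omega c z = (fun v => \sum_i \sum_j crd i v * (crd j (J v) *
    Re (local_expr c omega z [:: bas R i; bas R j]))).
    by apply/funext => u; exact: hval_sum.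
  apply: differentiable_continuous; apply: (smooth_diff (U := setT)) => //.
  have oT := @openT V.
  have sid := @smooth_id R V setT oT.
  apply: smooth_sum => // i; apply: smooth_sum => // j.
  apply: smoothM => //; first exact: smooth_crd.
  apply: smoothM => //; last exact: smooth_cst.
  case: j => j.
    have -> : (fun y : V => crd (inl j) (J y)) = (fun y => - crd (inr j) y).
      by apply/funext => y; rewrite (crdJ j y).1.
    by apply: smoothN => //; exact: (@smooth_crd R n V (fun y => y) setT (inr j) oT sid).
  have -> : (fun y : V => crd (inr j) (J y)) = (fun y => crd (inl j) y).
    by apply/funext => y; rewrite (crdJ j y).2.
  exact: (@smooth_crd R n V (fun y => y) setT (inl j) oT sid).
have hS v : S v -> usc_at (fun v => ((hval omega c z v)^-1)%:E) v /\ (((hval omega c z v)^-1)%:E < +oo)%E.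
  move=> [_ /= v1]; split; last exact: ltry.
  have v0 : v != 0 by rewrite -normr_gt0; exact: lt_le_trans v1.
  have cv : {for v, continuous (fun u => (hval omega c z u)^-1)}.
    by apply: cvgV; [rewrite gt_eqF // pos|exact: ch].
  exact: usc_continuous cv.
have [M hM] := usc_bounded cS hS.
have M1 : 0 < `|M| + 1 by rewrite ltr_wpDl.
exists (`|M| + 1)^-1; first by rewrite invr_gt0.
move=> v; have [->|v0] := eqVneq v 0.
  have := hvalZ 0 0 bp cz; rewrite scale0r expr0n /= mul0r => ->.
  by rewrite normr0 expr0n mulr0.
have nv : 0 < `|v| by rewrite normr_gt0.
pose w := `|v|^-1 *: v.
have nw : `|w| = 1 by rewrite normrZ ger0_norm ?invr_ge0 // mulVf // gt_eqF.
have w0 : w != 0 by rewrite -normr_gt0 nw.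
have Sw : S w by split; rewrite /= ?sub0r ?normrN nw.
have hw : 0 < hval omega c z w by exact: pos.
have := hM w Sw; rewrite lee_fin => h.
have hw1 : (`|M| + 1)^-1 <= hval omega c z w.
  rewrite -[leRHS]invrK lef_pV2 ?posrE ?invr_gt0 //; apply: le_trans h _.
  by apply: le_trans (ler_norm M) _; rewrite lerDl.
have -> : hval omega c z v = `|v| ^+ 2 * hval omega c z w.
  have vw : `|v| *: w = v by rewrite /w scalerA divff ?scale1r // gt_eqF.
  by rewrite -{1}vw; exact: (hvalZ _ _ bp cz).
by rewrite mulrC ler_wpM2l // exprn_ge0.
Qed.

Lemma hval_at phi c (y : X) v : chart_dom c y ->
  Re (phi y [:: v; J v]) = hval phi c (chart_coord c y)
    ('D_v (trans (chartAt y) c) (chart_coord (chartAt y) y)).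
Proof.
move=> cy; have dy := dom_chartAt y.
have oy : overlap (chartAt y) c (chart_coord (chartAt y) y).
  by apply/overlapP; split; [exact: coord_image|rewrite coordK].
rewrite -(local_expr_at phi y) (local_expr_trans _ _ oy) /= /hval.
rewrite (trans_hol v oy); congr (Re (local_expr c phi _ _)).
by rewrite /trans /= coordK.
Qed.

Definition perturbed (kappa : R) f (theta omega : diffForm X) (a : R) : diffForm X :=
  fadd (fadd (ddc kappa (fmul f (@fone R n X))) theta) (fscale a%:C omega).

Lemma hval_perturbed (kappa : R) f (theta omega : diffForm X) (a : R) c z v :
  smooth_fun f -> chart_image c z -> hval (perturbed kappa f theta omega a) c z v =
  kappa / 2 * levi (f \o chart_param c) z v + hval theta c z v + a * hval omega c z v.
Proof.
move=> sf cz; have oU := @image_open R n X c.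
have -> : hval (perturbed kappa f theta omega a) c z v =
    Re (local_expr c (ddc kappa (fmul f (@fone R n X))) z [:: v; J v] +
      local_expr c theta z [:: v; J v] + a%:C * local_expr c omega z [:: v; J v]) by [].
rewrite (local_ddc kappa v (J v) sf cz) JJ /hval /levi.
have hN : hes (f \o chart_param c) z v (- v) = - hes (f \o chart_param c) z v v.
  have := hesL oU (sf c) v v v (-1) 0 cz.
  by rewrite scaleN1r scale0r addr0 mul0r addr0 mulN1r.
rewrite hN; move: (hes _ _ _ _) (hes _ _ _ _) => h1 h2.
case: (local_expr c theta z _) => t1 t2; case: (local_expr c omega z _) => o1 o2 /=.
by ring.
Qed.

End LeviForm.

Section Smoothing.
Variables (R : realType) (n : nat) (X : complexManifold R n).
Local Notation V := (Cn R n).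
Local Notation Re := complex.Re.
Variables (kappa : R) (omega : diffForm X).
Hypotheses (kappa_gt0 : 0 < kappa) (hom : hermitian_form omega).

(** The interface between smoothing and currents: the approximants are globally smooth and bounded,
    but converge and have controlled curvature on [W] only. The constant may be enlarged freely. *)
Definition regularizable (theta : diffForm X) (u : X -> R) (W : set X) (C : R) :=
  exists (v : nat -> X -> R) (B : R), [/\ forall N, smooth_fun (v N),
    forall N y, `|v N y| <= B, forall y, W y -> v ^~ y @ \oo --> u y
  & forall N (a : R) y xi, W y -> C <= a ->
    0 <= Re (perturbed kappa (v N) theta omega a y [:: xi; J xi])].

Lemma norm_low (p q s t : R) : `|p| <= s * t -> `|q - p| <= 1 * s -> - ((t + 1) * s) <= q.
Proof. by rewrite !ler_norml mulrDl mul1r mulrC => /andP[? _] /andP[? _]; lra. Qed.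

Lemma norm_half (p q s d : R) : d * s <= p -> `|q - p| <= d / 2 * s -> d / 2 * s <= q.
Proof. by rewrite ler_norml => ? /andP[? _]; lra. Qed.

(** The local approximants are cut off by a bump equal to 1 near the centre and extended by 0. The
    constant [C] is fixed before [k], because the curvature loss in [psh_smoothing] does not involve
    [k]. *)
Lemma quasi_psh_local (theta : diffForm X) (u : X -> \bar R) (x : X) :
  form_bidegree 1 1 theta -> quasi_psh u ->
  exists (C : R) (W : set X), [/\ 0 <= C, open W, W x &
    forall k : nat, regularizable theta (truncation u k) W C].
Proof.
move=> bth /(_ x)[U [f [g [oU Ux Uc [pf sg] ufg]]]].
set c := chartAt x in Ux Uc ufg *; pose z0 := chart_coord c x.
have cx : chart_dom c x := dom_chartAt x.
have cz0 : chart_image c z0 := Uc _ Ux.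
have [r [A [r0 A0 rU hk]]] := psh_smoothing oU Ux pf sg.
have bome : form_bidegree 1 1 omega by case: hom.
have [d d0 hd] := hval_lower hom cz0.
have d2 : 0 < d / 2 by rewrite divr_gt0.
have [r1 r10 h1] := hval_close bome cz0 d2.
have [r2 r20 h2] := hval_close bth cz0 ltr01.
pose Ct := \sum_i \sum_j `|Re (local_expr c theta z0 [:: bas R i; bas R j])|.
have Ct0 : 0 <= Ct by apply: sumr_ge0 => i _; apply: sumr_ge0.
have ht z v : `|z - z0| < r2 -> - ((Ct + 1) * `|v| ^+ 2) <= hval theta c z v.
  move=> /h2[_ /(_ v)]; have := hval_le v bth.2 cz0; rewrite -/Ct.
  exact: norm_low.
have hw z v : `|z - z0| < r1 -> d / 2 * `|v| ^+ 2 <= hval omega c z v.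
  by move=> /h1[_ /(_ v)]; have := hd v; exact: norm_half.
have : \forall z \near z0, vbump z0 r z = 1 by exact: vbump1.
rewrite -near_nbhs; case/nbhs_ballP=> r3 /= r30 h3.
pose K1 := kappa / 2 * A * (n + n)%:R.
have K10 : 0 <= K1 by rewrite !mulr_ge0 // ltW // divr_gt0.
(* Per unit of |w|^2, [K1] bounds the loss of dd^c (with qd <= 2n |w|^2), Ct + 1 the negativity of
   [theta], and d/2 is what [omega] contributes. *)
pose C := (K1 + Ct + 1) / (d / 2).
have C0 : 0 <= C by apply: divr_ge0; [rewrite !addr_ge0|exact: ltW].
pose rho := Num.min (Num.min r r1) (Num.min r2 r3).
have rho0 : 0 < rho by rewrite !lt_min r0 r10 r20.
have rhoP z : `|z - z0| < rho -> [/\ `|z - z0| <= r, `|z - z0| < r1, `|z - z0| < r2 & vbump z0 r z = 1].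
  rewrite !lt_min => /andP[/andP[/ltW -> ->] /andP[-> zr3]]; split=> //.
  by apply: h3; rewrite -ball_normE /= distrC.
pose Bz := [set z : V | `|z - z0| < rho].
have oB : open Bz.
  have -> : Bz = ball z0 rho by apply/seteqP; split=> z; rewrite -ball_normE /Bz /= distrC.
  exact: ball_open.
pose W := chart_dom c `&` chart_coord c @^-1` Bz.
exists C, W; split=> //.
- rewrite openE => y [cy By]; apply: filterI.
    by apply: open_nbhs_nbhs; split=> //; exact: dom_open.
  by apply: (coord_continuous cy); apply: open_nbhs_nbhs.
- by split=> //; rewrite /Bz /= subrr normr0.
move=> k; have [B [F [sF FB Fc Fl]]] := hk k%:R.
pose v N := extend c (fun z => vbump z0 r z * F N z).
have B0 : 0 <= B by apply: le_trans (FB 0%N z0 _); rewrite // subrr normr0 ltW.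
have oc := @image_open R n X c.
have sv N : smooth_fun (v N).
  apply: (@extend_smooth R n X c _ [set z | `|z0 - z| <= r]).
  - apply: smoothM => //; first exact: vbump_smooth.
    by apply: (smooth_subset (U := setT)).
  - exact: ball_compact.
  - by move=> z /=; rewrite distrC => /rU /Uc.
  - by move=> z _ /= /negP; rewrite -ltNge => /(vbump_supp r0) ->; rewrite mul0r.
exists v, B; split=> // [N y|y [cy By]|N a y xi [cy By] Ca].
- rewrite /v /extend; case: pselect => cy; last by rewrite normr0.
  have [zr|zr] := leP `|chart_coord c y - z0| r.
    rewrite normrM -[leRHS]mul1r ler_pM ?FB // ger0_norm ?plateau_ge0 //.
    exact: plateau_le1.
  by rewrite (vbump_supp r0) ?mul0r ?normr0 // distrC.
- have [zr _ _ b1] := rhoP _ By.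
  rewrite (_ : v ^~ y = F ^~ (chart_coord c y)); last first.
    by apply/funext => N; rewrite /v extend_in // b1 mul1r.
  rewrite /truncation -[y in u y](coordK cy) ufg; last exact: rU.
  exact: Fc.
have [zr z1 z2 b1] := rhoP _ By.
have cz := coord_image cy; set z := chart_coord c y in zr z1 z2 b1 cz By *.
rewrite (hval_at _ xi cy) -/z; move: ('D_xi _ _) => w.
rewrite (hval_perturbed kappa theta omega a w (sv N) cz).
have E : levi (v N \o chart_param c) z w = levi (F N) z w.
  have oBc : open (Bz `&` chart_image c) by exact: openI.
  have eqF y' : (Bz `&` chart_image c) y' -> (v N \o chart_param c) y' = F N y'.
    move=> [By' cy']; rewrite /= /v extend_in; last exact: image_param.
    by rewrite image_coord //; have [_ _ _ ->] := rhoP _ By'; rewrite mul1r.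
  have Bzz : (Bz `&` chart_image c) z by [].
  by rewrite /levi !(hes_near _ _ oBc Bzz eqF).
rewrite E; have l1 := Fl N z w zr; have l2 := ht z w z2; have l3 := hw z w z1.
have q1 := qd_le w.
have k2 : 0 <= kappa / 2 by rewrite ltW // divr_gt0.
have e1 : - (K1 * `|w| ^+ 2) <= kappa / 2 * levi (F N) z w.
  apply: (@le_trans _ _ (kappa / 2 * - (A * qd w))); last exact: ler_wpM2l.
  have -> : K1 * `|w| ^+ 2 = kappa / 2 * (A * ((n + n)%:R * `|w| ^+ 2)) by rewrite /K1 !mulrA.
  by rewrite mulrN lerN2 ler_wpM2l // ler_wpM2l.
have w2 : 0 <= `|w| ^+ 2 by rewrite exprn_ge0.
have e3 : (K1 + Ct + 1) * `|w| ^+ 2 <= a * hval omega c z w.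
  apply: (@le_trans _ _ (C * (d / 2 * `|w| ^+ 2))).
    by rewrite /C mulrA divfK // gt_eqF.
  apply: ler_pM => //; by rewrite mulr_ge0 // ltW.
move: e1 l2 e3; move: (K1) (Ct) (`|w| ^+ 2) (kappa / 2 * _) (hval theta c z w) (a * _) => p1 p2 p3 p4 p5 p6.
by rewrite !mulrDl; lra.
Qed.

Hypothesis X_compact : compact [set: X].

Lemma quasi_psh_global (theta : diffForm X) (u : X -> \bar R) :
  form_bidegree 1 1 theta -> quasi_psh u ->
  exists C : R, 0 <= C /\ forall x : X, exists W : set X, [/\ open W, W x &
    forall (k : nat) C', C <= C' -> regularizable theta (truncation u k) W C'].
Proof.
move=> bth qu.
have [CW hCW] := @pick_fun _ _ (fun x (CW : R * set X) => [/\ 0 <= CW.1, open CW.2, CW.2 x &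
    forall k : nat, regularizable theta (truncation u k) CW.2 CW.1]) (fun x =>
      let: ex_intro C (ex_intro W H) := quasi_psh_local x bth qu in ex_intro _ (C, W) H).
have [l hl] := finite_cover X_compact (W := fun x => (CW x).2)
  (fun x => let: And4 _ h1 h2 _ := hCW x in conj h1 h2).
exists (\sum_(x <- l) (CW x).1); split.
  by apply: sumr_ge0 => x _; have [] := hCW x.
move=> y; have [x xl Wy] := hl y; have [_ oW _ hW] := hCW x.
exists (CW x).2; split=> // k C' hC'; have [v [B [h1 h2 h3 h4]]] := hW k.
exists v, B; split=> // N a z xi Wz Ca; apply: h4 => //; apply: le_trans Ca; apply: le_trans hC'.
rewrite (big_rem x xl) /= lerDl; apply: sumr_ge0 => x' _.
by have [] := hCW x'.
Qed.

End Smoothing.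

(** * Bedford-Taylor products *)

Section Preparation.
Variables (R : realType) (n : nat) (X : complexManifold R n).
Local Notation V := (Cn R n).
Local Notation C := R[i].
Local Notation Re := complex.Re.
Local Notation Im := complex.Im.
Local Notation Borel := (g_sigma_algebraType (@open X)).
Hypothesis X_compact : compact [set: X].
Implicit Types (f g : X -> R) (x y : X) (phi psi : diffForm X) (S : current X).

Lemma quasi_psh_usc (u : X -> \bar R) x : quasi_psh u -> usc_at u x /\ (u x < +oo)%E.
Proof.
move=> /(_ x)[U [f [g [oU Ux Uc [[fy us _] sg] ufg]]]].
have dx := dom_chartAt x.
have ux : u x = (f (chart_coord (chartAt x) x) + (g (chart_coord (chartAt x) x))%:E)%E.
  by rewrite -ufg // coordK.
have fx := fy _ Ux.
split; last by rewrite ux lte_add_pinfty // ltry.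
move=> b; rewrite ux => ub.
have usf : usc_at (fun z => (f z + (g z)%:E)%E) (chart_coord (chartAt x) x).
  apply: usc_add => //; first by move=> a; exact: us.
  by apply: differentiable_continuous; exact: smooth_diff sg Ux.
have N1 : \forall z \near chart_coord (chartAt x) x, U z /\ (f z + (g z)%:E < b%:E)%E.
  by apply: filterI; [exact: (near_open oU Ux)|exact: usf].
have N2 : \forall y \near x, U (chart_coord (chartAt x) y) /\
    (f (chart_coord (chartAt x) y) + (g (chart_coord (chartAt x) y))%:E < b%:E)%E.
  exact: (coord_continuous dx N1).
have N3 : \forall y \near x, chart_dom (chartAt x) y.
  by apply: open_nbhs_nbhs; split=> //; exact: dom_open.
apply: filterS2 N2 N3 => y [Uy yb] dy.
by rewrite -(coordK dy) ufg.
Qed.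

Lemma truncation_bmeas (u : X -> \bar R) (k : nat) : quasi_psh u ->
  bmeas (truncation u k : Borel -> R) /\
  forall x, maxe (u x) (- (k%:R : R))%:E \is a fin_num.
Proof.
move=> qu; have us x := quasi_psh_usc x qu.
have [M hM] := @usc_bounded R X [set: X] u X_compact (fun x _ => us x).
have fin x : maxe (u x) (- (k%:R : R))%:E \is a fin_num.
  by have [] := fine_max_bound k%:R (hM x I).
split; last by [].
have oU (a : R) : open [set x | truncation u k x < a].
  rewrite openE => x /= xa.
  have um : usc_at (fun y => maxe (u y) (- k%:R)%:E) x by apply: usc_max; case: (us x).
  have : (maxe (u x) (- k%:R)%:E < a%:E)%E by rewrite -(fineK (fin x)) lte_fin.
  by move=> /um; apply: filterS => y; rewrite -(fineK (fin y)) lte_fin.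
split; last first.
  exists (Num.max `|M| k%:R + k%:R) => x; have [_ h1 h2] := fine_max_bound k%:R (hM x I).
  rewrite ler_norml; apply/andP; split.
    by apply: le_trans h1; rewrite lerN2 lerDr le_max normr_ge0.
  apply: le_trans h2 _; rewrite ge_max; apply/andP; split.
    by apply: (le_trans (ler_norm M)); apply: (@le_trans _ _ (Num.max `|M| k%:R)); rewrite ?lerDl // le_max lexx.
  by apply: (@le_trans _ _ 0); rewrite ?oppr_le0 // addr_ge0 // le_max normr_ge0.
have mN : measurable_fun setT (fun x : Borel => - truncation u k x).
  apply: rays_measurable => a.
  have -> : [set x : Borel | a < - truncation u k x] = [set x | truncation u k x < - a].
    by apply/seteqP; split=> x /=; rewrite ltrNr.
  by apply: open_borel; exact: oU.
have -> : (truncation u k : Borel -> R) = (fun x => - - truncation u k x).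
  by apply/funext => x; rewrite opprK.
exact: measurable_funN.
Qed.

Lemma compact_borel (K : set X) : compact K -> measurable (K : set Borel).
Proof. by move=> cK; apply: closed_borel; apply: compact_closed => //; exact: manifold_hausdorff. Qed.

(** A partition of unity is taken subordinate to [W] around points of [K] and to the complement of
    [K] around the others. The members centred in [K] vanish off [W], and the remaining ones vanish
    on [K], so the former sum to 1 there. *)
Lemma cutoff_exists (K W : set X) : compact K -> open W -> K `<=` W ->
  exists2 h : X -> R, smooth_fun h & (forall x, K x -> h x = 1) /\ forall x, ~ W x -> h x = 0.
Proof.
move=> cK oW KW.
have clK : closed K by apply: compact_closed => //; exact: manifold_hausdorff.
pose W' x : set X := if pselect (K x) then W else ~` K.
have hW x : open (W' x) /\ W' x x.
  by rewrite /W'; case: pselect => Kx; split=> //; [exact: KW|exact: closed_openC].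
have [N [xx [b [h [KK [sb sh hK bK hb]]]]]] := partition_unity X_compact hW.
pose P k := `[< K (xx k) >].
exists (fun y => \sum_(k < N) (if P k then 1 else 0) * (h k y * b k y * b k y)).
  move=> c; apply: smooth_sum => [|k]; first exact: image_open.
  have s1 : smooth_fun (fun y => (if P k then 1 else 0) * (h k y * b k y * b k y)).
    apply: sfunZ; apply: sfunM; last exact: (sb k).1.
    by apply: sfunM; [exact: (sh k).1|exact: (sb k).1].
  exact: s1.
have b0 k y : ~ W' (xx k) y -> b k y = 0.
  by move=> nW; apply: bK => Ky; apply: nW; have [_ /(_ _ Ky)[]] := hK k.
split=> y Ky.
  apply: etrans _ (hb y); apply: eq_bigr => k _; rewrite /P; case: asboolP => Kx /=; first by rewrite mul1r.
  by rewrite mul0r b0 ?mulr0 // /W'; case: pselect => h1 // nK; exact: nK Ky.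
apply: big1 => k _; rewrite /P; case: asboolP => Kx /=; last by rewrite mul0r.
by rewrite b0 ?mulr0 // /W'; case: pselect.
Qed.

Variables (kappa : R) (omega : diffForm X).
Hypothesis hom : hermitian_form omega.

Lemma omega_bid : form_bidegree 1 1 omega.
Proof. by case: hom. Qed.

Lemma omega_sp x : strongly_positive 1 (omega x).
Proof.
have [[_ bo] ro po] := hom; apply: sp_psd11 => // v.
have [->|v0] := eqVneq v 0.
  have [[_ _ al] _] := bo x.
  have -> : J (0 : V) = 0 by rewrite linear0.
  by rewrite (al [:: 0; 0]) //= inE eqxx.
by have := po x v v0; rewrite ltcE => /andP[_ /ltW].
Qed.

Lemma fpow_sp r : sp_test_form r (fpow omega r).
Proof.
split; first exact: bid_fpow omega_bid.
move=> x; elim: r => [|r IH]; first exact: (@sp_Eform R n 0 [::]).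
exact: (sp_wedge (omega_sp x) IH).
Qed.

(** The alternative at each point is needed because the perturbed forms are positive only on the set
    where the smoothing is controlled, which contains the support of [phi]. *)
Lemma fwedge_sp r psi phi : form_bidegree 1 1 psi -> sp_test_form r phi ->
  (forall x, strongly_positive 1 (psi x) \/ forall s, phi x s = 0) ->
  sp_test_form r.+1 (fwedge psi phi).
Proof.
move=> bp [bph sph] H; split; first exact: (bid_fwedge bp bph).
move=> x; have [sp|z] := H x; first exact: (sp_wedge sp (sph x)).
have -> : fwedge psi phi x = (fun=> 0).
  apply/funext => s; rewrite /fwedge /wedge_alt big1 // => mm _.
  by rewrite z mulr0.
exact: sp0.
Qed.

Lemma perturbed_sp (f : X -> R) (theta : diffForm X) (a : R) x : smooth_fun f ->
  form_bidegree 1 1 theta -> real_form theta ->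
  (forall xi, 0 <= Re (perturbed kappa f theta omega a x [:: xi; J xi])) ->
  form_bidegree 1 1 (perturbed kappa f theta omega a) /\
  strongly_positive 1 (perturbed kappa f theta omega a x).
Proof.
move=> sf bt rt H; have [_ ro _] := hom.
have bd : form_bidegree 1 1 (ddc kappa (fmul f (@fone R n X))).
  by apply: ddc_bidegree; apply: bid_fmul => //; exact: bid_fone.
have bp : form_bidegree 1 1 (perturbed kappa f theta omega a).
  by apply: bid_fadd; [exact: bid_fadd|apply: bid_fscale; exact: omega_bid].
split=> //; apply: sp_psd11 => //; first by have [_] := bp.
move=> s; rewrite /perturbed /fadd /fscale.
have : Im (ddc kappa (fmul f (@fone R n X)) x s) = 0.
  have [[al _ _] _] := bd.2 x.
  have [sz|/al -> //] := eqVneq (size s) 2; case: s sz => [|v [|w []]] // _.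
  rewrite -(local_expr_at _ x) (local_ddc kappa v w sf) //.
  exact: coord_image (dom_chartAt x).
have := rt x s; have := ro x s.
case: (omega x s) => o1 o2; case: (theta x s) => t1 t2; case: (ddc _ _ x s) => d1 d2 /= -> -> ->.
by ring.
Qed.

End Preparation.

(** * Expansion of the perturbed product *)

Section Splits.
Variable I : eqType.
Implicit Types l : seq I.

(* The ways of replacing some entries of l: their number, and the entries left. *)
Fixpoint splits l : seq (nat * seq I) :=
  if l is j :: l' then [seq (q.1, j :: q.2) | q <- splits l'] ++ [seq (q.1.+1, q.2) | q <- splits l']
  else [:: (0%N, [::])].

Lemma splits_size l q : q \in splits l -> (q.1 + size q.2)%N = size l.
Proof.
elim: l q => [|j l IH] q /=; first by rewrite inE => /eqP ->.
by rewrite mem_cat => /orP[] /mapP[q' /IH qs ->] /=; rewrite -qs ?addnS ?addSn.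
Qed.

(** The first entry replaces nothing and the others at least one factor, so the full plain product
    can be isolated from strictly shorter ones. *)
Lemma splits_head l : splits l = (0%N, l) :: behead (splits l) /\
  forall q, q \in behead (splits l) -> (0 < q.1)%N.
Proof.
elim: l => [|j l [IH1 IH2]] //=; rewrite IH1 /=; split=> // q.
by rewrite mem_cat inE => /or3P[/mapP[q' /IH2 h ->]|/eqP ->|/mapP[q' _ ->]].
Qed.

End Splits.

(** * Order 0, positivity and mass bounds of the products *)

Section Products.
Variables (R : realType) (n : nat) (X : complexManifold R n).
Local Notation V := (Cn R n).
Local Notation C := R[i].
Local Notation Re := complex.Re.
Local Notation Im := complex.Im.
Local Notation Borel := (g_sigma_algebraType (@open X)).
Hypothesis X_compact : compact [set: X].
Variables (kappa : R) (omega : diffForm X).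
Hypothesis hom : hermitian_form omega.
Variables (I : eqType) (theta : I -> diffForm X) (T : current X) (s0 : nat).
Hypotheses (cth : forall j, closed_real11 (theta j)) (lT : linc s0 T) (pT : posc s0 T)
  (cT : forall t, (t.+1 = s0)%N -> clos t T).
Implicit Types (f g : X -> R) (x y : X) (phi psi sg : diffForm X) (S : current X) (l : seq I).

Definition btprod (v : I -> X -> R) l : current X :=
  foldr (fun j S => bedford_taylor kappa (v j) (theta j) S) T l.

(* prod_{j in l} (dd^c v_j + theta_j + c omega) /\ T *)
Definition perturbed_prod (v : I -> X -> R) (c : R) l : current X := fun phi =>
  \sum_(q <- splits l) (c ^+ q.1)%:C * btprod v q.2 (fwedge (fpow omega q.1) phi).

Lemma bom : form_bidegree 1 1 omega.
Proof. exact: omega_bid hom. Qed.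

Lemma fpow_wedge_bid a r phi : form_bidegree r r phi ->
  form_bidegree (a + r) (a + r) (fwedge (fpow omega a) phi).
Proof. by move=> bp; apply: bid_fwedge => //; apply: bid_fpow bom. Qed.

Lemma fwedge_fpow2 a phi psi : form_bidegree 1 1 psi ->
  fwedge (fpow omega a) (fwedge psi phi) = fwedge psi (fwedge (fpow omega a) phi).
Proof.
move=> bp; rewrite !fwedgeA; congr (fwedge _ phi).
by apply: (fwedgeC_even (alt_of (bid_fpow a bom)) (alt_of bp)); rewrite oddM andbF.
Qed.

Lemma fpowS a phi : fwedge omega (fwedge (fpow omega a) phi) = fwedge (fpow omega a.+1) phi.
Proof. by rewrite fwedgeA. Qed.

Lemma fwedge_lin a (t : C) phi psi : fwedge a (fadd (fscale t phi) psi) =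
  fadd (fscale t (fwedge a phi)) (fwedge a psi).
Proof.
apply/funext => x; apply/funext => s; rewrite /fwedge /fadd /fscale /wedge_alt mulr_sumr -big_split.
by apply: eq_bigr => mm _ /=; ring.
Qed.

Lemma fwedge_linl a (t : C) phi psi : fwedge (fadd (fscale t phi) psi) a =
  fadd (fscale t (fwedge phi a)) (fwedge psi a).
Proof.
apply/funext => x; apply/funext => s; rewrite /fwedge /fadd /fscale /wedge_alt mulr_sumr -big_split.
by apply: eq_bigr => mm _ /=; ring.
Qed.

Section Fixed.
Variables (v : I -> X -> R) (c : R).
Hypotheses (bv : forall j, bmeas (v j : Borel -> R))
  (reg : forall j x, exists W : set X, [/\ open W, W x & regularizable kappa omega (theta j) (v j) W c]).
Local Notation RR := (btprod v).
Local Notation Q := (perturbed_prod v c).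

(** The four facts proved together. Positivity concerns the perturbed product [Q], the other three
    the plain product [RR]. *)
Definition admissible l := forall r, (r + size l)%N = s0 ->
  [/\ linc r (RR l), ordc r (RR l), forall t, (t.+1 = r)%N -> clos t (RR l) & posc r (Q l)].

Lemma perturbed_linc l r : (r + size l)%N = s0 ->
  (forall q, q \in splits l -> linc (q.1 + r) (RR q.2)) -> linc r (Q l).
Proof.
move=> rl H t phi psi bp bs; rewrite /perturbed_prod mulr_sumr -big_split /= !big_seq.
apply: eq_bigr => q qs; rewrite fwedge_lin H //; try exact: fpow_wedge_bid.
by rewrite mulrDr mulrCA.
Qed.

(** The expansion for [j :: l] with only the outermost function replaced by [w]: each factor j is
    either kept, giving the first two terms, or replaced by c omega. Smoothing one factor at a time
    is enough. *)
Definition partial_prod (w : X -> R) j l phi : C :=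
  \sum_(q <- splits l) (c ^+ q.1)%:C * (mul_current w (RR q.2) (ddc kappa (fwedge (fpow omega q.1) phi)) +
    RR q.2 (fwedge (theta j) (fwedge (fpow omega q.1) phi)) +
    c%:C * RR q.2 (fwedge (fpow omega q.1.+1) phi)).

Lemma perturbed_cons j l phi : Q (j :: l) phi = partial_prod (v j) j l phi.
Proof.
rewrite /perturbed_prod /partial_prod /= big_cat /= !big_map -big_split /=; apply: eq_bigr => q _.
rewrite /bedford_taylor /ddc_current /wedge_current exprS [in LHS](mulrC c) rmorphM /=.
by rewrite !mulrDr mulrA.
Qed.

(** For smooth [w] integration by parts, legitimate because every plain product in the sum is
    closed, moves the whole outer factor to the test form. *)
Lemma partial_smooth w j l r phi : smooth_fun w -> (r.+1 + size l)%N = s0 ->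
  (forall q, q \in splits l -> admissible q.2) -> form_bidegree r r phi ->
  partial_prod w j l phi = Q l (fwedge (perturbed kappa w (theta j) omega c) phi).
Proof.
move=> sw rl H bp; rewrite /partial_prod /perturbed_prod !big_seq; apply: eq_bigr => q qs.
have deg : ((q.1 + r).+1 + size q.2)%N = s0.
  by rewrite -rl -(splits_size qs) !addSn addnCA addnA.
have [lq oq cq _] := H q qs _ deg.
have b1 := fpow_wedge_bid q.1 bp; have [bt _ _] := cth j.
have b2 := ddc_bidegree kappa b1.
have bd : form_bidegree 1 1 (ddc kappa (fmul w (@fone R n X))).
  by apply: ddc_bidegree; apply: bid_fmul => //; exact: bid_fone.
have bP : form_bidegree 1 1 (perturbed kappa w (theta j) omega c).
  by apply: bid_fadd; [exact: bid_fadd|apply: bid_fscale; exact: bom].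
congr (_ * _); rewrite (mul_smooth X_compact oq sw b2) (fwedge_fpow2 _ _ bP).
rewrite (ddc_by_parts kappa lq (cq _ erefl) sw b1) -fpowS.
set psi := fwedge (fpow omega q.1) phi in b1 b2 *.
have -> : perturbed kappa w (theta j) omega c = fadd (fscale 1
    (fadd (fscale 1 (ddc kappa (fmul w (@fone R n X)))) (theta j))) (fscale c%:C omega).
  by apply/funext => x; apply/funext => s; rewrite /perturbed /fadd /fscale !mul1r.
rewrite !fwedge_linl.
have w1 : form_bidegree (q.1 + r).+1 (q.1 + r).+1 (fwedge (ddc kappa (fmul w (@fone R n X))) psi) := bid_fwedge bd b1.
have w2 : form_bidegree (q.1 + r).+1 (q.1 + r).+1 (fwedge (theta j) psi) := bid_fwedge bt b1.
have w3 : form_bidegree (q.1 + r).+1 (q.1 + r).+1 (fwedge omega psi) := bid_fwedge bom b1.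
have -> : fwedge (fscale c%:C omega) psi = fscale c%:C (fwedge omega psi).
  apply/funext => x; apply/funext => s; rewrite /fwedge /fscale /wedge_alt mulr_sumr.
  by apply: eq_bigr => mm _ /=; ring.
rewrite (lq 1 _ _ (bid_fadd (bid_fscale 1 w1) w2) (bid_fscale _ w3)) (lq 1 _ _ w1 w2).
by rewrite (lincZ c%:C lq w3) !mul1r.
Qed.

Lemma fwedge_off psi phi x : (forall s, phi x s = 0) -> forall s, fwedge psi phi x s = 0.
Proof.
by move=> z s; rewrite /fwedge /wedge_alt big1 // => mm _; rewrite z mulr0.
Qed.

Lemma ddc_off (K : set X) phi : compact K -> (forall x, ~ K x -> forall s, phi x s = 0) ->
  forall x, ~ K x -> forall s, ddc kappa phi x s = 0.
Proof.
move=> cK z x nK s.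
have oK : open (~` K) by apply: closed_openC; apply: compact_closed => //; exact: manifold_hausdorff.
have F e chi y : (forall w, (~` K) w -> chi w = @fzero R n X w) -> (~` K) y ->
    fderiv e chi y = @fzero R n X y.
  by move=> H nKy; rewrite (fderiv_near e oK nKy H) fderiv0.
have E : fderiv (- 'i) (fderiv 'i phi) x = @fzero R n X x.
  by apply: (F _) => // y nKy; apply: (F _) => // w nKw; apply/funext => t; exact: z.
by rewrite /ddc /fscale delE delbarE E /fzero mulr0.
Qed.

Lemma fmul_cut (h : X -> R) (K : set X) phi : (forall x, K x -> h x = 1) ->
  (forall x, ~ K x -> forall s, phi x s = 0) -> fmul h phi = phi.
Proof.
move=> h1 z; apply/funext => x; apply/funext => s; rewrite /fmul.
by have [Kx|nK] := pselect (K x); [rewrite h1 // mul1r|rewrite z // mulr0].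
Qed.

(** For each smooth approximant the outer factor is a strongly positive form on the support of
    [phi], so positivity of [Q l] applies. The limit is bounded convergence against the measures of
    the shorter products, which have order 0 by hypothesis. *)
Lemma partial_local j l r phi (W K : set X) : (r.+1 + size l)%N = s0 ->
  (forall q, q \in splits l -> admissible q.2) -> sp_test_form r phi ->
  open W -> compact K -> K `<=` W -> (forall x, ~ K x -> forall s, phi x s = 0) ->
  regularizable kappa omega (theta j) (v j) W c -> 0 <= partial_prod (v j) j l phi.
Proof.
move=> rl H [bp sp] oW cK KW z [F [B [sF FB Fc Fp]]].
(* The approximants converge on [W] only; multiplication by [h] gives convergence everywhere and
   changes nothing on forms supported in [K]. *)
have [h sh [h1 h0]] := cutoff_exists X_compact cK oW KW.
have [Bh Bh0 hBh] := smooth_bounded X_compact sh.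
have [bt rt _] := cth j.
have lin : admissible l by have := H (0%N, l); rewrite (splits_head l).1 inE eqxx => /(_ isT).
have [_ _ _ pl] := lin _ rl.
have pos N : 0 <= partial_prod (F N) j l phi.
  rewrite (partial_smooth j (sF N) rl H bp); apply: pl.
  have bP : form_bidegree 1 1 (perturbed kappa (F N) (theta j) omega c).
    apply: bid_fadd; last by apply: bid_fscale; exact: bom.
    apply: bid_fadd => //; apply: ddc_bidegree; apply: bid_fmul => //; exact: bid_fone.
  apply: fwedge_sp => // x; have [Kx|nK] := pselect (K x); last by right; exact: z.
  left; have [] // := @perturbed_sp R n X kappa omega hom (F N) (theta j) c x (sF N) bt rt.
  by move=> xi; apply: Fp => //; exact: KW.
have meas f : smooth_fun f -> measurable_fun setT (f : Borel -> R) by move=> /(smooth_bmeas X_compact)[].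
have cvg (s : seq (nat * seq I)) : {subset s <= splits l} ->
    let A w := \sum_(q <- s) (c ^+ q.1)%:C * (mul_current w (RR q.2) (ddc kappa (fwedge (fpow omega q.1) phi)) +
      RR q.2 (fwedge (theta j) (fwedge (fpow omega q.1) phi)) +
      c%:C * RR q.2 (fwedge (fpow omega q.1.+1) phi)) in
    Re (A (F N)) @[N --> \oo] --> Re (A (v j)) /\ Im (A (F N)) @[N --> \oo] --> Im (A (v j)).
  elim: s => [|q s IH] sub /=.
    by rewrite !big_nil; split; under eq_fun do rewrite big_nil; exact: cvg_cst.
  have [|I1 I2] := IH; first by move=> q' q's; apply: sub; rewrite inE q's orbT.
  have qs : q \in splits l by apply: sub; rewrite inE eqxx.
  have deg : ((q.1 + r).+1 + size q.2)%N = s0.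
    by rewrite -rl -(splits_size qs) !addSn addnCA addnA.
  have [lq oq cq _] := H q qs _ deg.
  have b2 := ddc_bidegree kappa (fpow_wedge_bid q.1 bp).
  set sg := ddc kappa _ in b2 *.
  have zs : fmul h sg = sg.
    by apply: (fmul_cut h1); apply: (ddc_off cK) => x nK; apply: fwedge_off; exact: z.
  have E w : bmeas (w : Borel -> R) -> mul_current w (RR q.2) sg = mul_current (fun x => h x * w x) (RR q.2) sg.
    by move=> bw; rewrite -{1}zs (mul_fmul X_compact oq bw sh b2).
  have EF N := E (F N) (smooth_bmeas X_compact (sF N)).
  have [C1 C2] : Re (mul_current (fun x => h x * F N x) (RR q.2) sg) @[N --> \oo] -->
        Re (mul_current (fun x => h x * v j x) (RR q.2) sg) /\
      Im (mul_current (fun x => h x * F N x) (RR q.2) sg) @[N --> \oo] -->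
        Im (mul_current (fun x => h x * v j x) (RR q.2) sg).
    apply: (mul_cvg (B := Bh * B) X_compact oq b2).
    - by move=> N; apply: meas; exact: sfunM.
    - by move=> N x; rewrite normrM ler_pM.
    - move=> x; have [Wx|nW] := pselect (W x).
        by apply: cvgM; [exact: cvg_cst|exact: Fc].
      by rewrite h0 // mul0r; under eq_fun do rewrite mul0r; exact: cvg_cst.
  rewrite big_cons (E (v j) (bv j)).
  set x1 := RR q.2 (fwedge (theta j) _); set x2 := c%:C * _.
  have ReE (k : R) (p p' : C) : Re (k%:C * (p + x1 + x2) + p') = k * (Re p + Re (x1 + x2)) + Re p'.
    by case: p p' (x1) (x2) => a b [a' b'] [y1 y2] [y1' y2'] /=; ring.
  have ImE (k : R) (p p' : C) : Im (k%:C * (p + x1 + x2) + p') = k * (Im p + Im (x1 + x2)) + Im p'.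
    by case: p p' (x1) (x2) => a b [a' b'] [y1 y2] [y1' y2'] /=; ring.
  split.
    rewrite ReE; under eq_fun do rewrite big_cons EF ReE; apply: cvgD => //.
    by apply: cvgM; [exact: cvg_cst|apply: cvgD => //; exact: cvg_cst].
  rewrite ImE; under eq_fun do rewrite big_cons EF ImE; apply: cvgD => //.
  by apply: cvgM; [exact: cvg_cst|apply: cvgD => //; exact: cvg_cst].
have [C1 C2] := cvg (splits l) (fun q qs => qs).
have P N : Im (partial_prod (F N) j l phi) = 0 /\ 0 <= Re (partial_prod (F N) j l phi).
  by have := pos N; rewrite lecE => /andP[/eqP -> ->].
rewrite lecE; apply/andP; split.
  rewrite eq_sym; apply/eqP.
  apply: (cvg_unique _ _ C2) => //.
  rewrite (_ : (fun N => _) = fun=> 0); first exact: cvg_cst.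
  by apply/funext => N; exact: (P N).1.
rewrite -(cvg_lim _ C1) //; apply: limr_ge; first by apply/cvg_ex; eexists; exact: C1.
by apply: nearW => N; exact: (P N).2.
Qed.

(** Regularization is local, so the test form is cut by a partition of unity; linearity of the
    current sums up the local inequalities. *)
Lemma perturbed_posc j l r : (r.+1 + size l)%N = s0 -> linc r (Q (j :: l)) ->
  (forall q, q \in splits l -> admissible q.2) -> posc r (Q (j :: l)).
Proof.
move=> rl lQ H phi sp.
have [W hW] := pick_fun (reg j).
have [bp sph] := sp.
have [N [xx [b [h [K [sb sh hK bK hb]]]]]] := partition_unity X_compact (fun x =>
  let: And3 h1 h2 _ := hW x in conj h1 h2).
pose g k x := h k x * b k x * b k x.
have sg k : smooth_fun (g k).
  by apply: sfunM; [apply: sfunM; [exact: (sh k).1|exact: (sb k).1]|exact: (sb k).1].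
have g0 k x : 0 <= g k x by rewrite !mulr_ge0 ?(sh k).2 ?(sb k).2.
have E : phi = (fun x s => \sum_(k <- index_enum 'I_N) fmul (g k) phi x s).
  apply/funext => x; apply/funext => s; rewrite /fmul -mulr_suml.
  by rewrite -(rmorph_sum (@real_complex R)) hb mul1r.
have spk k : sp_test_form r (fmul (g k) phi) by exact: sp_fmul.
have [_ ES] := linc_sum (index_enum 'I_N) lQ (fun k => (spk k).1).
rewrite E ES; apply: sumr_ge0 => k _; rewrite perturbed_cons.
have [cK KW] := hK k; have [oW _ rW] := hW (xx k).
apply: (partial_local rl H (spk k) oW cK _ _ rW) => [x /KW[]//|x nK s].
by rewrite /fmul /g bK // mulr0 mul0r.
Qed.

(** The expansion is solved for its leading term: the plain product is the perturbed one minus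
    multiples of shorter plain products tested on omega^a /\ phi. *)
Lemma perturbed_ordc l r : (r + size l)%N = s0 -> ordc r (Q l) ->
  (forall q, q \in behead (splits l) -> ordc (q.1 + r) (RR q.2)) -> ordc r (RR l).
Proof.
move=> rl oQ H phi bp.
have part (Pt : C -> R) : (Pt = @complex.Re R \/ Pt = @complex.Im R) ->
    (forall q, q \in behead (splits l) -> order0 (fun f => Pt (RR q.2 (fmul f (fwedge (fpow omega q.1) phi))))) ->
    order0 (fun f => Pt (Q l (fmul f phi))) -> order0 (fun f => Pt (RR l (fmul f phi))).
  move=> hPt Hq HQ.
  have PtD a b : Pt (a + b) = Pt a + Pt b by case: hPt => ->; case: a b => [a1 a2] [b1 b2].
  have PtZ (k : R) a : Pt (k%:C * a) = k * Pt a by case: hPt => ->; case: a => [a1 a2] /=; ring.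
  pose L q f := if q \in behead (splits l) then
    c ^+ q.1 * Pt (RR q.2 (fmul f (fwedge (fpow omega q.1) phi))) else 0.
  have oL q : order0 (L q).
    rewrite /L; case: (boolP (q \in _)) => [qs|_]; last exact: order0_0.
    have := order0_comb (c ^+ q.1) 0 (Hq q qs) (order0_0 X).
    by apply: order0_eq => f sf; rewrite mulr0 addr0.
  have := order0_comb 1 (-1) HQ (order0_sum (behead (splits l)) oL).
  apply: order0_eq => f sf; rewrite mul1r mulN1r.
  rewrite /perturbed_prod (splits_head l).1 big_cons PtD PtZ expr0 mul1r.
  rewrite /fpow /= fwedge1 [X in _ - X]big_seq.
  have -> : Pt (\sum_(q <- behead (splits l)) (c ^+ q.1)%:C * RR q.2 (fwedge (fpow omega q.1) (fmul f phi))) =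
      \sum_(q <- behead (splits l) | q \in behead (splits l)) L q f.
    rewrite (big_morph Pt PtD (_ : Pt 0 = 0)); last by case: hPt => ->.
    rewrite big_seq; apply: eq_bigr => q qs; rewrite PtZ /L qs.
    by rewrite fmul_fwedger.
  by rewrite addrK.
split; [apply: (part (@complex.Re R))|apply: (part (@complex.Im R))]; try by [left|right].
- by move=> q qs; have [] := H q qs _ (fpow_wedge_bid q.1 bp).
- by have [] := oQ _ bp.
- by move=> q qs; have [] := H q qs _ (fpow_wedge_bid q.1 bp).
- by have [] := oQ _ bp.
Qed.

Lemma perturbed_nil phi : Q [::] phi = T phi.
Proof. by rewrite /perturbed_prod /= big_seq1 expr0 mul1r /fpow /= fwedge1. Qed.

(** Strong induction on the number of factors. The shorter products give linearity and positivity of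
    the perturbed product; positivity implies its order 0, and subtraction then gives order 0 of the
    plain product, as needed to multiply in the next function. *)
Lemma btprod_admissible l : admissible l.
Proof.
have [k] := ubnP (size l); elim: k l => // k IH [|j l] /=.
  move=> _ r; rewrite addn0 => ->.
  have E : Q [::] = T by apply/funext => phi; exact: perturbed_nil.
  split=> //; first exact: (posc_ordc X_compact lT pT).
  by rewrite E.
rewrite ltnS => lk r rl; have rl' : (r.+1 + size l)%N = s0 by rewrite -rl addnS.
have H q : q \in splits l -> admissible q.2.
  by move=> qs; apply: IH; rewrite -(splits_size qs) in lk; apply: leq_ltn_trans lk; exact: leq_addl.
have [l1 o1 c1 _] := IH l lk _ rl'.
have lR : linc r (RR (j :: l)) := bt_linc X_compact kappa l1 o1 (bv j) (cth j).
have sm q : q \in behead (splits (j :: l)) ->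
    [/\ linc (q.1 + r) (RR q.2) & ordc (q.1 + r) (RR q.2)].
  move=> qs; have [E /(_ q qs) q0] := splits_head (j :: l).
  have qs' : q \in splits (j :: l) by rewrite E inE qs orbT.
  have sz := splits_size qs'.
  have [|//|] := IH q.2 _ (q.1 + r)%N.
  - rewrite /= in sz; apply: leq_trans lk; rewrite -[(size l).+1]sz.
    by rewrite -{1}[size q.2]add0n ltn_add2r.
  - by rewrite -rl -sz addnAC addnC.
  by [].
have lQ : linc r (Q (j :: l)).
  apply: perturbed_linc => // q; rewrite (splits_head (j :: l)).1 inE => /orP[/eqP -> //|/sm[]//].
have pQ := perturbed_posc rl' lQ H.
split=> //; last first.
  by move=> t; apply: (bt_clos X_compact kappa l1 o1 c1 (bv j) (cth j)).
apply: perturbed_ordc => //; first exact: (posc_ordc X_compact lQ pQ).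
by move=> q /sm[].
Qed.

End Fixed.

(** Each step trades a factor for a product of the test form with [theta j], which stays
    dd^c-closed. In the end both sides are [T] on the same form, and the functions v have
    disappeared. *)
Lemma btprod_stokes (v v' : I -> X -> R) (c c' : R) l r phi :
  (forall j, bmeas (v j : Borel -> R)) -> (forall j, bmeas (v' j : Borel -> R)) ->
  (forall j x, exists W : set X, [/\ open W, W x & regularizable kappa omega (theta j) (v j) W c]) ->
  (forall j x, exists W : set X, [/\ open W, W x & regularizable kappa omega (theta j) (v' j) W c']) ->
  (r + size l)%N = s0 -> form_bidegree r r phi -> ddc kappa phi = @fzero R n X ->
  btprod v l phi = btprod v' l phi.
Proof.
move=> bv bv' rg rg'; elim: l r phi => //= j l IH r phi rl bp dp.
have rl' : (r.+1 + size l)%N = s0 by rewrite -rl addnS.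
have [l1 o1 _ _] := btprod_admissible bv rg rl'.
have [l2 o2 _ _] := btprod_admissible bv' rg' rl'.
have [-> d1] := bt_stokes X_compact l1 o1 (bv j) (cth j) bp dp.
have [-> _] := bt_stokes X_compact l2 o2 (bv' j) (cth j) bp dp.
by apply: IH rl' _ d1; have [bt _ _] := cth j; exact: (bid_fwedge bt bp).
Qed.

(** Uniformly bounded total variation, expressed by the total masses P 1 and N 1 of a decomposition
    into positive functionals. *)
Definition bounded_family (L : nat -> (X -> R) -> R) := exists M : R, forall k, exists P N,
  [/\ posfun P, posfun N, forall f, smooth_fun f -> L k f = P f - N f,
      P (fun=> 1) <= M & N (fun=> 1) <= M].

Lemma bounded_family_sub L L' (a : R) : 0 <= a -> bounded_family L -> bounded_family L' ->
  bounded_family (fun k f => L k f - a * L' k f).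
Proof.
move=> a0 [M hM] [M' hM']; exists (M + a * M') => k.
have [P [N [p1 p2 e m1 m2]]] := hM k; have [P' [N' [p1' p2' e' m1' m2']]] := hM' k.
exists (fun f => 1 * P f + a * N' f), (fun f => 1 * N f + a * P' f); split.
- exact: posfun_comb.
- exact: posfun_comb.
- by move=> f sf; rewrite e // e' //; ring.
- by rewrite mul1r lerD // ler_wpM2l.
- by rewrite mul1r lerD // ler_wpM2l.
Qed.

Lemma bounded_family_eq L L' : (forall k f, smooth_fun f -> L k f = L' k f) ->
  bounded_family L -> bounded_family L'.
Proof.
move=> E [M hM]; exists M => k; have [P [N [p1 p2 e m1 m2]]] := hM k.
by exists P, N; split=> // f sf; rewrite -E // e.
Qed.

Hypotheses (om1 : del (delbar omega) = @fzero R n X)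
  (om2 : fwedge (del omega) (delbar omega) = @fzero R n X).

Lemma fpowD a r : fwedge (fpow omega a) (fpow omega r) = fpow omega (a + r).
Proof. by elim: a => [|a IH]; [rewrite /fpow /= fwedge1|rewrite /= -fwedgeA IH]. Qed.

(* Stokes makes the total mass of the perturbed product independent of k. *)
Lemma btprod_bounded (v : nat -> I -> X -> R) c l r : 0 <= c ->
  (forall k j, bmeas (v k j : Borel -> R)) ->
  (forall k j x, exists W : set X, [/\ open W, W x & regularizable kappa omega (theta j) (v k j) W c]) ->
  (r + size l)%N = s0 ->
  bounded_family (fun k f => Re (btprod (v k) l (fmul f (fpow omega r)))).
Proof.
move=> c0 bv rg; have [N] := ubnP (size l); elim: N l r => // N IH l r lN rl.
have adm k := btprod_admissible (bv k) (rg k).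
have lQ k : linc r (perturbed_prod (v k) c l).
  apply: perturbed_linc => // q qs.
  by have [] := adm k q.2 (q.1 + r)%N; rewrite // -rl -(splits_size qs) addnAC addnC.
have HQ : bounded_family (fun k f => Re (perturbed_prod (v k) c l (fmul f (fpow omega r)))).
  (* The value at k = 0 serves for all k; the maximum with 0 also covers the negative part, which is
     the zero functional. *)
  exists (Num.max (Re (perturbed_prod (v 0%N) c l (fpow omega r))) 0) => k.
  have [_ _ _ pQ] := adm k l _ rl.
  have pf := posc_posfun (lQ k) pQ (fpow_sp hom r).
  exists (fun f => Re (perturbed_prod (v k) c l (fmul f (fpow omega r)))), (fun=> 0); split=> //.
  - split=> [f g _ _|a f _|f _ _] //; by rewrite ?addr0 ?mulr0.
  - by move=> f _; rewrite subr0.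
  - rewrite le_max; apply/orP; left.
    have -> : fmul (fun=> 1) (fpow omega r) = fpow omega r.
      by apply/funext => x; apply/funext => s; rewrite /fmul mul1r.
    rewrite le_eqVlt; apply/orP; left; apply/eqP; congr Re.
    rewrite /perturbed_prod !big_seq; apply: eq_bigr => q qs; congr (_ * _).
    rewrite fpowD; apply: (btprod_stokes (r := (q.1 + r)%N) (bv k) (bv 0%N) (rg k) (rg 0%N)).
    + by rewrite -rl -(splits_size qs) addnAC addnC.
    + exact: bid_fpow bom.
    + exact: (ddc_fpow kappa bom om1 om2).
  - by rewrite le_max lexx orbT.
(* The shorter products, bounded by induction, are subtracted one at a time; their coefficients c^a
   are nonnegative since c is. *)
have sub (s : seq (nat * seq I)) : {subset s <= behead (splits l)} -> bounded_family (fun k f =>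
    Re (perturbed_prod (v k) c l (fmul f (fpow omega r))) -
    \sum_(q <- s) c ^+ q.1 * Re (btprod (v k) q.2 (fmul f (fpow omega (q.1 + r))))).
  elim: s => [|q s IHs] sub.
    by apply: bounded_family_eq HQ => k f _; rewrite big_nil subr0.
  have IH' := IHs (fun q' h => sub q' (mem_behead (s := q :: s) h)).
  have qb : q \in behead (splits l) by apply: sub; rewrite inE eqxx.
  have [E /(_ q qb) q0] := splits_head l.
  have qs : q \in splits l by rewrite E inE qb orbT.
  have Bq : bounded_family (fun k f => Re (btprod (v k) q.2 (fmul f (fpow omega (q.1 + r))))).
    apply: IH; last by rewrite -rl -(splits_size qs) addnAC addnC.
    rewrite ltnS -(splits_size qs) in lN; apply: leq_trans lN.
    by rewrite -{1}[size q.2]add0n ltn_add2r.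
  have := bounded_family_sub (exprn_ge0 q.1 c0) IH' Bq.
  by apply: bounded_family_eq => k f _; rewrite big_cons opprD addrA addrAC.
have := sub (behead (splits l)) (fun q h => h).
apply: bounded_family_eq => k f sf.
rewrite /perturbed_prod (splits_head l).1 big_cons.
have ReD (a b : C) : Re (a + b) = Re a + Re b by case: a b => [a1 a2] [b1 b2].
have ReZ (t : R) (a : C) : Re (t%:C * a) = t * Re a by case: a => [a1 a2] /=; ring.
rewrite ReD ReZ expr0 mul1r /fpow [iter 0 _ _]/= fwedge1 Re_sum.
rewrite (eq_bigr (fun q => c ^+ q.1 * Re (btprod (v k) q.2 (fmul f (fpow omega (q.1 + r)))))) ?addrK //.
by move=> q _; rewrite ReZ -fmul_fwedger -fpowD.
Qed.

End Products.

(** * From bounded variation to masses of restrictions *)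

Section Main.
Variables (R : realType) (n : nat) (X : complexManifold R n).
Local Notation Re := complex.Re.
Local Notation Borel := (g_sigma_algebraType (@open X)).

(** Restricting to [A] and taking the mass on [K] integrates the product of the two indicators
    against one signed measure. That product lies between 0 and 1, so the positive part alone bounds
    the result. *)
Lemma mass_le (X_compact : compact [set: X]) (omega : diffForm X) (S : current X) (q : nat)
    (A K : set X) (P N : (X -> R) -> R) (M : R) : form_bidegree 1 1 omega -> ordc (n - q) S ->
  measurable (A : set Borel) -> measurable (K : set Borel) -> posfun P -> posfun N ->
  (forall f, smooth_fun f -> Re (S (fmul f (fpow omega (n - q)))) = P f - N f) ->
  P (fun=> 1) <= M -> mass omega q K (restrict_current A S) <= M.
Proof.
move=> bo oS mA mK pP pN eL; apply: le_trans.
have bp := bid_fpow (n - q) bo; set phi := fpow omega (n - q) in bp eL *.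
pose L f := Re (S (fmul f phi)); have oL : order0 L := (oS _ bp).1.
have bA := bmeas_indic R mA; have bK := bmeas_indic R mK.
have [eI eE] := order0_ext_spec X_compact oL.
have -> : mass omega q K (restrict_current A S) =
    order0_ext (fun f => Re (mul_current \1_A S (fmul f phi))) \1_K by [].
have o2 := (mul_ordc X_compact oS bA bp).1.
rewrite (order0_extE X_compact o2 (extfun_mul bA eI) _ bK).
  apply: (order0_ext_le X_compact pP pN eL); first exact: bmeasM.
  move=> x; rewrite !indicE; case: (_ \in A); case: (_ \in K); rewrite /= ?mulr1 ?mulr0 ?ler01 ?lexx //.
move=> f sf; rewrite (mul_fmul X_compact oS bA sf bp) /mul_current /=.
by congr order0_ext; apply/funext => x; rewrite mulrC.
Qed.

End Main.

(** Above -k, the strict inequality for [u j] is the same as that for its truncation, which is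
    real-valued and Borel. *)
Lemma above_borel (R : realType) (n : nat) (X : complexManifold R n) (X_compact : compact [set: X])
    (m : nat) (u : 'I_m -> X -> \bar R) (k : nat) : (forall j, quasi_psh (u j)) ->
  measurable ([set x | forall j, ((- k%:R)%:E < u j x)%E] : set (g_sigma_algebraType (@open X))).
Proof.
move=> qu; have -> : [set x | forall j, ((- k%:R)%:E < u j x)%E] =
    \bigcap_(j in [set: 'I_m]) [set x | - k%:R < truncation (u j) k x].
  apply/seteqP; split=> x H j; have [_ /(_ x) fx] := truncation_bmeas X_compact k (qu j).
    by move=> _ /=; rewrite -lte_fin /truncation fineK // lt_max H.
  by have := H j Logic.I; rewrite /= -lte_fin /truncation fineK // lt_max ltxx orbF.
apply: fin_bigcap_measurable => [|j _]; first exact: finite_finset.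
have [[mv _] _] := truncation_bmeas X_compact k (qu j).
have := mv measurableT _ (measurable_itv `](- k%:R), +oo[).
rewrite setTI; congr (measurable _); apply/seteqP; split=> x /=; by rewrite in_itv /= andbT.
Qed.

Theorem theorem1p1 (R : realType) (n : nat) (X : complexManifold R n)
    (X_compact : compact [set: X])
    (kappa : R) (kappa_gt0 : 0 < kappa)
    (omega : diffForm X) (omega_hermitian : hermitian_form omega)
    (omega_ddbar : del (delbar omega) = @fzero R n X)
    (omega_torsion : fwedge (del omega) (delbar omega) = @fzero R n X)
    (m p : nat) (Tj : 'I_m -> current X) (T : current X)
    (Tj_cp : forall j, closed_positive_current 1 (Tj j))
    (T_cp : closed_positive_current p T)
    (mp_le_n : (m + p <= n)%N) :
  non_pluripolar_product_well_defined kappa omega p Tj T.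
Proof.
move=> theta u hyp K cK.
have qu j : quasi_psh (u j) by have [_ [qp _ _] _] := hyp j.
have cth j : closed_real11 (theta j) by have [] := hyp j.
have [[pn lT _] pT clT] := T_cp.
have cT t : t.+1 = (n - p)%N -> clos t T.
  by move=> tp psi; apply: clT; rewrite tp subnK.
have [c hc] := pick_fun (fun j => quasi_psh_global kappa_gt0 omega_hermitian X_compact
  (let: And3 b _ _ := cth j in b) (qu j)).
(* A single constant for all factors and all truncation levels: each [c j] is nonnegative and
   regularizability persists when the constant grows. *)
pose C := \sum_j c j.
have C0 : 0 <= C by apply: sumr_ge0 => j _; exact: (hc j).1.
have bv k j := (truncation_bmeas X_compact k (qu j)).1.
have reg k j x : exists W : set X, [/\ open W, W x &
    regularizable kappa omega (theta j) (truncation (u j) k) W C].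
  have [_ /(_ x)[W [oW Wx hW]]] := hc j; exists W; split=> //; apply: hW.
  rewrite /C (bigD1 j) //= lerDl; apply: sumr_ge0 => i _; exact: (hc i).1.
have deg : (n - (m + p) + size (enum 'I_m))%N = (n - p)%N.
  by rewrite size_enum_ord; apply/eqP; rewrite -(eqn_add2r p) subnK // -addnA subnK.
have bo := omega_bid omega_hermitian.
(* This bound is independent of [K] as well: it controls the variation on the whole compact
   manifold. *)
have [M hM] := btprod_bounded X_compact omega_hermitian cth lT pT cT omega_ddbar omega_torsion
  (v := fun k j => truncation (u j) k) C0 bv reg deg.
exists M => k; have [P [N [pP pN e P1 _]]] := hM k.
have [_ oR _ _] := btprod_admissible X_compact omega_hermitian cth lT pT cT (bv k) (reg k) deg.
apply: (mass_le X_compact bo oR _ _ pP pN e P1).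
  exact: above_borel.
exact: compact_borel.
Qed.
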